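(* Let $V$ be the set-theoretic universe and let $\mathbb{P}\in V$ be a proper notion of forcing which has the Laver property and preserves the ground model reals non-meager. Let $\mathcal{A}\in V$ be a Boolean algebra which is $\sigma$-complete (in $V$). Then, for every $\mathbb{P}$-generic filter $G$ over $V$, the algebra $\mathcal{A}$ has the Vitali--Hahn--Saks property in $V[G]$.
   Context: Measures: a measure on a Boolean algebra $\mathcal{A}$ is a finitely additive complex-valued function $\mu\colon\mathcal{A}\to\mathbb{C}$ with finite variation $\|\mu\|$. $K_{\mathcal{A}}$ denotes the Stone space of $\mathcal{A}$; each measure on $\mathcal{A}$ extends uniquely to a regular Borel measure on $K_{\mathcal{A}}$ with the same variation, and the space of all measures on $\mathcal{A}$ is thereby identified isometrically with the dual space $C(K_{\mathcal{A}})^*$ of the Banach space of continuous complex-valued functions on $K_{\mathcal{A}}$ with the supremum norm. A sequence $\langle\mu_n\colon n\in\omega\rangle$ of measures on $\mathcal{A}$ is pointwise convergent if $\lim_{n}\mu_n(A)$ exists for every $A\in\mathcal{A}$, and weakly convergent if $\lim_n x^{**}(\mu_n)$ exists for every $x^{**}\in C(K_{\mathcal{A}})^{**}$. $\mathcal{A}$ has the Vitali--Hahn--Saks property if every pointwise convergent sequence of measures on $\mathcal{A}$ is weakly convergent. ''In $V[G]$'' means that all these notions (measures, sequences, $K_{\mathcal{A}}$, etc.) are evaluated in $V[G]$ for the Boolean algebra $\mathcal{A}$ (which in $V[G]$ need not be $\sigma$-complete). Laver property: $\mathbb{P}$ has the Laver property if for any $\mathbb{P}$-generic filter $G$ over $V$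 and any functions $f\in\omega^\omega\cap V$ and $g\in\omega^\omega\cap V[G]$ such that $f$ eventually dominates $g$ ($g\le^* f$), there exists in $V$ a function $H\colon\omega\to[\omega]^{<\omega}$ such that $|H(n)|\le n+1$ and $g(n)\in H(n)$ for all $n\in\omega$. $\mathbb{P}$ preserves the ground model reals non-meager if $\mathbb{R}^V$ (the set of reals of $V$) is a non-meager subset of $\mathbb{R}^{V[G]}$ for any $\mathbb{P}$-generic filter $G$ over $V$. *)

(* Defs.v *)
From HB Require Import structures.
From mathcomp Require Import all_boot all_order all_algebra.
From mathcomp Require Import finmap.
From mathcomp Require Import complex.
From mathcomp Require Import all_classical all_reals all_analysis.

Set Implicit Arguments.
Unset Strict Implicit.
Unset Printing Implicit Defensive.

Import Order.TTheory GRing.Theory Num.Theory.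
Import numFieldNormedType.Exports.
Local Open Scope classical_set_scope.
Local Open Scope ring_scope.

(* The ambient universe of sets is Aczel's type of well-founded trees.  The
   ground model V is a transitive class of it satisfying ZFC, and V[G] is the
   class of the evaluations of the names lying in V.  A structure "in M", for
   M = V or M = V[G], is a Rocq object whose set-theoretic code belongs to M;
   every quantifier of a notion evaluated in M ranges over such objects. *)

Inductive Ens : Type := fam (J : Type) (f : J -> Ens).

(* Sets are trees up to bisimulation. *)
Fixpoint eqE (x y : Ens) : Prop :=
  match x, y with
  | @fam J f, @fam K g =>
      (forall i, exists j, eqE (f i) (g j)) /\
      (forall j, exists i, eqE (f i) (g j))
  end.

Definition inE (x y : Ens) : Prop := let: @fam J g := y in exists j, eqE x (g j).

Definition emptyE : Ens := fam (fun e : Empty_set => match e with end).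

Definition succE (x : Ens) : Ens :=
  let: @fam J f := x in fam (fun o : option J => if o is Some i then f i else x).

Definition upair (x y : Ens) : Ens := fam (fun b : bool => if b then x else y).

Definition opair (x y : Ens) : Ens := upair (upair x x) (upair x y).

(** First-order set theory relativized to a class *)

Definition class := Ens -> Prop.

Inductive fml : Type :=
| FMem of nat & nat
| FEq of nat & nat
| FFalse
| FImp of fml & fml
| FAll of nat & fml.

Definition upd (e : nat -> Ens) (n : nat) (x : Ens) : nat -> Ens :=
  fun k => if k == n then x else e k.

Fixpoint sat (M : class) (e : nat -> Ens) (phi : fml) : Prop :=
  match phi with
  | FMem i j => inE (e i) (e j)
  | FEq i j => eqE (e i) (e j)
  | FFalse => False
  | FImp a b => sat M e a -> sat M e b
  | FAll n a => forall x, M x -> sat M (upd e n x) a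
  end.

(* Extensionality and Foundation hold in every transitive class. *)
Record transitive_ZFC (M : class) : Prop := TransitiveZFC {
  zfc_proper : forall x y, eqE x y -> M x -> M y;
  zfc_trans : forall x y, M y -> inE x y -> M x;
  zfc_pairing : forall x y, M x -> M y ->
    exists2 z, M z & forall w, inE w z <-> eqE w x \/ eqE w y;
  zfc_union : forall x, M x ->
    exists2 z, M z & forall w, inE w z <-> exists2 y, inE y x & inE w y;
  zfc_powerset : forall x, M x ->
    exists2 z, M z &
      forall w, inE w z <-> M w /\ (forall u, inE u w -> inE u x);
  zfc_infinity :
    exists2 z, M z & inE emptyE z /\ (forall w, inE w z -> inE (succE w) z);
  zfc_separation : forall phi e x, (forall n, M (e n)) -> M x ->
    exists2 z, M z &
      forall w, inE w z <-> inE w x /\ sat M (upd e 0 w) phi;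
  zfc_replacement : forall phi e x, (forall n, M (e n)) -> M x ->
    (forall w, inE w x ->
       exists2 y, M y & forall y', M y' ->
         (sat M (upd (upd e 0 w) 1 y') phi <-> eqE y' y)) ->
    exists2 z, M z & forall y, inE y z <->
      exists2 w, inE w x & M y /\ sat M (upd (upd e 0 w) 1 y) phi;
  zfc_choice : forall x, M x ->
    (forall y, inE y x -> exists u, inE u y) ->
    (forall y y' u, inE y x -> inE y' x -> inE u y -> inE u y' -> eqE y y') ->
    exists2 c, M c & forall y, inE y x ->
      exists2 u, inE u y & forall w, inE w c /\ inE w y <-> eqE w u
}.

(** Codes *)

Class Coded (T : Type) := encode : T -> Ens.

#[global] Instance coded_nat : Coded nat :=
  fix codeN n := if n is m.+1 then succE (codeN m) else emptyE.
#[global] Instance coded_bool : Coded bool := fun b : bool => encode (b : nat).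
#[global] Instance coded_pair S T (cS : Coded S) (cT : Coded T) :
  Coded (S * T) := fun p => opair (encode p.1) (encode p.2).
#[global] Instance coded_set T (cT : Coded T) : Coded (T -> Prop) :=
  fun X => @fam {t : T | X t} (fun t => encode (sval t)).
#[global] Instance coded_fun S T (cS : Coded S) (cT : Coded T) :
  Coded (S -> T) := fun f => @fam S (fun s => encode (s, f s)).
#[global] Instance coded_fset : Coded {fset nat} :=
  fun A => encode (fun n : nat => n \in A : Prop).
#[global] Instance coded_int : Coded int := fun z => encode (z < 0, absz z).
#[global] Instance coded_rat : Coded rat := fun q => encode (numq q, denq q).
(* A real is coded by its lower Dedekind cut in the rationals, so that the reals
   of M are the x : R such that M (encode x). *)
#[global] Instance coded_real (R : realType) : Coded R :=
  fun x => encode (fun q : rat => ratr q < x : Prop).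
#[global] Instance coded_complex (R : realType) : Coded R[i] :=
  fun z => encode (complex.Re z, complex.Im z).
#[global] Instance coded_sig T (cT : Coded T) (Q : T -> Prop) :
  Coded {t : T | Q t} := fun t => encode (sval t).

Definition coded_in (M : class) (T : Type) (cT : Coded T) : Prop :=
  (forall x y : T, eqE (encode x) (encode y) -> x = y) /\
  M (encode (fun _ : T => True)).

(* Every preordered set lying in M arises in this way from some T and cT. *)
Definition ordered_in (M : class) d (T : preorderType d) (cT : Coded T) : Prop :=
  coded_in M cT /\ M (encode (fun p : T * T => (p.1 <= p.2)%O : Prop)).

(** Generic extensions *)

(* Stronger conditions are smaller. *)
Definition dense d (P : preorderType d) (D : P -> Prop) : Prop :=
  forall p, exists2 q, D q & (q <= p)%O.

Definition generic (V : class) d (P : preorderType d) (cP : Coded P)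
    (G : P -> Prop) : Prop :=
  [/\ exists p, G p,
      forall p q, G p -> (p <= q)%O -> G q,
      forall p q, G p -> G q -> exists2 r, G r & (r <= p)%O /\ (r <= q)%O
    & forall D : P -> Prop, V (encode D) -> dense D -> exists2 p, G p & D p].

(* evaluates G t x: x = {t_1^G | (t_1, p) in t for some p in G}. *)
Inductive evaluates P (cP : Coded P) (G : P -> Prop) : Ens -> Ens -> Prop :=
| Evaluates t x :
    (forall y, inE y x -> exists s p,
        [/\ inE (opair s (encode p)) t, G p & evaluates cP G s y]) ->
    (forall s p, inE (opair s (encode p)) t -> G p ->
        exists2 y, inE y x & evaluates cP G s y) ->
    evaluates cP G t x.

Definition ext (V : class) P (cP : Coded P) (G : P -> Prop) : class :=
  fun x => exists2 t, V t & evaluates cP G t x.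

(** Properness, the Laver property, preservation of non-meagerness *)

Section CountableSubsets.
Variables (M : class) (X : Type) (cX : Coded X).

Definition uncountable_cardinal : Prop :=
  [/\ forall x z, inE z (encode x) -> exists y : X, eqE z (encode y),
      forall (x : X) z w, inE z (encode x) -> inE w z -> inE w (encode x),
      forall (x : X) (f : X -> X), M (encode f) -> injective f ->
        exists y, ~ inE (encode (f y)) (encode x)
    & forall f : X -> nat, M (encode f) -> ~ injective f].

(* The elements of [X]^omega in M. *)
Definition countable_in (a : X -> Prop) : Prop :=
  exists e : nat -> X,
    [/\ M (encode e), injective e & forall x, a x <-> exists n, e n = x].

Definition club (C : (X -> Prop) -> Prop) : Prop :=
  [/\ forall a, C a -> countable_in a,
      forall a, countable_in a -> exists2 b, C b & a `<=` b
    & forall a : nat -> X -> Prop, M (encode a) -> (forall n, C (a n)) ->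
        (forall n, a n `<=` a n.+1) -> C (fun x => exists n, a n x)].

Definition stationary (S : (X -> Prop) -> Prop) : Prop :=
  forall C : (X -> Prop) -> Prop, M (encode C) -> club C ->
    exists2 a, C a & S a.

End CountableSubsets.

(* Stationary subsets of [X]^omega, X an uncountable cardinal, stay stationary. *)
Definition proper_forcing (V : class) d (P : preorderType d) (cP : Coded P) :=
  forall (X : Type) (cX : Coded X),
    coded_in V cX -> uncountable_cardinal V cX ->
  forall S : (X -> Prop) -> Prop, V (encode S) ->
    (forall a, S a -> countable_in V cX a) -> stationary V cX S ->
  forall G, generic V cP G -> stationary (ext V cP G) cX S.

Definition laver_property (V : class) d (P : preorderType d) (cP : Coded P) :=
  forall G, generic V cP G ->
  forall f g : nat -> nat, V (encode f) -> ext V cP G (encode g) ->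
    (exists n0, forall n, (n0 <= n)%N -> (g n <= f n)%N) ->
  exists2 H : nat -> {fset nat}, V (encode H) &
    forall n, (#|` H n| <= n.+1)%N /\ g n \in H n.

Section Meager.
Variables (M : class) (R : realType).

Definition nowhere_dense_in (F : R -> Prop) : Prop :=
  forall a b : R, M (encode a) -> M (encode b) -> a < b ->
  exists c d : R, [/\ M (encode c), M (encode d), a <= c < d & d <= b] /\
    forall x, c < x < d -> ~ F x.

Definition meager_in (X : R -> Prop) : Prop :=
  exists F : nat -> R -> Prop,
    [/\ M (encode F), forall n, nowhere_dense_in (F n)
      & forall x, X x -> exists n, F n x].

End Meager.

Definition preserves_nonmeager (R : realType) (V : class) d (P : preorderType d)
    (cP : Coded P) :=
  forall G, generic V cP G ->
    ~ meager_in (ext V cP G) (fun x : R => V (encode x)).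

(** Boolean algebras and the Vitali-Hahn-Saks property *)

Definition sigma_complete (M : class) d (B : ctbDistrLatticeType d)
    (cB : Coded B) :=
  forall a : nat -> B, M (encode a) ->
    exists s : B, forall b, (s <= b)%O <-> forall n, (a n <= b)%O.

(* Dual of a normed space E of functions X -> C, computed in M. *)
Section Dual.
Variables (M : class) (R : realType) (X : Type) (cX : Coded X).
Variables (Q : (X -> R[i]) -> Prop).
Let E := {f : X -> R[i] | Q f}.
Variable nrm : E -> R.

Definition linear_in (F : E -> R[i]) : Prop :=
  forall (a : R[i]) (f g h : E), M (encode a) ->
    (forall x, sval h x = a * sval f x + sval g x) -> F h = a * F f + F g.

Definition in_dual (F : E -> R[i]) : Prop :=
  [/\ M (encode F), linear_in F
    & exists c : R, forall f, Normc.normc (F f) <= c * nrm f].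

Definition dual_norm (F : {F : E -> R[i] | in_dual F}) : R :=
  sup [set Normc.normc (sval F f) | f in [set f | nrm f <= 1]].

End Dual.

Section VitaliHahnSaks.
Variables (M : class) (R : realType) (d : Order.disp_t).
Variables (B : ctbDistrLatticeType d) (cB : Coded B).

Definition is_measure (m : B -> R[i]) : Prop :=
  [/\ M (encode m),
      forall a b, (a `&` b = \bot)%O -> m (a `|` b)%O = m a + m b
    & exists c : R, forall s : seq B,
        pairwise (fun a b => (a `&` b == \bot)%O) s ->
        \sum_(a <- s) Normc.normc (m a) <= c].

Definition ultrafilter (x : B -> Prop) : Prop :=
  [/\ x \top%O /\ ~ x \bot%O,
      forall a b, x a -> (a <= b)%O -> x b,
      forall a b, x a -> x b -> x (a `&` b)%O
    & forall a, x a \/ x (~` a)%O].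

Definition stone := {x : B -> Prop | ultrafilter x /\ M (encode x)}.

#[local] Instance coded_stone : Coded stone := fun x => encode (sval x).

(* The clopen sets {x | a in x}, a : B, form a base of the topology. *)
Definition continuous_in (f : stone -> R[i]) : Prop :=
  M (encode f) /\
  forall (x : stone) (eps : R), 0 < eps -> exists2 a, sval x a &
    forall y : stone, sval y a -> Normc.normc (f y - f x) < eps.

Definition CK := {f : stone -> R[i] | continuous_in f}.

Definition sup_norm (f : CK) : R := sup (range (fun x => Normc.normc (sval f x))).

Definition CK_dual := {F : CK -> R[i] | in_dual M _ sup_norm F}.

Definition CK_dual_norm : CK_dual -> R := @dual_norm M R _ _ _ sup_norm.

Definition CK_bidual := {F : CK_dual -> R[i] | in_dual M _ CK_dual_norm F}.

(* The functional f |-> \int f dm on C(K): as the indicators of clopen sets span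
   a dense subspace, it is the only one whose value at the indicator of
   {x | a in x} is m a for all a : B. *)
Definition represents (F : CK_dual) (m : B -> R[i]) : Prop :=
  forall (a : B) (f : CK),
    (forall x : stone, sval f x = if `[< sval x a >] then 1 else 0) ->
    sval F f = m a.

Definition converges_in (u : nat -> R[i]) : Prop :=
  exists2 l : R[i], M (encode l) & u @ \oo --> (l : (R[i] : numFieldType)).

Definition pointwise_convergent (m : nat -> B -> R[i]) : Prop :=
  forall a, converges_in (fun n => m n a).

Definition weakly_convergent (m : nat -> B -> R[i]) : Prop :=
  exists2 F : nat -> CK_dual, forall n, represents (F n) (m n) &
    forall Phi : CK_bidual, converges_in (fun n => sval Phi (F n)).

Definition vitali_hahn_saks : Prop :=
  forall m : nat -> B -> R[i], M (encode m) -> (forall n, is_measure (m n)) ->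
    pointwise_convergent m -> weakly_convergent m.

End VitaliHahnSaks.

(* Main.v *)
Require Import Defs.
From Stdlib Require Import Relations Wellfounded.
From HB Require Import structures.
From mathcomp Require Import all_boot all_order all_algebra.
From mathcomp Require Import finmap.
From mathcomp Require Import complex.
From mathcomp Require Import all_classical all_reals all_analysis.
From mathcomp Require Import zify ring lra.

Set Implicit Arguments.
Unset Strict Implicit.
Unset Printing Implicit Defensive.

Import Order.TTheory GRing.Theory Num.Theory.
Import numFieldNormedType.Exports.
Import Defs.
Local Open Scope classical_set_scope.
Local Open Scope ring_scope.

(* Let nu be a pointwise null sequence of measures in V[G].  If nu were unbounded, or not
   uniformly controlled by finitely many of its terms, then disjoint bumps of nu could be
   chosen among countably many elements of the algebra that properness encloses in a countable
   family of V.  The Laver property confines the n-th choice to few candidates known in V, and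
   a ground model real that is generic for countably many dense sets of V[G], which exists by
   non-meagerness, selects infinitely many bumps inside V.  Their supremum, which
   sigma-completeness provides, contradicts the pointwise convergence.  So nu is bounded and
   controlled; by strict convexity, every infinite set of its terms has midpoint combinations
   that are uniformly small on the algebra, whence each functional of the bidual tends to 0
   along nu.  A convergent sequence is reduced to a null one by subtracting its limit, a
   measure that is integrated against continuous functions by compactness of the Stone space. *)

(** The algebra is sigma-complete in V only, so a supremum can be formed only for a family that lies
    in V, whereas the measures, and every choice made from them, live in V[G]. This shapes the
    argument: whatever has to enter a supremum is pulled back to V by one of the three hypotheses on
    the forcing, and the rest stays in V[G]. V[G] is given merely as the class of values of names.
    That it contains the sets defined along the way rests on the forcing theorem, which gives
    Zermelo set theory in V[G]; choice there comes from a well-order in V of a set of V that is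
    mapped onto the set in question. Working in V[G] then means to show that typed objects have
    their codes in it. Midpoints are enough for the final step: if the real or imaginary part of a
    functional, up to sign, is at least e on infinitely many terms, it is at least e on all their
    iterated midpoints, and one of these is uniformly small. This replaces the separation theorem
    and the Radon-Nikodym theorem, and takes place inside V[G] with rational coefficients. *)

(** * Trees up to bisimulation and the quotient by it *)

Lemma eqE_refl x : eqE x x.
Proof. by elim: x => J f IH; split => i; exists i. Qed.

Lemma eqE_sym x y : eqE x y -> eqE y x.
Proof.
elim: x y => J f IH [K g] [h1 h2]; split => i.
  by have [j /IH] := h2 i; exists j.
by have [j /IH] := h1 i; exists j.
Qed.

Lemma eqE_trans x y z : eqE x y -> eqE y z -> eqE x z.
Proof.
elim: x y z => J f IH [K g] [L h] [h1 h2] [h3 h4]; split => i.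
  by have [j fg] := h1 i; have [l gh] := h3 j; exists l; apply: IH fg gh.
by have [j gh] := h4 i; have [l fg] := h2 j; exists l; apply: IH fg gh.
Qed.

Lemma inE_eqE x x' y y' : eqE x x' -> eqE y y' -> inE x y -> inE x' y'.
Proof.
case: y y' => [J f] [K g] e [h _] [j xj]; have [k jk] := h j.
by exists k; apply: eqE_trans (eqE_sym e) (eqE_trans xj jk).
Qed.

Lemma eqE_ext x y : (forall w, inE w x <-> inE w y) -> eqE x y.
Proof.
case: x y => [J f] [K g] h; split => i.
  by apply/(h (f i)); exists i; exact: eqE_refl.
have /(h (g i)) [j e] : inE (g i) (fam g) by exists i; exact: eqE_refl.
by exists j; exact: eqE_sym.
Qed.

(* Passing to the quotient makes extensional equality Leibniz equality. *)
Definition hset := {X : Ens -> Prop | exists x, X = eqE x}.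

Definition cl (x : Ens) : hset := exist _ (eqE x) (ex_intro _ x erefl).

Lemma clE x y : cl x = cl y <-> eqE x y.
Proof.
split=> [[e]|e].
  by have := eqE_refl y; rewrite -e.
apply: eq_exist => /=; apply/funext => z; apply/propext; split.
  exact: eqE_trans (eqE_sym e).
exact: eqE_trans e.
Qed.

Definition rp (u : hset) : Ens := sval (cid (svalP u)).

Lemma rpK u : cl (rp u) = u.
Proof. by case: u => X h; rewrite /rp; case: cid => x /= e; apply: eq_exist. Qed.

Lemma rp_cl x : eqE (rp (cl x)) x.
Proof. by apply/clE; rewrite rpK. Qed.

Definition mem_h (u v : hset) := inE (rp u) (rp v).
Notation "u ∈ v" := (mem_h u v) (at level 70, no associativity).

Lemma mem_cl x y : cl x ∈ cl y <-> inE x y.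
Proof.
by split; apply: inE_eqE; do ?[exact: rp_cl | apply: eqE_sym; exact: rp_cl].
Qed.

Lemma hset_ext u v : (forall w, w ∈ u <-> w ∈ v) -> u = v.
Proof.
move=> h; rewrite -(rpK u) -(rpK v); apply/clE/eqE_ext => w.
by have := h (cl w); rewrite -{1}(rpK u) -{1}(rpK v) !mem_cl.
Qed.

Lemma mem_wf : well_founded mem_h.
Proof.
have h x : Acc mem_h (cl x).
  elim: x => J f IH; constructor => u; rewrite -(rpK u) mem_cl => -[j e].
  by rewrite (_ : cl _ = cl (f j)) //; apply/clE.
by move=> u; rewrite -(rpK u).
Qed.

Definition famh (J : Type) (f : J -> hset) : hset := cl (fam (fun j => rp (f j))).

Lemma mem_famh (J : Type) (f : J -> hset) w : w ∈ famh f <-> exists j, w = f j.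
Proof.
rewrite -{1}(rpK w) mem_cl; split=> -[j e]; exists j.
  by rewrite -(rpK w) -(rpK (f j)); apply/clE.
by rewrite e; exact: eqE_refl.
Qed.

Definition up (u v : hset) : hset := cl (upair (rp u) (rp v)).

Lemma mem_up w u v : w ∈ up u v <-> w = u \/ w = v.
Proof.
rewrite /up -{1}(rpK w) mem_cl -{2 3}(rpK w) -{2}(rpK u) -{2}(rpK v) !clE.
split=> [[[] e]|[e|e]]; by [left | right | exists true | exists false].
Qed.

Lemma cl_upair x y : cl (upair x y) = up (cl x) (cl y).
Proof.
apply/clE; split=> -[]; first [by exists true; apply: eqE_sym (rp_cl _)
  | by exists false; apply: eqE_sym (rp_cl _) | by exists true; exact: rp_cl
  | by exists false; exact: rp_cl].
Qed.

Definition op (u v : hset) : hset := up (up u u) (up u v).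

Lemma cl_opair x y : cl (opair x y) = op (cl x) (cl y).
Proof. by rewrite /opair !cl_upair. Qed.

Lemma up_eq a b c d : up a b = up c d -> (a = c /\ b = d) \/ (a = d /\ b = c).
Proof.
move=> e.
have := (mem_up a c d).1; have := (mem_up b c d).1; rewrite -e !mem_up.
have := (mem_up c a b).1; have := (mem_up d a b).1; rewrite e !mem_up.
move=> h1 h2 h3 h4.
have [h1' h2'] := (h1 (or_intror erefl), h2 (or_introl erefl)).
have [h3' h4'] := (h3 (or_intror erefl), h4 (or_introl erefl)).
by intuition congruence.
Qed.

Lemma op_inj a b c d : op a b = op c d -> a = c /\ b = d.
Proof.
case/up_eq => -[].
  by case/up_eq => -[-> _] /up_eq[[_ ->]|[-> ->]].
move=> /up_eq e1 /up_eq e2; intuition congruence.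
Qed.

Definition emp : hset := cl emptyE.

Lemma mem_emp w : ~ w ∈ emp.
Proof. by rewrite -(rpK w) mem_cl => -[]. Qed.

Definition suc (u : hset) : hset := cl (succE (rp u)).

Lemma mem_suc w u : w ∈ suc u <-> w ∈ u \/ w = u.
Proof.
have -> : w = u <-> eqE (rp w) (rp u) by rewrite -clE !rpK.
rewrite /mem_h /suc; set x := rp u.
have -> : inE (rp w) (rp (cl (succE x))) = inE (rp w) (succE x).
  by apply/propext; split; apply: inE_eqE;
     do ?[exact: eqE_refl | exact: rp_cl | exact: eqE_sym (rp_cl _)].
case: x => J f; split=> [[[j|] e]|[[j e]|e]].
- by left; exists j.
- by right.
- by exists (Some j).
- by exists None.
Qed.

Lemma cl_succE x : cl (succE x) = suc (cl x).
Proof.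
apply: hset_ext => w; rewrite mem_suc -(rpK w) !mem_cl clE.
by case: x => J f; split=> [[[j|] e]|[[j e]|e]];
  [left; exists j | right | exists (Some j) | exists None].
Qed.

(* Codes as elements of the quotient *)
#[global] Hint Mode Coded ! : typeclass_instances.

Definition code (T : Type) (cT : Coded T) (t : T) : hset := cl (encode t).
Arguments code {T cT} t.

Lemma code_pair (S T : Type) (cS : Coded S) (cT : Coded T) (s : S) (t : T) :
  code (s, t) = op (code s) (code t).
Proof. exact: cl_opair. Qed.

Lemma mem_set (T : Type) (cT : Coded T) (A : T -> Prop) w :
  w ∈ code A <-> exists2 t, A t & w = code t.
Proof.
rewrite -{1}(rpK w) mem_cl; split.
  by move=> -[[t At] /= /clE]; rewrite rpK; exists t.
by move=> [t At /(congr1 rp) ->]; exists (exist _ t At); exact: rp_cl.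
Qed.

Lemma mem_fun (S T : Type) (cS : Coded S) (cT : Coded T) (f : S -> T) w :
  w ∈ code f <-> exists s, w = op (code s) (code (f s)).
Proof.
rewrite -{1}(rpK w) mem_cl; split.
  by move=> -[s /clE]; rewrite rpK => ->; exists s; exact: code_pair.
move=> [s]; rewrite -code_pair => /(congr1 rp) ->; exists s; exact: rp_cl.
Qed.

Lemma code_nat0 : code 0%N = emp. Proof. by []. Qed.

Lemma code_natS n : code n.+1 = suc (code n).
Proof. exact: cl_succE. Qed.

Lemma mem_nat w n : w ∈ code n <-> exists2 m, (m < n)%N & w = code m.
Proof.
elim: n => [|n IH].
  by split=> [/mem_emp//|[]].
rewrite code_natS mem_suc IH; split=> [[[m mn ->]|->]|[m]].
- by exists m => //; exact: ltnW.
- by exists n.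
rewrite ltnS leq_eqVlt => /orP[/eqP->|mn] ->; [by right|by left; exists m].
Qed.

Lemma code_nat_inj : injective (code : nat -> hset).
Proof.
have irr m n : (m < n)%N -> code m <> code n.
  elim: n m => // n _ m mn e.
  have : code m ∈ code m by rewrite {2}e mem_nat; exists m.
  elim/(well_founded_ind mem_wf): (code m) => x IH xx; exact: (IH x xx xx).
by move=> m n e; case: (ltngtP m n) => // h; case: (irr _ _ h).
Qed.

(** * Formulas and definability over a class *)

Definition cls := hset -> Prop.

Definition ue (e : nat -> hset) (n : nat) (x : hset) : nat -> hset :=
  fun k => if k == n then x else e k.

Fixpoint sath (N : cls) (e : nat -> hset) (phi : fml) : Prop :=
  match phi with
  | FMem i j => e i ∈ e j
  | FEq i j => e i = e j
  | FFalse => False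
  | FImp a b => sath N e a -> sath N e b
  | FAll n a => forall x, N x -> sath N (ue e n x) a
  end.

Lemma sat_eqE (V : class) phi e e' :
  (forall n, eqE (e n) (e' n)) -> sat V e phi <-> sat V e' phi.
Proof.
elim: phi e e' => [i j|i j||a IHa b IHb|n a IH] e e' h //=.
- by split; apply: inE_eqE => //; exact: eqE_sym.
- split=> k; first exact: eqE_trans (eqE_sym (h i)) (eqE_trans k (h j)).
  exact: eqE_trans (h i) (eqE_trans k (eqE_sym (h j))).
- by rewrite (IHa _ _ h) (IHb _ _ h).
by split=> k x /k; apply: (IH _ _ _).1 => m; rewrite /upd; case: eqP => // _;
  [exact: eqE_refl | exact: eqE_refl | exact: eqE_sym].
Qed.

Lemma sath_sat (V : class) (HV : transitive_ZFC V) phi e :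
  sath (fun u => V (rp u)) e phi <-> sat V (fun n => rp (e n)) phi.
Proof.
elim: phi e => [i j|i j||a IHa b IHb|n a IH] e //=.
- by rewrite -{1}(rpK (e i)) -{1}(rpK (e j)) clE.
- by rewrite IHa IHb.
split=> h x Vx.
  have /IH : sath (fun u => V (rp u)) (ue e n (cl x)) a.
    by apply: h; apply: (zfc_proper HV) Vx; exact: eqE_sym (rp_cl x).
  apply: (sat_eqE _ _ _).1 => m; rewrite /ue /upd; case: eqP => // _.
    exact: rp_cl.
  exact: eqE_refl.
apply/IH; have := h _ Vx; apply: (sat_eqE _ _ _).1 => m.
by rewrite /ue /upd; case: eqP => // _; exact: eqE_refl.
Qed.

(* [A] is definable over [N]; parameters are passed through the environment. *)
Definition Df (N : cls) (A : (nat -> hset) -> Prop) : Prop :=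
  exists phi, forall e, (forall n, N (e n)) -> (A e <-> sath N e phi).

Section Definability.
Variable N : cls.
Implicit Types A B : (nat -> hset) -> Prop.

Lemma Df_iff A B :
  (forall e, (forall n, N (e n)) -> (A e <-> B e)) -> Df N B -> Df N A.
Proof. by move=> h [phi hphi]; exists phi => e he; rewrite h // hphi. Qed.

Lemma Df_mem i j : Df N (fun e => e i ∈ e j).
Proof. by exists (FMem i j). Qed.

Lemma Df_eq i j : Df N (fun e => e i = e j).
Proof. by exists (FEq i j). Qed.

Lemma Df_false : Df N (fun=> False).
Proof. by exists FFalse. Qed.

Lemma Df_imp A B : Df N A -> Df N B -> Df N (fun e => A e -> B e).
Proof.
by move=> [a ha] [b hb]; exists (FImp a b) => e he /=; rewrite ha // hb.
Qed.

Lemma Df_not A : Df N A -> Df N (fun e => ~ A e).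
Proof. by move=> h; apply: Df_imp h Df_false. Qed.

Lemma Df_and A B : Df N A -> Df N B -> Df N (fun e => A e /\ B e).
Proof.
move=> ha hb; apply: (@Df_iff _ (fun e => ~ (A e -> ~ B e))).
  by move=> e _; split=> [[a b] /(_ a)//|/not_implyP[a /contrapT]].
exact: Df_not (Df_imp ha (Df_not hb)).
Qed.

Lemma Df_or A B : Df N A -> Df N B -> Df N (fun e => A e \/ B e).
Proof.
move=> ha hb; apply: (@Df_iff _ (fun e => ~ A e -> B e)).
  by move=> e _; split=> [[//|//]|h]; case: (pselect (A e)) => [|/h]; [left|right].
exact: Df_imp (Df_not ha) hb.
Qed.

Lemma Df_equiv A B : Df N A -> Df N B -> Df N (fun e => A e <-> B e).
Proof. by move=> ha hb; apply: Df_and; apply: Df_imp. Qed.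

(** The second hypothesis says that [P] reads the variable [n] only through its last argument, so
    that overwriting it is harmless; for concrete formulas it holds by computation. *)
Lemma Df_all n (P : (nat -> hset) -> hset -> Prop) :
  Df N (fun e => P e (e n)) -> (forall e x, P (ue e n x) x = P e x) ->
  Df N (fun e => forall x, N x -> P e x).
Proof.
move=> [phi h] hP; exists (FAll n phi) => e he /=.
have aux x : N x -> (P e x <-> sath N (ue e n x) phi).
  move=> Nx; rewrite -h; first by rewrite -(hP e x) /ue eqxx.
  by move=> m; rewrite /ue; case: eqP.
by split=> k x Nx; apply/(aux x Nx)/k.
Qed.

Lemma Df_ex n (P : (nat -> hset) -> hset -> Prop) :
  Df N (fun e => P e (e n)) -> (forall e x, P (ue e n x) x = P e x) ->
  Df N (fun e => exists x, N x /\ P e x).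
Proof.
move=> h hP.
apply: (@Df_iff _ (fun e => ~ forall x, N x -> ~ P e x)).
  move=> e _; split=> [[x [Nx Px]] /(_ x Nx)//|/existsNP[x]].
  by move/not_implyP=> [Nx /contrapT Px]; exists x.
apply: Df_not; apply: (@Df_all n (fun e x => ~ P e x)); first exact: Df_not h.
by move=> e x; rewrite hP.
Qed.

Hypothesis trN : forall x y, N y -> x ∈ y -> N x.

(** Transitivity of [N] makes a quantifier over all members of a set of [N] the same as one
    relativized to [N]. *)
Lemma Df_allb n i (P : (nat -> hset) -> hset -> Prop) :
  Df N (fun e => e n ∈ e i -> P e (e n)) -> (i == n) = false ->
  (forall e x, P (ue e n x) x = P e x) ->
  Df N (fun e => forall x, x ∈ e i -> P e x).
Proof.
move=> h ni hP; apply: (@Df_iff _ (fun e => forall x, N x -> x ∈ e i -> P e x)).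
  by move=> e he; split=> k x; [move=> _; exact: k|move=> xe; apply: k => //; exact: trN xe].
apply: (@Df_all n (fun e x => x ∈ e i -> P e x)) => // e x.
by rewrite hP /ue ni.
Qed.

Lemma Df_exb n i (P : (nat -> hset) -> hset -> Prop) :
  Df N (fun e => e n ∈ e i /\ P e (e n)) -> (i == n) = false ->
  (forall e x, P (ue e n x) x = P e x) ->
  Df N (fun e => exists x, x ∈ e i /\ P e x).
Proof.
move=> h ni hP; apply: (@Df_iff _ (fun e => exists x, N x /\ x ∈ e i /\ P e x)).
  by move=> e he; split=> [[x [xe Px]]|[x [_ k]]]; exists x => //; split=> //; exact: trN xe.
apply: (@Df_ex n (fun e x => x ∈ e i /\ P e x)) => // e x.
by rewrite hP /ue ni.
Qed.

Hypothesis upN : forall x y, N x -> N y -> N (up x y).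

Lemma Df_up i j k : Df N (fun e => e i = up (e j) (e k)).
Proof.
pose n := (i + j + k).+1.
have [ni nj nk] : [/\ i == n = false, j == n = false & k == n = false].
  by rewrite /n; split; apply/eqP; lia.
apply: (@Df_iff _ (fun e => forall w, N w -> (w ∈ e i <-> w = e j \/ w = e k))).
  move=> e he; split=> [-> w _|h]; first exact: mem_up.
  apply: hset_ext => w; rewrite mem_up.
  split=> [wi|hw]; first by apply/h => //; exact: trN wi.
  by apply/h => //; case: hw => ->.
apply: (@Df_all n (fun e w => w ∈ e i <-> w = e j \/ w = e k)).
  by apply: Df_equiv (Df_mem _ _) (Df_or (Df_eq _ _) (Df_eq _ _)).
by move=> e x; rewrite /ue ni nj nk.
Qed.

Lemma opN x y : N x -> N y -> N (op x y).
Proof. by move=> hx hy; do !apply: upN. Qed.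

Lemma Df_op i j k : Df N (fun e => e i = op (e j) (e k)).
Proof.
pose n := (i + j + k).+1; pose m := n.+1.
have [ni nj nk] : [/\ i == n = false, j == n = false & k == n = false].
  by rewrite /n; split; apply/eqP; lia.
have [mi mj mk mn] :
  [/\ i == m = false, j == m = false, k == m = false & n == m = false].
  by rewrite /m /n; split; apply/eqP; lia.
apply: (@Df_iff _ (fun e => exists a, N a /\ (a = up (e j) (e j) /\
   exists b, N b /\ (b = up (e j) (e k) /\ e i = up a b)))).
  move=> e he; split=> [->|[a [_ [-> [b [_ [-> ->]]]]]]//].
  by exists (up (e j) (e j)); split; [exact: upN|split=> //];
     exists (up (e j) (e k)); split=> //; exact: upN.
apply: (@Df_ex n (fun e a => a = up (e j) (e j) /\
   exists b, N b /\ (b = up (e j) (e k) /\ e i = up a b))); last first.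
  by move=> e x; rewrite /ue ni nj nk.
apply: Df_and (Df_up _ _ _) _.
apply: (@Df_ex m (fun e b => b = up (e j) (e k) /\ e i = up (e n) b)).
  exact: Df_and (Df_up _ _ _) (Df_up _ _ _).
by move=> e x; rewrite /ue mi mj mk mn.
Qed.

Lemma Df_opin i j k : Df N (fun e => op (e i) (e j) ∈ e k).
Proof.
pose n := (i + j + k).+1.
have [ni nj nk] : [/\ i == n = false, j == n = false & k == n = false].
  by rewrite /n; split; apply/eqP; lia.
apply: (@Df_iff _ (fun e => exists x, x ∈ e k /\ x = op (e i) (e j))).
  by move=> e he; split=> [h|[x [? <-]]//]; exists (op (e i) (e j)).
apply: (@Df_exb n k (fun e x => x = op (e i) (e j))) => //.
  by apply: Df_and (Df_mem _ _) (Df_op _ _ _).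
by move=> e x; rewrite /ue ni nj.
Qed.

End Definability.

(** * Zermelo set theory in a class *)

Definition full (T : Type) (cT : Coded T) : hset := code (fun _ : T => True).
Arguments full T {cT}.
Definition omega : hset := full nat.

(** The axioms shared by V and V[G]. Infinity is stated as membership of [omega] itself, and
    separation is stated for definable predicates, so that no formula has to be written down
    later. *)
Record zermelo (N : cls) : Prop := Zermelo {
  z_trans : forall x y, N y -> x ∈ y -> N x;
  z_pair : forall x y, N x -> N y -> N (up x y);
  z_union : forall x, N x ->
    exists2 z, N z & forall w, w ∈ z <-> exists2 y, y ∈ x & w ∈ y;
  z_pow : forall x, N x ->
    exists2 z, N z & forall w, w ∈ z <-> N w /\ forall u, u ∈ w -> u ∈ x;
  z_inf : N (omega);
  z_sep : forall A, Df N A -> forall e x, (forall n, N (e n)) -> N x ->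
    exists2 z, N z & forall w, w ∈ z <-> w ∈ x /\ A (ue e 0 w)
}.

Ltac ztac :=
  match goal with h : zermelo ?N |- _ =>
    first [exact (z_trans h) | exact (z_pair h)] end.

Ltac dfh n := fail.

(** Definability by recursion on the shape of the predicate. The bound variables are numbered from
    [n] on, which must exceed the variables in use; calls with 10 leave enough room. *)
Ltac dfn n :=
  cbv beta;
  lazymatch goal with
  | |- Df _ (fun e => e _ ∈ e _) => exact: Df_mem
  | |- Df _ (fun e => e _ = e _) => exact: Df_eq
  | |- Df _ (fun e => False) => exact: Df_false
  | |- Df _ (fun e => e _ = op (e _) (e _)) =>
      apply: Df_op; ztac
  | |- Df _ (fun e => e _ = up (e _) (e _)) =>
      apply: Df_up; ztac
  | |- Df _ (fun e => op (e _) (e _) ∈ e _) =>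
      apply: Df_opin; ztac
  | |- Df _ (fun e => ~ @?P e) => apply: (@Df_not _ P); dfn n
  | |- Df _ (fun e => @?P e <-> @?Q e) =>
      apply: (@Df_equiv _ P Q); dfn n
  | |- Df _ (fun e => @?P e /\ @?Q e) =>
      apply: (@Df_and _ P Q); dfn n
  | |- Df _ (fun e => @?P e \/ @?Q e) =>
      apply: (@Df_or _ P Q); dfn n
  | |- Df _ (fun e => forall x, x ∈ e ?i -> @?P e x) =>
      apply: (@Df_allb _ _ n i P); [ztac | dfn n.+1
        | reflexivity | reflexivity]
  | |- Df ?N (fun e => forall x, ?N x -> @?P e x) =>
      apply: (@Df_all _ n P); [dfn n.+1 | reflexivity]
  | |- Df _ (fun e => exists x, x ∈ e ?i /\ @?P e x) =>
      apply: (@Df_exb _ _ n i P); [ztac | dfn n.+1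
        | reflexivity | reflexivity]
  | |- Df ?N (fun e => exists x, ?N x /\ @?P e x) =>
      apply: (@Df_ex _ n P); [dfn n.+1 | reflexivity]
  | |- Df _ (fun e => @?P e -> @?Q e) =>
      apply: (@Df_imp _ P Q); dfn n
  | |- _ => dfh n
  end.

Definition le_ (l : seq hset) : nat -> hset := fun n => nth emp l n.

Fixpoint alln (N : cls) (l : seq hset) : Prop :=
  if l is x :: l' then N x /\ alln N l' else True.

Lemma alln_env (N : cls) l : N emp -> alln N l -> forall n, N (le_ l n).
Proof.
move=> h0; elim: l => [|x l IH] /=; first by move=> _ n; rewrite /le_ nth_nil.
by move=> [Nx /IH h] [|n] //; exact: (h n).
Qed.

Section Zermelo.
Variables (N : cls) (hN : zermelo N).

Lemma z_emp : N emp.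
Proof.
apply: (z_trans hN (z_inf hN)); rewrite /omega /full mem_set.
by exists 0%N; rewrite ?code_nat0.
Qed.

Lemma z_op x y : N x -> N y -> N (op x y).
Proof. by apply: opN => *; exact: (z_pair hN). Qed.

Lemma z_op_inv x y : N (op x y) -> N x /\ N y.
Proof.
move=> h; have k : N (up x y) by apply: (z_trans hN h); apply/mem_up; right.
by split; apply: (z_trans hN k); apply/mem_up; [left|right].
Qed.

Lemma z_sepl (A : (nat -> hset) -> Prop) l x :
  Df N A -> alln N l -> N x ->
  exists2 z, N z & forall w, w ∈ z <-> w ∈ x /\ A (le_ (w :: l)).
Proof.
move=> dA hl Nx.
have he := @alln_env N (emp :: l) z_emp (conj z_emp hl).
have [z Nz hz] := z_sep hN dA he Nx; exists z => // w; rewrite hz.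
suff -> : ue (le_ (emp :: l)) 0 w = le_ (w :: l) by [].
by apply/funext => -[|n].
Qed.

Lemma z_setU x y : N x -> N y ->
  exists2 z, N z & forall w, w ∈ z <-> w ∈ x \/ w ∈ y.
Proof.
move=> Nx Ny; have [z Nz hz] := z_union hN (z_pair hN Nx Ny).
exists z => // w; rewrite hz; split=> [[u /mem_up[]->]|[h|h]]; [by left|by right|..].
  by exists x => //; apply/mem_up; left.
by exists y => //; apply/mem_up; right.
Qed.

(** Kuratowski pairs are members of the double power set of the union of x and y. *)
Lemma z_prod x y : N x -> N y ->
  exists2 z, N z & forall w, w ∈ z <-> exists a b, [/\ w = op a b, a ∈ x & b ∈ y].
Proof.
move=> Nx Ny; have [u Nu hu] := z_setU Nx Ny.
have [p Np hp] := z_pow hN Nu; have [q Nq hq] := z_pow hN Np.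
have [|||z Nz hz] := @z_sepl (fun e => exists a, a ∈ e 1%N /\ exists b, b ∈ e 2%N /\
  e 0%N = op a b) [:: x; y] q; [by dfn 10%N|by do !split|by []|].
exists z => // w; rewrite hz /le_ /=; split=> [[_ [a [ax [b [by_ ->]]]]]|[a [b [-> ax by_]]]].
  by exists a, b.
have [Na Nb] := (z_trans hN Nx ax, z_trans hN Ny by_).
split; last by exists a; split=> //; exists b.
apply/hq; split; first exact: z_op.
have aux c d : c ∈ u -> d ∈ u -> up c d ∈ p.
  move=> cu du; apply/hp; split; last by move=> v /mem_up[]->.
  by apply: (z_pair hN); exact: (z_trans hN Nu).
by move=> v /mem_up[]->; apply: aux; apply/hu; by [left|right].
Qed.

End Zermelo.

(* Replacement and choice are only needed in the ground model. *)
Record zfc (N : cls) : Prop := Zfc {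
  zfc_zermelo :> zermelo N;
  h_repl : forall A l x, Df N A -> alln N l -> N x ->
    (forall w, w ∈ x -> exists2 y, N y & forall y', N y' ->
       (A (le_ [:: w, y' & l]) <-> y' = y)) ->
    exists2 z, N z & forall y, y ∈ z <->
      exists2 w, w ∈ x & N y /\ A (le_ [:: w, y & l]);
  h_choice : forall x, N x -> (forall y, y ∈ x -> exists u, u ∈ y) ->
    (forall y y' u, y ∈ x -> y' ∈ x -> u ∈ y -> u ∈ y' -> y = y') ->
    exists2 c, N c & forall y, y ∈ x ->
      exists2 u, u ∈ y & forall w, w ∈ c /\ w ∈ y <-> w = u
}.

(** * The ground model as a class of the quotient *)

Definition clsh (V : class) : cls := fun u => V (rp u).

Lemma clsh_cl (V : class) (HV : transitive_ZFC V) x : clsh V (cl x) <-> V x.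
Proof.
split; apply: (zfc_proper HV); first exact: rp_cl.
exact: eqE_sym (rp_cl x).
Qed.

Section Ground.
Variables (V : class) (HV : transitive_ZFC V).
Let N := clsh V.

Let N_cl x : N (cl x) <-> V x.
Proof. exact: clsh_cl. Qed.

Lemma clsh_mem (P : hset -> Prop) : (exists2 z, V z & forall w, inE w z <-> P (cl w)) ->
  exists2 z, N z & forall w, w ∈ z <-> P w.
Proof.
move=> [u Vu hu]; exists (cl u); first exact/clsh_cl.
by move=> w; rewrite -(rpK w) mem_cl hu.
Qed.

Lemma clsh_trans x y : N y -> x ∈ y -> N x.
Proof. exact: (zfc_trans HV). Qed.

Lemma clsh_pair x y : N x -> N y -> N (up x y).
Proof.
move=> Nx Ny; have [|z Nz hz] := @clsh_mem (fun w => w = x \/ w = y); last first.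
  suff <- : z = up x y by [].
  by apply: hset_ext => w; rewrite hz mem_up.
have [z Vz hz] := zfc_pairing HV Nx Ny; exists z => // w.
by rewrite hz -!clE !rpK.
Qed.

Lemma clsh_sep A : Df N A -> forall e x, (forall n, N (e n)) -> N x ->
  exists2 z, N z & forall w, w ∈ z <-> w ∈ x /\ A (ue e 0 w).
Proof.
move=> [phi hphi] e x he Nx; apply: clsh_mem.
have [z Vz hz] := zfc_separation HV phi he Nx; exists z => // w; rewrite hz.
have -> : cl w ∈ x <-> inE w (rp x) by rewrite -{1}(rpK x) mem_cl.
suff aux : inE w (rp x) -> (sat V (upd (fun n => rp (e n)) 0 w) phi <-> A (ue e 0 (cl w))).
  by split=> -[wx /(aux wx)].
move=> wx; rewrite hphi; last first.
  move=> n; rewrite /ue; case: eqP => // _; apply/N_cl.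
  exact: (zfc_trans HV) Nx wx.
rewrite (sath_sat HV); apply: sat_eqE => n; rewrite /ue /upd.
case: eqP => _; [exact: eqE_sym (rp_cl w) | exact: eqE_refl].
Qed.


Lemma clsh_sepl (A : (nat -> hset) -> Prop) l x : Df N A -> alln N l -> N emp -> N x ->
  exists2 z, N z & forall w, w ∈ z <-> w ∈ x /\ A (le_ (w :: l)).
Proof.
move=> dA hl N0 Nx.
have he := @alln_env N (emp :: l) N0 (conj N0 hl).
have [z Nz hz] := clsh_sep dA he Nx; exists z => // w; rewrite hz.
suff -> : ue (le_ (emp :: l)) 0 w = le_ (w :: l) by [].
by apply/funext => -[|n].
Qed.

(* The natural numbers are the transitive sets in whose successor every
   nonempty member is a successor; foundation is used here. *)
Lemma clsh_inf : N (omega).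
Proof.
have [z0 Vz [z0e z0s]] := zfc_infinity HV.
pose z := cl z0; have Nz : N z by apply/N_cl.
have ze : emp ∈ z by rewrite mem_cl.
have zs w : w ∈ z -> suc w ∈ z.
  by rewrite -(rpK w) mem_cl => /z0s; rewrite -mem_cl cl_succE.
have N0 : N emp := clsh_trans Nz ze.
have trN := clsh_trans; have upN := clsh_pair.
pose A := fun e : nat -> hset =>
  (forall y, y ∈ e 0%N -> forall x, x ∈ y -> x ∈ e 0%N) /\
  forall y, N y -> (y = e 0%N \/ y ∈ e 0%N) -> (y = e 1%N \/ exists v, v ∈ y /\
    forall w, N w -> (w ∈ y <-> w ∈ v \/ w = v)).
have dA : Df N A.
  rewrite /A; apply: Df_and.
    apply: (@Df_allb _ trN 10 0) => //; apply: Df_imp; first exact: Df_mem.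
    by apply: (@Df_allb _ trN 11 10) => //; apply: Df_imp; exact: Df_mem.
  apply: (@Df_all _ 10) => //.
  apply: Df_imp; first by apply: Df_or; [exact: Df_eq|exact: Df_mem].
  apply: Df_or; first exact: Df_eq.
  apply: (@Df_exb _ trN 11 10) => //; apply: Df_and; first exact: Df_mem.
  apply: (@Df_all _ 12) => //; apply: Df_equiv; first exact: Df_mem.
  by apply: Df_or; [exact: Df_mem|exact: Df_eq].
have [om Nom hom] := clsh_sepl dA (l := [:: emp]) (conj N0 I) N0 Nz.
suff -> : omega = om by [].
apply: hset_ext => w; rewrite /omega /full mem_set hom /A /=; split.
  move=> [n _ ->].
  have zn (m : nat) : code m ∈ z by elim: m => // m /zs; rewrite -code_natS.
  split=> //; split.
    move=> y /mem_nat[m mn ->] x /mem_nat[k km ->]; apply/mem_nat.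
    by exists k => //; exact: ltn_trans mn.
  have aux (m : nat) : code m = emp \/ exists v, v ∈ code m /\
      forall w, N w -> w ∈ code m <-> w ∈ v \/ w = v.
    case: m => [|m]; first by left.
    right; exists (code m); split; first by apply/mem_nat; exists m.
    by move=> w' _; rewrite code_natS mem_suc.
  by move=> y _ [->|/mem_nat[m _ ->]]; exact: aux.
move=> [wz]; have {wz} := trN _ _ Nz wz.
elim/(well_founded_ind mem_wf): w => w IH wz [tw hw].
have [->|[v [vw hv]]] := hw w wz (or_introl erefl); first by exists 0%N.
have ev : w = suc v.
  apply: hset_ext => x; rewrite mem_suc; split=> [xw|h].
    by apply/hv => //; exact: trN xw.
  by apply/hv => //; case: h => [xv|->]; [exact: trN (trN _ _ wz vw) xv|exact: trN vw].
have [||n _ en] := IH v vw; [exact: trN vw| |]; last by exists n.+1 => //; rewrite ev en code_natS.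
split=> [y yv x xy|y Ny h].
  have : x ∈ w by apply: tw xy; rewrite ev mem_suc; left.
  rewrite {1}ev mem_suc => -[//|exv]; subst x.
  have cyc (a b : hset) : a ∈ b -> b ∈ a -> False.
    elim/(well_founded_ind mem_wf): a b => a IHa b ab ba.
    exact: (IHa b ba a ba ab).
  by case: (cyc _ _ xy yv).
by apply: hw => //; right; rewrite ev mem_suc; case: h; [right|left].
Qed.

Lemma clsh_zermelo : zermelo N.
Proof.
split; [exact: clsh_trans|exact: clsh_pair|..|exact: clsh_inf|exact: clsh_sep].
- move=> x Nx; apply: clsh_mem; have [z Vz hz] := zfc_union HV Nx.
  exists z => // w; rewrite hz; split=> [[y yx wy]|[y yx wy]].
    by exists (cl y); rewrite ?mem_cl // -(rpK x) mem_cl.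
  by exists (rp y) => //; rewrite -mem_cl rpK.
- move=> x Nx; apply: clsh_mem; have [z Vz hz] := zfc_powerset HV Nx.
  exists z => // w; rewrite hz N_cl.
  split=> -[Vw k]; split=> // u.
    by rewrite -(rpK u) mem_cl => /k; rewrite -mem_cl (rpK x).
  by rewrite -mem_cl => /k; rewrite -{1}(rpK x) mem_cl.
Qed.

Lemma clsh_zfc : zfc N.
Proof.
have hN := clsh_zermelo; have N0 := z_emp hN.
split=> //.
- move=> A l x [phi hphi] hl Nx hfun; apply: clsh_mem.
  pose e := le_ [:: emp, emp & l].
  have he : forall n, N (e n) by apply: alln_env.
  have key w y : N w -> N y -> A (le_ [:: w, y & l]) <->
      sat V (upd (upd (fun n => rp (e n)) 0 (rp w)) 1 (rp y)) phi.
    move=> Nw Ny; rewrite hphi; last by apply: alln_env.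
    rewrite sath_sat //; apply: sat_eqE => -[|[|n]]; exact: eqE_refl.
  have [|z Vz hz] := @zfc_replacement _ HV phi (fun n => rp (e n)) (rp x) he Nx.
    move=> w wx; have wx' : cl w ∈ x by rewrite -(rpK x) mem_cl.
    have [y Ny hy] := hfun _ wx'; exists (rp y) => // y' Vy'.
    have Nw : N (cl w) := z_trans hN Nx wx'.
    have Ny' : N (cl y') by apply/N_cl.
    rewrite -clE rpK -hy // key //; apply: sat_eqE => -[|[|n]];
      by [exact: eqE_refl | exact: eqE_sym (rp_cl _)].
  exists z => // y; rewrite hz; split=> -[w wx [/N_cl Vy h]].
    have wx' : cl w ∈ x by rewrite -(rpK x) mem_cl.
    exists (cl w) => //; split=> //.
    apply/key; [exact: z_trans wx'|by []|].
    apply: (sat_eqE _ _ _).1 h => -[|[|n]];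
      by [exact: eqE_refl | exact: eqE_sym (rp_cl _)].
  exists (rp w); first exact: wx.
  split=> //.
  have /(key w _ (z_trans hN Nx wx) ((N_cl _).2 Vy)) := h.
  apply: (sat_eqE _ _ _).1 => -[|[|n]]; by [exact: eqE_refl | exact: rp_cl].
- move=> x Nx ne disj.
  have [||c Vc hc] := zfc_choice HV Nx.
  + move=> y yx; have [|u uy] := ne (cl y); first by rewrite -(rpK x) mem_cl.
    by exists (rp u); rewrite -mem_cl rpK.
  + move=> y y' u yx yx' uy uy'; apply/clE; apply: (disj _ _ (cl u));
      by rewrite ?mem_cl // -(rpK x) mem_cl.
  exists (cl c); first exact/N_cl.
  move=> y yx; have [u uy hu] := hc _ yx; exists (cl u).
    by rewrite -(rpK y) mem_cl.
  move=> w; rewrite -(rpK w) -(rpK y) !mem_cl clE; exact: hu.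
Qed.

End Ground.

(** * Renaming of variables and definable recursion *)

Lemma fml_rename (N : cls) phi : exists K, forall f : nat -> nat, exists phi',
  forall e e', (forall k, (k < K)%N -> e' k = e (f k)) ->
  (sath N e' phi <-> sath N e phi').
Proof.
elim: phi => [i j|i j||a [Ka ha] b [Kb hb]|n a [K ha]].
- exists (i + j).+1 => f; exists (FMem (f i) (f j)) => e e' h /=.
  by rewrite !h //; lia.
- exists (i + j).+1 => f; exists (FEq (f i) (f j)) => e e' h /=.
  by rewrite !h //; lia.
- by exists 0%N => f; exists FFalse.
- exists (Ka + Kb)%N => f; have [[a' ha'] [b' hb']] := (ha f, hb f).
  exists (FImp a' b') => e e' h /=.
  by rewrite (ha' e e') ?(hb' e e') // => k hk; apply: h; lia.
(* The bound variable becomes one above all [f k] with k < K, which prevents capture. *)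
exists K => f; pose m := (\sum_(k < K) f k).+1.
have [a' ha'] := ha (fun k => if k == n then m else f k).
exists (FAll m a') => e e' h /=.
suff k x : sath N (ue e' n x) a <-> sath N (ue e m x) a'.
  by split=> H x /H /k.
apply: ha' => k kK; rewrite /ue; case: eqP => _; first by rewrite eqxx.
rewrite h //; case: eqP => // e1; suff : (f k < m)%N by rewrite e1 ltnn.
by rewrite /m ltnS (bigD1 (Ordinal kK)) //= leq_addr.
Qed.

Lemma Df_sub (N : cls) A (f : nat -> nat) :
  Df N A -> Df N (fun e => A (fun n => e (f n))).
Proof.
move=> [phi hphi]; have [K hK] := fml_rename N phi; have [phi' h] := hK f.
by exists phi' => e he; rewrite hphi // (h e).
Qed.

Lemma Df2 (N : cls) (A : hset -> hset -> Prop) :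
  Df N (fun e => A (e 0%N) (e 1%N)) -> forall i j, Df N (fun e => A (e i) (e j)).
Proof. by move=> h i j; exact: (Df_sub (nth 0%N [:: i; j]) h). Qed.

Lemma Df3 (N : cls) (A : hset -> hset -> hset -> Prop) :
  Df N (fun e => A (e 0%N) (e 1%N) (e 2%N)) ->
  forall i j k, Df N (fun e => A (e i) (e j) (e k)).
Proof. by move=> h i j k; exact: (Df_sub (nth 0%N [:: i; j; k]) h). Qed.

Lemma Df4 (N : cls) (A : hset -> hset -> hset -> hset -> Prop) :
  Df N (fun e => A (e 0%N) (e 1%N) (e 2%N) (e 3%N)) ->
  forall i j k l, Df N (fun e => A (e i) (e j) (e k) (e l)).
Proof. by move=> h i j k l; exact: (Df_sub (nth 0%N [:: i; j; k; l]) h). Qed.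

(** From here on, an atom that is not primitive is closed by a definability statement in the
    context; this is why such statements are introduced by [have] just before [dfn]. *)
Ltac dfh n ::=
  solve [match goal with H : _ |- _ => apply H end].

Section Recursion.
Variables (N : cls) (hN : zfc N).
Let hZ : zermelo N := hN.
Variables (c : hset) (Nc : N c).
Variables (E : hset -> hset -> hset -> Prop)
  (Psi : hset -> hset -> hset -> hset -> Prop).
Hypothesis HE0 : Df N (fun e => E (e 0%N) (e 1%N) (e 2%N)).
Hypothesis HP0 : Df N (fun e => Psi (e 0%N) (e 1%N) (e 2%N) (e 3%N)).
Let HE := Df3 HE0.
Let HP := Df4 HP0.
Hypothesis HEset : forall y, N y ->
  exists2 s, N s & forall z, z ∈ s <-> N z /\ E c z y.
Hypothesis HPsi : forall y s, N y -> N s ->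
  exists2 u, N u & forall u', N u' -> (Psi c y s u' <-> u' = u).
(** Induction is required for definable properties only, so that the recursion also runs along an
    order whose well-foundedness is known merely inside [N]. *)
Hypothesis Hind : forall A : hset -> Prop,
  (exists D l, [/\ Df N D, alln N l & forall y, N y -> (A y <-> D (le_ (y :: l)))]) ->
  (forall y, N y -> (forall z, N z -> E c z y -> A z) -> A y) ->
  forall y, N y -> A y.

(** An approximation to the recursive function: where it has a value, it has values at all
    predecessors, and the value is computed by [Psi] from the set [s] of those. Single-valuedness is
    not part of the definition; it follows by induction in [rec_rel_uniq]. *)
Definition derivation (c g : hset) : Prop :=
  forall y, N y -> forall u, N u -> op y u ∈ g ->
  (forall z, N z -> E c z y -> exists v, N v /\ op z v ∈ g) /\
  exists s, N s /\ ((forall v, N v ->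
    (v ∈ s <-> exists z, N z /\ (E c z y /\ op z v ∈ g))) /\ Psi c y s u).

Definition rec_rel (c y u : hset) : Prop :=
  exists g, N g /\ (derivation c g /\ op y u ∈ g).

Lemma derivation_Df i j : Df N (fun e => derivation (e i) (e j)).
Proof. by apply: Df2; rewrite /derivation; dfn 10%N. Qed.

Lemma rec_rel_Df i j k : Df N (fun e => rec_rel (e i) (e j) (e k)).
Proof. by have h := derivation_Df; apply: Df3; rewrite /rec_rel; dfn 10%N. Qed.

Lemma op_N y u g : N g -> op y u ∈ g -> N y /\ N u.
Proof. by move=> Ng /(z_trans hZ Ng) /(z_op_inv hZ). Qed.

Lemma rec_rel_uniq y : N y -> forall u u', N u -> N u' ->
  rec_rel c y u -> rec_rel c y u' -> u = u'.
Proof.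
move: y; apply: Hind.
  exists (fun e => forall u, N u -> forall u', N u' ->
    rec_rel (e 1%N) (e 0%N) u -> rec_rel (e 1%N) (e 0%N) u' -> u = u'), [:: c].
  split=> //; first by have h := rec_rel_Df; dfn 10%N.
  by move=> y _; split=> h *; exact: h.
move=> y Ny IH u u' Nu Nu' [g [Ng [dg yu]]] [g' [Ng' [dg' yu']]].
have [p [s [Ns [hs Ps]]]] := dg _ Ny _ Nu yu.
have [p' [s' [Ns' [hs' Ps']]]] := dg' _ Ny _ Nu' yu'.
have [x Nx hx] := HPsi Ny Ns.
suff es : s = s'.
  by rewrite -es in Ps'; move/(hx _ Nu): Ps => ->; move/(hx _ Nu'): Ps' => ->.
have tr := z_trans hZ.
apply: hset_ext => v; split=> [vs|vs].
  have Nv := tr _ _ Ns vs; have [z [Nz [Ez zv]]] := (hs _ Nv).1 vs.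
  have [v' [Nv' zv']] := p' _ Nz Ez.
  apply/hs' => //; exists z; split=> //; split=> //.
  by rewrite (IH z Nz Ez v v') //; [exists g|exists g'].
have Nv := tr _ _ Ns' vs; have [z [Nz [Ez zv]]] := (hs' _ Nv).1 vs.
have [v' [Nv' zv']] := p _ Nz Ez.
apply/hs => //; exists z; split=> //; split=> //.
by rewrite (IH z Nz Ez v v') //; [exists g'|exists g].
Qed.

(* The least derivation defined at [z] is definable, so replacement applies. *)
Definition least_derivation (c z g : hset) : Prop :=
  derivation c g /\ ((exists v, N v /\ op z v ∈ g) /\
  forall g', N g' -> derivation c g' -> (exists v, N v /\ op z v ∈ g') ->
    forall w, w ∈ g -> w ∈ g').

Lemma least_derivation_Df i j k : Df N (fun e => least_derivation (e i) (e j) (e k)).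
Proof. by have h := derivation_Df; apply: Df3; rewrite /least_derivation; dfn 10%N. Qed.

Lemma least_derivation_ex z u : N z -> N u -> rec_rel c z u ->
  exists2 g, N g & forall g', N g' -> (least_derivation c z g' <-> g' = g).
Proof.
move=> Nz Nu [g0 [Ng0 [dg0 zu]]].
have hd := derivation_Df.
have [|||g Ng hg] := z_sepl hZ (A := fun e => forall g', N g' ->
  derivation (e 1%N) g' -> (exists v, N v /\ op (e 2%N) v ∈ g') -> e 0%N ∈ g')
  (l := [:: c; z]) (x := g0).
- by dfn 10%N.
- by do !split.
- by [].
rewrite /le_ /= in hg.
have sub w : w ∈ g -> w ∈ g0 by move/hg => [].
have uv g' : N g' -> derivation c g' -> (exists v, N v /\ op z v ∈ g') -> op z u ∈ g'.
  move=> Ng' dg' [v [Nv zv]]; rewrite (rec_rel_uniq Nz Nu Nv) //; last by exists g'.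
  by exists g0.
have zg : op z u ∈ g by apply/hg; split.
have dg : derivation c g.
  move=> y Ny x Nx yx.
  have [p [s [Ns [hs Ps]]]] := dg0 _ Ny _ Nx (sub _ yx).
  have key z' v : N z' -> N v -> E c z' y -> op z' v ∈ g0 -> op z' v ∈ g.
    move=> Nz' Nv Ez' zv; apply/hg; split=> // g' Ng' dg' k.
    have yx' : op y x ∈ g' by move/hg: yx => [_]; apply.
    have [p' _] := dg' _ Ny _ Nx yx'.
    have [v' [Nv' zv']] := p' _ Nz' Ez'.
    by rewrite (rec_rel_uniq Nz' Nv Nv') //; [exists g0|exists g'].
  split=> [z' Nz' Ez'|].
    by have [v [Nv zv]] := p _ Nz' Ez'; exists v; split=> //; exact: key.
  exists s; split=> //; split=> // v Nv; rewrite hs //.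
  split=> -[z' [Nz' [Ez' zv]]]; exists z'; do 2!split=> //; [exact: key|exact: sub].
have lg : least_derivation c z g.
  split=> //; split; first by exists u.
  by move=> g' Ng' dg' k w /hg[_]; apply.
exists g => // g' Ng'; split=> [[dg' [k' m']]|-> //].
apply: hset_ext => w; split; first by apply: m' => //; exists u.
by case: lg => _ [_]; apply.
Qed.

(** By replacement the least derivations at the predecessors of y form a set. Derivations agree
    where both are defined, so the union h is one, and the pair of y and the value computed from h
    is added to it. *)
Lemma rec_rel_ex y : N y -> exists u, N u /\ rec_rel c y u.
Proof.
move: y; apply: Hind.
  exists (fun e => exists u, N u /\ rec_rel (e 1%N) (e 0%N) u), [:: c].
  by split=> //; have h := rec_rel_Df; dfn 10%N.
move=> y Ny IH; have [p Np hp] := HEset Ny.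
have ldf := least_derivation_Df; have hd := derivation_Df.
have [||||G NG hG] := h_repl hN (A := fun e => least_derivation (e 2%N) (e 0%N) (e 1%N))
   (l := [:: c]) (x := p).
- by dfn 10%N.
- by do !split.
- by [].
- move=> w /hp[Nw Ew]; have [u [Nu r]] := IH w Nw Ew.
  exact: least_derivation_ex r.
have [h Nh hh] := z_union hZ NG; rewrite /le_ /= in hG.
have tr := z_trans hZ.
have sub g w : g ∈ G -> w ∈ g -> w ∈ h by move=> gG wg; apply/hh; exists g.
have relh z v : op z v ∈ h -> rec_rel c z v.
  by move=> /hh[g /hG[w _ [Ng [dg _]]] zv]; exists g.
have dh : derivation c h.
  move=> x Nx u Nu /hh[g gG xu].
  have [w _ [Ng [dg _]]] := (hG g).1 gG.
  have [q [s [Ns [hs Ps]]]] := dg _ Nx _ Nu xu.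
  split=> [z Nz Ez|].
    by have [v [Nv zv]] := q _ Nz Ez; exists v; split=> //; exact: sub zv.
  exists s; split=> //; split=> // v Nv; rewrite hs //.
  split=> -[z [Nz [Ez zv]]]; exists z; do 2!split=> //; first exact: sub zv.
  have [v' [Nv' zv']] := q _ Nz Ez.
  rewrite (rec_rel_uniq Nz Nv Nv') //; first exact: relh.
  by exists g.
have [[u yu]|ny] := pselect (exists u, op y u ∈ h).
  by exists u; split; [have [] := op_N Nh yu|exact: relh].
(* A second component of a pair in h is found two unions below h. *)
have [U NU hU] := z_union hZ Nh; have [W NW hW] := z_union hZ NU.
have [|||s Ns hs] := z_sepl hZ (A := fun e => exists z, N z /\ (E (e 1%N) z (e 2%N) /\
  op z (e 0%N) ∈ e 3%N)) (l := [:: c; y; h]) (x := W).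
- by dfn 10%N.
- by do !split.
- by [].
rewrite /le_ /= in hs.
have hs' v : v ∈ s <-> exists z, N z /\ (E c z y /\ op z v ∈ h).
  rewrite hs; split=> [[]//|k]; split=> //; have [z [Nz [Ez zv]]] := k.
  apply/hW; exists (up z v); last by apply/mem_up; right.
  by apply/hU; exists (op z v) => //; apply/mem_up; right.
have [u Nu hu] := HPsi Ny Ns.
have [g Ng hg] := z_setU hZ Nh (z_pair hZ (z_op hZ Ny Nu) (z_op hZ Ny Nu)).
have hg' x v : op x v ∈ g <-> op x v ∈ h \/ (x = y /\ v = u).
  rewrite hg mem_up; split=> [[|[|]/op_inj]|[|[-> ->]]]; tauto.
exists u; split=> //; exists g; split=> //; split; last by apply/hg'; right.
move=> x Nx v Nv /hg'[xv|[-> ->]].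
  have [q [t [Nt [ht Pt]]]] := dh _ Nx _ Nv xv; split=> [z Nz Ez|].
    by have [v' [Nv' zv']] := q _ Nz Ez; exists v'; split=> //; apply/hg'; left.
  exists t; split=> //; split=> // v' Nv'; rewrite ht //.
  split=> -[z [Nz [Ez zv]]]; exists z; do 2!split=> //; first by apply/hg'; left.
  case/hg': zv => // -[zy _]; subst z.
  by have [v'' [_ yv]] := q _ Nz Ez; case: ny; exists v''.
have pred z : N z -> E c z y -> exists v, N v /\ op z v ∈ h.
  move=> Nz Ez; have [u' [Nu' r]] := IH z Nz Ez.
  have [g' Ng' hg''] := least_derivation_ex Nz Nu' r.
  have lg := (hg'' _ Ng').2 erefl; have [_ [[v' [Nv' zv]] _]] := lg.
  exists v'; split=> //; apply: (sub g') => //; apply/hG.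
  by exists z => //; apply/hp.
split=> [z Nz Ez|].
  by have [v' [Nv' zv']] := pred _ Nz Ez; exists v'; split=> //; apply/hg'; left.
exists s; split=> //; split; last exact/hu.
move=> v' Nv'; rewrite hs'; split=> -[z [Nz [Ez zv]]]; exists z; do 2!split=> //.
  by apply/hg'; left.
case/hg': zv => // -[zy _]; subst z.
by have [v'' [_ yv]] := pred _ Nz Ez; case: ny; exists v''.
Qed.

Theorem recursion : exists F : hset -> hset,
  [/\ forall y, N y -> N (F y),
      forall y, N y -> exists2 s, N s &
        (forall v, v ∈ s <-> exists z, [/\ N z, E c z y & v = F z]) /\ Psi c y s (F y)
    & forall d, N d -> exists2 z, N z & forall w, w ∈ z <-> exists2 y, y ∈ d & w = op y (F y)].
Proof.
have tr := z_trans hZ.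
have ex y : exists u, N y -> N u /\ rec_rel c y u.
  have [Ny|nNy] := pselect (N y); last by exists emp.
  by have [u h] := rec_rel_ex Ny; exists u.
have [F hF] := choice ex.
have uF y u : N y -> N u -> rec_rel c y u -> u = F y.
  by move=> Ny Nu r; have [? ?] := hF y Ny; exact: (rec_rel_uniq Ny).
exists F; split=> [y /hF[]//|y Ny|d Nd].
  have [NF [g [Ng [dg yu]]]] := hF y Ny.
  have [p [s [Ns [hs Ps]]]] := dg _ Ny _ NF yu.
  exists s => //; split=> // v; split=> [vs|[z [Nz Ez ->]]].
    have Nv := tr _ _ Ns vs; have [z [Nz [Ez zv]]] := (hs _ Nv).1 vs.
    by exists z; split=> //; apply: uF => //; exists g.
  have [v' [Nv' zv']] := p _ Nz Ez; have [NFz _] := hF z Nz.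
  apply/hs => //; exists z; do 2!split=> //.
  by rewrite -(uF z v') //; exists g.
have rdf := rec_rel_Df.
have [||||z Nz hz] := h_repl hN (A := fun e => exists u, N u /\ (rec_rel (e 2%N) (e 0%N) u /\
   e 1%N = op (e 0%N) u)) (l := [:: c]) (x := d).
- by dfn 10%N.
- by do !split.
- by [].
- move=> w wd; have Nw := tr _ _ Nd wd; have [NF r] := hF w Nw.
  exists (op w (F w)); first exact: z_op.
  rewrite /le_ /= => y' Ny'; split=> [[u [Nu [ru ->]]]|->].
    by rewrite (uF w u).
  by exists (F w).
exists z => // w; rewrite hz /le_ /=; split=> [[y yd [Nw [u [Nu [ru ->]]]]]|[y yd ->]].
  by exists y => //; rewrite -(uF y u) //; exact: tr yd.
have Ny := tr _ _ Nd yd; have [NF r] := hF y Ny.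
exists y => //; split; first exact: z_op.
by exists (F y).
Qed.

End Recursion.

Lemma mem_induction (N : cls) (A : hset -> Prop) :
  (forall y, N y -> (forall z, N z -> z ∈ y -> A z) -> A y) -> forall y, N y -> A y.
Proof.
move=> h y; elim/(well_founded_ind mem_wf): y => y IH Ny.
by apply: h => // z Nz zy; exact: IH.
Qed.

(** Recursion on membership: the value at y consists of y and of the members of the values at its
    members. The result bounds the relation of forced equality by a set. *)
Lemma transitive_closure (N : cls) (hN : zfc N) y : N y ->
  exists t, [/\ N t, y ∈ t & forall u v, u ∈ t -> v ∈ u -> v ∈ t].
Proof.
have hZ : zermelo N := hN; have tr := z_trans hZ.
have [|||||F [NF hF _]] := @recursion N hN emp (z_emp hZ) (fun _ z y => z ∈ y)
  (fun _ y s u => forall w, N w -> (w ∈ u <-> w = y \/ exists v, v ∈ s /\ w ∈ v)).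
- by dfn 10%N.
- by dfn 10%N.
- by move=> x Nx; exists x => // z; split=> [zx|[]//]; split=> //; exact: tr zx.
- move=> x s Nx Ns; have [U NU hU] := z_union hZ Ns.
  have [u Nu hu] := z_setU hZ (z_pair hZ Nx Nx) NU.
  have hu' w : w ∈ u <-> w = x \/ exists v, v ∈ s /\ w ∈ v.
    rewrite hu mem_up hU; split=> [[[]|[v]]|[|[v []]]]; [by left|by left|..].
    + by right; exists v.
    + by move=> ->; left; left.
    + by right; exists v.
  exists u => // u' Nu'; split=> [h|-> //]; apply: hset_ext => w.
  by split=> [wu|/hu' wu]; [apply/hu'/h => //; exact: tr wu|apply/h => //];
    case: wu => [->//|[v [vs wv]]]; exact: tr (tr _ _ Ns vs) wv.
- by move=> A _; exact: mem_induction.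
have mF w x : N w -> N x -> (w ∈ F x <-> w = x \/ exists z, z ∈ x /\ w ∈ F z).
  move=> Nw Nx; have [s Ns [hs ->]] := hF x Nx; last by [].
  split=> -[|[v [vs wv]]]; [by left|right|by left|right].
    by move/hs: vs => [z [Nz zx ev]]; exists z; rewrite -ev.
  by exists (F v); split=> //; apply/hs; exists v; split=> //; exact: tr vs.
move=> Ny; exists (F y); split; [exact: NF|by apply/mF => //; left|].
move: y Ny; apply: mem_induction => y Ny IH u v uF vu.
have Nu := tr _ _ (NF y Ny) uF; have Nv := tr _ _ Nu vu.
apply/mF => //; right; have [uy|[z [zy uz]]] := (mF u y Nu Ny).1 uF.
  by exists v; split; [rewrite -uy|apply/mF => //; left].
by exists z; split=> //; apply: IH vu => //; exact: tr zy.
Qed.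

(** A tree may branch over any subtype of an index type, so replacement holds in the ambient
    universe for arbitrary functional relations. It provides the values of names, which are formed
    outside V. *)
Lemma ext_replacement (t : hset) (R : hset -> hset -> Prop) :
  (forall w y y', R w y -> R w y' -> y = y') ->
  exists x, forall y, y ∈ x <-> exists2 w, w ∈ t & R w y.
Proof.
move=> fR; rewrite -(rpK t); case: (rp t) => J f.
pose g (j : {j : J | exists y, R (cl (f j)) y}) := sval (cid (svalP j)).
have gP j : R (cl (f (sval j))) (g j) by rewrite /g; case: cid.
exists (famh g) => y; rewrite mem_famh; split=> [[j ->]|[w]].
  by exists (cl (f (sval j))) => //; rewrite mem_cl; exists (sval j); exact: eqE_refl.
rewrite -{1}(rpK w) mem_cl => -[j /clE]; rewrite rpK => -> Ry.
have ex : exists y, R (cl (f j)) y by exists y.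
by exists (exist _ j ex); apply: fR Ry _; exact: gP (exist _ j ex).
Qed.

(** * Names and their values *)

Definition name_rel (s t : hset) : Prop := exists q, op s q ∈ t.

Lemma name_rel_wf : well_founded name_rel.
Proof.
apply: (wf_incl _ name_rel (clos_trans _ mem_h)); last exact: wf_clos_trans mem_wf.
move=> s t [q h]; apply: t_trans (t_step _ _ _ _ h).
apply: (t_trans _ _ _ (up s s)); apply: t_step.
  by apply/mem_up; left.
by apply/mem_up; left.
Qed.

Section Evaluation.
Variables (P : Type) (cP : Coded P) (G : P -> Prop).

Definition gen (u : hset) : Prop := exists2 p, G p & u = code p.

Definition pick_h (Q : hset -> Prop) : hset :=
  if pselect (exists x, Q x) is left h then sval (cid h) else emp.

Definition vlF (t : hset) (rec : forall s, name_rel s t -> hset) : hset :=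
  pick_h (fun x => forall y, y ∈ x <->
    exists s q (h : op s q ∈ t), gen q /\ y = rec s (ex_intro _ q h)).

Definition vl : hset -> hset := Fix name_rel_wf (fun=> hset) vlF.

Lemma mem_vl t y : y ∈ vl t <-> exists s q, [/\ op s q ∈ t, gen q & y = vl s].
Proof.
rewrite /vl Fix_eq -/vl; last first.
  move=> x f g fg; congr (vlF _); apply: functional_extensionality_dep => s.
  by apply: functional_extensionality_dep => h.
have [|x hx] := @ext_replacement t
  (fun w y => exists s q, [/\ w = op s q, gen q & y = vl s]); last first.
  rewrite /vlF /pick_h; case: pselect => [e|[]]; first case: cid => /= z ->.
    by split=> [[s [q [h [gq ->]]]]|[s [q [h gq ->]]]]; exists s, q.
  exists x => z; rewrite hx; split=> [[w wt [s [q [ew gq ->]]]]|[s [q [h [gq ->]]]]].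
    by rewrite ew in wt; exists s, q, wt.
  by exists (op s q) => //; exists s, q.
by move=> w z z' [s [q [-> _ ->]]] [s' [q' [/op_inj[-> _] _ ->]]].
Qed.

(** Well-founded recursion on names turns the inductive evaluation relation into a total function on
    the quotient. *)
Lemma evaluatesE t x : evaluates cP G t x <-> cl x = vl (cl t).
Proof.
move ec: (cl t) => u; elim/(well_founded_ind name_rel_wf): u t x ec => u IH t x ec.
split=> [h|ex].
  case: h ec IH => {}t {}x h1 h2 ec IH.
  apply: hset_ext => y; rewrite mem_vl -{1}(rpK y) mem_cl; split.
    move=> /h1[s [p [spt Gp ev]]].
    have h : op (cl s) (code p) ∈ u by rewrite -ec -cl_opair mem_cl.
    exists (cl s), (code p); split=> //; first by exists p.
    by rewrite -(rpK y); apply/(IH (cl s) _ s) => //; exists (code p).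
  move=> [s [q [h [p Gp eq] ey]]]; have [||z zx ev] := h2 (rp s) p; last 1 first.
  - have /(IH s _ (rp s)) := ev; rewrite rpK => ez; rewrite -mem_cl rpK ey -ez //.
      by rewrite mem_cl.
    by exists q.
  - by rewrite -mem_cl cl_opair rpK ec -/(code p) -eq.
  - by [].
constructor=> [y yx|s p spt Gp].
  have : cl y ∈ vl u by rewrite -ex mem_cl.
  move=> /mem_vl[s [q [h [p Gp eq] ey]]]; exists (rp s), p; split=> //.
    by rewrite -mem_cl cl_opair rpK ec -/(code p) -eq.
  by apply/(IH s) => //; [exists q|exact: rpK].
have h : op (cl s) (code p) ∈ u by rewrite -ec -cl_opair mem_cl.
have : vl (cl s) ∈ cl x by rewrite ex mem_vl; exists (cl s), (code p); split=> //; exists p.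
rewrite -(rpK (vl (cl s))) mem_cl => vx; exists (rp (vl (cl s))) => //.
by apply/(IH (cl s)) => //; [exists (code p)|exact: rpK].
Qed.

End Evaluation.

(** * The forcing relation and its definability *)

Section Forcing.
Variable N : cls.

Definition tri (W s t p : hset) : Prop :=
  exists x, N x /\ (x = op t p /\ op s x ∈ W).

(** A triple (s, t, p) of [W] claims that p forces s = t. The claim is justified by back and forth:
    below p and below q, a member (s', q) of s is densely matched by a member (t', q') of t through
    another triple of [W], and conversely. *)
Definition bisim (PO W : hset) : Prop :=
  forall s, N s -> forall t, N t -> forall p, N p -> tri W s t p ->
  (forall s', N s' -> forall q, N q -> op s' q ∈ s ->
   forall r, N r -> op r p ∈ PO -> op r q ∈ PO ->
   exists r', N r' /\ (op r' r ∈ PO /\ exists t', N t' /\ exists q', N q' /\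
     (op t' q' ∈ t /\ (op r' q' ∈ PO /\ tri W s' t' r')))) /\
  (forall t', N t' -> forall q, N q -> op t' q ∈ t ->
   forall r, N r -> op r p ∈ PO -> op r q ∈ PO ->
   exists r', N r' /\ (op r' r ∈ PO /\ exists s', N s' /\ exists q', N q' /\
     (op s' q' ∈ s /\ (op r' q' ∈ PO /\ tri W s' t' r')))).

(** Forced equality as the existence of a bisimulation that is a set of the ground model. This gives
    one formula at once, in place of a simultaneous recursion on pairs of names. *)
Definition feq (PO p s t : hset) : Prop :=
  exists W, N W /\ (bisim PO W /\
    exists p0, N p0 /\ (op p p0 ∈ PO /\ tri W s t p0)).

Definition fmem (PO p s t : hset) : Prop :=
  forall q, N q -> op q p ∈ PO -> exists r, N r /\ (op r q ∈ PO /\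
    exists t', N t' /\ exists q', N q' /\
    (op t' q' ∈ t /\ (op r q' ∈ PO /\ feq PO r s t'))).

(** The clauses are arranged so that what is forced densely below p is forced by p ([forces_dense]);
    an implication to [FFalse] is forced by p exactly if no stronger condition forces its
    premise. *)
Fixpoint forces (phi : fml) (PO p : hset) (sg : nat -> hset) : Prop :=
  match phi with
  | FMem i j => fmem PO p (sg i) (sg j)
  | FEq i j => forall q, N q -> op q p ∈ PO ->
      exists r, N r /\ (op r q ∈ PO /\ feq PO r (sg i) (sg j))
  | FFalse => False
  | FImp a b => forall q, N q -> op q p ∈ PO -> forces a PO q sg ->
      exists r, N r /\ (op r q ∈ PO /\ forces b PO r sg)
  | FAll n a => forall t, N t -> forces a PO p (ue sg n t)
  end.

Hypothesis hN : zermelo N.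

Lemma tri_Df i j k l : Df N (fun e => tri (e i) (e j) (e k) (e l)).
Proof. by apply: Df4; rewrite /tri; dfn 10%N. Qed.

Lemma bisim_Df i j : Df N (fun e => bisim (e i) (e j)).
Proof. by have h := tri_Df; apply: Df2; rewrite /bisim; dfn 10%N. Qed.

Lemma feq_Df i j k l : Df N (fun e => feq (e i) (e j) (e k) (e l)).
Proof.
by have h := tri_Df; have h' := bisim_Df; apply: Df4; rewrite /feq; dfn 10%N.
Qed.

Lemma fmem_Df i j k l : Df N (fun e => fmem (e i) (e j) (e k) (e l)).
Proof. by have h := feq_Df; apply: Df4; rewrite /fmem; dfn 10%N. Qed.

(** Variable 0 holds the condition, 3 the order and [n.+4] the name for the variable n of [phi]; 1
    and 2 are left for the conditions bound inside [forces]. *)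
Lemma forces_Df phi : Df N (fun e => forces phi (e 3%N) (e 0%N) (fun n => e n.+4)).
Proof.
elim: phi => [i j|i j||a IHa b IHb|n a [phi h]] /=.
- exact: fmem_Df.
- apply: (@Df_all _ 1) => //; apply: Df_imp; first by apply: Df_opin; ztac.
  apply: (@Df_ex _ 2) => //; apply: Df_and; first by apply: Df_opin; ztac.
  exact: feq_Df.
- exact: Df_false.
- apply: (@Df_all _ 1) => //; apply: Df_imp; first by apply: Df_opin; ztac.
  apply: Df_imp; first exact: (Df_sub (fun k => if k is k'.+1 then k else 1%N) IHa).
  apply: (@Df_ex _ 2) => //; apply: Df_and; first by apply: Df_opin; ztac.
  exact: (Df_sub (fun k => if k is k'.+1 then k else 2%N) IHb).
exists (FAll n.+4 phi) => e he /=.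
have aux t : N t -> (forces a (e 3%N) (e 0%N) (ue (fun n => e n.+4) n t) <->
   sath N (ue e n.+4 t) phi).
  by move=> Nt; rewrite -h // => m; rewrite /ue; case: eqP.
by split=> k t Nt; apply/(aux t Nt)/k.
Qed.

End Forcing.

Lemma Df_exue (N : cls) n A : Df N A -> Df N (fun e => exists t, N t /\ A (ue e n t)).
Proof.
move=> [phi h]; exists (FImp (FAll n (FImp phi FFalse)) FFalse) => e he /=.
have aux t : N t -> (A (ue e n t) <-> sath N (ue e n t) phi).
  by move=> Nt; apply: h => m; rewrite /ue; case: eqP.
split=> [[t [Nt /(aux t Nt) s]] /(_ t Nt)//|k].
by apply: contrapT => k'; apply: k => t Nt /(aux t Nt) At; apply: k'; exists t.
Qed.

(** * The forcing theorem and Zermelo set theory in V[G] *)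

Section Extension.
Variables (V : class) (HV : transitive_ZFC V).
Variables (dP : Order.disp_t) (P : preorderType dP) (cP : Coded P).
Hypothesis HP : ordered_in V cP.
Variables (G : P -> Prop) (HG : generic V cP G).

Let N := clsh V.
Let hN : zfc N := clsh_zfc HV.
Let hZ : zermelo N := hN.
Let tr := z_trans hZ.
Let Pc := full P.
Let PO := code (fun p : P * P => (p.1 <= p.2)%O : Prop).
Let NPc : N Pc. Proof. by apply/(clsh_cl HV); exact: HP.1.2. Qed.
Let NPO : N PO. Proof. by apply/(clsh_cl HV); exact: HP.2. Qed.
Let Gs := gen cP G.
Notation vl := (vl cP G).

Lemma code_P_inj : injective (code : P -> hset).
Proof. by move=> p q /clE; exact: HP.1.1. Qed.

Lemma mem_Pc u : u ∈ Pc <-> exists p : P, u = code p.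
Proof. by rewrite mem_set; split=> [[p]|[p]]; exists p. Qed.

Lemma mem_PO q p : op q p ∈ PO <-> exists a b : P, [/\ q = code a, p = code b & (a <= b)%O].
Proof.
rewrite mem_set; split=> [[[a b] /= ab]|[a [b [-> -> ab]]]]; last first.
  by exists (a, b) => //; rewrite code_pair.
by rewrite code_pair => /op_inj[-> ->]; exists a, b.
Qed.

Lemma PO_code q p : op (code q) (code p) ∈ PO <-> (q <= p)%O.
Proof.
rewrite mem_PO; split=> [[a [b [/code_P_inj-> /code_P_inj->]]]//|qp].
by exists q, p.
Qed.

Lemma PO_refl p : p ∈ Pc -> op p p ∈ PO.
Proof. by move=> /mem_Pc[a ->]; apply/PO_code. Qed.

Lemma PO_trans p q r : op r q ∈ PO -> op q p ∈ PO -> op r p ∈ PO.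
Proof.
move=> /mem_PO[a [b [-> -> ab]]] /mem_PO[b' [c [/code_P_inj e -> bc]]].
by subst b'; apply/PO_code; exact: le_trans bc.
Qed.

Lemma PO_l q p : op q p ∈ PO -> q ∈ Pc.
Proof. by move=> /mem_PO[a [b [-> _ _]]]; apply/mem_Pc; exists a. Qed.

Lemma N_Pc p : p ∈ Pc -> N p. Proof. exact: tr. Qed.

Lemma gen_Pc p : Gs p -> p ∈ Pc.
Proof. by move=> [a _ ->]; apply/mem_Pc; exists a. Qed.

Lemma gen_N p : Gs p -> N p. Proof. by move=> /gen_Pc/N_Pc. Qed.

Lemma gen_ex : exists p, Gs p.
Proof. by case: HG => -[p Gp] _ _ _; exists (code p); exists p. Qed.

Lemma gen_up p q : Gs p -> op p q ∈ PO -> Gs q.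
Proof.
case: HG => _ hup _ _ [a Ga ->] /mem_PO[a' [b [/code_P_inj e -> ab]]]; subst a'.
by exists b => //; exact: hup ab.
Qed.

Lemma gen_dir p q : Gs p -> Gs q -> exists r, [/\ Gs r, op r p ∈ PO & op r q ∈ PO].
Proof.
case: HG => _ _ hdir _ [a Ga ->] [b Gb ->]; have [c Gc [ca cb]] := hdir a b Ga Gb.
by exists (code c); split; [exists c| exact/PO_code| exact/PO_code].
Qed.

Lemma gen_dense D : N D ->
  (forall p, p ∈ Pc -> exists2 q, q ∈ D & op q p ∈ PO) -> exists2 p, Gs p & p ∈ D.
Proof.
move=> ND dD; case: HG => _ _ _ hg.
have [|||D' ND' hD'] := z_sepl hZ (A := fun e => e 0%N ∈ e 1%N) (l := [:: Pc]) (x := D).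
- by dfn 10%N.
- by do !split.
- by [].
have [||p Gp Dp] := hg (fun p => code p ∈ D).
- apply/(clsh_cl HV); rewrite -/(code _).
  suff -> : @code _ (coded_set cP) (fun p => @code _ cP p ∈ D) = D' by [].
  apply: hset_ext => w; rewrite mem_set hD' /le_ /= mem_Pc.
  by split=> [[p Dp ->]|[Dw [p e]]]; [split=> //; exists p|exists p; rewrite -?e].
- move=> p; have [|q Dq qp] := dD (code p); first by apply/mem_Pc; exists p.
  have /mem_Pc[q' e] := PO_l qp; subst q; exists q' => //; exact/PO_code.
- by exists (code p) => //; exists p.
Qed.

(** [D] becomes dense when the conditions incompatible with r are added, and none of these belongs
    to a filter containing r. *)
Lemma gen_below D r : N D -> Gs r ->
  (forall p, op p r ∈ PO -> exists2 q, q ∈ D & op q p ∈ PO) -> exists2 p, Gs p & p ∈ D.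
Proof.
move=> ND Gr dD; have Nr := gen_N Gr.
have [|||D' ND' hD'] := z_sepl hZ (A := fun e => e 0%N ∈ e 1%N \/
   ~ exists q, N q /\ (op q (e 0%N) ∈ e 2%N /\ op q (e 3%N) ∈ e 2%N))
   (l := [:: D; PO; r]) (x := Pc).
- by dfn 10%N.
- by do !split.
- by [].
rewrite /le_ /= in hD'.
have [p pP|p Gp /hD'[_ []]] := @gen_dense D' ND'; last 2 first.
- by exists p.
- have [q [Gq qp qr]] := gen_dir Gp Gr; case.
  by exists q; split=> //; exact: gen_N.
have [[q [Nq [qp qr]]]|no] := pselect (exists q, N q /\ (op q p ∈ PO /\ op q r ∈ PO)).
  have [q' Dq' q'q] := dD _ qr; exists q'; last exact: PO_trans qp.
  by apply/hD'; split; [exact: PO_l q'q|left].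
by exists p; [apply/hD'; split=> //; right|exact: PO_refl].
Qed.

Notation force phi p sg := (forces N phi PO p sg).

Lemma triE W s t p : N W -> tri N W s t p <-> op s (op t p) ∈ W.
Proof.
move=> NW; split=> [[x [_ [-> //]]]|h]; exists (op t p); split=> //.
by have [] := z_op_inv hZ (tr NW h).
Qed.

Lemma feq_mono p q s t : op q p ∈ PO -> feq N PO p s t -> feq N PO q s t.
Proof.
move=> qp [W [NW [bW [p0 [Np0 [pp0 h]]]]]]; exists W; do 2!split=> //.
by exists p0; split=> //; split=> //; exact: PO_trans pp0.
Qed.

Lemma forces_mono phi p q sg : op q p ∈ PO -> force phi p sg -> force phi q sg.
Proof.
elim: phi p q sg => [i j|i j||a IHa b IHb|n a IH] p q sg qp //=.
- by move=> h r Nr rq; apply: h => //; exact: PO_trans qp.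
- by move=> h r Nr rq; apply: h => //; exact: PO_trans qp.
- by move=> h r Nr rq; apply: h => //; exact: PO_trans qp.
- by move=> h t Nt; apply: IH qp _; exact: h.
Qed.

Lemma forces_dense phi p sg : p ∈ Pc ->
  (forall q, op q p ∈ PO -> exists2 r, op r q ∈ PO & force phi r sg) -> force phi p sg.
Proof.
elim: phi p sg => [i j|i j||a IHa b IHb|n a IH] p sg pP /= h.
- move=> q Nq /h[r rq k]; have [r' [Nr' [r'r k']]] := k r (N_Pc (PO_l rq)) (PO_refl (PO_l rq)).
  by exists r'; split=> //; split=> //; exact: PO_trans rq.
- move=> q Nq /h[r rq k]; have [r' [Nr' [r'r k']]] := k r (N_Pc (PO_l rq)) (PO_refl (PO_l rq)).
  by exists r'; split=> //; split=> //; exact: PO_trans rq.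
- by have [r _] := h p (PO_refl pP).
- move=> q Nq /h[r rq k] fq.
  have [r' [Nr' [r'r k']]] := k r (N_Pc (PO_l rq)) (PO_refl (PO_l rq)) (forces_mono rq fq).
  by exists r'; split=> //; split=> //; exact: PO_trans rq.
- move=> t Nt; apply: IH => // q /h[r rq k]; exists r => //; exact: k.
Qed.

Lemma name_N s q t : N t -> op s q ∈ t -> N s /\ N q.
Proof. by move=> Nt /(tr Nt) /(z_op_inv hZ). Qed.

(** Induction on s. For a member (s', q) of s with q in the filter, the conditions that match s'
    with a member of t are dense below a common extension of p and q, hence met by the filter. *)
Lemma bisim_val W : N W -> bisim N PO W ->
  forall s t p, N s -> N t -> Gs p -> op s (op t p) ∈ W -> vl s = vl t.
Proof.
move=> NW bW s; elim/(well_founded_ind name_rel_wf): s => s IH t p Ns Nt Gp stp.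
have Np := gen_N Gp.
have [b1 b2] := bW s Ns t Nt p Np ((triE _ _ _ NW).2 stp).
apply: hset_ext => y; rewrite !mem_vl; split=> -[s' [q [h Gq ->]]].
  have [Ns' Nq] := name_N Ns h; have [r [Gr rp_ rq]] := gen_dir Gp Gq.
  have [|||D ND hD] := z_sepl hZ (A := fun e => exists t', N t' /\ exists q', N q' /\
     (op t' q' ∈ e 1%N /\ (op (e 0%N) q' ∈ e 2%N /\ tri N (e 3%N) (e 4%N) t' (e 0%N))))
     (l := [:: t; PO; W; s']) (x := Pc).
  - by have h' := tri_Df hZ; dfn 10%N.
  - by do !split.
  - by [].
  have [p1 p1r|r' Gr' /hD[_ [t' [Nt' [q' [Nq' [tq [rq' /(triE _ _ _ NW) k]]]]]]]] :=
    @gen_below D r ND Gr; last first.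
    exists t', q'; split=> //; first exact: gen_up rq'.
    by apply: (IH s' _ t' r') => //; exists q.
  have [||r' [Nr' [r'p1 k]]] := b1 s' Ns' q Nq h p1 (N_Pc (PO_l p1r)).
  - exact: PO_trans rp_.
  - exact: PO_trans rq.
  by exists r' => //; apply/hD; split=> //; exact: PO_l r'p1.
have [Ns' Nq] := name_N Nt h; have [r [Gr rp_ rq]] := gen_dir Gp Gq.
have [|||D ND hD] := z_sepl hZ (A := fun e => exists t', N t' /\ exists q', N q' /\
   (op t' q' ∈ e 1%N /\ (op (e 0%N) q' ∈ e 2%N /\ tri N (e 3%N) t' (e 4%N) (e 0%N))))
   (l := [:: s; PO; W; s']) (x := Pc).
- by have h' := tri_Df hZ; dfn 10%N.
- by do !split.
- by [].
have [p1 p1r|r' Gr' /hD[_ [t' [Nt' [q' [Nq' [tq [rq' /(triE _ _ _ NW) k]]]]]]]] :=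
  @gen_below D r ND Gr; last first.
  exists t', q'; split=> //; first exact: gen_up rq'.
  by symmetry; apply: (IH t' _ s' r') => //; exists q'.
have [||r' [Nr' [r'p1 k]]] := b2 s' Ns' q Nq h p1 (N_Pc (PO_l p1r)).
- exact: PO_trans rp_.
- exact: PO_trans rq.
by exists r' => //; apply/hD; split=> //; exact: PO_l r'p1.
Qed.

(* If no condition below [p] decides against [s = t], the relation "forced
   equal", restricted to a transitive set and enlarged by [(s, t, p)], is a
   bisimulation. *)
Lemma feq_intro p s t : p ∈ Pc -> N s -> N t ->
  (forall s' q, op s' q ∈ s -> forall r, op r p ∈ PO -> op r q ∈ PO ->
   exists r' t' q', [/\ op r' r ∈ PO, op t' q' ∈ t, op r' q' ∈ PO & feq N PO r' s' t']) ->
  (forall t' q, op t' q ∈ t -> forall r, op r p ∈ PO -> op r q ∈ PO ->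
   exists r' s' q', [/\ op r' r ∈ PO, op s' q' ∈ s, op r' q' ∈ PO & feq N PO r' s' t']) ->
  feq N PO p s t.
Proof.
move=> pP Ns Nt h1 h2.
have [T [NT stT trT]] := transitive_closure hN (z_op hZ Ns Nt).
have opT a b : op a b ∈ T -> a ∈ T /\ b ∈ T.
  move=> h; have k : up a b ∈ T by apply: trT h _; apply/mem_up; right.
  by split; apply: trT k _; apply/mem_up; [left|right].
have [sT tT] := opT _ _ stT.
have [X1 NX1 hX1] := z_prod hZ NT NPc; have [X NX hX] := z_prod hZ NT NX1.
have [|||W NW hW] := z_sepl hZ (A := fun e => exists a, N a /\ exists b, N b /\ exists r, N r /\
   exists x, N x /\ (x = op b r /\ (e 0%N = op a x /\
     (feq N (e 1%N) r a b \/ (a = e 2%N /\ (b = e 3%N /\ r = e 4%N))))))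
   (l := [:: PO; s; t; p]) (x := X).
- by have h := feq_Df hZ; dfn 10%N.
- by do !split=> //; exact: N_Pc.
- by [].
have Np := N_Pc pP.
have hW' a b r : op a (op b r) ∈ W <-> [/\ a ∈ T, b ∈ T, r ∈ Pc &
    feq N PO r a b \/ (a = s /\ (b = t /\ r = p))].
  rewrite hW hX /le_ /=; split=> [[[a1 [x [/op_inj[-> <-] aT]]]]|[aT bT rP k]].
    move=> /hX1[b1 [r1 [/op_inj[-> ->] bT rP]]].
    by move=> [a2 [_ [b2 [_ [r2 [_ [x2 [_ [-> [/op_inj[<- /op_inj[<- <-]] k]]]]]]]]]].
  split; first by exists a, (op b r); split=> //; apply/hX1; exists b, r.
  have [Na Nb Nr] := And3 (tr NT aT) (tr NT bT) (N_Pc rP).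
  exists a; split=> //; exists b; split=> //; exists r; split=> //.
  by exists (op b r); split=> //; exact: z_op.
exists W; split=> //; split; last first.
  exists p; split=> //; split; first exact: PO_refl.
  by apply/triE => //; apply/hW'; split=> //; right.
move=> a Na b Nb r Nr /(triE _ _ _ NW)/hW'[aT bT rP k].
have sub x y u : op x y ∈ u -> u ∈ T -> x ∈ T.
  by move=> h uT; have [] := opT x y (trT _ _ uT h).
split=> s' Ns' q Nq h r1 Nr1 r1r r1q.
  suff [r' [t' [q' [h1' h2' h3' h4']]]] : exists r' t' q', [/\ op r' r1 ∈ PO,
      op t' q' ∈ b, op r' q' ∈ PO & feq N PO r' s' t'].
    have [Nt' Nq'] := name_N Nb h2'.
    exists r'; split; first exact: N_Pc (PO_l h1').
    split=> //; exists t'; split=> //; exists q'; do 3!split=> //.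
    apply/triE => //; apply/hW'; split; [exact: sub h aT|exact: sub h2' bT|exact: PO_l h1'|].
    by left.
  case: k => [[W' [NW' [bW' [p0 [Np0 [rp0 k]]]]]]|[ea [eb er]]]; last first.
    by subst a b r; exact: (h1 _ _ h).
  have [b1 _] := bW' a Na b Nb p0 Np0 k.
  have [r' [Nr' [r'r1 [t' [Nt' [q' [Nq' [tq [r'q' k']]]]]]]]] :=
    b1 _ Ns' _ Nq h r1 Nr1 (PO_trans r1r rp0) r1q.
  exists r', t', q'; split=> //; exists W'; do 2!split=> //.
  by exists r'; split=> //; split=> //; exact: PO_refl (PO_l r'r1).
suff [r' [t' [q' [h1' h2' h3' h4']]]] : exists r' t' q', [/\ op r' r1 ∈ PO,
    op t' q' ∈ a, op r' q' ∈ PO & feq N PO r' t' s'].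
  have [Nt' Nq'] := name_N Na h2'.
  exists r'; split; first exact: N_Pc (PO_l h1').
  split=> //; exists t'; split=> //; exists q'; do 3!split=> //.
  apply/triE => //; apply/hW'; split; [exact: sub h2' aT|exact: sub h bT|exact: PO_l h1'|].
  by left.
case: k => [[W' [NW' [bW' [p0 [Np0 [rp0 k]]]]]]|[ea [eb er]]]; last first.
  by subst a b r; exact: (h2 _ _ h).
have [_ b2] := bW' a Na b Nb p0 Np0 k.
have [r' [Nr' [r'r1 [t' [Nt' [q' [Nq' [tq [r'q' k']]]]]]]]] :=
  b2 _ Ns' _ Nq h r1 Nr1 (PO_trans r1r rp0) r1q.
exists r', t', q'; split=> //; exists W'; do 2!split=> //.
by exists r'; split=> //; split=> //; exact: PO_refl (PO_l r'r1).
Qed.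

(** From right to left this is [bisim_val]. Conversely, the conditions that force equality or leave
    some member of one name unmatched in the other are dense by [feq_intro]; a condition of the
    second kind in the filter would contradict the induction hypothesis. *)
Lemma feq_truth s t : N s -> N t -> vl s = vl t <-> exists2 p, Gs p & feq N PO p s t.
Proof.
move=> Ns Nt; split; last first.
  move=> [p Gp [W [NW [bW [p0 [Np0 [pp0 /(triE _ _ _ NW) h]]]]]]].
  exact: (bisim_val NW bW Ns Nt (gen_up Gp pp0)).
elim/(well_founded_ind name_rel_wf): s t Ns Nt => s IH t Ns Nt est.
have [|||D ND hD] := z_sepl hZ (A := fun e => feq N (e 1%N) (e 0%N) (e 2%N) (e 3%N) \/
  ((exists s', N s' /\ exists q, N q /\ (op s' q ∈ e 2%N /\ (op (e 0%N) q ∈ e 1%N /\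
     forall t', N t' -> forall q', N q' -> op t' q' ∈ e 3%N -> forall r, N r ->
      op r (e 0%N) ∈ e 1%N -> op r q' ∈ e 1%N -> ~ feq N (e 1%N) r s' t'))) \/
   (exists t', N t' /\ exists q, N q /\ (op t' q ∈ e 3%N /\ (op (e 0%N) q ∈ e 1%N /\
     forall s', N s' -> forall q', N q' -> op s' q' ∈ e 2%N -> forall r, N r ->
      op r (e 0%N) ∈ e 1%N -> op r q' ∈ e 1%N -> ~ feq N (e 1%N) r s' t')))))
  (l := [:: PO; s; t]) (x := Pc).
- by have h := feq_Df hZ; dfn 10%N.
- by do !split.
- by [].
rewrite /le_ /= in hD.
have [p pP|p Gp /hD[_ [h|[]]]] := gen_dense ND; last 3 first.
- by exists p.
- move=> [s' [Ns' [q [Nq [sq [pq no]]]]]].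
  have : vl s' ∈ vl t by rewrite -est mem_vl; exists s', q; split=> //; exact: gen_up pq.
  rewrite mem_vl => -[t' [q' [tq' Gq' e]]]; have [Nt' Nq'] := name_N Nt tq'.
  have [||||r Gr hr] := IH s' _ t'; rewrite ?e //; first by exists q.
  have [r1 [Gr1 r1r r1p]] := gen_dir Gr Gp; have [r2 [Gr2 r21 r2q]] := gen_dir Gr1 Gq'.
  case: (no t' Nt' q' Nq' tq' r2 (gen_N Gr2)) => //; first exact: PO_trans r1p.
  by apply: feq_mono hr; exact: PO_trans r1r.
- move=> [t' [Nt' [q [Nq [tq [pq no]]]]]].
  have : vl t' ∈ vl s by rewrite est mem_vl; exists t', q; split=> //; exact: gen_up pq.
  rewrite mem_vl => -[s' [q' [sq' Gq' e]]]; have [Ns' Nq'] := name_N Ns sq'.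
  have [||||r Gr hr] := IH s' _ t'; rewrite ?e //; first by exists q'.
  have [r1 [Gr1 r1r r1p]] := gen_dir Gr Gp; have [r2 [Gr2 r21 r2q]] := gen_dir Gr1 Gq'.
  case: (no s' Ns' q' Nq' sq' r2 (gen_N Gr2)) => //; first exact: PO_trans r1p.
  by apply: feq_mono hr; exact: PO_trans r1r.
apply: contrapT => no.
have nod r : op r p ∈ PO -> ~ r ∈ D by move=> rp_ rD; apply: no; exists r.
case: (nod p (PO_refl pP)); apply/hD; split=> //; left.
apply: feq_intro => // s' q h r rp_ rq; apply: contrapT => nex.
  apply: (nod _ rp_); apply/hD; split; first exact: PO_l rp_.
  have [Ns' Nq] := name_N Ns h.
  right; left; exists s'; split=> //; exists q; do 3!split=> //.
  by move=> t' Nt' q' Nq' tq r' Nr' r'r r'q' f; apply: nex; exists r', t', q'.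
apply: (nod _ rp_); apply/hD; split; first exact: PO_l rp_.
have [Ns' Nq] := name_N Nt h.
right; right; exists s'; split=> //; exists q; do 3!split=> //.
by move=> t' Nt' q' Nq' tq r' Nr' r'r r'q' f; apply: nex; exists r', t', q'.
Qed.


Definition extM : cls := fun x => exists2 t, N t & x = vl t.
Notation M := extM.

Lemma forces_set (A : (nat -> hset) -> Prop) sg : Df N A -> (forall n, N (sg n)) ->
  exists2 D, N D & forall w, w ∈ D <-> w ∈ Pc /\
    A (fun n => match n with 0 => w | 1 => emp | 2 => Pc | 3 => PO | n.+4 => sg n end).
Proof.
move=> dA hs.
pose e n := match n with 0 | 1 => emp | 2 => Pc | 3 => PO | n.+4 => sg n end.
have [|D ND hD] := z_sep hZ dA (e := e) _ NPc.
  by case=> [|[|[|[|n]]]] //=; exact: z_emp hZ.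
exists D => // w; rewrite hD; suff -> : ue e 0 w = fun n => match n with
  0 => w | 1 => emp | 2 => Pc | 3 => PO | n.+4 => sg n end by [].
by apply/funext => -[|[|[|[|n]]]].
Qed.

(** By induction on [phi]: the conditions that decide the formula form a dense set, which lies in V
    because forcing is definable there, and genericity supplies one of them. *)
Lemma forces_truth phi sg : (forall n, N (sg n)) ->
  sath M (fun n => vl (sg n)) phi <-> exists2 p, Gs p & force phi p sg.
Proof.
have neg psi sg' : (forall n, N (sg' n)) -> (exists2 p, Gs p & force psi p sg') ->
    (exists2 p, Gs p & force (FImp psi FFalse) p sg') -> False.
  move=> _ [p Gp fp] [q Gq fq]; have [r [Gr rp_ rq]] := gen_dir Gp Gq.
  by have [_ [_ [_ []]]] := fq r (gen_N Gr) rq (forces_mono rp_ fp).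
elim: phi sg => [i j|i j||a IHa b IHb|n a IH] sg hs /=.
- split=> [|[p Gp h]].
    rewrite mem_vl => -[t' [q' [h Gq e]]]; have [Nt' Nq'] := name_N (hs j) h.
    have [p0 Gp0 f] := (feq_truth (hs i) Nt').1 e.
    have [p [Gp pp0 pq']] := gen_dir Gp0 Gq; exists p => // q Nq qp.
    exists q; split=> //; split; first exact: PO_refl (PO_l qp).
    exists t'; split=> //; exists q'; do 3!split=> //; first exact: PO_trans pq'.
    by apply: feq_mono f; exact: PO_trans pp0.
  have dA : Df N (fun e => exists t', N t' /\ exists q', N q' /\
      (op t' q' ∈ e j.+4 /\ (op (e 0%N) q' ∈ e 3%N /\ feq N (e 3%N) (e 0%N) (e i.+4) t'))).
    apply: (@Df4 N (fun u v w x => exists t', N t' /\ exists q', N q' /\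
      (op t' q' ∈ v /\ (op u q' ∈ w /\ feq N w u x t'))) _ 0 j.+4 3 i.+4).
    by have h' := feq_Df hZ; dfn 10%N.
  have [D ND hD] := forces_set dA hs.
  have [p1 p1p|p1 Gp1 /hD[_ /= [t' [Nt' [q' [Nq' [h1 [h2 h3]]]]]]]] := @gen_below D p ND Gp.
  - have [r [Nr [rp1 k]]] := h p1 (N_Pc (PO_l p1p)) p1p.
    by exists r => //; apply/hD; split=> //; exact: PO_l rp1.
  rewrite mem_vl; exists t', q'; split=> //; first exact: gen_up h2.
  by apply/feq_truth => //; exists p1.
- split=> [/feq_truth[] // p Gp f|[p Gp h]].
    exists p => // q Nq qp; exists q; split=> //; split; first exact: PO_refl (PO_l qp).
    exact: feq_mono f.
  have [D ND hD] := forces_set (A := fun e => feq N (e 3%N) (e 0%N) (e i.+4) (e j.+4))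
    (feq_Df hZ _ _ _ _) hs.
  have [p1 p1p|p1 Gp1 /hD[_ /= f]] := @gen_below D p ND Gp.
    have [r [Nr [rp1 k]]] := h p1 (N_Pc (PO_l p1p)) p1p.
    by exists r => //; apply/hD; split=> //; exact: PO_l rp1.
  by apply/feq_truth => //; exists p1.
- by split=> // -[].
- split=> [h|[p Gp h] /IHa[] // q Gq fa]; last first.
    have [r [Gr rp_ rq]] := gen_dir Gp Gq.
    have [D ND hD] := forces_set (forces_Df hZ b) hs.
    have [p1 p1r|p1 Gp1 /hD[_ /= f]] := @gen_below D r ND Gr.
      have p1p := PO_trans p1r rp_.
      have [|r' [Nr' [r'p1 k]]] := h p1 (N_Pc (PO_l p1r)) p1p.
        by apply: forces_mono fa; exact: PO_trans rq.
      by exists r' => //; apply/hD; split=> //; exact: PO_l r'p1.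
    by apply/IHb => //; exists p1.
  (* The conditions that force the implication, or that force its premise and refute its
     conclusion. *)
  have [D ND hD] := forces_set (A := fun e =>
    forces N (FImp a b) (e 3%N) (e 0%N) (fun n => e n.+4) \/
    forces N a (e 3%N) (e 0%N) (fun n => e n.+4) /\
    forces N (FImp b FFalse) (e 3%N) (e 0%N) (fun n => e n.+4))
    (Df_or (forces_Df hZ _) (Df_and (forces_Df hZ _) (forces_Df hZ _))) hs.
  have [p pP|p Gp /hD[_ /= [f|[fa fb]]]] := gen_dense ND; last 2 first.
  + by exists p.
  + have /h/(IHb _ hs) k : sath M (fun n => vl (sg n)) a by apply/IHa => //; exists p.
    by case: (neg b sg hs k); exists p.
  have [f|nf] := pselect (force (FImp a b) p sg).
    by exists p; [apply/hD; split=> //; left|exact: PO_refl].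
  have [q Nq /not_implyP[qp /not_implyP[fa nb]]] : exists2 q, N q &
      ~ (op q p ∈ PO -> force a q sg -> exists r, N r /\ (op r q ∈ PO /\ force b r sg)).
    by apply: contrapT => k; apply: nf => q Nq; apply: contrapT => k'; apply: k; exists q.
  exists q => //; apply/hD; split; first exact: PO_l qp.
  by right; split=> // r Nr rq fb; case: nb; exists r.
have env t : N t -> forall m, N (ue sg n t m) by move=> Nt m; rewrite /ue; case: eqP.
have ue_vl t : ue (fun m => vl (sg m)) n (vl t) = fun m => vl (ue sg n t m).
  by apply/funext => m; rewrite /ue; case: eqP.
split=> [h|[p Gp h] x [t Nt ->]]; last first.
  by rewrite ue_vl; apply/(IH _ (env t Nt)); exists p => //; exact: h.
have dA : Df N (fun e => forces N (FAll n a) (e 3%N) (e 0%N) (fun n => e n.+4) \/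
    exists t, N t /\ forces N (FImp a FFalse) (e 3%N) (e 0%N) (ue (fun n => e n.+4) n t)).
  apply: Df_or; first exact: (forces_Df hZ (FAll n a)).
  exact: (Df_exue n.+4 (forces_Df hZ (FImp a FFalse))).
have [D ND hD] := forces_set dA hs.
have [p pP|p Gp /hD[_ /= [f|[t [Nt f]]]]] := gen_dense ND.
- have [f|nf] := pselect (force (FAll n a) p sg).
    by exists p; [apply/hD; split=> //; left|exact: PO_refl].
  have [t Nt nt] : exists2 t, N t & ~ force a p (ue sg n t).
    by apply: contrapT => k; apply: nf => t Nt; apply: contrapT => k'; apply: k; exists t.
  have [q [qp nq]] : exists q, op q p ∈ PO /\
      forall r, op r q ∈ PO -> ~ force a r (ue sg n t).
    apply: contrapT => k; apply: nt; apply: forces_dense => // q qp.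
    apply: contrapT => k'; apply: k; exists q; split=> // r rq fr.
    by apply: k'; exists r.
  exists q => //; apply/hD; split; first exact: PO_l qp.
  by right; exists t; split=> // r Nr rq /(nq r rq).
- by exists p.
have := h _ (ex_intro2 _ _ t Nt erefl); rewrite ue_vl => /(IH _ (env t Nt)) k.
by case: (neg a (ue sg n t) (env t Nt) k); exists p.
Qed.

(** The canonical name of y consists of all pairs of the name of a member of y and a condition. All
    conditions are attached because a preorder need not have a largest element. *)
Lemma vl_check_fun : exists F : hset -> hset,
  (forall y, N y -> N (F y) /\ vl (F y) = y) /\
  forall d, N d -> exists2 z, N z & forall w, w ∈ z <-> exists2 y, y ∈ d & w = op y (F y).
Proof.
have [|||||F [NF hF gF]] := @recursion N hN Pc NPc (fun _ z y => z ∈ y)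
  (fun c y s u => forall w, N w -> (w ∈ u <-> exists v, v ∈ s /\ exists p, p ∈ c /\ w = op v p)).
- by dfn 10%N.
- by dfn 10%N.
- by move=> x Nx; exists x => // z; split=> [zx|[]//]; split=> //; exact: tr zx.
- move=> x s Nx Ns; have [z Nz hz] := z_prod hZ Ns NPc; exists z => // u' Nu'.
  have hz' w : w ∈ z <-> exists v, v ∈ s /\ exists p, p ∈ Pc /\ w = op v p.
    rewrite hz; split=> [[a [b [-> as_ bP]]]|[a [as_ [b [bP ->]]]]].
      by exists a; split=> //; exists b.
    by exists a, b.
  split=> [h|-> w _]; last exact: hz'.
  apply: hset_ext => w; split=> [wu|/hz' k]; first by apply/hz'/h => //; exact: tr wu.
  apply/h => //; have [v [vs [p [pP ->]]]] := k.
  exact: z_op (tr Ns vs) (N_Pc pP).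
- by move=> A _; exact: mem_induction.
have [p0 G0] := gen_ex.
exists F; split=> // y Ny; split; first exact: NF.
move: y Ny; apply: (@mem_induction N) => y Ny IH.
have [s Ns [hs hP]] := hF y Ny.
apply: hset_ext => w; rewrite mem_vl; split=> [[a [q [h Gq ->]]]|wy].
  have [v [vs [p [_ /op_inj[ea _]]]]] := (hP _ (tr (NF _ Ny) h)).1 h.
  by subst a; have [z [Nz zy ->]] := (hs v).1 vs; rewrite IH.
have Nw := tr Ny wy; exists (F w), p0; split=> //; last by rewrite IH.
apply/hP; first exact: z_op (NF _ Nw) (gen_N G0).
exists (F w); split; first by apply/hs; exists w.
by exists p0; split=> //; exact: gen_Pc.
Qed.

Lemma vl_check y : N y -> exists2 t, N t & vl t = y.
Proof. by have [F [h _]] := vl_check_fun; move=> /h[? ?]; exists (F y). Qed.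

Lemma ext_sub x : N x -> M x.
Proof. by move=> /vl_check[t Nt <-]; exists t. Qed.

Lemma name_dom t : N t -> exists2 d, N d & forall s q, op s q ∈ t -> s ∈ d.
Proof.
move=> Nt; have [U NU hU] := z_union hZ Nt; have [W NW hW] := z_union hZ NU.
exists W => // s q h; apply/hW; exists (up s q); last by apply/mem_up; left.
by apply/hU; exists (op s q) => //; apply/mem_up; right.
Qed.

Lemma extM_trans x y : M y -> x ∈ y -> M x.
Proof.
move=> [t Nt ->]; rewrite mem_vl => -[s [q [h _ ->]]].
by exists s => //; have [] := name_N Nt h.
Qed.

(** For x with name t, the subset is named by the pairs (t', p) such that (t', q) is in t, p is
    below q, and p forces the formula at t'. *)
Lemma extM_sep A : Df M A -> forall e x, (forall n, M (e n)) -> M x ->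
  exists2 z, M z & forall w, w ∈ z <-> w ∈ x /\ A (ue e 0 w).
Proof.
move=> [phi hphi] e x he [t Nt ->].
have [sg hsg] := choice (fun n => let: ex_intro2 s Ns es := he n in
  ex_intro (fun s => N s /\ e n = vl s) s (conj Ns es)).
have [d Nd hd] := name_dom Nt; have [X NX hX] := z_prod hZ Nd NPc.
pose B e := exists t', N t' /\ exists p, N p /\ (e 0%N = op t' p /\
  exists q, N q /\ (op t' q ∈ e 4%N /\ (op p q ∈ e 3%N /\
    forces N phi (e 3%N) p (fun m => if m is m'.+1 then e m'.+4.+4.+3 else t')))).
have dB : Df N B.
  apply: (@Df_ex _ 6) => //; apply: (@Df_ex _ 5) => //.
  apply: Df_and; first by apply: Df_op; ztac.
  apply: (@Df_ex _ 7) => //; apply: Df_and; first by apply: Df_opin; ztac.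
  apply: Df_and; first by apply: Df_opin; ztac.
  apply: Df_iff (Df_sub (fun k => match k with
    0 => 5 | 1 => 1 | 2 => 2 | 3 => 3 | 4 => 6 | m.+4 => m.+4.+4.+2 end) (forces_Df hZ phi)).
  by move=> e0 _; suff -> : (fun m => if m is m'.+1 then e0 m'.+4.+4.+3 else e0 6%N) =
     (fun n => e0 (match n.+4 with 0 => 5 | 1 => 1 | 2 => 2 | 3 => 3 | 4 => 6
        | m.+4 => m.+4.+4.+2 end)); [|apply/funext => -[|m]].
(* Variables 5 to 7 are bound in [B]; the name of the variable m of [phi] sits at m + 10, and the
   place of variable 0 is taken by t'. *)
pose e0 n := match n with 3 => PO | 4 => t | m.+4.+4.+2 => sg m | _ => emp end.
have he0 n : N (e0 n).
  by do 10![case: n => [|n]; first by rewrite /e0 //; exact: z_emp hZ]; have [] := hsg n.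
have [u Nu hu] := z_sep hZ dB he0 NX.
have fsg p t' w : N t' -> (forces N phi PO p (fun m => if m is m'.+1 then
    ue e0 0 w m'.+4.+4.+3 else t') = force phi p (ue sg 0 t')).
  by move=> Nt'; congr forces; apply/funext => -[|m].
have hu' w : w ∈ u <-> exists t' p q, [/\ w = op t' p, op t' q ∈ t, op p q ∈ PO
    & force phi p (ue sg 0 t')].
  rewrite hu; split=> [[_ [t' [Nt' [p [Np [ew [q [Nq [h1 [h2 h3]]]]]]]]]]|].
    by exists t', p, q; split=> //; move: h3; rewrite fsg.
  move=> [t' [p [q [-> h1 h2 h3]]]]; have [Nt' Nq] := name_N Nt h1.
  have pP := PO_l h2; split; first by apply/hX; exists t', p; split=> //; exact: hd h1.
  exists t'; split=> //; exists p; split; first exact: N_Pc.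
  by split=> //; exists q; do 3!split=> //; rewrite fsg.
exists (vl u); first by exists u.
have ue_vl t' : ue e 0 (vl t') = fun m => vl (ue sg 0 t' m).
  by apply/funext => m; rewrite /ue; case: eqP => // _; have [] := hsg m.
have hA t' : N t' -> A (ue e 0 (vl t')) <-> exists2 p, Gs p & force phi p (ue sg 0 t').
  move=> Nt'; rewrite hphi ?ue_vl; last first.
    by move=> n; rewrite /ue; case: eqP => _; [exists t'|exists (sg n); have [] := hsg n].
  by apply: forces_truth => n; rewrite /ue; case: eqP => // _; have [] := hsg n.
move=> w; rewrite !mem_vl; split.
  move=> [t' [p [/hu'[t1 [p1 [q [/op_inj[<- <-] h1 h2 h3]]]] Gp ->]]].
  split; first by exists t', q; split=> //; exact: gen_up h2.
  by apply/hA; [have [] := name_N Nt h1|exists p].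
move=> [[t' [q [h Gq ->]]] /hA k]; have [Nt' Nq] := name_N Nt h.
have [p1 Gp1 f] := k Nt'; have [p [Gp pp1 pq]] := gen_dir Gp1 Gq.
exists t', p; split=> //; apply/hu'; exists t', p, q; split=> //.
exact: forces_mono f.
Qed.

Lemma extM_pair x y : M x -> M y -> M (up x y).
Proof.
move=> [s Ns ->] [t Nt ->]; have [z Nz hz] := z_prod hZ (z_pair hZ Ns Nt) NPc.
exists z => //; have [p0 G0] := gen_ex.
apply: hset_ext => w; rewrite mem_vl mem_up; split=> [h|[q [p [/hz[a [b [/op_inj[-> _]]]]]]]].
  have k u : u ∈ up s t -> exists s' q, [/\ op s' q ∈ z, gen cP G q & vl u = vl s'].
    move=> us; exists u, p0; split=> //; apply/hz; exists u, p0; split=> //.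
    exact: gen_Pc.
  by case: h => ->; apply: k; apply/mem_up; [left|right].
by move=> /mem_up[]-> _ _ ->; [left|right].
Qed.

Lemma extM_union x : M x -> exists2 z, M z & forall w, w ∈ z <-> exists2 y, y ∈ x & w ∈ y.
Proof.
move=> [t Nt ->]; have [d Nd hd] := name_dom Nt.
have [D ND hD] := z_union hZ Nd; have [S NS hS] := name_dom ND.
have [X NX hX] := z_prod hZ NS NPc.
have [|||u Nu hu] := z_sepl hZ (A := fun e => exists s, N s /\ exists p, N p /\
   (e 0%N = op s p /\ exists t', N t' /\ exists q, N q /\ exists q', N q' /\
    (op t' q ∈ e 1%N /\ (op s q' ∈ t' /\ (op p q ∈ e 2%N /\ op p q' ∈ e 2%N)))))
   (l := [:: t; PO]) (x := X).
- by dfn 10%N.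
- by do !split.
- by [].
rewrite /le_ /= in hu.
exists (vl u); first by exists u.
move=> w; rewrite mem_vl; split.
  move=> [s [p [/hu[_ [s' [_ [p' [_ [/op_inj[<- <-] k]]]]]] Gp ->]]].
  move: k => [t' [_ [q [_ [q' [_ [h1 [h2 [h3 h4]]]]]]]]].
  exists (vl t'); rewrite mem_vl; [exists t', q|exists s, q']; split=> //;
    exact: gen_up Gp _.
move=> [y]; rewrite mem_vl => -[t' [q [h1 Gq ->]]]; rewrite mem_vl => -[s [q' [h2 Gq' ->]]].
have [p [Gp pq pq']] := gen_dir Gq Gq'; exists s, p; split=> //.
have [Nt' Nq] := name_N Nt h1; have [Ns Nq'] := name_N Nt' h2.
apply/hu; split.
  apply/hX; exists s, p; split=> //; last exact: gen_Pc.
  by apply: (hS s q'); apply/hD; exists t' => //; exact: hd h1.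
exists s; split=> //; exists p; split; first exact: gen_N.
by split=> //; exists t'; split=> //; exists q; split=> //; exists q'.
Qed.

(** A subset w of x with a name s is also named by the pairs (t', p) with t' in the domain of the
    name of x and p forcing t' to be in s. These names form a set of V; separation then removes the
    values that are not subsets of x. *)
Lemma extM_pow x : M x ->
  exists2 z, M z & forall w, w ∈ z <-> M w /\ forall u, u ∈ w -> u ∈ x.
Proof.
move=> Mx; have [t Nt ex] := Mx; have [d Nd hd] := name_dom Nt.
have [X NX hX] := z_prod hZ Nd NPc; have [Q NQ hQ] := z_pow hZ NX.
have [Y NY hY] := z_prod hZ NQ NPc; have [p0 G0] := gen_ex.
pose env n := if n is 1%N then x else emp.
have Menv n : M (env n).
  by case: n => [|[|n]] //; apply: ext_sub; exact: z_emp hZ.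
have [|z Mz hz] := @extM_sep (fun e => forall u, u ∈ e 0%N -> u ∈ e 1%N) _
    env (vl Y) Menv (ex_intro2 _ _ Y NY erefl).
  apply: (@Df_allb _ extM_trans 10 0) => //; apply: Df_imp; exact: Df_mem.
exists z => // w; rewrite hz /ue /=; split=> [[wY h]|[Mw h]].
  by split=> //; apply: extM_trans wY; exists Y.
split=> //; have [s Ns ew] := Mw; rewrite mem_vl.
have [|||u Nu hu] := z_sepl hZ (A := fun e => exists t', N t' /\ exists p, N p /\
   (e 0%N = op t' p /\ fmem N (e 1%N) p t' (e 2%N))) (l := [:: PO; s]) (x := X).
- by have h' := fmem_Df hZ; dfn 10%N.
- by do !split.
- by [].
rewrite /le_ /= in hu.
have mem_s t' : N t' -> vl t' ∈ w <-> exists2 p, Gs p & fmem N PO p t' s.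
  move=> Nt'; rewrite ew; have := @forces_truth (FMem 0 1) (fun n => if n is 0 then t' else s).
  by apply; case.
exists u, p0; split=> //.
  apply/hY; exists u, p0; split=> //; last exact: gen_Pc.
  by apply/hQ; split=> // v /hu[].
apply: hset_ext => v; rewrite mem_vl; split=> [vw|[t' [p [/hu[/hX[a [b [/op_inj[-> _] ad _]]]]]]]].
  have := h v vw; rewrite ex mem_vl => -[t' [q [h1 Gq ev]]]; have [Nt' Nq] := name_N Nt h1.
  rewrite ev in vw; have [p Gp f] := (mem_s t' Nt').1 vw.
  exists t', p; split=> //; apply/hu; split.
    by apply/hX; exists t', p; split=> //; [exact: hd h1|exact: gen_Pc].
  by exists t'; split=> //; exists p; split=> //; exact: gen_N.
move=> [a' [Na' [p' [_ [/op_inj[<- <-] f]]]]] Gp ->.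
by apply/mem_s; [exact: tr ad|exists p].
Qed.

Theorem ext_zermelo : zermelo M.
Proof.
split; [exact: extM_trans|exact: extM_pair|exact: extM_union|exact: extM_pow| |exact: extM_sep].
by apply: ext_sub; exact: z_inf hZ.
Qed.

Lemma extME x : ext V cP G x <-> M (cl x).
Proof.
split=> [[t Vt /evaluatesE ->]|[t Nt e]]; first by exists (cl t) => //; exact/(clsh_cl HV).
by exists (rp t) => //; apply/evaluatesE; rewrite rpK.
Qed.

Lemma vl_up a b p q : gen cP G p -> gen cP G q -> vl (up (op a p) (op b q)) = up (vl a) (vl b).
Proof.
move=> gp gq; apply: hset_ext => w; rewrite mem_vl mem_up; split.
  by move=> [s [r [/mem_up[]/op_inj[-> _] _ ->]]]; [left|right].
by case=> ->; [exists a, p|exists b, q]; split=> //; apply/mem_up; [left|right].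
Qed.

(* With a = (s, p) in a name t of z, the pair of a and the value of s is named by a
   name all of whose conditions are p. *)
Lemma ground_surjection z : M z -> exists D W, [/\ N D, M W,
  forall y, y ∈ z -> exists2 a, a ∈ D & op a y ∈ W
  & forall a y y', op a y ∈ W -> op a y' ∈ W -> y = y'].
Proof.
move=> [t Nt ->]; have [F [hF gF]] := vl_check_fun.
have [|||D ND hD] := z_sepl hZ (A := fun e => exists s, N s /\ exists p, N p /\ e 0%N = op s p)
  (l := [::]) (x := t); [by dfn 10%N|by []|by []|].
have [g Ng hg] := gF D ND; rewrite /le_ /= in hD.
pose nm b s p := up (op (up (op b p) (op b p)) p) (op (up (op b p) (op s p)) p).
have Nnm b s p : N b -> N s -> N p -> N (nm b s p).
  by move=> Nb Ns Np; do ?[apply: z_op => //|apply: (z_pair hZ) => //].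
have Xnm b s p : N b -> N s -> N p -> exists bp, N bp /\ exists sp, N sp /\
   exists x1, N x1 /\ exists x2, N x2 /\ exists o1, N o1 /\ exists o2, N o2 /\ exists o, N o /\
   (bp = op b p /\ (sp = op s p /\ (x1 = up bp bp /\ (x2 = up bp sp /\ (o1 = op x1 p /\
   (o2 = op x2 p /\ (o = up o1 o2 /\ op (nm b s p) p = op o p))))))).
  move=> Nb Ns Np; have N1 := z_op hZ Nb Np; have N2 := z_op hZ Ns Np.
  have N3 := z_pair hZ N1 N1; have N4 := z_pair hZ N1 N2.
  have N5 := z_op hZ N3 Np; have N6 := z_op hZ N4 Np; have N7 := z_pair hZ N5 N6.
  refine (ex_intro _ _ (conj N1 (ex_intro _ _ (conj N2 (ex_intro _ _ (conj N3 _)))))).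
  refine (ex_intro _ _ (conj N4 (ex_intro _ _ (conj N5 (ex_intro _ _ (conj N6 _)))))).
  by refine (ex_intro _ _ (conj N7 _)).
have [||||W NW hW] := h_repl hN (A := fun e => exists s, N s /\ exists p, N p /\ exists b, N b /\
  (e 0%N = op s p /\ (op (e 0%N) b ∈ e 2%N /\ exists bp, N bp /\ exists sp, N sp /\
   exists x1, N x1 /\ exists x2, N x2 /\ exists o1, N o1 /\ exists o2, N o2 /\ exists o, N o /\
   (bp = op b p /\ (sp = op s p /\ (x1 = up bp bp /\ (x2 = up bp sp /\ (o1 = op x1 p /\
   (o2 = op x2 p /\ (o = up o1 o2 /\ e 1%N = op o p)))))))))) (l := [:: g]) (x := D).
- by dfn 10%N.
- by [].
- by [].
- move=> w wD; have /hD[wt [s [Ns [p [Np ew]]]]] := wD; have Nw := tr Nt wt; have [NFw _] := hF w Nw.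
  exists (op (nm (F w) s p) p); first by apply: z_op => //; exact: Nnm.
  rewrite /le_ /= => y' Ny'; split.
    move=> [s' [_ [p' [_ [b [Nb [ew' [wb [bp [_ [u0 [_ [x1 [_ [x2 [_ [w3 [_ [w4 [_ [w5 [_ [e1 [e2 [e3 [e4 [e5 [e6 [e7 ->]]]]]]]]]]]]]]]]]]]]]]]]]]]]].
    have /hg[w2 _ /op_inj[e8 e9]] := wb; have [e10 e11] : s = s' /\ p = p' by apply: op_inj; rewrite -ew.
    by rewrite e7 e5 e6 e3 e4 e1 e2 e9 -e8 e10 e11.
  move=> ->; exists s; split=> //; exists p; split=> //; exists (F w); split=> //; split=> //.
  split; first by apply/hg; exists w.
  exact: Xnm.
exists D, (vl W); split=> //; first by exists W.
- move=> y /mem_vl[s [p [h gp ->]]]; have [Ns Np] := name_N Nt h.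
  have hd : op s p ∈ D by apply/hD; split=> //; exists s; split=> //; exists p.
  exists (op s p) => //; have [NF eF] := hF _ (tr Nt h).
  have -> : op (op s p) (vl s) = vl (nm (F (op s p)) s p) by rewrite /nm !vl_up // eF.
  apply/mem_vl; exists (nm (F (op s p)) s p), p; split=> //; apply/hW.
  exists (op s p) => //; split; first by apply: z_op => //; exact: Nnm.
  exists s; split=> //; exists p; split=> //; exists (F (op s p)); split=> //; split=> //.
  split; first by apply/hg; exists (op s p).
  exact: Xnm.
have key a y : op a y ∈ vl W -> exists s p, a = op s p /\ y = vl s.
  move=> /mem_vl[s' [q [/hW[w wD [_]]]]]; rewrite /le_ /=.
  move=> [s [_ [p [_ [b [Nb [ew' [wb [bp [_ [u0 [_ [x1 [_ [x2 [_ [w3 [_ [w4 [_ [w5 [_ [e1 [e2 [e3 [e4 [e5 [e6 [e7 e8]]]]]]]]]]]]]]]]]]]]]]]]]]]]]  gq.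
  have /hg[w2 w2D /op_inj[e9 e10]] := wb; move: e8 => /op_inj[-> eq]; rewrite eq in gq.
  have [_ eF] := hF _ (tr ND w2D).
  by rewrite e7 e5 e6 e3 e4 e1 e2 !vl_up // e10 eF -e9 => /op_inj[-> ->]; exists s, p.
by move=> a y y' /key[s [p [-> ->]]] /key[s' [p' [/op_inj[-> _] ->]]].
Qed.

End Extension.

(* Typed sets, relations and functions inside a model *)
Existing Class zermelo.

(** [ms] and [mf] say that a subset of a type, or a function between types, belongs to the model.
    Their closure under logical operations and composition takes over the part of separation by
    formulas. *)
Definition ms (N : cls) (T : Type) (cT : Coded T) (A : T -> Prop) : Prop := N (code A).
Definition mf (N : cls) (S T : Type) (cS : Coded S) (cT : Coded T) (f : S -> T) : Prop :=
  N (code f).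
Arguments ms N {T cT} A.
Arguments mf N {S T cS cT} f.

(** The type represents a set of the model, each member having exactly one element of the type as
    its name; quantifiers over such a type are bounded quantifiers of the model. *)
Class inN (N : cls) (T : Type) (cT : Coded T) : Prop := InN {
  in_inj : injective (code : T -> hset);
  in_full : N (full T)
}.
Arguments inN N T {cT}.
#[global] Hint Mode inN - ! - : typeclass_instances.

Definition pow (N : cls) (T : Type) (cT : Coded T) := {A : T -> Prop | ms N A}.
Arguments pow N T {cT}.
#[global] Instance coded_pow (N : cls) (T : Type) (cT : Coded T) : Coded (pow N T) :=
  coded_sig (coded_set cT) (Q := fun A => ms N A).

Definition fsp (N : cls) (S T : Type) (cS : Coded S) (cT : Coded T) :=
  {f : S -> T | mf N f}.
Arguments fsp N S T {cS cT}.
#[global] Instance coded_fsp (N : cls) (S T : Type) (cS : Coded S) (cT : Coded T) :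
  Coded (fsp N S T) := coded_sig (coded_fun cS cT) (Q := fun f => mf N f).

Lemma mem_full (T : Type) (cT : Coded T) u : u ∈ full T <-> exists t : T, u = code t.
Proof. by rewrite mem_set; split=> [[t]|[t]]; exists t. Qed.

Section Typed.
Context {N : cls} {hN : zermelo N}.
Let tr := z_trans hN.
Notation inj T := (@in_inj N T _ _).

Section OneType.
Context {T : Type} {cT : Coded T} {iT : inN N T}.
Implicit Types (A B : T -> Prop).

Lemma code_in (t : T) : N (code t).
Proof. by apply: (tr (in_full (T := T))); apply/mem_full; exists t. Qed.

Lemma mem_ms A t : code t ∈ code A <-> A t.
Proof. by rewrite mem_set; split=> [[t' At' /(inj T) ->]|At]; [|exists t]. Qed.

Lemma ms_sep D l A : Df N D -> alln N l ->
  (forall t : T, A t <-> D (le_ (code t :: l))) -> ms N A.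
Proof.
move=> dD hl hA; have [z Nz hz] := z_sepl hN dD hl (in_full (T := T)).
have e : z = code A; last by rewrite /ms -e.
apply: hset_ext => w; rewrite hz mem_full mem_set.
by split=> [[[t ->] /hA]|[t /hA At ->]]; [exists t|split=> //; exists t].
Qed.

Lemma msI a A : N a -> (forall t : T, A t <-> code t ∈ a) -> ms N A.
Proof.
move=> Na h; apply: (@ms_sep (fun e => e 0%N ∈ e 1%N) [:: a]) => //.
exact: Df_mem.
Qed.

Lemma ms_and A B : ms N A -> ms N B -> ms N (fun t => A t /\ B t).
Proof.
move=> hA hB; apply: (@ms_sep (fun e => e 0%N ∈ e 1%N /\ e 0%N ∈ e 2%N)
   [:: code A; code B]) => [||t]; [by dfn 9%N|by []|by rewrite -!mem_ms].
Qed.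

Lemma ms_not A : ms N A -> ms N (fun t => ~ A t).
Proof.
move=> hA; apply: (@ms_sep (fun e => ~ e 0%N ∈ e 1%N)
   [:: code A]) => [||t]; [by dfn 9%N|by []|by rewrite -!mem_ms].
Qed.

Lemma ms_const (P : Prop) : ms N (fun _ : T => P).
Proof.
have [p|np] := pselect P.
  by apply: (@ms_sep (fun e => e 0%N = e 0%N) [::]) => //; dfn 9%N.
by apply: (@ms_sep (fun e => ~ e 0%N = e 0%N) [::]) => //; dfn 9%N.
Qed.

Lemma ms_iff A B : (forall t, A t <-> B t) -> ms N B -> ms N A.
Proof. by move=> h; have -> : A = B; first (apply/funext => t; apply/propext). Qed.

Lemma ms_imp A B : ms N A -> ms N B -> ms N (fun t => A t -> B t).
Proof.
move=> hA hB; apply: (ms_iff (B := fun t => ~ (A t /\ ~ B t))).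
  by move=> t; split=> [h []//|h a]; [move=> /h|apply: contrapT => b; apply: h].
by apply: ms_not; apply: ms_and => //; exact: ms_not.
Qed.

Lemma ms_or A B : ms N A -> ms N B -> ms N (fun t => A t \/ B t).
Proof.
move=> hA hB; apply: (ms_iff (B := fun t => ~ A t -> B t)).
  by move=> t; split=> [[//|//]|h]; case: (pselect (A t)) => [|/h]; [left|right].
by apply: ms_imp => //; exact: ms_not.
Qed.

Lemma ms_equiv A B : ms N A -> ms N B -> ms N (fun t => A t <-> B t).
Proof. by move=> hA hB; apply: ms_and; exact: ms_imp. Qed.

Lemma ms_and3 A B (C : T -> Prop) : ms N A -> ms N B -> ms N C ->
  ms N (fun t => [/\ A t, B t & C t]).
Proof.
move=> hA hB hC; apply: (ms_iff (B := fun t => A t /\ (B t /\ C t))).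
  by move=> t; split=> [[]|[? []]].
by apply: ms_and => //; exact: ms_and.
Qed.

Lemma ms_and4 A B (C D : T -> Prop) : ms N A -> ms N B -> ms N C -> ms N D ->
  ms N (fun t => [/\ A t, B t, C t & D t]).
Proof.
move=> hA hB hC hD; apply: (ms_iff (B := fun t => A t /\ [/\ B t, C t & D t])).
  by move=> t; split=> [[]|[? []]].
by apply: ms_and => //; exact: ms_and3.
Qed.

End OneType.

#[local] Instance inN_prod_ (S T : Type) (cS : Coded S) (cT : Coded T) :
  inN N S -> inN N T -> inN N (S * T).
Proof.
move=> iS iT; split.
  by move=> [s t] [s' t']; rewrite !code_pair => /op_inj[/(inj S)-> /(inj T)->].
have [z Nz hz] := z_prod hN (in_full (T := S)) (in_full (T := T)).
have e : full (S * T) = z; last by rewrite e.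
apply: hset_ext => w; rewrite mem_full hz; split=> [[[s t] ->]|].
  by exists (code s), (code t); rewrite code_pair; split=> //; apply/mem_full;
    [exists s|exists t].
by move=> [a [b [-> /mem_full[s ->] /mem_full[t ->]]]]; exists (s, t); rewrite code_pair.
Qed.

Section TwoTypes.
Context {S T : Type} {cS : Coded S} {cT : Coded T} {iS : inN N S} {iT : inN N T}.

Lemma ms_ex (A : S -> T -> Prop) :
  ms N (fun p : S * T => A p.1 p.2) -> ms N (fun s => exists t, A s t).
Proof.
move=> hA; apply: (@ms_sep _ _ _ (fun e => exists u, u ∈ e 1%N /\ op (e 0%N) u ∈ e 2%N)
   [:: full T; code (fun p : S * T => A p.1 p.2)]) => [||s].
- by dfn 9%N.
- by do !split=> //; exact: in_full.
rewrite /le_ /=; split=> [[t h]|[u [/mem_full[t ->]]]].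
  by exists (code t); split; [apply/mem_full; exists t|rewrite -code_pair mem_ms].
by rewrite -code_pair mem_ms; exists t.
Qed.

Lemma ms_all (A : S -> T -> Prop) :
  ms N (fun p : S * T => A p.1 p.2) -> ms N (fun s => forall t, A s t).
Proof.
move=> hA; apply: (ms_iff (B := fun s => ~ exists t, ~ A s t)).
  move=> s; split=> [h [t]|h t]; first by move/(_ (h t)).
  by apply: contrapT => n; apply: h; exists t.
by apply: ms_not; apply: ms_ex; exact: ms_not.
Qed.

Lemma ms_ex2 (A B : S -> T -> Prop) :
  ms N (fun p : S * T => A p.1 p.2) -> ms N (fun p : S * T => B p.1 p.2) ->
  ms N (fun s => exists2 t, A s t & B s t).
Proof.
move=> hA hB; apply: (ms_iff (B := fun s => exists t, A s t /\ B s t)).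
  by move=> s; split=> [[t a b]|[t [a b]]]; exists t.
by apply: ms_ex; exact: ms_and.
Qed.

Lemma mem_mf (f : S -> T) s t : op (code s) (code t) ∈ code f <-> f s = t.
Proof.
rewrite mem_fun; split=> [[s' /op_inj[/(inj S)-> /(inj T)->]]//|<-].
by exists s.
Qed.

Lemma mf_graph (f : S -> T) : mf N f <-> ms N (fun p : S * T => f p.1 = p.2).
Proof.
have e : code f = code (fun p : S * T => f p.1 = p.2); last by rewrite /mf /ms e.
apply: hset_ext => w; rewrite mem_fun mem_set.
split=> [[s ->]|[[s t] /= <- ->]]; last by exists s; rewrite code_pair.
by exists (s, f s) => //; rewrite code_pair.
Qed.

Lemma mf_iff (f g : S -> T) : (forall t, f t = g t) -> mf N g -> mf N f.
Proof. by move=> h; have -> : f = g; first apply/funext. Qed.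

Lemma ms_pre (f : S -> T) (A : T -> Prop) : mf N f -> ms N A -> ms N (fun s => A (f s)).
Proof.
move=> hf hA; apply: (@ms_sep _ _ _ (fun e => exists u, u ∈ e 1%N /\ op (e 0%N) u ∈ e 2%N)
   [:: code A; code f]) => [||s]; [by dfn 9%N|by []|].
rewrite /le_ /=; split=> [h|[u [/mem_set[t At ->] /mem_mf ->]]//].
by exists (code (f s)); rewrite mem_ms mem_mf.
Qed.

End TwoTypes.

Section Maps.
Context {T : Type} {cT : Coded T} {iT : inN N T}.

Lemma mf_id : mf N (fun t : T => t).
Proof.
apply/mf_graph; apply: (@ms_sep _ _ _ (fun e => exists a, a ∈ e 1%N /\ e 0%N = op a a)
  [:: full T]) => [||[t t']]; [by dfn 9%N|by split=> //; exact: in_full|].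
rewrite /le_ /= code_pair; split=> [->|[a [_ /op_inj[e1 e2]]]].
  by exists (code t'); split=> //; apply/mem_full; exists t'.
by apply: (inj T); rewrite e1.
Qed.

Lemma mf_const {U : Type} {cU : Coded U} {iU : inN N U} (u : U) : mf N (fun _ : T => u).
Proof.
apply/mf_graph; apply: (@ms_sep _ _ _ (fun e => exists a, a ∈ e 1%N /\ e 0%N = op a (e 2%N))
  [:: full T; code u]) => [||[t u']].
- by dfn 9%N.
- by do !split=> //; [exact: in_full|exact: code_in].
rewrite /le_ /= code_pair; split=> [->|[a [_ /op_inj[_ /(inj U)->]]]//].
by exists (code t); split=> //; apply/mem_full; exists t.
Qed.

Context {S : Type} {cS : Coded S} {iS : inN N S}.
Context {U : Type} {cU : Coded U} {iU : inN N U}.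

Lemma mf_pr1 : mf N (fun p : S * T => p.1).
Proof.
apply/mf_graph; apply: (@ms_sep _ _ _ (fun e => exists a, a ∈ e 1%N /\ exists b, b ∈ e 2%N /\
   exists x, N x /\ (x = op a b /\ e 0%N = op x a)) [:: full S; full T]) => [||[[s t] s']].
- by dfn 9%N.
- by do !split=> //; exact: in_full.
rewrite /le_ /= !code_pair; split=> [->|[a [_ [b [_ [x [_ [-> ]]]]]]]].
  exists (code s'); split; first by apply/mem_full; exists s'.
  exists (code t); split; first by apply/mem_full; exists t.
  by exists (op (code s') (code t)); split=> //; apply: z_op; exact: code_in.
by move=> /op_inj[/op_inj[<- _] /(inj S)->].
Qed.

Lemma mf_pr2 : mf N (fun p : S * T => p.2).
Proof.
apply/mf_graph; apply: (@ms_sep _ _ _ (fun e => exists a, a ∈ e 1%N /\ exists b, b ∈ e 2%N /\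
   exists x, N x /\ (x = op a b /\ e 0%N = op x b)) [:: full S; full T]) => [||[[s t] t']].
- by dfn 9%N.
- by do !split=> //; exact: in_full.
rewrite /le_ /= !code_pair; split=> [->|[a [_ [b [_ [x [_ [-> ]]]]]]]].
  exists (code s); split; first by apply/mem_full; exists s.
  exists (code t'); split; first by apply/mem_full; exists t'.
  by exists (op (code s) (code t')); split=> //; apply: z_op; exact: code_in.
by move=> /op_inj[/op_inj[_ <-] /(inj T)->].
Qed.

Lemma mf_comp (f : S -> T) (g : T -> U) : mf N f -> mf N g -> mf N (fun s => g (f s)).
Proof.
move=> hf hg; apply/mf_graph.
apply: (@ms_sep _ _ _ (fun e => exists s, s ∈ e 1%N /\ exists t, t ∈ e 2%N /\
  exists u, u ∈ e 3%N /\ (e 0%N = op s u /\ (op s t ∈ e 4%N /\ op t u ∈ e 5%N)))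
  [:: full S; full T; full U; code f; code g]) => [||[s u]].
- by dfn 9%N.
- by do !split=> //; exact: in_full.
rewrite /le_ /= !code_pair; split=> [<-|[a [/mem_full[s' ->] [b [/mem_full[t ->]]]]]].
  exists (code s); split; first by apply/mem_full; exists s.
  exists (code (f s)); split; first by apply/mem_full; exists (f s).
  exists (code (g (f s))); split; first by apply/mem_full; exists (g (f s)).
  by rewrite !mem_mf.
by move=> [c [_ [/op_inj[/(inj S)-> <-] [/mem_mf <- /mem_mf ->]]]].
Qed.

Lemma mf_pair (f : S -> T) (g : S -> U) : mf N f -> mf N g -> mf N (fun s => (f s, g s)).
Proof.
move=> hf hg; apply/mf_graph.
apply: (@ms_sep _ _ _ (fun e => exists s, s ∈ e 1%N /\ exists t, t ∈ e 2%N /\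
  exists u, u ∈ e 3%N /\ exists x, N x /\ (x = op t u /\ (e 0%N = op s x /\
   (op s t ∈ e 4%N /\ op s u ∈ e 5%N))))
  [:: full S; full T; full U; code f; code g]) => [||[s [t u]]].
- by dfn 9%N.
- by do !split=> //; exact: in_full.
rewrite /le_ /= !code_pair; split=> [[<- <-]|[a [/mem_full[s' ->] [b [/mem_full[t' ->]]]]]].
  exists (code s); split; first by apply/mem_full; exists s.
  exists (code (f s)); split; first by apply/mem_full; exists (f s).
  exists (code (g s)); split; first by apply/mem_full; exists (g s).
  exists (op (code (f s)) (code (g s))); rewrite !mem_mf; split=> //.
  by apply: z_op; exact: code_in.
move=> [c [/mem_full[u' ->] [x [_ [-> [/op_inj[/(inj S)-> /op_inj[/(inj T)-> /(inj U)->]]]]]]]].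
by rewrite !mem_mf => -[-> ->].
Qed.

End Maps.
End Typed.

#[global] Instance inN_prod (N : cls) (hN : zermelo N) (S T : Type) (cS : Coded S)
  (cT : Coded T) : inN N S -> inN N T -> inN N (S * T).
Proof. exact: inN_prod_. Qed.

Definition ms2 (N : cls) (T U : Type) (cT : Coded T) (cU : Coded U) (R : T -> U -> Prop) :=
  ms N (fun p : T * U => R p.1 p.2).
Definition ms3 (N : cls) (T U W : Type) (cT : Coded T) (cU : Coded U) (cW : Coded W)
  (R : T -> U -> W -> Prop) := ms N (fun p : T * U * W => R p.1.1 p.1.2 p.2).
Definition ms4 (N : cls) (T U W X : Type) (cT : Coded T) (cU : Coded U) (cW : Coded W)
  (cX : Coded X) (R : T -> U -> W -> X -> Prop) :=
  ms N (fun p : T * U * W * X => R p.1.1.1 p.1.1.2 p.1.2 p.2).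
Definition mf2 (N : cls) (T U W : Type) (cT : Coded T) (cU : Coded U) (cW : Coded W)
  (h : T -> U -> W) := mf N (fun p : T * U => h p.1 p.2).
Definition mf3 (N : cls) (T U W X : Type) (cT : Coded T) (cU : Coded U) (cW : Coded W)
  (cX : Coded X) (h : T -> U -> W -> X) := mf N (fun p : T * U * W => h p.1.1 p.1.2 p.2).
Arguments ms2 N {T U cT cU} R.
Arguments ms3 N {T U W cT cU cW} R.
Arguments ms4 N {T U W X cT cU cW cX} R.
Arguments mf2 N {T U W cT cU cW} h.
Arguments mf3 N {T U W X cT cU cW cX} h.

Section Derived.
Context {N : cls} {hN : zermelo N}.
Context {S : Type} {cS : Coded S} {iS : inN N S}.
Context {T : Type} {cT : Coded T} {iT : inN N T}.
Context {U : Type} {cU : Coded U} {iU : inN N U}.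
Context {W : Type} {cW : Coded W} {iW : inN N W}.
Context {X : Type} {cX : Coded X} {iX : inN N X}.

Lemma mf_fst (f : S -> T * U) : mf N f -> mf N (fun s => (f s).1).
Proof. by move=> h; apply: mf_comp h mf_pr1. Qed.

Lemma mf_snd (f : S -> T * U) : mf N f -> mf N (fun s => (f s).2).
Proof. by move=> h; apply: mf_comp h mf_pr2. Qed.

Lemma ms_pre2 (a : S -> T) (b : S -> U) (R : T -> U -> Prop) :
  ms2 N R -> mf N a -> mf N b -> ms N (fun s => R (a s) (b s)).
Proof.
by move=> hR ha hb; exact: (ms_pre (A := fun p => R p.1 p.2) (mf_pair ha hb) hR).
Qed.

Lemma ms_pre3 (a : S -> T) (b : S -> U) (c : S -> W) (R : T -> U -> W -> Prop) :
  ms3 N R ->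
  mf N a -> mf N b -> mf N c -> ms N (fun s => R (a s) (b s) (c s)).
Proof.
move=> hR ha hb hc.
exact: (ms_pre (A := fun p => R p.1.1 p.1.2 p.2) (mf_pair (mf_pair ha hb) hc) hR).
Qed.

Lemma ms_pre4 (a : S -> T) (b : S -> U) (c : S -> W) (d : S -> X)
    (R : T -> U -> W -> X -> Prop) :
  ms4 N R ->
  mf N a -> mf N b -> mf N c -> mf N d -> ms N (fun s => R (a s) (b s) (c s) (d s)).
Proof.
move=> hR ha hb hc hd.
exact: (ms_pre (A := fun p => R p.1.1.1 p.1.1.2 p.1.2 p.2)
  (mf_pair (mf_pair (mf_pair ha hb) hc) hd) hR).
Qed.

Lemma mf_comp2 (a : S -> T) (b : S -> U) (h : T -> U -> W) :
  mf2 N h -> mf N a -> mf N b -> mf N (fun s => h (a s) (b s)).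
Proof.
by move=> hh ha hb; exact: (mf_comp (g := fun p => h p.1 p.2) (mf_pair ha hb) hh).
Qed.

Lemma mf_comp3 (a : S -> T) (b : S -> U) (c : S -> W) (h : T -> U -> W -> X) :
  mf3 N h ->
  mf N a -> mf N b -> mf N c -> mf N (fun s => h (a s) (b s) (c s)).
Proof.
move=> hh ha hb hc.
exact: (mf_comp (g := fun p => h p.1.1 p.1.2 p.2) (mf_pair (mf_pair ha hb) hc) hh).
Qed.

End Derived.

Section Derived2.
Context {N : cls} {hN : zermelo N}.
Context {S : Type} {cS : Coded S} {iS : inN N S}.
Context {T : Type} {cT : Coded T} {iT : inN N T}.

Lemma ms_eq (f g : S -> T) : mf N f -> mf N g -> ms N (fun s => f s = g s).
Proof.
move=> hf hg; refine (ms_pre2 (R := fun x y : T => x = y) _ hf hg).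
exact: (mf_graph (fun x : T => x)).1 mf_id.
Qed.

Lemma mfI (f : S -> T) : ms N (fun p : S * T => f p.1 = p.2) -> mf N f.
Proof. exact: (mf_graph f).2. Qed.



End Derived2.

Create HintDb mst discriminated.
#[global] Hint Constants Opaque : mst.

(* The type of an arithmetic expression is the sort of a structure. *)
Ltac mst_type T :=
  lazymatch T with
  | nat => idtac | bool => idtac | int => idtac | rat => idtac
  | _ => let T' := eval hnf in T in
    lazymatch T' with
    | nat => change T with nat | int => change T with int
    | rat => change T with rat | _ => idtac
    end
  end.

Ltac mst_norm :=
  lazymatch goal with
  | |- @mf _ ?S ?T _ _ _ => mst_type S; mst_type T
  | |- @mf2 _ ?T ?U ?W _ _ _ _ => mst_type T; mst_type U; mst_type W
  | |- @ms2 _ ?T ?U _ _ _ => mst_type T; mst_type U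
  | |- @ms3 _ ?T ?U ?W _ _ _ _ => mst_type T; mst_type U; mst_type W
  | |- _ => idtac
  end.

Ltac mst_arith := fail.

Ltac mhyp :=
  match goal with
  | h : ms ?N ?A |- ms ?N ?A => exact h
  | h : mf ?N ?f |- mf ?N ?f => exact h
  end.

Ltac mhave :=
  mst_norm;
  first [mhyp | lazymatch goal with
        | |- ms2 _ _ => unfold ms2 | |- ms3 _ _ => unfold ms3 | |- ms4 _ _ => unfold ms4
        | |- mf2 _ _ => unfold mf2 | |- mf3 _ _ => unfold mf3 end; cbv beta; mhyp
    | solve [typeclasses eauto with mst typeclass_instances] | mst_arith].

Ltac mst_more := fail.

(** Membership in the model by recursion on the shape of the predicate or function. What remains
    after connectives, quantifiers, pairs and projections is a constant, a hypothesis, a hint, or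
    such a thing composed with functions of the model. *)
Ltac mst :=
  cbv beta; mst_norm;
  lazymatch goal with
  | |- ms _ (fun t => @?A t /\ @?B t) => refine (ms_and (A := A) (B := B) _ _); mst
  | |- ms _ (fun t => [/\ @?A t, @?B t & @?C t]) =>
      refine (ms_and3 (A := A) (B := B) (C := C) _ _ _); mst
  | |- ms _ (fun t => [/\ @?A t, @?B t, @?C t & @?D t]) =>
      refine (ms_and4 (A := A) (B := B) (C := C) (D := D) _ _ _ _); mst
  | |- ms _ (fun t => @?A t \/ @?B t) => refine (ms_or (A := A) (B := B) _ _); mst
  | |- ms _ (fun t => @?A t <-> @?B t) => refine (ms_equiv (A := A) (B := B) _ _); mst
  | |- ms _ (fun t => ~ @?A t) => refine (ms_not (A := A) _); mst
  | |- ms _ (fun t => @?A t -> @?B t) => refine (ms_imp (A := A) (B := B) _ _); mst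
  | |- ms _ (fun t => exists x, @?A t x) => refine (ms_ex (A := A) _); mst
  | |- ms _ (fun t => exists2 x, @?A t x & @?B t x) =>
      refine (ms_ex2 (A := A) (B := B) _ _); mst
  | |- ms _ (fun t => @?a t = @?b t) =>
      first [refine (ms_eq (f := a) (g := b) _ _); mst | mst_more]
  | |- ms _ (fun t => forall x, @?A t x) => refine (ms_all (A := A) _); mst
  | |- mf _ (fun t => t) => exact mf_id
  | |- mf _ fst => exact mf_pr1
  | |- mf _ snd => exact mf_pr2
  | |- mf _ (fun t => (@?f t).1) => refine (mf_fst (f := f) _); mst
  | |- mf _ (fun t => (@?f t).2) => refine (mf_snd (f := f) _); mst
  | |- mf _ (fun t => (@?f t, @?g t)) => refine (mf_pair (f := f) (g := g) _ _); mst
  | |- _ => mst_atom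
  end
with mst_atom :=
  first
  [ match goal with |- ms _ (fun _ => ?P) => exact (ms_const _) end
  | match goal with |- mf _ (fun _ => ?c) => exact (mf_const _) end
  | mst_more
  | mhyp
  | match goal with |- ms _ (fun t => is_true (?R (@?a t) (@?b t))) =>
      refine (ms_pre2 (a := a) (b := b) (R := fun x y => is_true (R x y)) _ _ _);
        [solve [mhave] | mst | mst] end
  | match goal with |- ms _ (fun t => is_true (?R (@?a t))) =>
      refine (ms_pre (f := a) (A := fun x => is_true (R x)) _ _);
        [mst | solve [mhave]] end
  | match goal with |- ms _ (fun t => ?R (@?a t)) =>
      refine (ms_pre (f := a) (A := R) _ _); [mst | solve [mhave]] end
  | match goal with |- ms _ (fun t => ?R (@?a t) (@?b t)) =>
      refine (ms_pre2 (R := R) (a := a) (b := b) _ _ _); [solve [mhave] | mst | mst] end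
  | match goal with |- ms _ (fun t => ?R (@?a t) (@?b t) (@?c t)) =>
      refine (ms_pre3 (R := R) (a := a) (b := b) (c := c) _ _ _ _);
        [solve [mhave] | mst | mst | mst] end
  | match goal with |- ms _ (fun t => ?R (@?a t) (@?b t) (@?c t) (@?d t)) =>
      refine (ms_pre4 (R := R) (a := a) (b := b) (c := c) (d := d) _ _ _ _ _);
        [solve [mhave] | mst | mst | mst | mst] end
  | match goal with |- mf _ (fun t => ?h (@?a t)) =>
      refine (mf_comp (f := a) (g := h) _ _); [mst | solve [mhave]] end
  | match goal with |- mf _ (fun t => ?h (@?a t) (@?b t)) =>
      refine (mf_comp2 (h := h) (a := a) (b := b) _ _ _);
        [solve [mhave] | mst | mst] end
  | match goal with |- mf _ (fun t => ?h (@?a t) (@?b t) (@?c t)) =>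
      refine (mf_comp3 (h := h) (a := a) (b := b) (c := c) _ _ _ _);
        [solve [mhave] | mst | mst | mst] end ].

Section MapIf.
Context {N : cls} {hN : zermelo N}.
Context {S : Type} {cS : Coded S} {iS : inN N S}.
Context {T : Type} {cT : Coded T} {iT : inN N T}.

Lemma mf_if (b : S -> bool) (f g : S -> T) : ms N (fun s => is_true (b s)) ->
  mf N f -> mf N g -> mf N (fun s => if b s then f s else g s).
Proof.
move=> hb hf hg; apply: mfI.
apply: (ms_iff (B := fun p : S * T => (b p.1 : Prop) /\ f p.1 = p.2 \/
   ~ b p.1 /\ g p.1 = p.2)).
  move=> [s t] /=; case: (b s); split=> [->|[[h e]|[h e]]] //;
    by [left | right | case: h].
by mst.
Qed.

End MapIf.

Ltac mst_if :=
  match goal with |- mf _ (fun t => if _ then _ else _) => refine (mf_if _ _ _); mst end.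
Ltac mst_more ::= mst_if.

Section Powers.
Context {N : cls} {hN : zermelo N}.
Context {T : Type} {cT : Coded T} {iT : inN N T}.
Context {S : Type} {cS : Coded S} {iS : inN N S}.
Notation inj T := (@in_inj N T _ _).

#[global] Instance inN_pow : inN N (pow N T).
Proof.
split=> [[A hA] [B hB] e|].
  apply: eq_exist; apply/funext => t; apply/propext.
  have eAB : code A = code B := e; by rewrite -(mem_ms A) -(mem_ms B) eAB.
have [z Nz hz] := z_pow hN (in_full (T := T)).
have e : full (pow N T) = z; last by rewrite e.
apply: hset_ext => w; rewrite mem_full hz; split=> [[[A hA] ->]|[Nw h]].
  by split=> // u /mem_set[t _ ->]; apply/mem_full; exists t.
have e : code (fun t : T => code t ∈ w) = w.
  apply: hset_ext => u; rewrite mem_set; split=> [[t h' ->]//|uw].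
  by have /mem_full[t et] := h u uw; exists t; rewrite -?et.
have hA : ms N (fun t : T => code t ∈ w) by rewrite /ms e.
by exists (exist _ _ hA); rewrite -[LHS]e.
Qed.

Lemma ms_in : ms N (fun p : pow N T * T => sval p.1 p.2).
Proof.
apply: (@ms_sep _ _ _ _ _ (fun e => exists a, a ∈ e 1%N /\ exists t, t ∈ e 2%N /\
   (e 0%N = op a t /\ t ∈ a)) [:: full (pow N T); full T]) => [||[A t]].
- by dfn 9%N.
- by do !split=> //; exact: in_full.
have cA : code A = code (sval A) by [].
rewrite /le_ /= code_pair; split=> [h|[a [_ [u [_ [/op_inj[<- <-]]]]]]].
  exists (code A); split; first by apply/mem_full; exists A.
  exists (code t); split; first by apply/mem_full; exists t.
  by split=> //; rewrite cA mem_ms.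
by rewrite cA mem_ms.
Qed.


Lemma ms_in_of {U : Type} {cU : Coded U} {iU : inN N U} (a : U -> pow N T) (b : U -> T) :
  mf N a -> mf N b -> ms N (fun s => sval (a s) (b s)).
Proof.
by move=> ha hb; exact: (ms_pre2 (R := fun (x : pow N T) y => sval x y) ms_in ha hb).
Qed.

Lemma mf_pow (h : S -> pow N T) :
  ms N (fun p : S * T => sval (h p.1) p.2) -> mf N h.
Proof.
move=> hh; apply: mfI.
apply: (ms_iff (B := fun p : S * pow N T => forall t, sval (h p.1) t <-> sval p.2 t)).
  move=> [s A] /=; split=> [->//|e]; case: (h s) A e => B hB [A hA] /= e.
  by apply: eq_exist; apply/funext => t; apply/propext.
apply: ms_all; apply: ms_equiv; last by
  refine (ms_in_of (a := fun t => t.1.2) (b := fun t => t.2) _ _); mst.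
by refine (ms_pre2 (R := fun s t => sval (h s) t) (a := fun t => t.1.1)
  (b := fun t => t.2) hh _ _); mst.
Qed.

#[global] Instance inN_fsp : inN N (fsp N S T).
Proof.
split=> [[f hf] [g hg] e|].
  apply: eq_exist; apply/funext => s.
  by have eAB : code f = code g := e; apply/esym/mem_mf; rewrite -eAB mem_mf.
have [z Nz hz] := z_pow hN (in_full (T := S * T)).
have [|||F NF hF] := z_sepl hN (A := fun e => forall s, s ∈ e 1%N -> exists t, t ∈ e 2%N /\
   (op s t ∈ e 0%N /\ forall t', t' ∈ e 2%N -> op s t' ∈ e 0%N -> t' = t))
   (l := [:: full S; full T]) (x := z).
- by dfn 9%N.
- by do !split=> //; exact: in_full.
- by [].
rewrite /le_ /= in hF.
have e : full (fsp N S T) = F; last by rewrite e.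
apply: hset_ext => w; rewrite mem_full hF hz; split=> [[[f hf] ->]|[[Nw h] k]].
  have -> : code (exist (fun f => mf N f) f hf) = code f by [].
  split.
    split=> // u /mem_fun[s ->]; apply/mem_full; exists (s, f s).
    by rewrite code_pair.
  move=> u /mem_full[s ->]; exists (code (f s)); split; first by apply/mem_full; exists (f s).
  by split; [apply/mem_mf|move=> t' /mem_full[t ->] /mem_mf ->].
have ex (s : S) : exists t : T, op (code s) (code t) ∈ w /\
    forall t' : T, op (code s) (code t') ∈ w -> t' = t.
  have [|u [/mem_full[t ->] [k1 k2]]] := k (code s); first by apply/mem_full; exists s.
  exists t; split=> // t' st'; apply/(inj T)/k2 => //.
  by apply/mem_full; exists t'.
have [f hf] := choice ex.
have e : code f = w.
  apply: hset_ext => u; rewrite mem_fun; split=> [[s ->]|uw]; first by have [] := hf s.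
  have /mem_full[[s t] et] := h u uw; exists s; rewrite et code_pair.
  rewrite et code_pair in uw; by rewrite -((hf s).2 _ uw).
have Nf : mf N f by rewrite /mf e.
by exists (exist _ f Nf); rewrite -[LHS]e.
Qed.

Lemma mf_ev : mf N (fun p : fsp N S T * S => sval p.1 p.2).
Proof.
apply: mfI.
apply: (@ms_sep _ _ _ _ _ (fun e => exists f, f ∈ e 1%N /\ exists s, s ∈ e 2%N /\
   exists t, t ∈ e 3%N /\ exists x, N x /\ (x = op f s /\ (e 0%N = op x t /\ op s t ∈ f)))
   [:: full (fsp N S T); full S; full T]) => [||[[f s] t]].
- by dfn 9%N.
- by do !split=> //; exact: in_full.
have cf : code f = code (sval f) by [].
rewrite /le_ /= !code_pair; split=> [<-|[a [_ [b [_ [c [_ [x [_ [-> ]]]]]]]]]].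
  exists (code f); split; first by apply/mem_full; exists f.
  exists (code s); split; first by apply/mem_full; exists s.
  exists (code (sval f s)); split; first by apply/mem_full; exists (sval f s).
  exists (op (code f) (code s)); split; first by apply: z_op; exact: code_in.
  by split=> //; split=> //; rewrite cf mem_mf.
by move=> [/op_inj[/op_inj[<- <-] <-]]; rewrite cf mem_mf.
Qed.


Lemma mf_ev_of {U : Type} {cU : Coded U} {iU : inN N U} (a : U -> fsp N S T) (b : U -> S) :
  mf N a -> mf N b -> mf N (fun s => sval (a s) (b s)).
Proof.
by move=> ha hb; exact: (mf_comp2 (h := fun (x : fsp N S T) y => sval x y) mf_ev ha hb).
Qed.

Lemma mf_fsp (U : Type) (cU : Coded U) (iU : inN N U) (h : U -> fsp N S T) :
  mf N (fun p : U * S => sval (h p.1) p.2) -> mf N h.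
Proof.
move=> hh; apply: mfI.
apply: (ms_iff (B := fun p : U * fsp N S T => forall s, sval (h p.1) s = sval p.2 s)).
  move=> [s A] /=; split=> [->//|e]; case: (h s) A e => B hB [A hA] /= e.
  by apply: eq_exist; apply/funext => t.
apply: ms_all; apply: ms_eq; last by
  refine (mf_ev_of (a := fun t => t.1.2) (b := fun t => t.2) _ _); mst.
by refine (mf_comp2 (h := fun s t => sval (h s) t) (a := fun t => t.1.1)
  (b := fun t => t.2) hh _ _); mst.
Qed.

(** A type that has the same codes as a subset of a known set of the model is itself a set of the
    model. Booleans, integers, rationals, reals, points of the Stone space and continuous functions
    are all obtained in this way. *)
Lemma inN_image (j : S -> T) (iS' : injective (code : S -> hset)) :
  (forall s, code (j s) = code s) -> ms N (fun t => exists s, t = j s) -> inN N S /\ mf N j.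
Proof.
move=> hj hi; have iS1 : inN N S.
  split=> //; have e : full S = code (fun t => exists s, t = j s); last by rewrite e.
  apply: hset_ext => w; rewrite mem_full mem_set; split=> [[s ->]|[t [s ->] ->]].
    by exists (j s); [exists s|].
  by exists s.
split=> //; have e : code (fun s : S => s) = code j; last first.
  by rewrite /mf -e; exact: (mf_id (iT := iS1)).
by apply: hset_ext => w; rewrite !mem_fun; split=> -[s ->]; exists s; rewrite hj.
Qed.

End Powers.

Ltac mst_sval :=
  match goal with
  | |- ms _ (fun t => sval (@?a t) (@?b t)) => refine (ms_in_of (a := a) (b := b) _ _); mst
  | |- mf _ (fun t => sval (@?a t) (@?b t)) => refine (mf_ev_of (a := a) (b := b) _ _); mst
  end.
Ltac mst_more ::= first [mst_if | mst_sval].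



(** * Arithmetic inside a model *)

Section NatIn.
Context {N : cls} {hN : zermelo N}.

#[global] Instance inN_nat : inN N nat.
Proof. by split; [exact: code_nat_inj|exact: z_inf hN]. Qed.

Lemma ms_leq : ms2 N (fun m n : nat => is_true (m <= n)%N).
Proof.
apply: (@ms_sep N hN (nat * nat)%type _ _ (fun e => exists a, a ∈ e 1%N /\ exists b, b ∈ e 1%N /\
   (e 0%N = op a b /\ ~ b ∈ a)) [:: full nat]) => [||[m n]].
- by dfn 9%N.
- by do !split=> //; exact: in_full.
rewrite /le_ /= code_pair; split=> [mn|[a [_ [b [_ [/op_inj[<- <-]]]]]]].
  exists (code m); split; first by apply/mem_full; exists m.
  exists (code n); split; first by apply/mem_full; exists n.
  split=> // /mem_nat[k km /code_nat_inj e]; subst k.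
  by move: mn; rewrite leqNgt km.
by move=> h; rewrite leqNgt; apply/negP => nm; apply: h; apply/mem_nat; exists n.
Qed.
#[local] Hint Resolve ms_leq : mst.

Lemma mf_succ : mf N S.
Proof.
apply: mfI; apply: (ms_iff (B := fun p : nat * nat => ~ (p.2 <= p.1)%N /\
  forall k, (k <= p.1)%N \/ (p.2 <= k)%N)); last by mst.
move=> [m s] /=; split=> [<-|[h k]]; first by split=> [|k]; [lia|case: (leqP k m); [left|right]].
by have := k m.+1; lia.
Qed.
#[local] Hint Resolve mf_succ : mst.

Section Rec.
Context {U : Type} {cU : Coded U} {iU : inN N U}.
Context {T : Type} {cT : Coded T} {iT : inN N T}.

(** The graph is described by finite attempts [phi] of the model, which are correct up to the
    argument; this stays within Zermelo set theory. *)
Lemma mf_rec (g : U -> T) (h : U -> nat -> T -> T) (f : U -> nat -> T) :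
  (forall u, f u 0%N = g u) -> (forall u n, f u n.+1 = h u n (f u n)) ->
  mf N g -> mf N (fun p : U * nat * T => h p.1.1 p.1.2 p.2) ->
  mf N (fun p : U * nat => f p.1 p.2).
Proof.
move=> f0 fS hg hh; apply: mfI; apply: (ms_iff (B := fun p : U * nat * T =>
   exists phi : fsp N nat T, [/\ sval phi 0%N = g p.1.1,
     forall m, (m.+1 <= p.1.2)%N -> sval phi m.+1 = h p.1.1 m (sval phi m)
     & sval phi p.1.2 = p.2])); last by mst.
move=> [[u n] t] /=; split=> [<-|[phi [h0 hS <-]]]; last first.
  have : (n <= n)%N by []. 
  elim: {-2}n => [_|m IH mn]; first by rewrite f0 h0.
  by rewrite fS hS // IH // ltnW.
(* The attempt that follows f up to k and is constant afterwards lies in the model, by induction on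
   k outside of it. *)
have hphi k : mf N (fun m => f u (minn m k)).
  elim: k => [|k IH].
    by apply: (mf_iff (g := fun=> f u 0%N)) => [m|]; [rewrite minn0|mst].
  apply: (mf_iff (g := fun m => if (m <= k)%N then f u (minn m k) else f u k.+1)); last by mst.
  by move=> m; case: leqP => h'; congr f; lia.
exists (exist (fun f => mf N f) _ (hphi n)) => /=; split; rewrite ?minnn ?min0n //.
by move=> m mn; rewrite (minn_idPl mn) (minn_idPl (ltnW mn)).
Qed.

End Rec.

Lemma mf_addn : mf2 N addn.
Proof.
apply: (mf_rec (g := id) (h := fun _ _ t => t.+1) (f := addn)); try by mst.
  by move=> u; rewrite addn0.
by move=> u n; rewrite addnS.
Qed.
#[local] Hint Resolve mf_addn : mst.

Lemma mf_muln : mf2 N muln.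
Proof.
apply: (mf_rec (g := fun=> 0%N) (h := fun u _ t => (u + t)%N) (f := muln)); try by mst.
  by move=> u; rewrite muln0.
by move=> u n; rewrite mulnS.
Qed.
#[local] Hint Resolve mf_muln : mst.

Lemma mf_pow2 : mf N (fun n : nat => (2 ^ n)%N).
Proof.
have h : mf N (fun p : nat * nat => (2 ^ p.2)%N).
  apply: (mf_rec (g := fun=> 1%N) (h := fun _ _ t => (t + t)%N) (f := fun _ n => (2 ^ n)%N));
    try by mst.
    by move=> u; rewrite expn0.
  by move=> u n; rewrite expnS mul2n addnn.
by apply: (mf_comp (f := fun n : nat => (0%N, n)) _ h); mst.
Qed.
#[local] Hint Resolve mf_pow2 : mst.

End NatIn.

#[global] Hint Resolve ms_leq mf_succ mf_addn mf_muln mf_pow2 : mst.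

Definition pr (a b : nat) : nat := ((a + b) * (a + b) + a)%N.

(** The remainder a is smaller than the gap between the squares of a + b and a + b + 1. *)
Lemma pr_inj a b c d : pr a b = pr c d -> a = c /\ b = d.
Proof.
rewrite /pr => e.
have s : (a + b = c + d)%N.
  have [h|h|//] := ltngtP (a + b)%N (c + d)%N.
    have : ((a + b).+1 * (a + b).+1 <= (c + d) * (c + d))%N by rewrite leq_mul.
    by rewrite mulSn mulnS; lia.
  have : ((c + d).+1 * (c + d).+1 <= (a + b) * (a + b))%N by rewrite leq_mul.
  by rewrite mulSn mulnS; lia.
by rewrite s in e; lia.
Qed.

Definition un (i : nat) : nat * nat :=
  if [pick p : 'I_i.+1 * 'I_i.+1 | pr p.1 p.2 == i] is Some p then (p.1 : nat, p.2 : nat)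
  else (0, 0)%N.

Lemma pr_ge a b : (a <= pr a b)%N /\ (b <= pr a b)%N.
Proof. by rewrite /pr; split; nia. Qed.

Lemma un_pr a b : un (pr a b) = (a, b).
Proof.
have [ha hb] := pr_ge a b; rewrite /un; case: pickP => [[x y] /= /eqP /pr_inj[-> ->]//|].
have ha' : (a < (pr a b).+1)%N by []. have hb' : (b < (pr a b).+1)%N by [].
by move/(_ (Ordinal ha', Ordinal hb')); rewrite /= eqxx.
Qed.

Lemma un_out i : (forall a b, pr a b <> i) -> un i = (0, 0)%N.
Proof. by rewrite /un; case: pickP => // p /eqP e /(_ p.1 p.2). Qed.

(** A number codes the sequence of first components met while taking second components repeatedly.
    By [dig_ex] every finite sequence starts such a sequence, so that finite sequences are
    quantified over as numbers. *)
Definition dig (i l : nat) : nat := (un (iter l (fun j => (un j).2) i)).1.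

Lemma dig_ex L (t : nat -> nat) : exists i, forall l, (l < L)%N -> dig i l = t l.
Proof.
elim: L t => [|L IH] t; first by exists 0%N.
have [i hi] := IH (fun l => t l.+1); exists (pr (t 0%N) i) => -[_|l lL].
  by rewrite /dig /= un_pr.
by rewrite /dig iterSr un_pr /=; exact: hi.
Qed.

Section RatIn.
Context {N : cls} {hN : zermelo N}.

Lemma mf_un : mf N un.
Proof.
apply: mfI; apply: (ms_iff (B := fun p : nat * (nat * nat) =>
   (p.2.1 + p.2.2) * (p.2.1 + p.2.2) + p.2.1 = p.1 \/
   (forall a b, ~ (a + b) * (a + b) + a = p.1) /\ p.2 = (0, 0)))%N; last by mst.
move=> [i [a b]] /=; rewrite -/(pr a b); split=> [e|[<-|[h ->]]]; last 2 first.
- exact: un_pr.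
- exact: un_out.
have [[c [d cd]]|h] := pselect (exists c d, pr c d = i).
  by left; rewrite -cd un_pr in e; case: e => <- <-.
right; split; last by rewrite -e un_out // => c d cd; apply: h; exists c, d.
by move=> c d cd; apply: h; exists c, d.
Qed.
#[local] Hint Resolve mf_un : mst.

Lemma mf_dig : mf2 N dig.
Proof.
have h : mf N (fun p : nat * nat => iter p.2 (fun j => (un j).2) p.1).
  by apply: (mf_rec (g := id) (h := fun _ _ t => (un t).2)
    (f := fun i l => iter l (fun j => (un j).2) i)) => //; mst.
rewrite /mf2 /dig; refine (mf_fst _); refine (mf_comp (g := un) h _); mhave.
Qed.
#[local] Hint Resolve mf_dig : mst.

Lemma inN_bool_ : inN N bool /\ mf N nat_of_bool.
Proof.
apply: inN_image => //.
  by move=> [] [] // /code_nat_inj.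
apply: (ms_iff (B := fun n => (n <= 1)%N)); last by mst.
by move=> n; split=> [[[] ->]//|]; case: n => [|[|]] // _; [exists false|exists true].
Qed.

#[global] Instance inN_bool : inN N bool := inN_bool_.1.

Lemma inN_int_ : inN N int /\ mf N (fun z : int => (z < 0, absz z)).
Proof.
apply: (inN_image (j := fun z : int => (z < 0, absz z))) => //.
  have h : forall z : int, code z = code (z < 0, absz z) by [].
  move=> z z'; rewrite !h => /(@in_inj N (bool * nat)%type _ _)[].
  by case: z => m; case: z' => n //= _ [->].
apply: (ms_iff (B := fun p : bool * nat => p.1 = false \/ (1 <= p.2)%N)); last by mst.
move=> [b n]; split=> [[[m|m] [-> ->]]|/= [->|]]; [by left|by right|by exists (Posz n)|].
case: b n => -[|n] // _; last by exists (Posz n.+1).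
by exists (Negz n).
Qed.

#[global] Instance inN_int : inN N int := inN_int_.1.

(** Integers are handled as differences of natural numbers, which reduces their operations and their
    order to those of [nat]. *)
Definition idiff (z : int) (a b : nat) : Prop := z = a%:Z - b%:Z.
Definition ltz0 (z : int) : bool := z < 0.

Lemma ms_intdiff : ms3 N idiff.
Proof.
have h := inN_int_.2.
apply: (ms_iff (B := fun p : int * nat * nat =>
  ltz0 p.1.1 = true /\ (absz p.1.1 + p.1.2)%N = p.2 \/
  ltz0 p.1.1 = false /\ p.1.2 = (absz p.1.1 + p.2)%N)).
  move=> [[z a] b]; rewrite /idiff /ltz0 /=; split.
    by move=> e; case: ltP => hz; [left|right]; split=> //; rewrite e in hz *; lia.
  by move=> [[hz]|[hz]]; lia.
have h1 : mf N ltz0 by exact: (mf_fst h).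
have h2 : mf N absz by exact: (mf_snd h).
by mst.
Qed.
#[local] Hint Resolve ms_intdiff : mst.

Lemma int_diff (z : int) : exists a b : nat, z = a%:Z - b%:Z.
Proof. by case: z => n; [exists n, 0%N|exists 0%N, n.+1]; lia. Qed.

Lemma mf_addz : mf2 N (T := int) (U := int) (W := int) +%R.
Proof.
apply: mfI; apply: (ms_iff (B := fun p : int * int * int => forall a b c d : nat,
   idiff p.1.1 a b -> idiff p.1.2 c d -> idiff p.2 (a + c)%N (b + d)%N)).
  move=> [[x y] z]; rewrite /idiff /=; split=> [<- a b c d -> ->|]; first by lia.
  have [a [b ex]] := int_diff x; have [c [d ey]] := int_diff y.
  by move/(_ a b c d ex ey); lia.
by mst.
Qed.
#[local] Hint Resolve mf_addz : mst.

Lemma mf_mulz : mf2 N (T := int) (U := int) (W := int) *%R.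
Proof.
apply: mfI; apply: (ms_iff (B := fun p : int * int * int => forall a b c d : nat,
   idiff p.1.1 a b -> idiff p.1.2 c d ->
   idiff p.2 (a * c + b * d)%N (a * d + b * c)%N)).
  move=> [[x y] z]; rewrite /idiff /=; split=> [<- a b c d -> ->|].
    by rewrite !PoszD !PoszM; ring.
  have [a [b ex]] := int_diff x; have [c [d ey]] := int_diff y.
  by move/(_ a b c d ex ey) ->; rewrite ex ey !PoszD !PoszM; ring.
by mst.
Qed.
#[local] Hint Resolve mf_mulz : mst.

Lemma ms_lez : ms2 N (fun x y : int => is_true (x <= y)).
Proof.
apply: (ms_iff (B := fun p : int * int => forall a b c d : nat,
   idiff p.1 a b -> idiff p.2 c d -> (a + d <= b + c)%N)).
  move=> [x y]; rewrite /idiff /=; split=> [h a b c d ex ey|h]; first by lia.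
  have [a [b ex]] := int_diff x; have [c [d ey]] := int_diff y.
  by have := h a b c d ex ey; lia.
by mst.
Qed.
#[local] Hint Resolve ms_lez : mst.

Lemma mf_posz : mf N Posz.
Proof.
apply: mfI; apply: (ms_iff (B := fun p : nat * int => idiff p.2 p.1 0)); last by mst.
by move=> [n z]; rewrite /idiff /=; split=> [<-|->]; rewrite subr0.
Qed.
#[local] Hint Resolve mf_posz : mst.

Lemma mf_absz : mf N absz.
Proof. exact: (mf_snd inN_int_.2). Qed.
#[local] Hint Resolve mf_absz : mst.

Lemma ms_odd : ms N (fun n : nat => is_true (odd n)).
Proof.
apply: (ms_iff (B := fun n : nat => exists k, n = (k + k).+1)); last by mst.
move=> n; split=> [on|[k ->]]; last by rewrite /= addnn odd_double.
by exists n./2; rewrite -[LHS]odd_double_half on addnn.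
Qed.
#[local] Hint Resolve ms_odd : mst.

(* The structure found by unification may differ from the one in the hints. *)
Ltac mst_arith ::=
  lazymatch goal with
  | |- @mf2 _ int _ _ _ _ _ (@GRing.add _) => exact mf_addz
  | |- @mf2 _ int _ _ _ _ _ (@GRing.mul _) => exact mf_mulz
  | |- @ms2 _ int _ _ _ _ => exact ms_lez
  end.

Lemma inN_rat_ : inN N rat /\ mf N (fun q : rat => (numq q, denq q)).
Proof.
apply: (inN_image (j := fun q : rat => (numq q, denq q))) => //.
  have h : forall q : rat, code q = code (numq q, denq q) by [].
  move=> q q'; rewrite !h => /(@in_inj N (int * int)%type _ _)[en ed].
  by rewrite -(divq_num_den q) -(divq_num_den q') en ed.
have h2 : mf N absz by exact: (mf_snd inN_int_.2).
apply: (ms_iff (B := fun p : int * int => ~ p.2 <= 0%:Z /\ forall k a b : nat,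
   absz p.1 = (k * a)%N -> absz p.2 = (k * b)%N -> k = 1%N)); last by mst.
move=> [n d] /=; split=> [[q [-> ->]]|[d0 h]].
  split=> [|k a b en ed]; first by have := denq_gt0 q; lia.
  have := coprime_num_den q; rewrite en ed /coprime => /eqP e.
  have : (k %| 1)%N by rewrite -e dvdn_gcd !dvdn_mulr.
  by rewrite dvdn1 => /eqP.
have cop : coprime (absz n) (absz d).
  rewrite /coprime; apply/eqP.
  have /dvdnP[a ea] := dvdn_gcdl (absz n) (absz d).
  have /dvdnP[b eb] := dvdn_gcdr (absz n) (absz d).
  by apply: (h _ a b); rewrite mulnC.
have dpos : 0 < d by lia.
exists (n%:Q / d%:Q); congr pair; first by rewrite coprimeq_num // gtr0_sg // mul1r.
by rewrite coprimeq_den // gt_eqF // gtr0_norm.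
Qed.

#[global] Instance inN_rat : inN N rat := inN_rat_.1.

Lemma mf_numq : mf N numq. Proof. exact: (mf_fst inN_rat_.2). Qed.
#[local] Hint Resolve mf_numq : mst.
Lemma mf_denq : mf N denq. Proof. exact: (mf_snd inN_rat_.2). Qed.
#[local] Hint Resolve mf_denq : mst.

Lemma rat_eqE (q : rat) (n d : int) : d != 0 ->
  q = n%:Q / d%:Q <-> numq q * d = n * denq q.
Proof.
move=> d0; have dq0 : d%:Q != 0 by rewrite intr_eq0.
have e0 : (denq q)%:Q != 0 by rewrite intr_eq0 denq_neq0.
split=> [e|e].
  apply: (@intr_inj rat); rewrite !rmorphM /=.
  by rewrite -{1}(divq_num_den q) in e; move/eqP: e; rewrite eqr_div // => /eqP.
rewrite -{1}(divq_num_den q); apply/eqP; rewrite eqr_div // -!rmorphM /=.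
by rewrite e.
Qed.

Lemma den_neq0 (q r : rat) : denq q * denq r != 0.
Proof. by rewrite mulf_neq0 // denq_neq0. Qed.

Lemma mf_addq : mf2 N (T := rat) (U := rat) (W := rat) +%R.
Proof.
apply: mfI; apply: (ms_iff (B := fun p : rat * rat * rat =>
  numq p.2 * (denq p.1.1 * denq p.1.2) =
  (numq p.1.1 * denq p.1.2 + numq p.1.2 * denq p.1.1) * denq p.2)); last by mst.
move=> [[x y] z] /=; rewrite -rat_eqE ?den_neq0 //.
rewrite -{1}(divq_num_den x) -{1}(divq_num_den y) addf_div ?intr_eq0 ?denq_neq0 //.
by rewrite rmorphD !rmorphM /=; split=> [->|->].
Qed.
#[local] Hint Resolve mf_addq : mst.

Lemma mf_mulq : mf2 N (T := rat) (U := rat) (W := rat) *%R.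
Proof.
apply: mfI; apply: (ms_iff (B := fun p : rat * rat * rat =>
  numq p.2 * (denq p.1.1 * denq p.1.2) =
  (numq p.1.1 * numq p.1.2) * denq p.2)); last by mst.
move=> [[x y] z] /=; rewrite -rat_eqE ?den_neq0 //.
rewrite -{1}(divq_num_den x) -{1}(divq_num_den y) mulf_div.
by rewrite -!rmorphM /=; split=> [->|->].
Qed.
#[local] Hint Resolve mf_mulq : mst.

Lemma ms_leq_rat : ms2 N (fun x y : rat => is_true (x <= y)).
Proof.
apply: (ms_iff (B := fun p : rat * rat =>
  numq p.1 * denq p.2 <= numq p.2 * denq p.1)); last by mst.
move=> [x y] /=; have h (q : rat) : 0 < (denq q)%:Q by rewrite ltr0z denq_gt0.
rewrite -{1}(divq_num_den x) -{1}(divq_num_den y) ler_pdivrMr // mulrAC ler_pdivlMr //.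
by rewrite -!rmorphM /= ler_int.
Qed.
#[local] Hint Resolve ms_leq_rat : mst.

Lemma ms_ltq : ms2 N (fun x y : rat => is_true (x < y)).
Proof.
apply: (ms_iff (B := fun p : rat * rat => ~ p.2 <= p.1)); last by mst.
by move=> [x y] /=; rewrite ltNge; split=> /negP.
Qed.
#[local] Hint Resolve ms_ltq : mst.

Ltac mst_arith ::=
  lazymatch goal with
  | |- @mf2 _ int _ _ _ _ _ (@GRing.add _) => exact mf_addz
  | |- @mf2 _ int _ _ _ _ _ (@GRing.mul _) => exact mf_mulz
  | |- @ms2 _ int _ _ _ _ => exact ms_lez
  | |- @mf2 _ rat _ _ _ _ _ (@GRing.add _) => exact mf_addq
  | |- @mf2 _ rat _ _ _ _ _ (@GRing.mul _) => exact mf_mulq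
  | |- @ms2 _ rat _ _ _ _ => first [exact ms_leq_rat | exact ms_ltq]
  end.

Lemma mf_oppq : mf N (T := rat) (-%R : rat -> rat).
Proof.
apply: mfI; apply: (ms_iff (B := fun p : rat * rat => p.1 + p.2 = 0)); last by mst.
by move=> [x y] /=; split=> [<-|/eqP]; rewrite ?addrN // addrC addr_eq0 => /eqP->; rewrite ?opprK.
Qed.
#[local] Hint Resolve mf_oppq : mst.

Lemma mf_invq : mf N (T := rat) (@GRing.inv rat).
Proof.
apply: mfI; apply: (ms_iff (B := fun p : rat * rat => p.1 * p.2 = 1 \/ (p.1 = 0 /\ p.2 = 0))); last by mst.
move=> [x y] /=; split=> [<-|[e|[-> ->]]]; last by rewrite invr0.
  by have [->|x0] := eqVneq x 0; [right; rewrite invr0|left; rewrite divff].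
have x0 : x != 0 by apply/eqP => x0; move: e; rewrite x0 mul0r => /eqP; rewrite eq_sym oner_eq0.
by apply: (mulfI x0); rewrite e divff.
Qed.
#[local] Hint Resolve mf_invq : mst.

Lemma mf_intq : mf N (T := rat) (intmul (1 : rat)).
Proof.
apply: mfI; apply: (ms_iff (B := fun p : int * rat => numq p.2 = p.1 /\ denq p.2 = 1%N%:Z)); last by mst.
move=> [z q] /=; split=> [<-|[<- e]]; first by rewrite numq_int denq_int.
by rewrite -[RHS]divq_num_den e divr1.
Qed.
#[local] Hint Resolve mf_intq : mst.

Lemma mf_natq : mf N (T := rat) (GRing.natmul (1 : rat)).
Proof.
apply: (mf_iff (g := fun n : nat => (Posz n)%:Q)) => [n|]; first by rewrite pmulrn.
by refine (mf_comp (f := Posz) (g := intmul (1 : rat)) _ _); mhave.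
Qed.
#[local] Hint Resolve mf_natq : mst.

End RatIn.

#[global] Hint Resolve mf_un mf_dig ms_intdiff mf_addz mf_mulz ms_lez mf_posz mf_absz ms_odd mf_numq mf_denq mf_addq mf_mulq ms_leq_rat ms_ltq mf_oppq mf_invq mf_intq mf_natq : mst.


Ltac mst_arith ::=
  lazymatch goal with
  | |- @mf2 _ int _ _ _ _ _ (@GRing.add _) => exact mf_addz
  | |- @mf2 _ int _ _ _ _ _ (@GRing.mul _) => exact mf_mulz
  | |- @ms2 _ int _ _ _ _ => exact ms_lez
  | |- @mf2 _ rat _ _ _ _ _ (@GRing.add _) => exact mf_addq
  | |- @mf2 _ rat _ _ _ _ _ (@GRing.mul _) => exact mf_mulq
  | |- @mf _ rat _ _ _ (@GRing.opp _) => exact mf_oppq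
  | |- @mf _ rat _ _ _ (@GRing.inv _) => exact mf_invq
  | |- @mf _ int _ _ _ (@intmul _ _) => exact mf_intq
  | |- @mf _ nat _ _ _ (@GRing.natmul _ _) => exact mf_natq
  | |- @ms2 _ rat _ _ _ _ => first [exact ms_leq_rat | exact ms_ltq]
  end.

(** * Real-valued functions inside a model *)

Section Cuts.
Variable R : realType.

Definition cut (x : R) : rat -> Prop := fun q => ratr q < x.

Lemma rat_between (x y : R) : x < y -> exists q : rat, x < ratr q < y.
Proof. by move=> /rat_in_itvoo[q]; rewrite in_itv /=; exists q. Qed.

Lemma cut_le (x y : R) : (forall q, cut x q -> cut y q) -> x <= y.
Proof.
move=> h; rewrite leNgt; apply/negP => /rat_between[q /andP[yq qx]].
by have := h q qx; rewrite /cut => /(lt_trans yq); rewrite ltxx.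
Qed.

Lemma cut_inj (x y : R) : cut x = cut y -> x = y.
Proof. by move=> e; apply/eqP; rewrite eq_le; apply/andP; split; apply: cut_le => q; rewrite e. Qed.

Lemma cut_ex (A : rat -> Prop) : (exists q, A q) -> (exists q, ~ A q) ->
  (forall q r, q < r -> A r -> A q) -> (forall q, A q -> exists2 r, q < r & A r) ->
  exists x : R, cut x = A.
Proof.
move=> [q0 A0] [q1 A1] down noMax; pose E := [set ratr q | q in A] : set R.
have ub q : ~ A q -> ubound E (ratr q).
  move=> nA _ [r Ar <-]; rewrite ler_rat leNgt; apply/negP => qr; exact: nA (down _ _ qr Ar).
have hs : has_sup E by split; [exists (ratr q0), q0|exists (ratr q1); exact: ub].
exists (sup E); apply/funext => q; apply/propext; rewrite /cut; split=> [qs|Aq].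
  apply: contrapT => nA; have := sup_le_ub hs.1 (ub _ nA).
  by rewrite leNgt qs.
have [r qr Ar] := noMax q Aq; apply: (@lt_le_trans _ _ (ratr r)); first by rewrite ltr_rat.
by apply: sup_upper_bound => //; exists r.
Qed.

End Cuts.

(** [R] is the ambient field and exceeds the reals of the model, so a function into it is tested
    through its cuts; [mr_mf] shows the agreement with membership of the coded function. *)
Definition mr (N : cls) (R : realType) (T : Type) (cT : Coded T) (f : T -> R) : Prop :=
  ms2 N (fun t q => is_true (ratr q < f t)).
Arguments mr N {R T cT} f.

Section RealIn.
Context {N : cls} {hN : zermelo N} {R : realType}.

Lemma code_cut (x : R) : code x = code (cut x). Proof. by []. Qed.

Lemma mem_cut (x : R) q : code q ∈ code x <-> ratr q < x.
Proof. by rewrite code_cut (mem_ms (N := N)). Qed.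

Lemma code_real_inj : injective (code : R -> hset).
Proof.
move=> x y e; apply: cut_inj; apply/funext => q; apply/propext.
by rewrite /cut -!mem_cut e.
Qed.

Section OneType.
Context {T : Type} {cT : Coded T} {iT : inN N T}.
Implicit Types f g : T -> R.

Lemma mr_mf f : mf N f <-> mr N f.
Proof.
have key (h : T -> pow N rat) : (forall t, sval (h t) = cut (f t)) -> code h = code f.
  move=> eh; apply: hset_ext => w; rewrite !mem_fun; split=> -[t ->]; exists t;
    by rewrite code_cut -eh.
split=> [hf|hf].
  have hc t : ms N (cut (f t)).
    suff h : N (@code R (@coded_real R) (f t)) by exact: h.
    have /(z_trans hN hf) : op (code t) (code (f t)) ∈ code f by apply/mem_fun; exists t.
    by move/(z_op_inv hN) => [].
  pose h t : pow N rat := exist _ _ (hc t).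
  have hh : mf N h by rewrite /mf (key h).
  have : ms N (fun p : T * rat => sval (h p.1) p.2) by mst.
  by [].
have hc t : ms N (cut (f t)).
  by refine (ms_pre2 (a := fun=> t) (b := id) hf _ _); mst.
pose h t : pow N rat := exist _ _ (hc t).
have e : code h = code f by apply: key.
by rewrite /mf -e; apply: mf_pow.
Qed.

Lemma mr_fin f : mr N f -> forall t, N (code (f t)).
Proof.
move=> /mr_mf hf t.
have /(z_trans hN hf) : op (code t) (code (f t)) ∈ code f by apply/mem_fun; exists t.
by move/(z_op_inv hN) => [].
Qed.

Lemma mr_iff f g : (forall t, f t = g t) -> mr N g -> mr N f.
Proof. by move=> h; have -> : f = g; first apply/funext. Qed.

Lemma mrI (f : T -> R) (B : T * rat -> Prop) :
  (forall t q, ratr q < f t <-> B (t, q)) -> ms N B -> mr N f.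
Proof. by move=> h; apply: ms_iff => -[t q]; exact: h. Qed.

Lemma mr_comp {S : Type} {cS : Coded S} {iS : inN N S} (h : S -> T) f :
  mf N h -> mr N f -> mr N (fun s => f (h s)).
Proof. by move=> hh hf; refine (ms_pre2 (a := fun p => h p.1) (b := fun p => p.2) hf _ _); mst. Qed.

Lemma mr_const (x : R) : N (code x) -> mr N (fun _ : T => x).
Proof.
rewrite code_cut => hx; apply: (mrI (B := fun p : T * rat => cut x p.2)) => //.
have {}hx : ms N (cut x) by []. 
by refine (ms_pre (f := fun p => p.2) (A := cut x) _ hx); mst.
Qed.

Lemma mr_rat (h : T -> rat) : mf N h -> mr N (fun t => ratr (h t) : R).
Proof.
move=> hh; apply: (mrI (B := fun p => p.2 < h p.1)); last by mst.
by move=> t q; rewrite ltr_rat.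
Qed.

Lemma mr_add f g : mr N f -> mr N g -> mr N (fun t => f t + g t).
Proof.
move=> hf hg; rewrite /mr /ms2 in hf hg.
pose F t (q : rat) := is_true (ratr q < f t); pose G t (q : rat) := is_true (ratr q < g t).
apply: (mrI (B := fun p => exists a b, [/\ p.2 = a + b, F p.1 a & G p.1 b])); last first.
  by have hF : ms N (fun p => F p.1 p.2) := hf; have hG : ms N (fun p => G p.1 p.2) := hg; mst.
move=> t q; split=> /= [h|[a [b [-> ha hb]]]]; last by rewrite rmorphD ltrD.
have /rat_between[a /andP[h1 h2]] : ratr q - g t < f t by rewrite ltrBlDr.
exists a, (q - a); rewrite /F /G; split=> //; first by rewrite addrC subrK.
by rewrite rmorphB /= ltrBlDr -ltrBlDl.
Qed.

Lemma mr_opp f : mr N f -> mr N (fun t => - f t).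
Proof.
move=> hf; rewrite /mr /ms2 in hf; pose F t (q : rat) := is_true (ratr q < f t).
apply: (mrI (B := fun p => exists r, p.2 < - r /\ ~ F p.1 r)); last first.
  by have hF : ms N (fun p => F p.1 p.2) := hf; mst.
move=> t q; rewrite /F; split=> /= [|[r [qr /negP]]].
  rewrite ltrNr => /rat_between[r /andP[h1 h2]]; exists r; split.
    by rewrite ltrNr -(ltr_rat R) rmorphN.
  by apply/negP; rewrite -leNgt ltW.
rewrite -leNgt => fr; rewrite ltrNr; apply: (le_lt_trans fr).
by rewrite -rmorphN ltr_rat ltrNr.
Qed.

Lemma ms_ltr f g : mr N f -> mr N g -> ms N (fun t => is_true (f t < g t)).
Proof.
move=> hf hg; rewrite /mr /ms2 in hf hg.
pose F t (q : rat) := is_true (ratr q < f t); pose G t (q : rat) := is_true (ratr q < g t).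
apply: (ms_iff (B := fun t => exists q, ~ F t q /\ G t q)); last first.
  by have hF : ms N (fun p => F p.1 p.2) := hf; have hG : ms N (fun p => G p.1 p.2) := hg; mst.
move=> t; rewrite /F /G; split=> [/rat_between[q /andP[h1 h2]]|[q [/negP]]].
  by exists q; split=> //; apply/negP; rewrite -leNgt ltW.
by rewrite -leNgt; exact: le_lt_trans.
Qed.

Lemma ms_ler f g : mr N f -> mr N g -> ms N (fun t => is_true (f t <= g t)).
Proof.
move=> hf hg; apply: (ms_iff (B := fun t => ~ (g t < f t))).
  by move=> t; rewrite leNgt; split=> /negP.
by apply: ms_not; exact: ms_ltr.
Qed.

Lemma ms_eqr f g : mr N f -> mr N g -> ms N (fun t => f t = g t).
Proof.
move=> hf hg; apply: (ms_iff (B := fun t => f t <= g t /\ g t <= f t)).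
  by move=> t; split=> [->|[h1 h2]]; [|apply/eqP; rewrite eq_le h1].
by apply: ms_and; exact: ms_ler.
Qed.

Lemma mr_pos f : mr N f -> mr N (fun t => Num.max 0 (f t)).
Proof.
move=> hf; rewrite /mr /ms2 in hf; pose F t (q : rat) := is_true (ratr q < f t).
apply: (mrI (B := fun p => p.2 < 0 \/ F p.1 p.2)); last first.
  by have hF : ms N (fun p => F p.1 p.2) := hf; mst.
by move=> t q; rewrite lt_max ltrq0; split=> /orP.
Qed.

Lemma mr_mul_pos f g : (forall t, 0 <= f t) -> (forall t, 0 <= g t) ->
  mr N f -> mr N g -> mr N (fun t => f t * g t).
Proof.
move=> f0 g0 hf hg; rewrite /mr /ms2 in hf hg.
pose F t (q : rat) := is_true (ratr q < f t); pose G t (q : rat) := is_true (ratr q < g t).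
apply: (mrI (B := fun p => p.2 < 0 \/
   exists a b, [/\ 0 <= a, 0 <= b, F p.1 a /\ G p.1 b & p.2 < a * b])); last first.
  by have hF : ms N (fun p => F p.1 p.2) := hf; have hG : ms N (fun p => G p.1 p.2) := hg; mst.
move=> t q; rewrite /F /G /=; split=> [h|[q0|[a [b [a0 b0 [fa gb] qab]]]]]; last 2 first.
- by apply: (@lt_le_trans _ _ 0); rewrite ?ltrq0 // mulr_ge0.
- apply: (@lt_trans _ _ (ratr (a * b))); first by rewrite ltr_rat.
  by rewrite rmorphM ltr_pM // ler0q.
have [q0|q0] := ltP q 0; first by left.
right; have qR : 0 <= ratr q :> R by rewrite ler0q.
have fg : 0 < f t * g t := le_lt_trans qR h.
have ft : 0 < f t by rewrite lt_def f0 andbT; apply: contraTneq fg => ->; rewrite mul0r ltxx.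
have gt : 0 < g t by rewrite lt_def g0 andbT; apply: contraTneq fg => ->; rewrite mulr0 ltxx.
have /rat_between[a /andP[ha1 ha2]] : ratr q / g t < f t by rewrite ltr_pdivrMr.
have a0 : 0 < ratr a :> R by apply: le_lt_trans ha1; rewrite divr_ge0 // ltW.
have /rat_between[b /andP[hb1 hb2]] : ratr q / ratr a < g t.
  by rewrite ltr_pdivrMr // mulrC -ltr_pdivrMr.
exists a, b; split=> //.
- by rewrite -(ler0q R) ltW.
- by rewrite -(ler0q R); apply: le_trans (ltW hb1); rewrite divr_ge0 // ltW.
- by rewrite -(ltr_rat R) rmorphM mulrC -ltr_pdivrMr.
Qed.

(** Positive and negative parts reduce the product to nonnegative factors, for which cuts can be
    multiplied. *)
Lemma mr_mul f g : mr N f -> mr N g -> mr N (fun t => f t * g t).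
Proof.
move=> hf hg; pose p (h : T -> R) t := Num.max 0 (h t); pose n (h : T -> R) t := Num.max 0 (- h t).
have hp h : mr N h -> mr N (p h) by exact: mr_pos.
have hn h : mr N h -> mr N (n h) by move=> hh; apply: mr_pos; exact: mr_opp.
have p0 h t : 0 <= p h t by rewrite le_max lexx.
have n0 h t : 0 <= n h t by rewrite le_max lexx.
have e h t : h t = p h t - n h t.
  by rewrite /p /n; case: (leP 0 (h t)) => h0; case: leP => h1; lra.
apply: (@mr_iff _ (fun t => (p f t * p g t + n f t * n g t) +
    - (p f t * n g t + n f t * p g t))).
  by move=> t; rewrite (e f) (e g); ring.
apply: mr_add; last apply: mr_opp; apply: mr_add; apply: mr_mul_pos => //;
  by [exact: hp|exact: hn].
Qed.

Lemma mr_norm f : mr N f -> mr N (fun t => `|f t|).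
Proof.
move=> hf; apply: (@mr_iff _ (fun t => Num.max 0 (f t) + Num.max 0 (- f t))).
  move=> t; have [h0|h0] := leP 0 (f t).
    by rewrite ger0_norm //; case: (leP 0 (- f t)) => h1; lra.
  by rewrite ltr0_norm //; case: (leP 0 (- f t)) => h1; lra.
by apply: mr_add; apply: mr_pos => //; exact: mr_opp.
Qed.

End OneType.

Lemma code_ratr (q : rat) : N (code (ratr q : R)).
Proof. by apply: (mr_fin (T := nat) (f := fun=> ratr q) _ 0%N); apply: mr_rat; mst. Qed.

Lemma code_real0 : N (code (0 : R)). Proof. by rewrite -(rmorph0 (@ratr R)); exact: code_ratr. Qed.
Lemma code_real1 : N (code (1 : R)). Proof. by rewrite -(rmorph1 (@ratr R)); exact: code_ratr. Qed.

Definition rn := {x : R | N (code x)}.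
#[global] Instance coded_rn : Coded rn := coded_sig (@coded_real R) (Q := fun x => N (code x)).

Lemma rn_inj : injective (code : rn -> hset).
Proof. by move=> [x hx] [y hy] e; apply: eq_exist; apply: code_real_inj. Qed.

(** By completeness of the ambient field every Dedekind cut lying in [N] is the cut of a real, so
    the reals of [N] correspond to a definable subset of the power set of the rationals. *)
Lemma inN_rn_ : inN N rn /\ mr N (fun x : rn => sval x).
Proof.
pose j (x : rn) : pow N rat := exist (fun A => ms N A) (@cut R (sval x)) (svalP x).
have [||i1 i2] := @inN_image N hN (pow N rat) (@coded_pow N rat _) rn coded_rn j rn_inj.
- by [].
- apply: (ms_iff (B := fun A : pow N rat => [/\ exists q, sval A q, exists q, ~ sval A q,
    forall q r, q < r -> sval A r -> sval A q
    & forall q, sval A q -> exists2 r, q < r & sval A r])); last by mst.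
  move=> [A hA]; split=> [[x ->]|[/= h1 h2 h3 h4]].
    rewrite /= /cut; split.
    + have [|q /andP[_ h]] := @rat_between _ (sval x - 1) (sval x); last by exists q.
      by rewrite gtrDl oppr_lt0.
    + have [|q /andP[h _]] := @rat_between _ (sval x) (sval x + 1); first by rewrite ltrDl.
      by exists q; apply/negP; rewrite -leNgt ltW.
    + by move=> q r qr; apply: lt_trans; rewrite ltr_rat.
    + by move=> q /rat_between[r /andP[qr rx]]; exists r => //; rewrite -(ltr_rat R).
  have [x ex] := @cut_ex R A h1 h2 h3 h4.
  have hx : N (code x) by rewrite code_cut ex.
  by exists (exist _ x hx); apply: eq_exist.
split=> //; have : ms N (fun p : rn * rat => sval (j p.1) p.2) by mst.
by [].
Qed.

#[global] Instance inN_rn : inN N rn := inN_rn_.1.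

Section FunctionSpace.
Context {S : Type} {cS : Coded S} {iS : inN N S}.

Lemma fspR_fin (f : fsp N S R) s : N (code (sval f s)).
Proof. by have /mr_mf h := svalP f; exact: mr_fin h s. Qed.

Lemma inN_fspR_ : inN N (fsp N S R) /\ mr N (fun p : fsp N S R * S => sval p.1 p.2).
Proof.
pose j0 (f : fsp N S R) s : rn := exist _ (sval f s) (fspR_fin f s).
have hj0 f : @mf N S rn cS coded_rn (j0 f) by exact: svalP f.
pose j f : fsp N S rn := exist _ (j0 f) (hj0 f).
have inj : injective (code : fsp N S R -> hset).
  move=> f g e; have {}e : j f = j g by apply: (@in_inj N _ _ _).
  have : forall s, sval f s = sval g s by move=> s; exact: (congr1 (fun h => sval (sval h s)) e).
  by case: f {e} => f hf; case: g => g hg /= e; apply: eq_exist; apply/funext.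
have [||i1 i2] := @inN_image N hN (fsp N S rn) (@coded_fsp N S rn _ _) (fsp N S R) (@coded_fsp N S R _ _) j inj.
- by [].
- apply: (ms_iff (B := fun=> True)); last exact: ms_const.
  move=> [g hg]; split=> // _.
  have hf : mf N (fun s => sval (g s)) by [].
  exists (exist _ _ hf); apply: eq_exist; apply/funext => s.
  have e (x y : rn) : sval x = sval y -> x = y by case: x y => [x ?] [y ?] /= ?; apply: eq_exist.
  exact: e.
split=> //.
have h : mf N (fun p : fsp N S R * S => sval (j p.1) p.2) by mst.
exact: (mr_comp h inN_rn_.2).
Qed.

#[global] Instance inN_fspR : inN N (fsp N S R) := inN_fspR_.1.

Lemma mr_ev {T : Type} {cT : Coded T} {iT : inN N T} (a : T -> fsp N S R) (b : T -> S) :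
  mf N a -> mf N b -> mr N (fun t => sval (a t) (b t)).
Proof.
move=> ha hb; refine (mr_comp (h := fun t => (a t, b t)) _ inN_fspR_.2).
exact: mf_pair.
Qed.

End FunctionSpace.

Lemma mr_rn {T : Type} {cT : Coded T} {iT : inN N T} (a : T -> rn) :
  mf N a -> mr N (fun t => sval (a t)).
Proof. by move=> ha; exact: (mr_comp ha inN_rn_.2). Qed.

Lemma mr_comp2 {S T U : Type} {cS : Coded S} {cT : Coded T} {cU : Coded U}
  {iS : inN N S} {iT : inN N T} {iU : inN N U} (a : S -> T) (b : S -> U) (h : T -> U -> R) :
  mr N (fun p : T * U => h p.1 p.2) -> mf N a -> mf N b -> mr N (fun s => h (a s) (b s)).
Proof.
move=> hh ha hb; refine (mr_comp (h := fun t => (a t, b t)) _ hh).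
exact: mf_pair.
Qed.

End RealIn.
Arguments rn N R : clear implicits.

Ltac mrt_more := fail.

Ltac mrt :=
  cbv beta;
  lazymatch goal with
  | |- mr _ (fun t => @?f t + @?g t) => refine (mr_add (f := f) (g := g) _ _); mrt
  | |- mr _ (fun t => @?f t * @?g t) => refine (mr_mul (f := f) (g := g) _ _); mrt
  | |- mr _ (fun t => - @?f t) => refine (mr_opp (f := f) _); mrt
  | |- mr _ (fun t => `|@?f t|) => refine (mr_norm (f := f) _); mrt
  | |- mr _ (fun t => ratr (@?h t)) => refine (mr_rat (h := h) _); mst
  | |- _ => first
    [ match goal with |- mr _ (fun _ => ?c) =>
        apply: mr_const; first [exact code_real0 | exact code_real1 | exact (code_ratr _)
          | assumption] end
    | mrt_more
    | match goal with h : mr ?N ?f |- mr ?N ?f => exact h end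
    | match goal with |- mr _ (fun t => sval (@?a t) (@?b t)) =>
        refine (mr_ev (a := a) (b := b) _ _); mst end
    | match goal with |- mr _ (fun t => sval (@?a t)) => refine (mr_rn (a := a) _); mst end
    | match goal with h : mr ?N ?f |- mr ?N (fun t => ?f (@?a t)) =>
        refine (mr_comp (h := a) (f := f) _ h); mst end
    | match goal with h : mr ?N (fun p => ?f p.1 p.2) |- mr ?N (fun t => ?f (@?a t) (@?b t)) =>
        refine (mr_comp2 (a := a) (b := b) (h := f) h _ _); mst end ]
  end.

Ltac mst_real :=
  match goal with
  | |- ms _ (fun t => is_true (@Order.lt _ _ (@?a t) (@?b t))) =>
      refine (ms_ltr (f := a) (g := b) _ _); mrt
  | |- ms _ (fun t => is_true (@Order.le _ _ (@?a t) (@?b t))) =>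
      refine (ms_ler (f := a) (g := b) _ _); mrt
  | |- ms _ (fun t => @?a t = @?b t) =>
      refine (ms_eqr (f := a) (g := b) _ _); mrt
  end.
Ltac mst_more ::= first [mst_if | mst_sval | mst_real].

(** * Towers and well-orders *)

Section Tower.
Context {N : cls} {hN : zermelo N}.
Context {Y : Type} {cY : Coded Y} {iY : inN N Y}.
Variables (A0 : pow N Y) (f : pow N Y -> pow N Y).
Hypothesis hf : mf N f.
Hypothesis f_le : forall A y, sval A y -> sval (f A) y.

Notation "A ⊑ B" := (forall y, sval A y -> sval B y) (at level 70).

Lemma pow_eq (A B : pow N Y) : A ⊑ B -> B ⊑ A -> A = B.
Proof.
case: A B => [A hA] [B hB] /= h k; apply: eq_exist.
by apply/funext => y; apply/propext; split=> [/h|/k].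
Qed.

Lemma unionN (G : pow N (pow N Y)) :
  ms N (fun y => sval A0 y \/ exists A, sval G A /\ sval A y).
Proof. by mst. Qed.
Definition union_pow G : pow N Y := exist _ _ (unionN G).

Lemma mf_union : mf N union_pow.
Proof. by apply: mf_pow => /=; mst. Qed.
#[local] Hint Resolve mf_union : mst.

(** [union_pow] always includes [A0], so the empty union puts [A0] into every closed family. *)
Definition tower_closed (F : pow N Y -> Prop) : Prop :=
  (forall A, F A -> F (f A)) /\
  forall G : pow N (pow N Y), (forall A, sval G A -> F A) -> F (union_pow G).

(** The iteration of [f] from [A0] without ordinals, as the least closed family. It is available in
    every Zermelo model, and serves for well-orders in V as well as for prime ideals in V[G]. *)
Definition tower (A : pow N Y) : Prop :=
  forall F : pow N (pow N Y), tower_closed (sval F) -> sval F A.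

Lemma ms_tower : ms N tower.
Proof. by rewrite /tower /tower_closed; mst. Qed.

Lemma tower_ind (F : pow N Y -> Prop) : ms N F -> tower_closed F -> forall A, tower A -> F A.
Proof. by move=> hF cF A /(_ (exist _ F hF)); apply. Qed.

Lemma tower_step A : tower A -> tower (f A).
Proof. by move=> tA F cF; apply: cF.1; exact: tA. Qed.

Lemma tower_union (G : pow N (pow N Y)) : (forall A, sval G A -> tower A) -> tower (union_pow G).
Proof. by move=> h F cF; apply: cF.2 => A GA; exact: h. Qed.

Lemma tower_base A : tower A -> A0 ⊑ A.
Proof.
apply: (tower_ind (F := fun A => A0 ⊑ A)); first by mst.
by split=> [{}A h y /h /f_le|G h y]; [|left].
Qed.

(** The hypothesis on C is that [f] sends every properly smaller member of the tower below C. For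
    such a C, the members below C or above [f C] form a closed family. *)
Lemma tower_comparable C : tower C -> (forall A, tower A -> A ⊑ C -> ~ (C ⊑ A) -> f A ⊑ C) ->
  forall A, tower A -> A ⊑ C \/ f C ⊑ A.
Proof.
move=> tC eC A tA; have ht := ms_tower.
suff [//] : tower A /\ (A ⊑ C \/ f C ⊑ A).
apply: (tower_ind (F := fun A => tower A /\ (A ⊑ C \/ f C ⊑ A)) _ _ tA) => [|{tA A}]; first by mst.
split=> [A [tA h]|G hG].
  split; first exact: tower_step.
  case: h => [AC|CA]; last by right => y /CA/f_le.
  have [CA|nCA] := pselect (C ⊑ A); last by left; exact: eC.
  by right; rewrite (pow_eq AC CA).
split; first by apply: tower_union => A /hG[].
have [[A GA AC]|n] := pselect (exists2 A, sval G A & f C ⊑ A).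
  by right=> y /AC; right; exists A.
left=> y [|[A [GA Ay]]]; first exact: tower_base.
by have [_ [h|h]] := hG A GA; [exact: h|case: n; exists A].
Qed.

(** The members that satisfy the hypothesis of [tower_comparable] again form a closed family, so
    that all members do and the tower is a chain. *)
Lemma tower_extreme C : tower C -> forall A, tower A -> A ⊑ C -> ~ (C ⊑ A) -> f A ⊑ C.
Proof.
move=> tC; have ht := ms_tower.
suff [//] : tower C /\ (forall A, tower A -> A ⊑ C -> ~ (C ⊑ A) -> f A ⊑ C).
apply: (tower_ind (F := fun C => tower C /\ (forall A, tower A -> A ⊑ C -> ~ (C ⊑ A) -> f A ⊑ C)) _ _ tC) => [|{tC C}]; first by mst.
split=> [C [tC eC]|G hG].
  split=> [|A tA AC nCA]; first exact: tower_step.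
  have [AC'|CA] := tower_comparable tC eC tA; last by case: nCA.
  have [CA|nCA'] := pselect (C ⊑ A); first by rewrite (pow_eq AC' CA).
  by move=> y /(eC A tA AC' nCA')/f_le.
split=> [|A tA AU nUA]; first by apply: tower_union => A /hG[].
have [C [GC nCA]] : exists C, sval G C /\ ~ (C ⊑ A).
  apply: contrapT => n; apply: nUA => y [|[C [GC Cy]]]; first exact: tower_base.
  by apply: contrapT => nA; apply: n; exists C; split=> // /(_ _ Cy).
have [tC eC] := hG C GC.
have AC : A ⊑ C.
  by have [//|h] := tower_comparable tC eC tA; case: nCA => y /f_le/h.
by move=> y /(eC A tA AC nCA) Cy; right; exists C.
Qed.

Lemma tower_chain C A : tower C -> tower A -> A ⊑ C \/ f C ⊑ A.
Proof. by move=> tC; apply: tower_comparable => //; exact: tower_extreme. Qed.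

Lemma tower_top : exists2 U, tower U & f U ⊑ U.
Proof.
have hT : ms N tower := ms_tower.
exists (union_pow (exist _ tower hT)); first exact: tower_union.
by move=> y h; right; exists (f (union_pow (exist _ tower hT))); split=> //; apply: tower_step; exact: tower_union.
Qed.

End Tower.

Definition least (Y : Type) (lt : Y -> Y -> Prop) (A : Y -> Prop) (y : Y) : Prop :=
  A y /\ forall z, A z -> z = y \/ lt y z.

Lemma least_uniq (Y : Type) (lt : Y -> Y -> Prop) (A : Y -> Prop) (x y : Y) :
  (forall x, ~ lt x x) -> (forall x y z, lt x y -> lt y z -> lt x z) ->
  least lt A x -> least lt A y -> x = y.
Proof.
move=> irr tr [Ax hx] [Ay hy]; have [//|xy] := hx y Ay.
by have [//|yx] := hy x Ax; case: (irr x); exact: tr xy yx.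
Qed.

Section WellOrder.
Context {N : cls} {hZ : zfc N}.
Let hN : zermelo N := hZ.
#[local] Existing Instance hN.
Context {Y : Type} {cY : Coded Y} {iY : inN N Y}.

(** The products of the singleton of A with A, for nonempty A, are pairwise disjoint, so choice for
    disjoint families applies to them. *)
Lemma choice_in (y0 : Y) : exists2 ch : pow N Y -> Y, mf N ch &
  forall (A : pow N Y) y, sval A y -> sval A (ch A).
Proof.
pose (line := fun (A : pow N Y) (p : pow N Y * Y) => p.1 = A /\ sval A p.2).
have hline A : ms N (line A) by rewrite /line; mst.
pose L A : pow N (pow N Y * Y) := exist _ _ (hline A).
have hL : mf N L by apply: mf_pow => /=; rewrite /line; mst.
have hF : ms N (fun E => exists A, (exists y, sval A y) /\ E = L A) by mst.
have LE A w : w ∈ code (L A) <-> exists2 y, sval A y & w = code (A, y).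
  have -> : code (L A) = code (line A) by [].
  by rewrite mem_set; split=> [[[_ y] /= [/= -> Ay] ->]|[y Ay ->]]; [exists y|exists (A, y)].
have [x /mem_set[E [A [[y Ay] ->]] ->]|x x' u /mem_set[E [A [_ ->]] ->] /mem_set[E' [A' [_ ->]] ->]|c Nc hc] := h_choice hZ hF.
- by exists (code (A, y)); apply/LE; exists y.
- move=> /LE[y _ ->] /LE[y' _]; rewrite !code_pair => /op_inj[e _].
  by congr (code (L _)); apply: (@in_inj N) e.
have ex (A : pow N Y) : exists y, ((exists y, sval A y) /\ sval A y /\ code (A, y) ∈ c) \/
    (~ (exists y, sval A y) /\ y = y0).
  have [h|h] := pselect (exists y, sval A y); last by exists y0; right.
  have [|u /LE[y Ay eu] hu] := hc (code (L A)); first by apply/mem_set; exists (L A) => //; exists A.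
  exists y; left; do !split=> //.
  by have [_ /(_ erefl)[k _]] := hu u; rewrite -eu.
have [ch hch] := choice ex; exists ch; last first.
  by move=> A y Ay; case: (hch A) => [[_ []]|[[]]] //; exists y.
have hC : ms N (fun p : pow N Y * Y => code p ∈ c) by exact: (msI Nc).
apply: mfI; apply: (ms_iff (B := fun p => ((exists y, sval p.1 y) /\ sval p.1 p.2 /\ code p ∈ c) \/
    (~ (exists y, sval p.1 y) /\ p.2 = y0))).
  move=> [A y] /=; split=> [<-|]; first exact: hch.
  case: (hch A) => [[h1 [h2 h3]]|[h1 ->]] [[k1 [k2 k3]]|[k1 ->]] //.
  have [|u _ hu] := hc (code (L A)); first by apply/mem_set; exists (L A) => //; exists A.
  have e1 : code (A, ch A) = u by apply/hu; split=> //; apply/LE; exists (ch A).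
  have e2 : code (A, y) = u by apply/hu; split=> //; apply/LE; exists y.
  by move: e1; rewrite -e2 !code_pair => /op_inj[_]; exact: (@in_inj N).
pose (K := fun p : pow N Y * Y => code p ∈ c); have hK : ms N K := hC.
by refine (ms_or (ms_and _ (ms_and _ hK)) _); mst.
Qed.

(** Zermelo's proof: the tower adds one chosen new element at a time. y precedes z if it belongs to
    the largest member of the tower that omits z, and the least element of A is the one added to the
    largest member disjoint from A. *)
Lemma well_order_internal : exists lt : Y -> Y -> Prop,
  [/\ ms N (fun p => lt p.1 p.2), forall x, ~ lt x x, forall x y z, lt x y -> lt y z -> lt x z
    & forall A : pow N Y, (exists y, sval A y) -> exists y, least lt (sval A) y].
Proof.
have [[y0]|nY] := pselect (inhabited Y); last first.
  exists (fun _ _ => False); split; [by mst|by move=> x []|by []|].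
  by move=> A [y]; have := nY (inhabits y).
have [ch hch chP] := choice_in y0.
have h0 : ms N (fun _ : Y => False) by mst.
pose A0 : pow N Y := exist _ _ h0.
have hcmp (A : pow N Y) : ms N (fun y => ~ sval A y) by mst.
pose cmp (A : pow N Y) : pow N Y := exist _ _ (hcmp A).
have mcmp : mf N cmp by apply: mf_pow => /=; mst.
have hstep (A : pow N Y) : ms N (fun y => sval A y \/ y = ch (cmp A)) by mst.
pose f (A : pow N Y) : pow N Y := exist _ _ (hstep A).
have mf_f : mf N f by apply: mf_pow => /=; mst.
have fle (A : pow N Y) y : sval A y -> sval (f A) y by left.
pose (T := tower A0 f); have hT : ms N T by exact: ms_tower.
have chain (C A : pow N Y) : T C -> T A ->
  (forall y, sval A y -> sval C y) \/ (forall y, sval (f C) y -> sval A y) by exact: tower_chain.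
have fixed A : (forall y, sval (f A) y -> sval A y) -> forall y, sval A y.
  move=> h y; apply: contrapT => ny.
  by case: (chP (cmp A) y ny); apply: h; right.
have hbig (S : pow N Y) : ms N (fun A => T A /\ ~ exists y, sval A y /\ sval S y) by mst.
(* The largest member of the tower that is disjoint from S. *)
pose (big := fun S : pow N Y => union_pow A0 (exist _ _ (hbig S))).
have bigT S : T (big S) by apply: tower_union => A [].
have bigS S y : sval (big S) y -> ~ sval S y by case=> [//|[A [[_ n] Ay] Sy]]; apply: n; exists y.
have bigM (S A : pow N Y) : T A -> (forall y, sval A y -> ~ sval S y) -> forall y, sval A y -> sval (big S) y.
  by move=> TA n y Ay; right; exists A; split=> //; split=> // -[z [Az /n]]; apply.
have hsing z : ms N (fun y : Y => y = z) by mst.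
pose sing z : pow N Y := exist _ _ (hsing z).
pose (L := fun z => big (sing z)).
have Lz z : ~ sval (L z) z by move=> /bigS; apply.
have hlt : ms N (fun p : Y * Y => sval (L p.2) p.1).
  apply: (ms_iff (B := fun p => exists A, [/\ T A, ~ sval A p.2 & sval A p.1])); last by mst.
  move=> [y z] /=; split=> [h|[A [TA nz Ay]]].
    by exists (L z); split; [exact: bigT|exact: Lz|].
  by apply: (bigM (sing z) A) => // x Ax /= e; rewrite e in Ax.
exists (fun y z => sval (L z) y); split; [exact: hlt|exact: Lz| |].
  by move=> x y z; have [h|h] := chain (L z) (L y) (bigT _) (bigT _);
  [move=> /h|move=> _ /fle/h/Lz].
move=> A [a Aa]; pose (I := big A).
have [nf] : exists y, sval (f I) y /\ sval A y.
  apply: contrapT => n; have : sval I a; last by move/bigS; apply.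
  apply: fixed => y fy; apply: (bigM A (f I)) (fy).
    exact: tower_step (bigT _).
  by move=> z fz Az; apply: n; exists z.
move=> [[/bigS//|->]]; set c := ch _ => Ac; exists c; split=> // z Az.
have IL : forall y, sval I y -> sval (L z) y.
  apply: (bigM (sing z) I); first exact: bigT.
  by move=> y Iy /= e; rewrite e in Iy; exact: (bigS _ _ Iy Az).
have [LI|h] := chain I (L z) (bigT _) (bigT _); last by right; apply: h; right.
left; have e : L z = I by apply: pow_eq.
apply: contrapT => zc; have : sval (L z) c; last by rewrite e => /bigS; apply.
apply: (bigM (sing z) (f (L z))); [exact: tower_step (bigT _)| |by rewrite e; right].
by move=> y; rewrite e => -[Iy /= yz|-> /esym//]; rewrite yz in Iy; exact: (bigS _ _ Iy Az).
Qed.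

End WellOrder.

(** * Sets as types, collapse of well-orders, and cardinals *)

Definition dom (x : Ens) : Type := let: @fam J _ := x in J.
Definition child (x : Ens) : dom x -> Ens :=
  match x return dom x -> Ens with @fam J f => f end.
Arguments child x j : clear implicits.

Lemma inE_child x w : inE w x <-> exists j, eqE w (child x j).
Proof. by case: x. Qed.

(* One index is selected for each member, so that the codes of the members are distinct;
   unlike {u : hset | u ∈ a}, this type lives in the universe of the trees. *)
Definition selected (a : hset) (j : dom (rp a)) : Prop :=
  if pselect (exists i, cl (child (rp a) i) = cl (child (rp a) j)) is left h
  then sval (cid h) = j else False.
Arguments selected a j : clear implicits.
Definition elem (a : hset) := {j : dom (rp a) | selected a j}.
#[global] Instance coded_elem (a : hset) : Coded (elem a) := fun u => child (rp a) (sval u).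

Lemma elem_in (a : hset) (u : elem a) : code u ∈ a.
Proof.
have : cl (child (rp a) (sval u)) ∈ cl (rp a); last by rewrite rpK.
by rewrite mem_cl; apply/inE_child; exists (sval u); exact: eqE_refl.
Qed.

Lemma selectedP (a : hset) i j : cl (child (rp a) i) = cl (child (rp a) j) ->
  selected a i -> selected a j -> i = j.
Proof.
by rewrite /selected => ->; case: pselect => // h; move: (sval _) => k ei ej; rewrite -ei.
Qed.

Lemma elem_ex (a w : hset) : w ∈ a -> exists u : elem a, code u = w.
Proof.
rewrite -{1}(rpK a) -{1}(rpK w) mem_cl => /inE_child[j /clE]; rewrite rpK => ew.
have ex : exists i, cl (child (rp a) i) = w by exists j.
pose k := sval (cid ex); have ek : cl (child (rp a) k) = w := svalP (cid ex).
have hk : selected a k.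
  rewrite /selected; case: pselect => [|[]]; last by exists k.
  by rewrite ek => h; rewrite (Prop_irrelevance h ex).
by exists (exist _ k hk).
Qed.

Lemma code_elem_inj (a : hset) : injective (code : elem a -> hset).
Proof. by move=> [i hi] [j hj] e; apply: eq_exist; exact: selectedP e hi hj. Qed.

Lemma inN_elem (N : cls) (a : hset) : N a -> inN N (elem a).
Proof.
move=> Na; split; first exact: code_elem_inj.
have e : full (elem a) = a; last by rewrite e.
apply: hset_ext => w; rewrite mem_full; split=> [[u ->]|/elem_ex[u <-]]; [exact: elem_in|by exists u].
Qed.

Lemma code_fun_eq (S T U : Type) (cS : Coded S) (cT : Coded T) (cU : Coded U)
  (f : S -> T) (g : S -> U) : (forall s, code (f s) = code (g s)) -> code f = code g.
Proof. by move=> e; apply: hset_ext => w; rewrite !mem_fun; split=> -[s ->]; exists s; rewrite e. Qed.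

Lemma inN_sub (N M : cls) (T : Type) (cT : Coded T) : (forall x, N x -> M x) -> inN N T -> inN M T.
Proof. by move=> h [i j]; split=> //; exact: h. Qed.

Section Collapse.
Context {N : cls} {hZ : zfc N}.
Let hN : zermelo N := hZ.
#[local] Existing Instance hN.
Context {Y : Type} {cY : Coded Y} {iY : inN N Y}.

(** The Mostowski collapse carries the order into membership, which is well-founded in the ambient
    universe. Hence least elements exist for all predicates, not only for those of [N]; this is what
    allows the order to be used in V[G]. *)
Theorem well_order : exists (lt : Y -> Y -> Prop) (f : Y -> hset) (k : hset),
  [/\ ms N (fun p => lt p.1 p.2), forall x, ~ lt x x,
      forall x y z, lt x y -> lt y z -> lt x z,
      forall A : Y -> Prop, (exists y, A y) -> exists y, least lt A y
    & [/\ injective f, N k, forall u, u ∈ k <-> exists y, u = f y,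
          forall y u, u ∈ f y <-> exists2 z, lt z y & u = f z
        & exists2 g, N g & forall w, w ∈ g <-> exists y, w = op (code y) (f y)]].
Proof.
have [lt [mlt irr tr lst]] := @well_order_internal N hZ Y cY iY.
pose (c := code (fun p : Y * Y => lt p.1 p.2)).
have Nc : N c by [].
have cE y z : op (code y) (code z) ∈ c <-> lt y z by rewrite -code_pair mem_ms.
have cY1 u v : op u v ∈ c -> exists y z : Y, [/\ u = code y, v = code z & lt y z].
  by move=> /mem_set[[y z] /= l /esym]; rewrite code_pair => /op_inj[<- <-]; exists y, z.
(* The value at y is the set of the values at its predecessors. *)
have [|||||F [NF hF gF]] := @recursion N hZ c Nc (fun c z y => op z y ∈ c) (fun c y s u => u = s).
- by dfn 10%N.
- by dfn 10%N.
- move=> y Ny; have [|||s Ns hs] := z_sepl hN (A := fun e => op (e 0%N) (e 1%N) ∈ e 2%N)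
    (l := [:: y; c]) (x := full Y); [by dfn 10%N|by do !split|exact: in_full|].
  exists s => // z; rewrite hs; split=> [[h1 h2]|[_ h2]]; last first.
    by split=> //; have [z' [_ [-> _ _]]] := cY1 _ _ h2; apply/mem_full; exists z'.
  by split=> //; exact: z_trans hN _ _ (in_full (T := Y)) h1.
- by move=> y s _ Ns; exists s.
- move=> A [D [l [dD Nl hA]]] prog.
  have base (y : Y) : A (code y).
    apply: contrapT => nA.
    have hms : ms N (fun y : Y => ~ A (code y)).
      apply: (ms_sep (D := fun e => ~ D e) (l := l)) => //; first exact: Df_not.
      by move=> t; rewrite hA; last exact: code_in.
    have [|z [nz hz]] := lst (exist _ _ hms); first by exists y.
    apply: nz; apply: prog; first exact: code_in.
    move=> u Nu /cY1[x [z' [-> /(@in_inj N Y cY iY) <- xz]]]; apply: contrapT => nx.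
    by case: (hz x nx) => [e|l']; [rewrite e in xz; exact: irr xz|exact: irr (tr _ _ _ xz l')].
  move=> y Ny; have [[y' ->//]|ny] := pselect (exists y' : Y, y = code y').
  by apply: prog => // z _ /cY1[_ [y' [_ e _]]]; case: ny; exists y'.
pose (f := fun y : Y => F (code y)).
have fE y u : u ∈ f y <-> exists2 z, lt z y & u = f z.
  have [s _ [hs es]] := hF (code y) (code_in y); rewrite /f es hs.
  split=> [[z [_ /cY1[z' [y' [-> /(@in_inj N Y cY iY) <- l]]] ->]]|[z l ->]]; first by exists z'.
  by exists (code z); split; [exact: code_in|apply/cE|].
have tot x y : x = y \/ lt x y \/ lt y x.
  have hp : ms N (fun z : Y => z = x \/ z = y) by mst.
  have [|z [[e|e] hz]] := lst (exist _ _ hp); first by exists x; left.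
  - by have [->|] := hz y (or_intror erefl); [left|rewrite e; right; left].
  - by have [->|] := hz x (or_introl erefl); [left|rewrite e; right; right].
have irrf u : ~ u ∈ u.
  by elim/(well_founded_ind mem_wf): u => u IH uu; exact: (IH u uu uu).
have finj : injective f.
  by move=> x y e; have [//|[l|l]] := tot x y; case: (irrf (f x)); [rewrite {2}e|rewrite {1}e];
    apply/fE; [exists x|exists y].
have [g Ng hg] := gF (full Y) (in_full (T := Y)).
have [g1 Ng1 hg1] := z_union hN Ng; have [g2 Ng2 hg2] := z_union hN Ng1.
have [|||k Nk hk] := z_sepl hN (A := fun e => exists y, y ∈ e 1%N /\ op y (e 0%N) ∈ e 2%N)
    (l := [:: full Y; g]) (x := g2); [by dfn 10%N|by do !split=> //; exact: in_full|by []|].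
exists lt, f, k; split=> //; first move=> A [a Aa].
  have : exists y, f y = f a by exists a.
  elim/(well_founded_ind mem_wf): (f a) {-2}a (erefl (f a)) Aa => u IH {}a ea Aa _.
  have [[z [Az za]]|n] := pselect (exists z, A z /\ lt z a).
    by apply: (IH (f z) _ z) => //; [rewrite -ea; apply/fE; exists z|exists z].
  exists a; split=> // z Az; have [->|[h|za]] := tot z a; [by left|by case: n; exists z|by right].
split=> //.
  move=> u; rewrite hk /le_ /=; split=> [[_ [y [/mem_full[y' ->] /hg[z /mem_full[z' ->] /op_inj[e ->]]]]]|[y ->]].
    by exists z'.
  have h : op (code y) (f y) ∈ g by apply/hg; exists (code y) => //; apply/mem_full; exists y.
  split; last by exists (code y); split=> //; apply/mem_full; exists y.
  apply/hg2; exists (up (code y) (f y)); last by apply/mem_up; right.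
  by apply/hg1; exists (op (code y) (f y)) => //; apply/mem_up; right.
exists g => // w; rewrite hg; split=> [[y /mem_full[y' ->] ->]|[y ->]]; first by exists y'.
by exists (code y) => //; apply/mem_full; exists y.
Qed.

Lemma cantor (h : pow N nat -> nat) : mf N h -> ~ injective h.
Proof.
move=> hh inj; have hD : ms N (fun n => exists A, h A = n /\ ~ sval A n) by mst.
pose (D := exist _ _ hD : pow N nat).
have nD : ~ sval D (h D).
  by move=> Dh; have [A [/inj e n]] := Dh; apply: n; rewrite e.
by apply: (nD); exists D; split.
Qed.

(** The least ordinal into which [Y] injects, found among the collapse k of a well-order of [Y] and
    the members of k; minimality makes it a cardinal. *)
Lemma cardinal_above (p : pow N nat -> Y) : mf N p -> injective p ->
  exists a, [/\ N a, forall x w, x ∈ a -> w ∈ x -> w ∈ a,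
    forall x z w, x ∈ a -> z ∈ x -> w ∈ z -> w ∈ x,
    exists2 i : Y -> elem a, mf N i & injective i
  & forall x, x ∈ a -> ~ exists2 i : Y -> elem x, mf N i & injective i].
Proof.
move=> mp ip; have [lt [f [k [_ _ tr _ [finj Nk kE fE [g Ng hg]]]]]] := well_order.
pose (Q := fun a => exists2 i : Y -> elem a, mf N i & injective i).
pose (K := fun a => a = k \/ a ∈ k).
have Qk : Q k.
  have fk y : f y ∈ k by apply/kE; exists y.
  have [i hi] := choice (fun y => elem_ex (fk y)).
  exists i; last by move=> x y e; apply: finj; rewrite -!hi e.
  have e : g = code i; last by rewrite /mf -e.
  by apply: hset_ext => w; rewrite hg mem_fun; split=> -[y ->]; exists y; rewrite hi.
have [a [[Ka Qa] mina]] : exists a, (K a /\ Q a) /\ forall x, x ∈ a -> ~ (K x /\ Q x).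
  apply: contrapT => n; suff h u : ~ (K u /\ Q u) by apply: (h k); split=> //; left.
  elim/(well_founded_ind mem_wf): u => u IH h; apply: n; exists u; split=> // x /IH.
have Kt x : K a -> x ∈ a -> x ∈ k.
  by case=> [->//|/kE[y ->] /fE[z _ ->]]; apply/kE; exists z.
exists a; split=> //.
- by case: Ka => [->|/kE[y ->]]; [exact: Nk|apply: (z_trans hN Nk); apply/kE; exists y].
- move=> x w xa wx; case: Ka xa => [->|/kE[y ->]].
    by move=> /kE[z ez]; move: wx; rewrite ez => /fE[z' _ ->]; apply/kE; exists z'.
  move=> /fE[z zy ez]; move: wx; rewrite ez => /fE[z' z'z ->]; apply/fE; exists z' => //.
  exact: tr z'z zy.
- move=> x z w /(Kt x Ka)/kE[y ->] /fE[z' zy ->] /fE[w' wz ->]; apply/fE; exists w' => //.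
  exact: tr wz zy.
- by move=> x xa; have := mina x xa; move=> n q; apply: n; split=> //; right; exact: Kt.
Qed.

End Collapse.

(** Countable sets are those with injective enumerations. [nw] marks the first occurrences in h and
    [cnt] counts them; the injection e0, possibly from outside the model, shows that the counter is
    unbounded. *)
Lemma injective_enumeration (N : cls) (hN : zermelo N) (X : Type) (cX : Coded X) (iX : inN N X)
  (h e0 : nat -> X) : mf N h -> injective e0 -> (forall n, exists m, e0 n = h m) ->
  exists e : nat -> X, [/\ mf N e, injective e & forall x, (exists n, e n = x) <-> exists n, h n = x].
Proof.
move=> hh e0i e0h.
pose nw n := `[< forall i, (i < n)%N -> h i <> h n >].
have mnw : ms N (fun n => is_true (nw n)).
  apply: (ms_iff (B := fun n => forall i, (i < n)%N -> h i <> h n)); last by mst.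
  by move=> n; rewrite /nw asboolE.
pose cnt := fix cnt n := if n is m.+1 then (if nw m then (cnt m).+1 else cnt m) else 0%N.
have mcnt : mf N cnt.
  have hc : mf N (fun p : nat * nat => cnt p.2).
    apply: (mf_rec (g := fun _ : nat => 0%N) (h := fun (_ : nat) n c => if nw n then c.+1 else c)
      (f := fun _ n => cnt n)) => //; by mst.
  by refine (mf_comp (f := fun n => (n, n)) (g := fun p => cnt p.2) _ hc); mst.
have cntE n : cnt n = (\sum_(i < n) nw i)%N.
  by elim: n => [|n IH]; rewrite ?big_ord0 // big_ord_recr /= -IH; case: (nw n); rewrite ?addn1 ?addn0.
have first x : (exists n, h n = x) -> exists2 n, nw n & h n = x.
  move=> [n e]; have ex : exists n, `[< h n = x >] by exists n; apply/asboolP.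
  case: (ex_minnP ex) => m /asboolP hm mn; exists m => //; apply/asboolP => i im hi.
  have : (m <= i)%N by apply: mn; apply/asboolP; rewrite hi.
  by rewrite leqNgt im.
have unb k : exists n, (k < cnt n)%N.
  have ex j : exists m, nw m /\ h m = e0 j.
    by have [m em] := e0h j; have [|n a b] := first (e0 j); [exists m|exists n].
  have [m hm] := choice ex; pose L := (\max_(j < k.+1) m j).+1; exists L.
  have mL (j : 'I_k.+1) : (m j < L)%N by rewrite ltnS; exact: (leq_bigmax j).
  have mi : injective (fun j => Ordinal (mL j)).
    move=> i j [e]; apply/val_inj/e0i; by rewrite -(hm i).2 -(hm j).2 e.
  rewrite cntE -{1}(card_ord k.+1) -(card_imset _ mi) -sum1_card [leqRHS]big_mkcond_idem //=.
  rewrite big_mkcond; apply: leq_sum => i _; case: ifP => // /imsetP[j _ ->] /=.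
  by have [-> _] := hm j.
have cnt_mono m n : (m <= n)%N -> (cnt m <= cnt n)%N.
  by move/subnK <-; elim: (n - m)%N => // i IH; rewrite addSn /=; case: ifP => _ //; exact: leqW.
have cnt_inj m n : nw m -> nw n -> cnt m = cnt n -> m = n.
  move=> hm hn e; case: (ltngtP m n) => // l; have := cnt_mono _ _ l; rewrite /= ?hm ?hn e ltnn //.
have ex k : exists x, exists n, [/\ is_true (nw n), cnt n = k & h n = x].
  case: (ex_minnP (unb k)) => -[|n] //= kn mn; exists (h n), n; split=> //.
    by case: (boolP (nw n)) kn => // _ kn; have := mn n kn; rewrite ltnn.
  apply/eqP; rewrite eqn_leq; apply/andP; split; last by case: (nw n) kn => // /ltnW.
  by rewrite leqNgt; apply/negP => /mn; rewrite ltnn.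
have [e he] := choice ex; exists e; split.
- apply: mfI; apply: (ms_iff (B := fun p : nat * X => exists n, [/\ is_true (nw n), cnt n = p.1 & h n = p.2])); last by mst.
  move=> [k x] /=; split=> [<-//|[n [nn cn <-]]]; have [m [nm cm <-]] := he k.
  by rewrite (cnt_inj m n) // cm.
- move=> k k' ek; have [m [nm cm hm]] := he k; have [n [nn cn hn]] := he k'.
  have emn : m = n; last by rewrite -cm -cn emn.
  case: (ltngtP m n) => // l; [move/asboolP: nn|move/asboolP: nm] => /(_ _ l); by rewrite hm hn ek.
- move=> x; split=> [[k <-]|]; first by have [n [_ _ <-]] := he k; exists n.
  move=> /first[n nn hn]; exists (cnt n); have [m [nm cm <-]] := he (cnt n).
  by rewrite (cnt_inj m n).
Qed.

(** * Choice in V[G] and countable covers from properness *)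

Section Cover.
Variables (V : class) (HV : transitive_ZFC V).
Variables (dP : Order.disp_t) (P : preorderType dP) (cP : Coded P).
Hypothesis HP : ordered_in V cP.
Variables (G : P -> Prop) (HG : generic V cP G).
Hypothesis Hproper : proper_forcing V cP.

Let N := clsh V.
Let hZ : zfc N := clsh_zfc HV.
Let hN : zermelo N := hZ.
Notation M := (extM V cP G).
Let hM : zermelo M := ext_zermelo HV HP HG.
#[local] Existing Instance hN.
#[local] Existing Instance hM.
Let NM x : N x -> M x := @ext_sub V HV dP P cP HP G HG x.

(** A set D of V is mapped onto Z by a function of V[G]. A well-order of D in V has least elements
    for all subsets in V[G], and the least index of a suitable z is chosen. *)
Lemma choice_ext (T Z : Type) (cT : Coded T) (cZ : Coded Z) {iT : inN M T} {iZ : inN M Z}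
  (R : T -> Z -> Prop) : ms M (fun p => R p.1 p.2) -> (forall t, exists z, R t z) ->
  exists2 f : T -> Z, mf M f & forall t, R t (f t).
Proof.
move=> mR exR; have [D [W [ND MW hW fW]]] := ground_surjection HV HP HG (in_full (T := Z)).
have iD : inN N (elem D) := inN_elem ND; have iD' := inN_sub NM iD.
have [lt [_ [_ [mlt irr tr lst _]]]] := @well_order N hZ (elem D) _ iD.
have {}mlt : ms M (fun p : elem D * elem D => lt p.1 p.2) := NM mlt.
pose (S := fun (a : elem D) (z : Z) => op (code a) (code z) ∈ W).
have mS : ms M (fun p : elem D * Z => S p.1 p.2).
  by apply: (msI MW) => -[a z]; rewrite code_pair.
pose (A := fun t a => exists z, S a z /\ R t z).
have mA : ms M (fun p : T * elem D => A p.1 p.2) by rewrite /A; mst.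
have ex t : exists z, exists a, least lt (A t) a /\ S a z.
  have [z Rz] := exR t; have [|a aD aW] := hW (code z); first by apply/mem_full; exists z.
  have [a' ea] := elem_ex aD.
  have [|b lb] := lst (A t); first by exists a', z; split=> //; rewrite /S ea.
  by have [[z' [Sz' _]] _] := lb; exists z', b.
have fS a z z' : S a z -> S a z' -> z = z' by move=> h1 h2; apply: (@in_inj M Z cZ iZ); exact: fW h1 h2.
have lS t a z : least lt (A t) a -> S a z -> R t z.
  by move=> [[z' [Sz' Rz']] _] /(fS _ _ _ Sz') <-.
have [f hf] := choice ex; exists f; last by move=> t; have [a [la Sa]] := hf t; exact: lS la Sa.
apply: mfI; apply: (ms_iff (B := fun p => exists a, (A p.1 a /\ forall b, A p.1 b -> b = a \/ lt a b) /\ S a p.2)); last by mst.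
move=> [t z] /=; split=> [<-|[a [la Sa]]]; first exact: hf.
by have [b [lb Sb]] := hf t; move: Sb; rewrite (least_uniq irr tr lb la) => Sb; exact: fS Sb Sa.
Qed.

Variables (Y : Type) (cY : Coded Y) (iY : inN N Y).

(** [Y] is embedded in an uncountable cardinal a of V. The countable subsets of a that lie in V stay
    stationary in V[G], so one of them belongs to the club of the sets containing y0 and closed
    under the operations of V[G]. *)
Theorem closed_cover (y0 : Y) (F : nat -> Y -> Y -> Y) :
  mf M (fun p : nat * Y * Y => F p.1.1 p.1.2 p.2) ->
  exists2 c : nat -> Y, mf N c & c 0%N = y0 /\ forall n i j, exists k, F n (c i) (c j) = c k.
Proof.
(* The factor [pow N nat] makes the cardinal uncountable, by [cantor]. *)
move=> mF; pose (p := fun A : pow N nat => (y0, A)).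
have [|A B [] //|a [Na at1 at2 [i mi ii] small]] := @cardinal_above N hZ (Y * pow N nat)%type _ _ p.
  by rewrite /p; mst.
have iX : inN N (elem a) := inN_elem Na; have iX' := inN_sub NM iX; have iY' := inN_sub NM iY.
have VN T (cT : Coded T) (x : T) : V (encode x) <-> N (code x).
  by split=> [/(clsh_cl HV)|h]; [|apply/(clsh_cl HV)].
have MN T (cT : Coded T) (x : T) : ext V cP G (encode x) <-> M (code x) by exact: extME.
have inEc (w : Ens) (x : elem a) : inE w (encode x) <-> cl w ∈ code x by rewrite mem_cl.
have mem_el (x : elem a) w : cl w ∈ code x -> exists y : elem a, cl w = code y.
  by move=> h; have [y <-] := elem_ex (at1 _ _ (elem_in x) h); exists y.
have emb (x : elem a) (f : elem a -> elem a) : mf N f -> injective f ->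
    (forall y, code (f y) ∈ code x) -> False.
  move=> mf_ fi fx; have [j hj] := choice (fun y => elem_ex (fx (i y))).
  apply: (small _ (elem_in x)); exists j; last first.
    by move=> y z eyz; apply/ii/fi/code_elem_inj; rewrite -!hj eyz.
  have e1 : code j = code (fun y => f (i y)); last first.
    by rewrite /mf e1; exact: (mf_comp mi mf_).
  by apply: code_fun_eq.
have unc : uncountable_cardinal V (coded_elem (a := a)).
  split.
  - move=> x z /inEc/mem_el[y /clE]; by exists y.
  - move=> x z w /inEc zx; have [y ey] := mem_el _ _ zx; rewrite inEc -mem_cl.
    by move=> wz; exact: at2 (elem_in x) zx wz.
  - move=> x f /VN mf_ fi; apply: contrapT => n; apply: (emb x f) => // y.
    by apply: contrapT => h; apply: n; exists y => k; apply: h; exact/mem_cl.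
  - move=> f /VN mf_ fi; have {}mf_ : mf N f by [].
    apply: (@cantor N hZ (fun A => f (i (p A)))).
      by rewrite /p; mst.
    by move=> A B /fi/ii[].
have cin (N' : class) (K : cls) (hK : zermelo K) (iK : inN K (elem a)) :
    (forall T (cT : Coded T) (x : T), N' (encode x) <-> K (code x)) ->
    forall b : elem a -> Prop, countable_in N' (coded_elem (a := a)) b <->
    exists2 h : nat -> elem a, mf K h & injective h /\ forall x, b x <-> exists n, h n = x.
  move=> e' b; split=> [[h [/e' h1 h2 h3]]|[h h1 [h2 h3]]]; exists h => //.
  by split=> //; apply/e'.
have cV := cin V N hN iX VN; have cM := cin (ext V cP G) M hM iX' MN.
pose (ctb := fun b : elem a -> Prop => countable_in V (coded_elem (a := a)) b).
have codeP (K : cls) (hK : zermelo K) (iK : inN K (elem a)) (Q : (elem a -> Prop) -> Prop) :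
    (forall b, Q b -> ms K b) -> code Q = code (fun b : pow K (elem a) => Q (sval b)).
  move=> hQ; apply: hset_ext => w; rewrite !mem_set.
  by split=> [[b Qb ->]|[b Qb ->]]; [exists (exist _ b (hQ b Qb))|exists (sval b)].
have ms_ran (K : cls) (hK : zermelo K) (iK : inN K (elem a)) (h : nat -> elem a) b :
    mf K h -> (forall x, b x <-> exists n, h n = x) -> ms K b.
  by move=> mh hb; apply: (ms_iff hb); mst.
have NS : N (code ctb).
  have hs b : ctb b -> ms N b by move=> /cV[h mh [_ hb]]; exact: ms_ran mh hb.
  rewrite (codeP N hN iX ctb hs); change (ms N (fun b : pow N (elem a) => ctb (sval b))).
  apply: (ms_iff (B := fun b : pow N (elem a) => exists h : fsp N nat (elem a), injective (sval h) /\
     forall x, sval b x <-> exists n, sval h n = x)); last by rewrite /injective; mst.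
  move=> b; rewrite /ctb cV; split=> [[h mh [h1 h2]]|[[h mh] [h1 h2]]]; last by exists h.
  by exists (exist _ h mh).
have i0 : exists2 h : nat -> elem a, mf N h & injective h.
  have hsing n : ms N (fun m : nat => m = n) by mst.
  pose (sing := fun n => exist _ _ (hsing n) : pow N nat).
  have ms_sing : mf N sing by apply: mf_pow => /=; mst.
  exists (fun n => i (p (sing n))); first by rewrite /p; mst.
  by move=> m n /ii[/(congr1 (fun f => f m)) emn]; rewrite -emn.
have stV : stationary V (coded_elem (a := a)) ctb.
  move=> C _ [C1 C2 _]; have [h mh hi] := i0.
  have [|b Cb _] := C2 (fun x => exists n, h n = x); first by apply/cV; exists h.
  by exists b => //; exact: C1.
have inX : coded_in V (coded_elem (a := a)).
  split; last by apply/(VN _ _ (fun _ : elem a => True)); exact: in_full.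
  by move=> x y /clE; exact: code_elem_inj.
(* [ctb] consists of all countable sets of V, so its stationarity in V follows from the
   unboundedness of clubs alone. *)
have stM := Hproper inX unc (S := ctb) ((VN _ _ ctb).2 NS) (fun b h => h) stV HG.
pose (iy := fun y => i (y, (p (exist _ _ (ms_const False) : pow N nat)).2)).
have iy_inj : injective iy by move=> y y' /ii[].
have miyN : mf N iy by rewrite /iy; mst.
have miy : mf M iy := NM miyN.
pose (C := fun b : elem a -> Prop => countable_in (ext V cP G) (coded_elem (a := a)) b /\
   (b (iy y0) /\ forall n y y', b (iy y) -> b (iy y') -> b (iy (F n y y')))).
have MC : M (code C).
  have hC b : C b -> ms M b by move=> [/cM[h mh [_ hb]] _]; exact: ms_ran mh hb.
  rewrite (codeP M hM iX' C hC); change (ms M (fun b : pow M (elem a) => C (sval b))).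
  apply: (ms_iff (B := fun b : pow M (elem a) => (exists h : fsp M nat (elem a), injective (sval h) /\
     forall x, sval b x <-> exists n, sval h n = x) /\
     (sval b (iy y0) /\ forall n y y', sval b (iy y) -> sval b (iy y') -> sval b (iy (F n y y')))));
    last by rewrite /injective; mst.
  move=> b; rewrite /C cM; split=> [[[h mh [h1 h2]] h3]|[[[h mh] [h1 h2]] h3]]; last by split=> //; exists h.
  by split=> //; exists (exist _ h mh).
have enumM (h e0 : nat -> elem a) b : mf M h -> injective e0 -> (forall n, exists m, e0 n = h m) ->
    (forall x, b x <-> exists n, h n = x) -> countable_in (ext V cP G) (coded_elem (a := a)) b.
  move=> mh e0i e0h hb; apply/cM.
  have [e' [me' ei' he']] := injective_enumeration hM iX' mh e0i e0h.
  by exists e' => //; split=> // x; rewrite hb he'.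
have pre (K : cls) (hK : zermelo K) (iXK : inN K (elem a)) (iYK : inN K Y) (h : nat -> elem a) :
    mf K h -> mf K iy -> exists2 g : nat -> Y, mf K g &
    forall n, h n = iy (g n) \/ ~ (exists y, h n = iy y) /\ g n = y0.
  move=> mh mi'; have ex k : exists y, h k = iy y \/ ~ (exists y, h k = iy y) /\ y = y0.
    have [[y hy]|n] := pselect (exists y, h k = iy y); first by exists y; left.
    by exists y0; right.
  have [g hg] := choice ex; exists g => //.
  apply: mfI; apply: (ms_iff (B := fun q : nat * Y => h q.1 = iy q.2 \/ ~ (exists y, h q.1 = iy y) /\ q.2 = y0)).
    move=> [k y] /=; split=> [<-//|]; case: (hg k) => [h1|[h1 ->]] [h2|[h2 ->]] //.
    + by apply: iy_inj; rewrite -h1.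
    + by case: h2; exists (g k).
    + by case: h1; exists y.
  by mst.
have [|b [_ [b0 bF]] /cV[h mh [_ hb]]] := stM C ((MN _ _ C).2 MC).
- split=> [b []//|b /cM[h mh [hi hb]]|].
  + have [g mg hg] := pre M hM iX' iY' h mh miy.
    (* H s enumerates the values of the terms of depth at most s. *)
    pose (step := fun (H : nat -> Y) k => if (dig k 0 <= 0)%N then H (dig k 1)
      else if (dig k 0 <= 1)%N then y0 else F (dig k 1) (H (dig k 2)) (H (dig k 3))).
    pose (H := fix H s := if s is s'.+1 then step (H s') else g).
    have mH : mf M (fun q : nat * nat => H q.1 q.2).
      have mstep (D : fsp M nat Y) : mf M (step (sval D)) by rewrite /step; mst.
      pose (step' := fun D : fsp M nat Y => exist _ _ (mstep D) : fsp M nat Y).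
      have mstep' : mf M step' by apply: mf_fsp => /=; rewrite /step; mst.
      have mHs s : mf M (H s) by elim: s => [|s IH] //=; exact: (mstep (exist _ _ IH)).
      pose (H' := fun s => exist _ _ (mHs s) : fsp M nat Y).
      have mH2 : mf M (fun q : nat * nat => H' q.2).
        apply: (mf_rec (g := fun _ : nat => exist _ _ mg : fsp M nat Y)
          (h := fun _ _ D => step' D) (f := fun _ s => H' s)).
        * by move=> _; exact: eq_exist.
        * by move=> _ s; exact: eq_exist.
        * exact: mf_const.
        * by mst.
      pose (H2 := fun s => H' s).
      have {}mH2 : mf M H2 by refine (mf_comp (f := fun n : nat => (n, n)) _ mH2); mst.
      have : mf M (fun q : nat * nat => sval (H2 q.1) q.2) by mst.
      by [].
    have stepH s k : H s.+1 k = step (H s) k by [].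
    have Hmono s t k : exists k', H (t + s)%N k' = H s k.
      elim: t => [|t [k' IH]]; first by exists k.
      have [m hm] := dig_ex 2 (fun l => if l is 0 then 0%N else k').
      by exists m; rewrite addSn stepH /step hm //= hm.
    have HF n s k s' k' : exists s2 k2, H s2 k2 = F n (H s k) (H s' k').
      have [k1 e1] := Hmono s s' k; have [k2 e2] := Hmono s' s k'; rewrite addnC in e2.
      have [m hm] := dig_ex 4 (fun l => match l with 0 => 2 | 1 => n | 2 => k1 | _ => k2 end)%N.
      by exists (s' + s).+1, m; rewrite stepH /step !hm //= e1 e2.
    pose (h' := fun n => if (dig n 0 <= 0)%N then h (dig n 1) else iy (H (dig n 1) (dig n 2))).
    have h'l n : exists m, h' m = h n.
      have [m hm] := dig_ex 2 (fun l => if l is 0 then 0%N else n).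
      by exists m; rewrite /h' (hm 0%N) //= hm.
    have h'r s k : exists m, h' m = iy (H s k).
      have [m hm] := dig_ex 3 (fun l => match l with 0 => 1 | 1 => s | _ => k end)%N.
      by exists m; rewrite /h' !hm //=.
    have inH y : (exists m, h' m = iy y) -> exists s k, H s k = y.
      rewrite /h' => -[m]; case: ifP => _; last by move=> /iy_inj; exists (dig m 1), (dig m 2).
      by case: (hg (dig m 1)) => [->|[n _] e]; [move=> /iy_inj; exists 0%N, (dig m 1)|case: n; exists y].
    exists (fun x => exists m, h' m = x); last by move=> x /hb[n <-]; exact: h'l.
    split; last split.
    * apply: (enumM h' h) => //; first by rewrite /h'; mst.
      by move=> n; have [m em] := h'l n; exists m.
    * have [m hm] := dig_ex 1 (fun=> 1%N); have <- : H 1%N m = y0 by rewrite stepH /step hm //=.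
      exact: h'r.
    * move=> n y y' /inH[s [k <-]] /inH[s' [k' <-]]; have [s2 [k2 <-]] := HF n s k s' k'.
      exact: h'r.
  + move=> A /MN MA CA Ainc.
    have Ale m n x : (m <= n)%N -> A m x -> A n x.
      by move=> /subnK <-; elim: (n - m)%N => // t IH /IH; rewrite addSn; exact: Ainc.
    split; last split; first last.
    * move=> n y y' [m hm] [m' hm']; exists (maxn m m'); have [_ [_]] := CA (maxn m m'); apply.
        exact: (Ale _ _ _ (leq_maxl m m') hm).
      exact: (Ale _ _ _ (leq_maxr m m') hm').
    * by exists 0%N; have [_ []] := CA 0%N.
    have mA : ms M (fun p => A p.1 p.2).
      have hA n : ms M (A n) by have [/cM[h mh [_ hb]] _] := CA n; exact: ms_ran mh hb.
      pose (A' := fun n => exist _ _ (hA n) : pow M (elem a)).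
      have eA : code A' = code A by exact: code_fun_eq.
      have {}eA : mf M A' by rewrite /mf eA.
      have : ms M (fun p => sval (A' p.1) p.2) by mst.
      by [].
    pose (R := fun n (g : fsp M nat (elem a)) => forall x, A n x <-> exists k, sval g k = x).
    have mR : ms M (fun p => R p.1 p.2) by rewrite /R; mst.
    (* Enumerations of all the [A n] are chosen together inside V[G] and merged by the pairing
       function. *)
    have [|E mE hE] := choice_ext mR.
      by move=> n; have [/cM[h mh [_ hb]] _] := CA n; exists (exist _ h mh).
    have [/cM[h mh [hi hb]] _] := CA 0%N.
    apply: (enumM (fun n => sval (E (un n).1) (un n).2) h); [by mst|by []| |].
      move=> n; have /hE[k hk] : A 0%N (h n) by apply/hb; exists n.
      by exists (pr 0 k); rewrite un_pr.
    move=> x; split=> [[n /hE[k <-]]|[k <-]]; first by exists (pr n k); rewrite un_pr.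
    by exists (un k).1; apply/hE; exists (un k).2.
have [g mg hg] := pre N hN iX iY h mh miyN.
have bg n : b (iy (g n)) by case: (hg n) => [<-|[_ ->]//]; apply/hb; exists n.
(* Index 0 is reserved for y0; the other values are the points of [Y] whose images lie in b. *)
pose (c := fun n => if (dig n 0 <= 0)%N then y0 else g (dig n 1)).
exists c; first by rewrite /c; mst.
split=> [|n k k']; first by rewrite /c /dig /= (un_pr 0 0 : un 0 = _).
have bc m : b (iy (c m)) by rewrite /c; case: ifP.
have /hb[m hm] := bF n _ _ (bc k) (bc k').
have [x hx] := dig_ex 2 (fun l => if l is 0 then 1%N else m).
exists x; rewrite {3}/c !hx //=; apply: iy_inj; case: (hg m) => [<-//|[nm _]].
by case: nm; eexists; exact: hm.
Qed.

End Cover.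

(** * Ground model sequences that meet dense sets of V[G] *)

Section BinaryDigits.
Variable R : realType.
Implicit Types (r s : R).

Definition bdigit r p : bool := odd (absz (Num.floor (r * 2 ^+ p.+1))).

(** A real codes a sequence of naturals: the digits are arranged in rows by the pairing function,
    and the n-th term is the position of the first one in row n, or 0 if the row has none. Every row
    can still be steered after finitely many zeros. *)
Definition row_value r n j : Prop :=
  (bdigit r (pr n j) /\ forall i, (i < j)%N -> ~ bdigit r (pr n i)) \/
  ((forall i, ~ bdigit r (pr n i)) /\ j = 0%N).

Lemma row_value_ex r n : exists j, row_value r n j.
Proof.
have [ex|h] := pselect (exists j, bdigit r (pr n j)); last first.
  by exists 0%N; right; split=> // i di; apply: h; exists i.
case: (ex_minnP ex) => j dj mj; exists j; left; split=> // i ij di.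
by have := mj i di; rewrite leqNgt ij.
Qed.

Lemma row_value_fun r n i j : row_value r n i -> row_value r n j -> i = j.
Proof.
case=> [[d1 m1]|[n1 ->]] [[d2 m2]|[n2 ->]] //; try by [case: (n1 j)|case: (n2 i)].
by case: (ltngtP i j) => // h; [case: (m2 i h)|case: (m1 j h)].
Qed.

Lemma floor_half r s : Num.floor (r * 2) = Num.floor (s * 2) -> Num.floor r = Num.floor s.
Proof.
have key (t : R) z : (z <= Num.floor t) = (z * 2 <= Num.floor (t * 2)).
  by rewrite !floor_ge_int rmorphM /= ler_pM2r.
by move=> e; apply/eqP; rewrite eq_le; apply/andP; split; [rewrite key -e -key|rewrite key e -key].
Qed.

Lemma floor_level r s m p : (p <= m)%N ->
  Num.floor (r * 2 ^+ m) = Num.floor (s * 2 ^+ m) ->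
  Num.floor (r * 2 ^+ p) = Num.floor (s * 2 ^+ p).
Proof.
move=> /subnK <-; elim: (m - p)%N => // k IH; rewrite addSn => e; apply/IH/floor_half.
by rewrite -!mulrA -!exprSr.
Qed.

(** Every dyadic interval of level m contains one of level m + h on which the digits from m on are
    as prescribed. *)
Lemma prescribed_digits (d : nat -> bool) (z : int) m h : exists z' : int, forall r,
  Num.floor (r * 2 ^+ (m + h)) = z' -> Num.floor (r * 2 ^+ m) = z /\
    forall p, (m <= p < m + h)%N -> bdigit r p = d p.
Proof.
elim: h => [|h [z1 IH]]; first by exists z => r; rewrite addn0; split=> // p; case: ltngtP.
exists (z1 * 2 + (d (m + h)%N : nat)%:Z) => r; rewrite addnS => e.
have e1 : Num.floor (r * 2 ^+ (m + h)) = z1.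
  apply/floor_def; have := floor_itv (r * 2 ^+ (m + h).+1); rewrite e exprSr mulrA.
  rewrite !rmorphD rmorphM /=; case: (d _) => /= /andP[h1 h2]; apply/andP; split; lra.
have [h1 h2] := IH r e1; split=> // p /andP[mp]; rewrite ltnS leq_eqVlt => /orP[/eqP->|ph]; last first.
  by apply: h2; rewrite mp.
rewrite /bdigit e; case: (d _); lia.
Qed.

Lemma ratr_frac (z : int) n : ratr (z%:Q * n%:R^-1) = z%:~R / n%:R :> R.
Proof. by rewrite fmorph_div /= ratr_int ratr_nat. Qed.

End BinaryDigits.

Lemma ms_row_value (N : cls) (hN : zermelo N) (R : realType) :
  ms N (fun p : rn N R * nat * nat => row_value (sval p.1.1) p.1.2 p.2).
Proof.
have hd : ms N (fun p : rn N R * nat => is_true (bdigit (sval p.1) p.2)).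
  apply: (ms_iff (B := fun p => exists z : int, [/\ is_true (odd (absz z)),
    ratr (z%:Q * ((2 ^ p.2.+1)%N%:R)^-1) <= sval p.1
    & sval p.1 < ratr ((z + 1)%:Q * ((2 ^ p.2.+1)%N%:R)^-1)])); last by mst.
  move=> [[r hr] p] /=; have p0 : 0 < (2 ^ p.+1)%N%:R :> R by rewrite ltr0n expn_gt0.
  have eq z : (z%:~R <= r * 2 ^+ p.+1 < (z + 1)%:~R) =
      (ratr (z%:Q * ((2 ^ p.+1)%N%:R)^-1) <= r) && (r < ratr ((z + 1)%:Q * ((2 ^ p.+1)%N%:R)^-1)).
    by rewrite !ratr_frac ler_pdivrMr // ltr_pdivlMr // natrX.
  split=> [h|[z [oz h1 h2]]].
    by exists (Num.floor (r * 2 ^+ p.+1)); have := floor_itv (r * 2 ^+ p.+1); rewrite eq => /andP[].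
  by rewrite /bdigit (@floor_def _ _ z) // eq h1.
have hp : mf N (fun p : nat * nat => pr p.1 p.2) by rewrite /pr; mst.
pose (b := fun (r : rn N R) p => bdigit (sval r) p).
have {}hd : ms N (fun p : rn N R * nat => is_true (b p.1 p.2)) := hd.
apply: (ms_iff (B := fun p : rn N R * nat * nat => (b p.1.1 (pr p.1.2 p.2) /\
   forall i, (i < p.2)%N -> ~ b p.1.1 (pr p.1.2 i)) \/ ((forall i, ~ b p.1.1 (pr p.1.2 i)) /\ p.2 = 0%N))) => //.
by mst.
Qed.

Section GenericPoint.
Variables (R : realType) (V : class) (HV : transitive_ZFC V).
Variables (dP : Order.disp_t) (P : preorderType dP) (cP : Coded P).
Hypothesis HP : ordered_in V cP.
Variables (G : P -> Prop) (HG : generic V cP G).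
Hypothesis Hmeager : preserves_nonmeager R V cP.

Let N := clsh V.
Let hN : zermelo N := clsh_zfc HV.
Notation M := (extM V cP G).
Let hM : zermelo M := ext_zermelo HV HP HG.
#[local] Existing Instance hN.
#[local] Existing Instance hM.

(* The finite sequences dig i 0, ..., dig i (l - 1) are the conditions of Cohen forcing. *)
Definition dense_seq (D : nat -> nat -> Prop) : Prop := forall i l, exists i' l',
  [/\ (l <= l')%N, forall m, (m < l)%N -> dig i' m = dig i m & D i' l'].

(** Otherwise every ground model real would lie in one of the sets [F k] of reals whose decoded
    sequence avoids [D k]. These are nowhere dense: inside any interval the digits can be prescribed
    so that the decoded sequence extends a member of [D k]. *)
Theorem generic_point (D : nat -> nat -> nat -> Prop) : ms3 M D ->
  (forall k, dense_seq (D k)) ->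
  exists2 x : nat -> nat, mf N x & forall k, exists i l, D k i l /\ forall m, (m < l)%N -> x m = dig i m.
Proof.
move=> mD dD; apply: contrapT => nx; apply: (Hmeager HG).
pose (F := fun k (r : R) => M (code r) /\
  forall i l, D k i l -> exists m, (m < l)%N /\ ~ row_value r m (dig i m)).
have mF k : ms M (fun r : rn M R => F k (sval r)).
  pose (v := fun (r : rn M R) n j => row_value (sval r) n j).
  have mv : ms M (fun p : rn M R * nat * nat => v p.1.1 p.1.2 p.2) by exact: ms_row_value.
  have {}mD : ms M (fun p : nat * nat * nat => D p.1.1 p.1.2 p.2) := mD.
  apply: (ms_iff (B := fun r => forall i l, D k i l -> exists m, (m < l)%N /\ ~ v r m (dig i m))).
    by move=> [r hr]; rewrite /F /=; split=> [[]|].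
  by mst.
have mF2 : ms M (fun p : nat * rn M R => F p.1 (sval p.2)).
  pose (v := fun (r : rn M R) n j => row_value (sval r) n j).
  have mv : ms M (fun p : rn M R * nat * nat => v p.1.1 p.1.2 p.2) by exact: ms_row_value.
  have {}mD : ms M (fun p : nat * nat * nat => D p.1.1 p.1.2 p.2) := mD.
  apply: (ms_iff (B := fun p => forall i l, D p.1 i l -> exists m, (m < l)%N /\ ~ v p.2 m (dig i m))).
    by move=> [k [r hr]]; rewrite /F /=; split=> [[]|].
  by mst.
exists F; split.
- pose (F' := fun k => exist _ _ (mF k) : pow M (rn M R)).
  have mF' : mf M F' by apply: mf_pow.
  apply/(extME HV); have e : code F' = code F; last by rewrite -[cl _]e.
  apply: code_fun_eq => k; apply: hset_ext => w; rewrite [code (F' k)]/(code (sval (F' k))) !mem_set.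
  by split=> [[r Fr ->]|[r Fr ->]]; [exists (sval r)|exists (exist _ r Fr.1)].
- move=> k a b _ _ ab.
  have [m hm] : exists m, 3 < (b - a) * 2 ^+ m.
    exists (Num.bound (3 / (b - a))); set m := Num.bound _.
    rewrite mulrC -ltr_pdivrMr ?subr_gt0 //; apply: lt_le_trans (archi_boundP _) _.
      by rewrite divr_ge0 // subr_ge0 ltW.
    by rewrite -/m -natrX ler_nat ltnW // ltn_expl.
  (* The first dyadic interval of level m to the right of a; by the choice of m it ends at least one
     mesh before b. *)
  pose z := Num.floor (a * 2 ^+ m) + 1.
  pose r0 : R := z%:~R / 2 ^+ m.
  have r0z : Num.floor (r0 * 2 ^+ m) = z by rewrite /r0 divfK ?expf_neq0 // intrKfloor.
  (* Row n < m has either a one among the first m digits, or its first one can still be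
     placed at position pr n m. *)
  have [s hs] : exists s : nat -> nat, forall n, (n < m)%N ->
      (forall j, (pr n j < m)%N -> (j < s n)%N -> ~~ bdigit r0 (pr n j)) /\
      ((pr n (s n) < m)%N -> bdigit r0 (pr n (s n))).
    have ex n : exists j, (forall i, (pr n i < m)%N -> (i < j)%N -> ~~ bdigit r0 (pr n i)) /\
        ((pr n j < m)%N -> bdigit r0 (pr n j)).
      have [ex|h] := pselect (exists j, (pr n j < m)%N && bdigit r0 (pr n j)).
        case: (ex_minnP ex) => j /andP[h1 h2] mj; exists j; split=> // i im ij.
        by apply/negP => di; have := mj i; rewrite im di leqNgt ij => /(_ isT).
      exists m; split=> [i im _|hm']; first by apply/negP => di; apply: h; exists i; rewrite im.
      by have := (pr_ge n m).2; rewrite leqNgt hm'.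
    by have [s hs] := choice ex; exists s => n _.
  have [i ei] := dig_ex m s; have [i' [l [ml ei' Dl]]] := dD k i m.
  (* Below m the digits are already fixed; beyond, ones stand only at the places that give the rows
     n < l the values [dig i' n]. *)
  pose d p := if (p < m)%N then bdigit r0 p else [exists n : 'I_l, p == pr n (dig i' n)].
  pose h := (\max_(n < l) pr n (dig i' n)).+1.
  have [z' hz'] := @prescribed_digits R d z m h.
  pose q (y : int) : rat := y%:Q * ((2 ^ (m + h))%N%:R)^-1.
  have p0 n : 0 < 2 ^+ n :> R by rewrite exprn_gt0.
  have qE y : ratr (q y) = y%:~R / 2 ^+ (m + h) :> R.
    by rewrite ratr_frac natrX.
  have flr (r : R) : ratr (q z') <= r < ratr (q (z' + 1)) -> Num.floor (r * 2 ^+ (m + h)) = z'.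
    by rewrite !qE ler_pdivrMr // ltr_pdivlMr // => /floor_def.
  have cd : ratr (q z') < ratr (q (z' + 1)) :> R.
    by rewrite !qE ltr_pM2r ?invr_gt0 // ltr_int ltrDl.
  have in_ab (r : R) : ratr (q z') <= r < ratr (q (z' + 1)) -> a <= r <= b - (2 ^+ m)^-1.
    move=> /flr/hz'[ez _]; have := floor_itv (r * 2 ^+ m); have := floor_itv (a * 2 ^+ m).
    rewrite ez /z !rmorphD /= => /andP[_ h2] /andP[h3 h4]; apply/andP; split.
      by rewrite -(ler_pM2r (p0 m)); lra.
    rewrite -(ler_pM2r (p0 m)) mulrBl mulVf ?expf_neq0 //.
    have := floor_itv (a * 2 ^+ m) => /andP[h5 _]; rewrite mulrBl in hm; lra.
  exists (ratr (q z')), (ratr (q (z' + 1))); split; last first.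
    move=> r /andP[h1 h2] [_ /(_ i' l Dl)[n [nl]]]; apply; left.
    have fr : Num.floor (r * 2 ^+ (m + h)) = z' by apply: flr; rewrite ltW.
    have [f1 f2] := hz' r fr.
    have dr p : (p < m + h)%N -> bdigit r p = d p.
      move=> ph; case: (ltnP p m) => pm; last by rewrite f2 ?pm.
      by rewrite /d pm /bdigit (floor_level (s := r0) (m := m)) // f1 r0z.
    have bnd j : (j <= dig i' n)%N -> (pr n j < m + h)%N.
      move=> ji; apply: (@leq_trans h); last exact: leq_addl.
      rewrite ltnS; apply: (@leq_trans (pr n (dig i' n))); first by rewrite /pr leq_add // leq_mul // leq_add2l.
      exact: (leq_bigmax (Ordinal nl)).
    have sn : (n < m)%N -> dig i' n = s n by move=> nm; rewrite ei' // ei.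
    split.
      rewrite dr ?bnd // /d; case: ltnP => pm; last by apply/existsP; exists (Ordinal nl).
      have nm : (n < m)%N by apply: leq_ltn_trans pm; exact: (pr_ge _ _).1.
      by move: pm; rewrite sn //; exact: (hs n nm).2.
    move=> j jn; rewrite dr ?bnd ?(ltnW jn) // /d; case: ltnP => pm.
      have nm : (n < m)%N by apply: leq_ltn_trans pm; exact: (pr_ge _ _).1.
      by apply/negP/(hs n nm).1 => //; rewrite -sn.
    move=> /existsP[n' /eqP/pr_inj[en ej]]; move: jn; rewrite ej en ltnn //.
  have [c1 c2] := andP (in_ab _ (introT andP (conj (lexx _) cd))).
  split; [by apply/(extME HV); exact: code_ratr|by apply/(extME HV); exact: code_ratr|by rewrite c1|].
  rewrite leNgt; apply/negP => bq.
  (* [in_ab] excludes the right end point. Were it beyond b, then t would be a point of the interval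
     that is not below b. *)
  pose t := Num.max (ratr (q z')) b.
  have tq : ratr (q z') <= t < ratr (q (z' + 1)) by rewrite /t le_max lexx /= gt_max cd.
  have /andP[_] := in_ab t tq; rewrite leNgt => /negP; apply.
  by apply: (@lt_le_trans _ _ b); [rewrite gtrBl invr_gt0|rewrite /t le_max lexx orbT].
move=> r Vr; apply: contrapT => nF; apply: nx.
have Nr : N (code r) by apply/(clsh_cl HV).
have Mr : M (code r) by apply: (ext_sub HV HP HG).
have [x hx] := choice (row_value_ex r); exists x.
  apply: mfI; pose (r' := exist _ r Nr : rn N R).
  pose (v := fun (r : rn N R) n j => row_value (sval r) n j).
  have mv : ms N (fun p : rn N R * nat * nat => v p.1.1 p.1.2 p.2) by exact: ms_row_value.
  apply: (ms_iff (B := fun p : nat * nat => v r' p.1 p.2)); last by mst.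
  by move=> [n j] /=; split=> [<-|]; [exact: hx|move=> h; exact: row_value_fun (hx n) h].
move=> k; apply: contrapT => nD; apply: nF; exists k; split=> // i l Dl.
apply: contrapT => nm; apply: nD; exists i, l; split=> // m ml.
by apply: contrapT => ne; apply: nm; exists m; split=> // rv; apply: ne; exact: row_value_fun (hx m) rv.
Qed.

End GenericPoint.

Import Order.Theory.

(** * Disjoint bumps of a null sequence *)

Section Lattice.
Context {d : Order.disp_t} {B : ctbDistrLatticeType d}.
Implicit Types a b c s : B.
Local Open Scope order_scope.

Definition lub (Q : B -> Prop) s : Prop := forall w, s <= w <-> forall a, Q a -> a <= w.

Lemma lub_ub Q s a : lub Q s -> Q a -> a <= s.
Proof. by move=> h; apply: (h s).1. Qed.

Lemma lub_disjoint Q Q' s s' : lub Q s -> lub Q' s' ->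
  (forall a b, Q a -> Q' b -> a `&` b = \bot) -> s `&` s' = \bot.
Proof.
move=> h h' dj; apply/eqP; rewrite disj_leC; apply/h => a Qa; rewrite lexC.
by apply/h' => b Qb; rewrite lexC -disj_leC; apply/eqP; exact: dj.
Qed.

Lemma disjointW a b a' b' : a' <= a -> b' <= b -> a `&` b = \bot -> a' `&` b' = \bot.
Proof. by move=> ha hb e; apply/eqP; rewrite -lex0 -e; exact: leI2. Qed.

End Lattice.

Section Additive.
Context {R : realType} {d : Order.disp_t} {B : ctbDistrLatticeType d}.
Local Open Scope order_scope.

Definition additive_on (m : B -> R) : Prop :=
  forall a b, a `&` b = \bot -> m (a `|` b) = (m a + m b)%R.

Definition bounded_variation (m : B -> R) : Prop :=
  exists C : R, forall s : seq B, pairwise (fun a b => a `&` b == \bot) s ->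
    (\sum_(a <- s) `|m a| <= C)%R.

Lemma additive0 m : additive_on m -> m \bot = 0%R.
Proof.
by move=> /(_ \bot \bot (meet0x _)); rewrite join0x => e; apply: (addrI (m \bot)); rewrite addr0.
Qed.

Lemma additive_sub m a b : additive_on m -> a <= b -> m b = (m a + m (b `\` a))%R.
Proof.
move=> add ab; rewrite -add; last by apply/eqP; rewrite disj_leC lexC leBC.
by rewrite -[in LHS](joinIB a b) meetC (meet_l ab).
Qed.

Lemma pairwise_disjoint (a : nat -> B) L :
  (forall i j, (i < L)%N -> (j < L)%N -> i <> j -> a i `&` a j = \bot) ->
  pairwise (fun a b => a `&` b == \bot) [seq a i | i <- iota 0 L].
Proof.
move=> dj; rewrite pairwise_map; apply/(pairwiseP 0%N) => i j; rewrite !unfold_in /= size_iota => iL jL ij.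
by rewrite /= !nth_iota // !add0n; apply/eqP/dj => // e; rewrite e ltnn in ij.
Qed.

Lemma small_member m (a : nat -> B) (eta : R) : bounded_variation m -> (0 < eta)%R ->
  (forall i j, i <> j -> a i `&` a j = \bot) -> exists j, (`|m (a j)| < eta)%R.
Proof.
move=> [C hC] eta0 dj; apply: contrapT => n.
pose L := (Num.bound (`|C| / eta)).+1.
have := hC _ (pairwise_disjoint (a := a) (L := L) (fun i j _ _ => dj i j)).
rewrite big_map leNgt => /negP; apply.
have : (`|C| / eta < L%:R)%R.
  by apply: lt_trans (archi_boundP _) _; rewrite ?divr_ge0 ?(ltW eta0) // ltr_nat.
rewrite ltr_pdivrMr // => /(le_lt_trans (ler_norm C)) /lt_le_trans; apply.
have -> : iota 0 L = index_iota 0 L by rewrite /index_iota subn0.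
rewrite mulr_natl -{1}(subn0 L) -sumr_const_nat.
by rewrite big_seq [leRHS]big_seq; apply: ler_sum => j _; rewrite leNgt; apply/negP => h; apply: n; exists j.
Qed.

End Additive.

Section NullSequences.
Variables (R : realType) (V : class) (HV : transitive_ZFC V).
Variables (dP : Order.disp_t) (P : preorderType dP) (cP : Coded P).
Hypothesis HP : ordered_in V cP.
Variables (G : P -> Prop) (HG : generic V cP G).
Hypothesis Hmeager : preserves_nonmeager R V cP.
Variables (dB : Order.disp_t) (B : ctbDistrLatticeType dB) (cB : Coded B).
Hypothesis HB : ordered_in V cB.
Hypothesis Hsigma : sigma_complete V cB.

Let N := clsh V.
Let hN : zermelo N := clsh_zfc HV.
Notation M := (extM V cP G).
Let hM : zermelo M := ext_zermelo HV HP HG.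
#[local] Existing Instance hN.
#[local] Existing Instance hM.
Let NM x : N x -> M x := @ext_sub V HV dP P cP HP G HG x.

Lemma inN_algebra : inN N B.
Proof.
case: HB => -[inj full] _; split; last exact/(clsh_cl HV).
by move=> x y /clE; exact: inj.
Qed.
#[local] Existing Instance inN_algebra.
#[local] Instance inM_algebra : inN M B := inN_sub NM inN_algebra.

Lemma msN_le : ms N (fun p : B * B => is_true (p.1 <= p.2)%O).
Proof. exact/(clsh_cl HV)/HB.2. Qed.

Lemma msM_le : ms M (fun p : B * B => is_true (p.1 <= p.2)%O).
Proof. exact/NM/msN_le. Qed.

(** The only source of suprema: both the sequence and the set of selected indices must lie in V.
    Indices that are not selected contribute the bottom element. *)
Lemma lub_ex (e : nat -> B) (Q : nat -> Prop) : mf N e -> ms N Q ->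
  exists s, lub (fun a => exists n, Q n /\ a = e n) s.
Proof.
move=> me mQ; have [|s hs] := Hsigma (a := fun n => if `[< Q n >] then e n else \bot%O).
  apply/(clsh_cl HV); change (mf N (fun n => if `[< Q n >] then e n else \bot%O)).
  apply: mf_if => //; last exact: mf_const.
  by apply: (ms_iff (B := Q)) => // n; split=> [/asboolP|h] //; exact/asboolP.
exists s => w; rewrite hs; split=> [h a [n [Qn ->]]|h n].
  by have := h n; rewrite asboolT.
by case: asboolP => [Qn|_]; [apply: h; exists n|exact: le0x].
Qed.

Definition null_sequence (nu : nat -> B -> R) : Prop :=
  forall (a : B) (eps : R), 0 < eps -> exists n, forall k, (n <= k)%N -> `|nu k a| < eps.

Section Disjoint.
Variable nu : nat -> B -> R.
Hypothesis mnu : mr M (fun p => nu p.1 p.2).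
Hypothesis add_nu : forall k, additive_on (nu k).
Hypothesis bv_nu : forall k, bounded_variation (nu k).
Hypothesis null_nu : null_sequence nu.

Section Tail.
Variables (e : nat -> B) (lab : nat -> nat) (eta : R).

(* w i codes a pair (n_i, j_i); the index n is admissible at stage i if the first i
   digits of its label are j_0, ..., j_(i-1). *)
Definition admissible (w : nat -> nat) n i : Prop :=
  forall m, (m < i)%N -> dig (lab n) m = dig (w m) 1.
Definition entry (w : nat -> nat) i : nat := dig (w i) 0.

Definition earlier w i (a : B) : Prop :=
  exists n, (exists m, (m < i)%N /\ (admissible w (entry w m) m /\ n = entry w m)) /\ a = e n.
Definition later w i (a : B) : Prop := exists n, admissible w n i.+1 /\ a = e n.

(** At such a stage [nu k] sees only the current bump: it is below eta on the join of the earlier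
    entries and on every part of the join of all entries that remain admissible. *)
Definition good_stage (eps : R) w i n0 : Prop := exists k,
  [/\ (n0 <= entry w i)%N /\ (entry w i <= k)%N,
      forall m, (m < i)%N -> (entry w m < entry w i)%N,
      admissible w (entry w i) i
    & eps <= `|nu k (e (entry w i))| /\
      ((forall h, lub (earlier w i) h -> `|nu k h| < eta) /\
       forall s, lub (later w i) s -> forall a, (a <= s)%O -> `|nu k a| < eta)].

Lemma good_stage_ext eps w w' i n0 : (forall m, (m <= i)%N -> w m = w' m) ->
  good_stage eps w i n0 -> good_stage eps w' i n0.
Proof.
move=> h; have hi m : (m <= i)%N -> entry w m = entry w' m by move=> mi; rewrite /entry h.
have ha n m : (m <= i.+1)%N -> admissible w n m = admissible w' n m.
  move=> mi; apply/propext; split=> k l lm; have := k l lm; rewrite h //;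
    by rewrite -ltnS; exact: leq_trans mi.
have he : earlier w i = earlier w' i.
  apply/funext => a; apply/propext; split=> -[n [[m [mi [am ->]]] ->]].
    have [m1 m2] : (m <= i)%N /\ (m <= i.+1)%N by split; [exact: ltnW|exact: leqW (ltnW mi)].
    by exists (entry w m); split=> //; exists m; rewrite -hi // -ha.
  have [m1 m2] : (m <= i)%N /\ (m <= i.+1)%N by split; [exact: ltnW|exact: leqW (ltnW mi)].
  by exists (entry w' m); split=> //; exists m; rewrite hi // ha.
have hl : later w i = later w' i.
  by apply/funext => a; apply/propext; split=> -[n [an ->]]; exists n; rewrite ?ha // -ha.
move=> [k [h1 h2 h3 h4]]; exists k; rewrite -he -hl -hi // -ha //; split=> // m mi.
by rewrite -hi ?(ltnW mi) //; exact: h2.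
Qed.

Lemma dense_good_stage (q : rat) n0 : let eps := ratr q : R in 0 < eta ->
  mf N e -> mf N lab -> (forall i j, i <> j -> (e i `&` e j)%O = \bot%O) ->
  (forall v n0, exists n k, [/\ (n0 <= n)%N, (n <= k)%N, lab n = v & eps <= `|nu k (e n)|]) ->
  dense_seq (fun i' l => exists i, (i < l)%N /\ good_stage eps (dig i') i n0).
Proof.
move=> eps eta0 me mlab dj bump i0 l.
pose w0 m := dig i0 m.
have [h hh] : exists h, lub (earlier w0 l) h.
  apply: lub_ex => //; rewrite /admissible /entry /w0; mst.
have [n1 hn1] := null_nu h eta0.
have [v hv] := dig_ex l (fun m => dig (w0 m) 1).
pose n2 := (\max_(m < l) entry w0 m).+1.
have [n [k [hn nk labn bn]]] := bump v (maxn n0 (maxn n1 n2)).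
move: hn; rewrite !geq_max => /and3P[n0n n1n n2n].
pose cls_ j n' := (forall m, (m < l)%N -> dig (lab n') m = dig (w0 m) 1) /\ dig (lab n') l = j.
have /choice[s hs] : forall j, exists s, lub (fun a => exists n', cls_ j n' /\ a = e n') s.
  by move=> j; apply: lub_ex => //; rewrite /cls_ /w0; mst.
have [j sj] : exists j, forall a, (a <= s j)%O -> `|nu k a| < eta.
  apply: contrapT => nj.
  have /choice[a ha] : forall j, exists a, (a <= s j)%O /\ eta <= `|nu k a|.
    move=> j; apply: contrapT => na; apply: nj; exists j => a aj; rewrite ltNge; apply/negP => ea.
    by apply: na; exists a.
  have [|j] := small_member (a := a) (bv_nu k) eta0; last by rewrite ltNge (ha j).2.
  move=> i j ij; apply: disjointW (ha i).1 (ha j).1 (lub_disjoint (hs i) (hs j) _).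
  move=> _ _ [n' [[_ c1] ->]] [n'' [[_ c2] ->]]; apply: dj => e'; subst n''.
  by apply: ij; rewrite -c1 -c2.
have [y hy] := dig_ex 2 (fun m => if m is 0 then n else j).
have [i' hi'] := dig_ex l.+1 (fun m => if (m == l)%N then y else dig i0 m).
exists i', l.+1; split=> // [m ml|]; first by rewrite hi' ?ltn_eqF // ltnW.
have wl m : (m < l)%N -> dig i' m = w0 m by move=> ml; rewrite hi' ?ltn_eqF // ltnW.
have il m : (m < l)%N -> entry (dig i') m = entry w0 m by move=> ml; rewrite /entry wl.
have in_ : entry (dig i') l = n by rewrite /entry hi' // eqxx hy.
have ae m n' : (m <= l)%N -> admissible (dig i') n' m = admissible w0 n' m.
  move=> ml; apply/propext; split=> a x xm; have := a x xm; rewrite wl //; exact: leq_trans ml.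
exists l; split=> //; exists k; rewrite in_ ae //; split=> //.
- by move=> m ml; rewrite il //; apply: leq_trans n2n; rewrite ltnS; exact: (leq_bigmax (Ordinal ml)).
- by move=> m ml; rewrite labn hv.
split=> //; split.
  have -> : earlier (dig i') l = earlier w0 l.
    apply/funext => a; apply/propext; split=> -[n' [[m [ml [am ->]]] ->]].
      by exists (entry w0 m); rewrite -il //; split=> //; exists m; rewrite -ae ?(ltnW ml) // -il.
    by exists (entry w0 m); split=> //; exists m; rewrite ae ?(ltnW ml) // il.
  move=> h' hh'; have -> : h' = h; last by apply: hn1; exact: leq_trans nk.
  by apply/eqP; rewrite eq_le; apply/andP; split; [apply/hh' => a|apply/hh => a]; exact: lub_ub.
move=> s' hs' a as'; apply: sj; apply: le_trans as' _; apply/hs' => _ [n' [an ->]].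
apply: (lub_ub (hs j)); exists n'; split=> //; split.
  by move=> m ml; rewrite an ?(ltnW ml) // ?wl // ltnW.
by rewrite an // hi' // eqxx hy.
Qed.

End Tail.

(** Since every label recurs with arbitrarily late bumps, good stages are dense, and a sequence z of
    V has good stages beyond every n0. The entries of z that are admissible have a supremum b in the
    algebra, on which [nu k] cannot tend to 0. *)
Theorem no_disjoint_bumps (e : nat -> B) (lab : nat -> nat) (q : rat) : 0 < q ->
  mf N e -> mf N lab -> (forall i j, i <> j -> (e i `&` e j)%O = \bot%O) ->
  (forall v n0, exists n k, [/\ (n0 <= n)%N, (n <= k)%N, lab n = v & ratr q <= `|nu k (e n)|]) ->
  False.
Proof.
(* The values at b, at the join of the earlier entries and at the later remainder are each below
   eta, while the bump is at least four times eta. *)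
move=> q0 me mlab dj bump; pose r := (q / 4)%R; pose eta : R := ratr r.
have eta0 : 0 < eta by rewrite /eta /r ltr0q divr_gt0.
have [|n0|z mz hz] := generic_point HV HP HG Hmeager (D := fun n0 i' l =>
    exists i, (i < l)%N /\ good_stage e lab eta (ratr q) (dig i') i n0).
- have mle := msM_le; have me' : mf M e := NM me; have mlab' : mf M lab := NM mlab.
  by rewrite /ms3 /good_stage /earlier /later /lub /admissible /entry /eta; mst.
- exact: dense_good_stage.
(* The entries that are admissible at their own stage; this refers to z and the labels only, hence
   lies in V. *)
pose (Q := fun n => exists i, admissible lab z n i /\ n = entry z i).
have [b hb] : exists b, lub (fun a => exists n, Q n /\ a = e n) b.
  by apply: lub_ex => //; rewrite /Q /admissible /entry; mst.
have eta4 : ratr q = eta + eta + (eta + eta).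
  by rewrite /eta -!rmorphD /r; congr ratr; lra.
have [n1 hn1] := null_nu b eta0.
have [i' [l [[i [il /good_stage_ext gs]] hz']]] := hz n1.
have {gs} : good_stage e lab eta (ratr q) z i n1.
  by apply: gs => m mi; rewrite hz' //; exact: leq_ltn_trans il.
move=> [k [[n1i ik] inc adm [bk [hE hL]]]]; set n := entry z i in n1i ik inc adm bk.
have [h hh] : exists h, lub (earlier e lab z i) h.
  by apply: lub_ex => //; rewrite /admissible /entry; mst.
have [s hs] : exists s, lub (later e lab z i) s.
  by apply: lub_ex => //; rewrite /admissible /entry; mst.
have enb : (e n <= b)%O by apply: (lub_ub hb); exists n; split=> //; exists i.
have hb' : (h <= b)%O.
  by apply/hh => _ [n' [[m [mi [am en']]] ->]]; rewrite {n'}en' in am *; apply: (lub_ub hb); exists (entry z m); split=> //; exists m.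
have hn : (h `&` e n)%O = \bot%O.
  apply/eqP; rewrite disj_leC; apply/hh => _ [n' [[m [mi [am en']]] ->]]; rewrite {n'}en' in am *; rewrite -disj_leC.
  by apply/eqP/dj => em; have := inc m mi; rewrite em ltnn.
have bs : (b <= h `|` e n `|` s)%O.
  apply/hb => _ [n' [[m [am en']] ->]]; rewrite {n'}en' in am *; case: (ltngtP m i) => mi.
  - apply: le_trans (lub_ub hh _) _; last by rewrite -joinA leUl.
    by exists (entry z m); split=> //; exists m.
  - apply: le_trans (lub_ub hs _) _; last by rewrite leUr.
    by exists (entry z m); split=> // x xi; apply: am; exact: leq_trans xi _.
  - by rewrite mi -/n (le_trans _ (leUl _ _)) // leUr.
have hbn : (h <= b `\` e n)%O by rewrite diffE lexI hb' -disj_leC hn eqxx.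
have small : (b `\` e n `\` h <= s)%O by rewrite !leBLR joinA (joinC (e n)).
have := hn1 k (leq_trans n1i ik); have := hE h hh; have := hL s hs _ small.
move: bk; rewrite (additive_sub (add_nu k) enb) (additive_sub (add_nu k) hbn) eta4.
move: (nu k (e n)) (nu k h) (nu k (b `\` e n `\` h)%O) => x y t.
move=> h1 h2 h3 h4; have : `|x| <= `|x + (y + t)| + `|y| + `|t|.
  have e1 : x = (x + (y + t)) - y - t by ring.
  rewrite {1}e1; apply: le_trans (ler_normB _ _) _; rewrite lerD2r; exact: ler_normB.
lra.
Qed.

End Disjoint.
End NullSequences.

(** * Selection of bumps by the Laver property *)

Section LeastValue.
Context {K : cls} {hK : zermelo K} {T : Type} {cT : Coded T} {iT : inN K T}.

Lemma mf_least (Q : T -> nat -> Prop) : ms K (fun p => Q p.1 p.2) -> (forall t, exists n, Q t n) ->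
  exists2 f : T -> nat, mf K f & forall t, Q t (f t) /\ forall m, Q t m -> (f t <= m)%N.
Proof.
move=> mQ ex; have /choice[f hf] : forall t, exists n, Q t n /\ forall m, Q t m -> (n <= m)%N.
  move=> t; have ex' : exists n, `[< Q t n >] by have [n Qn] := ex t; exists n; apply/asboolP.
  by case: (ex_minnP ex') => n /asboolP Qn mn; exists n; split=> // m /asboolP/mn.
exists f => //; apply: mfI.
apply: (ms_iff (B := fun p => Q p.1 p.2 /\ forall m, Q p.1 m -> (p.2 <= m)%N)); last by mst.
move=> [t n] /=; split=> [<-//|[Qn mn]]; have [Qf mf_] := hf t.
by apply/eqP; rewrite eqn_leq mn // mf_.
Qed.

End LeastValue.

(** There are finitely many patterns of zeros on L digits, so codes for all of them are bounded.
    Computed in V, this bound dominates the function of V[G] to which the Laver property is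
    applied. *)
Lemma pattern_bound L : exists F, forall j, exists2 i, (i <= F)%N &
  forall l, (l < L)%N -> (dig i l = 0%N <-> dig j l = 0%N).
Proof.
have /choice[c hc] : forall A : {ffun 'I_L -> bool}, exists i, forall l : 'I_L, dig i l = A l :> nat.
  move=> A; have [i hi] := dig_ex L (fun l => if insub l is Some j then A j : nat else 0%N).
  exists i => l; rewrite hi // (insubT (fun l => l < L)%N (ltn_ord l)) /=.
  by congr (nat_of_bool (A _)); apply: val_inj.
exists (\max_A c A) => j; exists (c [ffun l : 'I_L => dig j l != 0%N]); first exact: leq_bigmax.
by move=> l lL; rewrite (hc _ (Ordinal lL)) ffunE /=; case: eqP.
Qed.

Section InitialJoin.
Context {d : Order.disp_t} {B : ctbDistrLatticeType d}.

Definition joins (f : nat -> B) n : B := (\join_(m < n) f m)%O.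

Lemma joinsS f n : joins f n.+1 = (joins f n `|` f n)%O.
Proof. exact: big_ord_recr. Qed.

Lemma le_joins f m n : (m < n)%N -> (f m <= joins f n)%O.
Proof. by move=> mn; exact: (@joins_sup _ _ _ (Ordinal mn) xpredT (fun i => f i)). Qed.

Lemma eq_joins f g n : (forall m, (m < n)%N -> f m = g m) -> joins f n = joins g n.
Proof. by move=> h; apply: eq_bigr => i _; exact: h. Qed.

Lemma joins_disjoint f m n : m <> n ->
  ((f m `\` joins f m) `&` (f n `\` joins f n))%O = \bot%O.
Proof.
have key i j : (i < j)%N -> ((f i `\` joins f i) `&` (f j `\` joins f j))%O = \bot%O.
  move=> ij; apply/eqP; rewrite disj_leC lexC; apply: le_trans (leBC _ _) _; rewrite leC.
  by apply: le_trans (leBx _ _) (le_joins _ ij).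
by move=> mn; case: (ltngtP m n) => // h; [exact: key|rewrite meetC; exact: key].
Qed.

Context {cB : Coded B} {K : cls} {hK : zermelo K} {iB : inN K B}.
Hypothesis mle : ms K (fun p : B * B => is_true (p.1 <= p.2)%O).

Lemma mf_join : mf K (fun p : B * B => (p.1 `|` p.2)%O).
Proof.
apply: mfI; apply: (ms_iff (B := fun p => forall w, is_true (p.2 <= w)%O <->
    (p.1.1 <= w)%O /\ (p.1.2 <= w)%O)); last by mst.
move=> [[a b] z] /=; split=> [<- w|h]; first by rewrite leUx; split=> [/andP|/andP].
have [hl hr] := (h z).1 (lexx z).
by apply/eqP; rewrite eq_le leUx hl hr; apply/h; rewrite leUl leUr.
Qed.

Lemma mf_diff : mf K (fun p : B * B => (p.1 `\` p.2)%O).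
Proof.
have mj := mf_join.
apply: mfI; apply: (ms_iff (B := fun p => forall w, is_true (p.2 <= w)%O <->
    (p.1.1 <= p.1.2 `|` w)%O)); last by mst.
move=> [[a b] z] /=; split=> [<- w|h]; first by rewrite leBLR.
by apply/eqP; rewrite eq_le leBLR; apply/andP; split; apply/h; rewrite -?leBLR.
Qed.

Lemma mf_joins {U : Type} {cU : Coded U} {iU : inN K U} (f : U -> nat -> B) :
  mf K (fun p => f p.1 p.2) -> mf K (fun p : U * nat => joins (f p.1) p.2).
Proof.
move=> mf_; have mj := mf_join.
apply: (mf_rec (g := fun _ : U => \bot%O) (h := fun u n b => (b `|` f u n)%O)
  (f := fun u n => joins (f u) n)).
- by move=> u; rewrite /joins big_ord0.
- by move=> u n; exact: joinsS.
- by mst.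
- by mst.
Qed.

End InitialJoin.

Section Selection.
Variables (R : realType) (V : class) (HV : transitive_ZFC V).
Variables (dP : Order.disp_t) (P : preorderType dP) (cP : Coded P).
Hypothesis HP : ordered_in V cP.
Variables (G : P -> Prop) (HG : generic V cP G).
Hypotheses (Hmeager : preserves_nonmeager R V cP) (Hlaver : laver_property V cP).
Variables (dB : Order.disp_t) (B : ctbDistrLatticeType dB) (cB : Coded B).
Hypothesis HB : ordered_in V cB.
Hypothesis Hsigma : sigma_complete V cB.

Let N := clsh V.
Let hN : zermelo N := clsh_zfc HV.
Notation M := (extM V cP G).
Let hM : zermelo M := ext_zermelo HV HP HG.
#[local] Existing Instance hN.
#[local] Existing Instance hM.
Let NM x : N x -> M x := @ext_sub V HV dP P cP HP G HG x.
Let inN_alg : inN N B := inN_algebra HV HB.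
#[local] Existing Instance inN_alg.
Let inM_alg : inN M B := inM_algebra HV HP HG HB.
#[local] Existing Instance inM_alg.

Variable nu : nat -> B -> R.
Hypothesis mnu : mr M (fun p => nu p.1 p.2).
Hypothesis add_nu : forall k, additive_on (nu k).
Hypothesis bv_nu : forall k, bounded_variation (nu k).
Hypothesis null_nu : null_sequence nu.

Definition disjoint_family (c : nat -> B) (t : nat -> nat) L : Prop :=
  forall r s, (r < L)%N -> (s < L)%N -> r <> s -> (c (t r) `&` c (t s))%O = \bot%O.

Section Block.
Variables (Ks : nat -> nat) (H : nat -> {fset nat}).
Hypothesis cardH : forall n, (#|` H n| <= n.+1)%N.

(** One more than what n + 1 sets of at most [Ks n] elements can cover, n + 1 being the number of
    guesses allowed by the Laver property. *)
Definition block_size n := ((n.+1 * Ks n).+1)%N.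

(* The candidates i in H n code subsets of the block n; those with more than Ks n elements
   are discarded. *)
Definition candidate n i : Prop := i \in H n /\
  exists w, forall l, (l < block_size n)%N -> dig i l <> 0%N -> exists s, (s < Ks n)%N /\ dig w s = l.

Lemma outside_candidates n : exists l, (l < block_size n)%N /\
  ~ exists i, candidate n i /\ dig i l <> 0%N.
Proof.
apply: contrapT => no.
have /choice[w hw] : forall i, exists w, candidate n i -> forall l, (l < block_size n)%N ->
    dig i l <> 0%N -> exists s, (s < Ks n)%N /\ dig w s = l.
  move=> i; have [[_ [w hw]]|nc] := pselect (candidate n i); first by exists w.
  by exists 0%N.
have sub : {subset iota 0 (block_size n) <= [seq dig (w i) s | i <- enum_fset (H n), s <- iota 0 (Ks n)]}.
  move=> l; rewrite mem_iota /= add0n => lL; apply: contrapT => nl; apply: no.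
  exists l; split=> // -[i [ci il]]; apply: nl; have [s [sK <-]] := hw i ci l lL il.
  by apply/allpairsP; exists (i, s); rewrite /= mem_iota sK; split=> //; exact: ci.1.
have := uniq_leq_size (iota_uniq 0 (block_size n)) sub.
rewrite size_iota size_allpairs size_iota leqNgt => /negP; apply.
by rewrite /block_size ltnS leq_mul2r cardH orbT.
Qed.

End Block.

(** A generic sequence x of V provides blocks of disjoint members of [c] that bump. Which members of
    a block are small is known in V[G] only, but by the Laver property V has n + 1 guesses for block
    n. As few members fail to be small, some member lies outside all relevant guesses; it is small
    and is found in V. The selected members, made disjoint, contradict [no_disjoint_bumps]. *)
Theorem no_bumps (c : nat -> B) (Ks : nat -> nat) (small : nat -> nat -> Prop) (q0 : rat) :
  0 < q0 -> mf N c -> mf N Ks -> ms M (fun p => small p.1 p.2) ->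
  c 0%N = \bot%O -> (forall n, small n 0%N) ->
  (forall n t L, disjoint_family c t L -> (forall r, (r < L)%N -> ~ small n (t r)) -> (L <= Ks n)%N) ->
  (forall n L q, exists2 t, disjoint_family c t L & forall r, (r < L)%N -> exists k, (n <= k)%N /\
     forall y, (forall m, (m < n)%N -> small m (dig y m) /\ (dig y m < q)%N) ->
       ratr q0 <= `|nu k (c (t r) `\` joins (fun m => c (dig y m)) n)%O|) ->
  False.
Proof.
move=> q00 mc mKs msm c0 small0 few rich; pose L := block_size Ks.
have mL : mf N L by rewrite /L /block_size; mst.
pose (blk := fun i l => dig i l.+1).
have mblk : mf N (fun p => blk p.1 p.2) by rewrite /blk; mst.
have [mc' mKs' mL'] : [/\ mf M c, mf M Ks & mf M L] by split; exact: NM.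
have mle : ms M (fun p : B * B => is_true (p.1 <= p.2)%O) := msM_le HV HP HG HB.
have mleN : ms N (fun p : B * B => is_true (p.1 <= p.2)%O) := msN_le HV HB.
(* Condition k = (v, n0): some n >= n0 carries the label v and a block all of whose members
   bump, whichever earlier members are subtracted. *)
pose (good := fun i n q => [/\ disjoint_family c (blk (dig i n)) (L n),
   forall m l, (m < n)%N -> (l < L m)%N -> (blk (dig i m) l < q)%N, (0 < q)%N
   & forall r, (r < L n)%N -> exists k, (n <= k)%N /\
     forall y, (forall m, (m < n)%N -> small m (dig y m) /\ (dig y m < q)%N) ->
       ratr q0 <= `|nu k (c (blk (dig i n) r) `\` joins (fun m => c (dig y m)) n)%O|]).
pose (D := fun k i len => exists n q, [/\ ((un k).2 <= n)%N, (n < len)%N,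
   dig (dig i n) 0 = (un k).1 & good i n q]).
have mD : ms3 M D.
  have mJ : mf M (fun p : nat * nat => joins (fun m => c (dig p.1 m)) p.2).
    by apply: (mf_joins mle (f := fun y m => c (dig y m))); mst.
  have md : mf M (fun p : B * B => (p.1 `\` p.2)%O) by exact: mf_diff mle.
  pose (jn := fun y n => joins (fun m => c (dig y m)) n).
  have {}mJ : mf M (fun p : nat * nat => jn p.1 p.2) := mJ.
  have mblk' : mf M (fun p : nat * nat => blk p.1 p.2) := NM mblk.
  apply: (ms_iff (B := fun p : nat * nat * nat => exists n q, [/\ ((un p.1.1).2 <= n)%N, (n < p.2)%N,
     dig (dig p.1.2 n) 0 = (un p.1.1).1 &
     [/\ forall r s, (r < L n)%N -> (s < L n)%N -> r <> s ->
            (forall w, is_true (w <= c (blk (dig p.1.2 n) r))%O -> is_true (w <= c (blk (dig p.1.2 n) s))%O -> w = \bot%O),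
      forall m l, (m < n)%N -> (l < L m)%N -> (blk (dig p.1.2 m) l < q)%N, (0 < q)%N
    & forall r, (r < L n)%N -> exists k, (n <= k)%N /\
     forall y, (forall m, (m < n)%N -> small m (dig y m) /\ (dig y m < q)%N) ->
       ratr q0 <= `|nu k (c (blk (dig p.1.2 n) r) `\` jn y n)%O|]])); last by mst.
  move=> [[k i] len] /=; split=> -[n [q [h1 h2 h3 [h4 h5 h6 h7]]]]; exists n, q; split=> //; split=> //.
    by move=> r s rL sL rs w w1 w2; apply/eqP; rewrite -lex0 -(h4 r s rL sL rs) lexI w1.
  by move=> r s rL sL rs; apply: (h4 r s) => //; rewrite ?leIl ?leIr.
have [k i len|x mx hx] := generic_point HV HP HG Hmeager mD.
  pose n := maxn (un k).2 len.
  (* A bound on the indices in the earlier blocks, so that the new bumps survive the subtraction of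
     whichever small members are selected from them. *)
  pose q := (\max_(m < n) \max_(l < L m) blk (dig i m) l).+1.
  have [t dt ht] := rich n (L n) q.
  have [y hy] := dig_ex (L n).+1 (fun l => if l is l'.+1 then t l' else (un k).1).
  have [i' hi'] := dig_ex n.+1 (fun m => if (m == n)%N then y else dig i m).
  have e1 m : (m < n)%N -> dig i' m = dig i m by move=> mn; rewrite hi' ?ltn_eqF // ltnW.
  have e2 : dig i' n = y by rewrite hi' // eqxx.
  have e3 l : (l < L n)%N -> blk y l = t l by move=> lL; rewrite /blk hy.
  exists i', n.+1; split.
  - exact: leq_trans (leq_maxr _ _) (leqnSn _).
  - by move=> m ml; rewrite e1 //; exact: leq_trans ml (leq_maxr _ _).
  exists n, q; rewrite e2; split; [exact: leq_maxl|by []|by rewrite hy|split=> //].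
  - by move=> r s rL sL rs; rewrite e2 !e3 //; exact: dt.
  - move=> m l mn lL; rewrite e1 // ltnS.
    apply: leq_trans (leq_bigmax (Ordinal mn)) => /=.
    exact: (leq_bigmax (F := fun l : 'I_(L m) => blk (dig i m) l) (Ordinal lL)).
  - by move=> r rL; rewrite e2 e3 //; exact: ht.
have [||f mf_ hf] := mf_least (K := N) (Q := fun n F => forall j, exists2 i, (i <= F)%N &
    forall l, (l < L n)%N -> (dig i l = 0%N <-> dig j l = 0%N)).
- by mst.
- by move=> n; exact: pattern_bound.
have mx' : mf M x := NM mx; have mblk' : mf M (fun p : nat * nat => blk p.1 p.2) := NM mblk.
(* [g n] marks, by its nonzero digits, the members of block n that are not small. It is the least
   code of its pattern, hence at most [f n]. *)
have [||g mg hg] := mf_least (K := M) (Q := fun n i => forall l, (l < L n)%N ->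
    (dig i l = 0%N <-> small n (blk (x n) l))).
- by mst.
- move=> n; have [i hi] := dig_ex (L n) (fun l => `[< ~ small n (blk (x n) l) >] : nat).
  exists i => l lL; rewrite hi //; case: asboolP => h; split=> //.
  by move=> _; apply: contrapT.
have gf n : (g n <= f n)%N.
  have [i il hi] := (hf n).1 (g n); apply: leq_trans il; apply: (hg n).2 => l lL.
  by rewrite hi //; exact: (hg n).1.
have [|||H VH hH] := Hlaver HG (f := f) (g := g).
- exact/(clsh_cl HV).
- exact/(extME HV).
- by exists 0%N => n _.
have cardH n : (#|` H n| <= n.+1)%N by have [] := hH n.
have mH : ms N (fun p : nat * nat => p.2 \in H p.1 : Prop).
  have NH : N (code H) by exact/(clsh_cl HV).
  have mH1 n : ms N (fun i : nat => i \in H n : Prop).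
    have : N (code (H n)).
      have /(z_trans hN NH) : op (code n) (code (H n)) ∈ code H by apply/mem_fun; exists n.
      by move/(z_op_inv hN) => [].
    by [].
  pose (H' := fun n => exist _ _ (mH1 n) : pow N nat).
  have eH : code H' = code H by exact: code_fun_eq.
  have {}eH : mf N H' by rewrite /mf eH.
  have : ms N (fun p => sval (H' p.1) p.2) by mst.
  by [].
(* The first position marked by no candidate, computed in V from [H]. *)
have [||ln mln hln] := mf_least (K := N) (Q := fun n l => (l < L n)%N /\
    ~ exists i, candidate Ks H n i /\ dig i l <> 0%N).
- pose (inH := fun n i => i \in H n : Prop).
  have {}mH : ms N (fun p : nat * nat => inH p.1 p.2) := mH.
  apply: (ms_iff (B := fun p : nat * nat => (p.2 < L p.1)%N /\ ~ exists i, (inH p.1 i /\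
    exists w, forall l, (l < L p.1)%N -> dig i l <> 0%N -> exists s, (s < Ks p.1)%N /\ dig w s = l)
    /\ dig i p.2 <> 0%N)) => //.
  by mst.
- by move=> n; exact: outside_candidates.
pose (dj := fun n => forall r s, (r < L n)%N -> (s < L n)%N -> r <> s ->
  forall w, is_true (w <= c (blk (x n) r))%O -> is_true (w <= c (blk (x n) s))%O -> w = \bot%O).
have djE n : dj n <-> disjoint_family c (blk (x n)) (L n).
  split=> h r s rL sL rs; first by apply: (h r s) => //; rewrite ?leIl ?leIr.
  by move=> w w1 w2; apply/eqP; rewrite -lex0 -(h r s rL sL rs) lexI w1.
have mdj : ms N dj by rewrite /dj; mst.
(* Where the block is not disjoint, the default 0 selects the bottom element, which is small. *)
pose (idx := fun n => if `[< dj n >] then blk (x n) (ln n) else 0%N).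
have midx : mf N idx.
  have mb : ms N (fun n => is_true `[< dj n >]).
    by apply: (ms_iff (B := dj)) => // n; split=> [/asboolP|h] //; exact/asboolP.
  by rewrite /idx; apply: mf_if => //; mst.
(* If the selected member were not small, then [g n], which is in [H n] and marks at most [Ks n]
   positions by [few], would be a candidate that marks it. *)
have small_idx n : small n (idx n).
  rewrite /idx; case: asboolP => // /djE djn; apply: contrapT => ns.
  have [[lL nU] _] := hln n; apply: nU; exists (g n).
  have gl l : (l < L n)%N -> (dig (g n) l = 0%N <-> small n (blk (x n) l)) by exact: (hg n).1.
  split; last by move=> /gl -/(_ lL).
  split; first by have [] := hH n.
  pose bad := [seq l <- iota 0 (L n) | dig (g n) l != 0%N].
  have badP l : l \in bad <-> (l < L n)%N /\ dig (g n) l <> 0%N.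
    by rewrite mem_filter mem_iota /= add0n; split=> [/andP[/eqP]|[-> /eqP ->]].
  have szb : (size bad <= Ks n)%N.
    apply: (few n (fun r => blk (x n) (nth 0%N bad r))) => [r s rb sb rs|r rb].
      have [rL _] := (badP _).1 (mem_nth 0%N rb); have [sL _] := (badP _).1 (mem_nth 0%N sb).
      apply: djn => // e; apply: rs; apply/eqP; rewrite -(nth_uniq 0%N rb sb) ?e //.
      exact: filter_uniq (iota_uniq _ _).
    by have [rL nz] := (badP _).1 (mem_nth 0%N rb); move=> /gl -/(_ rL).
  have [w hw] := dig_ex (size bad) (nth 0%N bad); exists w => l lL' nz.
  have lb : l \in bad by apply/badP.
  exists (index l bad); rewrite -index_mem in lb.
  by split; [exact: leq_trans lb szb|rewrite hw // nth_index // -index_mem].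
pose (e := fun n => c (idx n)); pose (e' := fun n => (e n `\` joins e n)%O).
have me' : mf N e'.
  have me : mf N e by rewrite /e; mst.
  have mJ : mf N (fun p : nat * nat => joins e p.2) by apply: (mf_joins mleN (f := fun _ : nat => e)); mst.
  have md : mf N (fun p : B * B => (p.1 `\` p.2)%O) by exact: mf_diff mleN.
  pose (jn := fun n => joins e n).
  have {}mJ : mf N jn by refine (mf_comp (f := fun n : nat => (n, n)) _ mJ); mst.
  by apply: (mf_iff (g := fun n => (e n `\` jn n)%O)) => //; mst.
apply: (no_disjoint_bumps HV HP HG Hmeager HB Hsigma mnu add_nu bv_nu null_nu
  (e := e') (lab := fun n => dig (x n) 0) q00 me').
- by mst.
- by move=> i j ij; exact: joins_disjoint.
move=> v n0; have [i [len [[n [q [n0n nl lab [h4 h5 h6 h7]]]] xi]]] := hx (pr v n0).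
rewrite un_pr /= in n0n lab.
have xm m : (m <= n)%N -> x m = dig i m by move=> mn; apply: xi; exact: leq_ltn_trans mn nl.
have djn : dj n by apply/djE; rewrite xm.
have [[lL _] _] := hln n.
have [k [nk hk]] := h7 _ lL.
have [y hy] := dig_ex n idx.
exists n, k; split=> //; first by rewrite xm.
have -> : e' n = (c (blk (dig i n) (ln n)) `\` joins (fun m => c (dig y m)) n)%O.
  rewrite /e' /e {1}/idx asboolT // xm //; congr (_ `\` _)%O.
  by apply: eq_joins => m mn; rewrite hy.
apply: hk => m mn; rewrite hy //; split=> //.
rewrite /idx; case: asboolP => // _; rewrite xm ?(ltnW mn) //; apply: h5 => //.
by have [[]] := hln m.
Qed.

End Selection.

(** * Boundedness and uniform control of null sequences *)

Section AdditiveBounds.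
Context {R : realType} {d : Order.disp_t} {B : ctbDistrLatticeType d}.
Variable m : B -> R.
Hypothesis add : additive_on m.
Local Open Scope order_scope.

Lemma additive_split a b : m a = (m (a `&` b) + m (a `\` b))%R.
Proof.
rewrite -add ?joinIB //; apply/eqP; rewrite disj_leC lexC.
by apply: le_trans (leBC _ _) _; rewrite leC leIr.
Qed.

Lemma additive_joins (s : seq B) : pairwise (fun a b => a `&` b == \bot) s ->
  m (\join_(a <- s) a) = (\sum_(a <- s) m a)%R.
Proof.
elim: s => [|a s IH] /=; first by rewrite !big_nil additive0.
move=> /andP[/allP h /IH e]; rewrite !big_cons add ?e //.
apply/eqP; rewrite disj_leC lexC; apply/joinsP_seq => b bs _.
by rewrite lexC -disj_leC h.
Qed.

Lemma variation_le (C : R) : (forall a, `|m a| <= C)%R ->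
  forall s : seq B, pairwise (fun a b => a `&` b == \bot) s -> (\sum_(a <- s) `|m a| <= C + C)%R.
Proof.
move=> hC s ps; rewrite (bigID (fun a => 0 <= m a)%R) /=; apply: lerD.
  rewrite -big_filter (eq_big_seq m); last by move=> a; rewrite mem_filter => /andP[/ger0_norm ->].
  by rewrite -additive_joins ?pairwise_filter //; apply: le_trans (hC _); exact: ler_norm.
rewrite -big_filter (eq_big_seq (fun a => - m a)%R); last first.
  by move=> a; rewrite mem_filter -ltNge => /andP[/ltr0_norm ->].
rewrite sumrN -additive_joins ?pairwise_filter //; apply: le_trans (hC _).
by rewrite -normrN; exact: ler_norm.
Qed.

End AdditiveBounds.

Section Control.
Variables (R : realType) (V : class) (HV : transitive_ZFC V).
Variables (dP : Order.disp_t) (P : preorderType dP) (cP : Coded P).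
Hypothesis HP : ordered_in V cP.
Variables (G : P -> Prop) (HG : generic V cP G).
Hypotheses (Hproper : proper_forcing V cP) (Hlaver : laver_property V cP).
Hypothesis Hmeager : preserves_nonmeager R V cP.
Variables (dB : Order.disp_t) (B : ctbDistrLatticeType dB) (cB : Coded B).
Hypothesis HB : ordered_in V cB.
Hypothesis Hsigma : sigma_complete V cB.

Let N := clsh V.
Let hN : zermelo N := clsh_zfc HV.
Notation M := (extM V cP G).
Let hM : zermelo M := ext_zermelo HV HP HG.
#[local] Existing Instance hN.
#[local] Existing Instance hM.
Let NM x : N x -> M x := @ext_sub V HV dP P cP HP G HG x.
Let inN_alg : inN N B := inN_algebra HV HB.
#[local] Existing Instance inN_alg.
Let inM_alg : inN M B := inM_algebra HV HP HG HB.
#[local] Existing Instance inM_alg.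
Let mle : ms M (fun p : B * B => is_true (p.1 <= p.2)%O) := msM_le HV HP HG HB.

(** The cover theorem for one family of operations, whose index carries a tag that selects join,
    difference, top or [W]. *)
Lemma closed_algebra (W : nat -> B -> B) : mf M (fun p => W p.1 p.2) ->
  exists2 c : nat -> B, mf N c & [/\ c 0%N = \bot%O, exists k, c k = \top%O,
    forall i j, exists k, (c i `|` c j)%O = c k, forall i j, exists k, (c i `\` c j)%O = c k
  & forall n i, exists k, W n (c i) = c k].
Proof.
move=> mW.
pose (F := fun n (a b : B) => if (dig n 0 <= 0)%N then (a `|` b)%O else
  if (dig n 0 <= 1)%N then (a `\` b)%O else if (dig n 0 <= 2)%N then \top%O else W (dig n 1) a).
have [|c mc [c0 cF]] := closed_cover HV HP HG Hproper inN_alg (\bot%O : B) (F := F).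
  have mj : mf M (fun p : B * B => (p.1 `|` p.2)%O) by exact: mf_join mle.
  have md : mf M (fun p : B * B => (p.1 `\` p.2)%O) by exact: mf_diff mle.
  by rewrite /F; mst.
have tag t n : exists x, dig x 0 = t /\ dig x 1 = n.
  have [x hx] := dig_ex 2 (fun l => if l is 0 then t else n).
  by exists x; rewrite !hx.
exists c => //; split=> //.
- have [x [x0 _]] := tag 2 0; have [k] := cF x 0%N 0%N; rewrite /F x0 /= => h.
  by exists k; rewrite -h.
- by move=> i j; have [x [x0 _]] := tag 0 0; have [k] := cF x i j; rewrite /F x0 /= => h; exists k; rewrite -h.
- by move=> i j; have [x [x0 _]] := tag 1 0; have [k] := cF x i j; rewrite /F x0 /= => h; exists k; rewrite -h.
- by move=> n i; have [x [x0 x1]] := tag 3 n; have [k] := cF x i i; rewrite /F x0 x1 /= => h; exists k; rewrite -h.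
Qed.

Variable nu : nat -> B -> R.
Hypothesis mnu : mr M (fun p => nu p.1 p.2).
Hypothesis add_nu : forall k, additive_on (nu k).
Hypothesis bv_nu : forall k, bounded_variation (nu k).
Hypothesis null_nu : null_sequence nu.

Lemma bounded_below n : exists C : R, forall k a, (k < n)%N -> `|nu k a| <= C.
Proof.
have /choice[C hC] k : exists C, forall a, `|nu k a| <= C.
  have [C hC] := bv_nu k; exists C => a; have := hC [:: a].
  by rewrite big_seq1 => -> //=.
exists (\sum_(k < n) `|C k|) => k a kn; apply: le_trans (hC k a) _.
rewrite (bigD1 (Ordinal kn)) //= (le_trans (ler_norm _)) // lerDl.
by apply: sumr_ge0 => i _.
Qed.

Lemma disjoint_extend (c : nat -> B) t L j : disjoint_family c t L ->
  (forall r, (r < L)%N -> (c (t r) `&` c j)%O = \bot%O) ->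
  disjoint_family c (fun r => if (r == L)%N then j else t r) L.+1.
Proof.
move=> dt dj r s rL sL rs.
have lt x : (x < L.+1)%N -> x <> L -> (x < L)%N by rewrite ltnS ltn_neqAle => -> /eqP ->.
case: eqP => [er|nr]; case: eqP => [es|ns].
- by case: rs; rewrite er es.
- by rewrite meetC; apply: dj; exact: lt.
- by apply: dj; exact: lt.
- by apply: dt => //; exact: lt.
Qed.

Section Unbounded.

Definition heavy b : Prop := forall C : nat, exists k a, (a <= b)%O /\ ratr C%:R < `|nu k a|.

Lemma heavy_split b a : heavy b -> (a <= b)%O -> heavy a \/ heavy (b `\` a)%O.
Proof.
move=> hb ab; apply: contrapT => /not_orP[/existsNP[C1 h1] /existsNP[C2 h2]].
have [k [x [xb]]] := hb (C1 + C2)%N; rewrite ltNge => /negP; apply.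
rewrite (additive_split (add_nu k) x a) natrD rmorphD.
apply: le_trans (ler_normD _ _) (lerD _ _); rewrite leNgt; apply/negP => h.
  by apply: h1; exists k, (x `&` a)%O; rewrite leIr.
by apply: h2; exists k, (x `\` a)%O; rewrite leBl.
Qed.

(** A value of modulus above 2 at a part a is found for some k; its size forces k beyond the first n
    terms and beyond the point from which [nu k b] is below 1, so that the complement of a in b
    carries more than 1 as well. *)
Lemma heavy_witness n b : heavy b -> exists a k, [/\ (a <= b)%O, (n <= k)%N,
  1 <= `|nu k a| & 1 <= `|nu k (b `\` a)%O|].
Proof.
move=> hb; have [n1 hn1] := null_nu b (@ltr01 R).
have [C hC] := bounded_below (maxn n n1); have [k [a [ab ka]]] := hb (Num.bound `|C|).+2.
have hk : (maxn n n1 <= k)%N.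
  rewrite leqNgt; apply/negP => /(hC k a); rewrite leNgt => /negP; apply; apply: lt_trans ka.
  apply: le_lt_trans (ler_norm _) _; apply: lt_trans (archi_boundP (normr_ge0 _)) _.
  by rewrite ratr_nat ltr_nat.
move: hk; rewrite geq_max => /andP[nk n1k].
have ka2 : 2 < `|nu k a| by apply: le_lt_trans ka; rewrite ratr_nat ler_nat.
exists a, k; split=> //; first lra.
have := hn1 k n1k; rewrite (additive_sub (add_nu k) ab) => h.
have := ler_normB (nu k a + nu k (b `\` a)%O) (nu k (b `\` a)%O); rewrite addrK; lra.
Qed.

(** Were the sequence unbounded, the heavy elements would contain an ultrafilter of a countable
    algebra of V. The members outside it are declared small; two disjoint members cannot both lie in
    it, and any heavy element splits off arbitrarily many disjoint bumps. *)
Lemma null_bounded : exists C : R, forall k a, `|nu k a| <= C.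
Proof.
apply: contrapT => unb.
have htop : heavy \top%O.
  move=> C; apply: contrapT => h; apply: unb; exists (ratr C%:R) => k a; rewrite leNgt.
  by apply/negP => ka; apply: h; exists k, a; rewrite lex1.
have mh : ms M heavy by rewrite /heavy; mst.
have md : mf M (fun p : B * B => (p.1 `\` p.2)%O) by exact: mf_diff mle.
(* [W] splits a heavy element into two parts that both bump at a late index; the algebra is closed
   under it. *)
have [||W mW hW] := choice_ext HV HP HG (T := (nat * B)%type) (Z := B)
  (R := fun p a => heavy p.2 -> exists k, [/\ (a <= p.2)%O, (p.1 <= k)%N,
     ratr 1 <= `|nu k a| & ratr 1 <= `|nu k (p.2 `\` a)%O|]).
- by mst.
- move=> [n b]; have [hb|nb] := pselect (heavy b); last by exists \bot%O.
  have [a [k h]] := heavy_witness n hb; exists a => _; exists k.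
  by move: h; rewrite !rmorph1.
have [|c mc [c0 [kt ct] _ cd cW]] := closed_algebra (W := fun n b => W (n, b)); first by mst.
(* [p] decides the members of [c] in turn and stays heavy; [p i] minus y is the meet of [p i] with
   [c i]. *)
pose (p := fix p j : B := if j is i.+1 then
  let y := (p i `\` c i)%O in if `[< heavy (p i `\` y)%O >] then (p i `\` y)%O else y else \top%O).
have pS j : p j.+1 = if `[< heavy (p j `\` (p j `\` c j))%O >] then (p j `\` (p j `\` c j))%O
    else (p j `\` c j)%O by [].
have mp : mf M p.
  have mh' : ms M (fun b => is_true `[< heavy b >]).
    by apply: (ms_iff (B := heavy)) => // b; split=> [/asboolP|h] //; exact/asboolP.
  pose (hv := fun b => `[< heavy b >]); have {}mh' : ms M (fun b => is_true (hv b)) := mh'.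
  have mc' : mf M c := NM mc.
  have mp2 : mf M (fun q : nat * nat => p q.2).
    apply: (mf_rec (g := fun _ : nat => \top%O) (h := fun (_ : nat) j b =>
      if hv (b `\` (b `\` c j))%O then (b `\` (b `\` c j))%O else (b `\` c j)%O)
      (f := fun _ j => p j)) => //; by mst.
  by refine (mf_comp (f := fun n : nat => (n, n)) (g := fun q => p q.2) _ mp2); mst.
have hp j : heavy (p j).
  elim: j => // j IH; rewrite pS; case: asboolP => // nh.
  by have [//|] := heavy_split IH (leBx _ (c j)).
have pc j : exists k, p j = c k.
  elim: j => [|j [k IH]]; first by exists kt.
  have [k1 e1] := cd k j; have [k2 e2] := cd k k1.
  by rewrite pS IH e1 e2; case: ifP => _; [exists k2|exists k1].
have pdec i j : (i <= j)%N -> (p j <= p i)%O.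
  move=> /subnK <-; elim: (j - i)%N => // k IH; rewrite addSn.
  by apply: le_trans IH; rewrite pS; case: ifP => _; exact: leBx.
pose (small := fun (n j : nat) => ~ heavy (p j `\` (p j `\` c j))%O).
have nheavy0 : ~ heavy \bot%O.
  move=> /(_ 0%N)[k [a []]]; rewrite lex0 => /eqP ->.
  by rewrite (additive0 (add_nu k)) normr0 rmorph0 ltxx.
have pnon n j : ~ small n j -> (p j.+1 <= c j)%O.
  move=> /contrapT h; rewrite pS asboolT // leBLR.
  by rewrite joinC -leBLR.
have psm n j : small n j -> (p j.+1 `&` c j)%O = \bot%O.
  by move=> h; apply/eqP; rewrite disj_leC pS asboolF // leBC.
apply: (no_bumps HV HP HG Hmeager Hlaver HB Hsigma mnu add_nu bv_nu null_nu
  (c := c) (Ks := fun=> 1%N) (small := small) (q0 := 1)) => //.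
- exact: mf_const.
- by have mc' : mf M c := NM mc; rewrite /small; mst.
- by move=> n h; apply: nheavy0; move: h; rewrite c0 diffx0 diffxx.
- move=> n t [|[|L]] // dt ns; case: nheavy0.
  have h1 := pnon n _ (ns 0%N isT); have h2 := pnon n _ (ns 1%N isT).
  rewrite -(dt 0%N 1%N isT isT) //.
  have : heavy (p (maxn (t 0%N) (t 1%N)).+1) by [].
  suff le : (p (maxn (t 0%N) (t 1%N)).+1 <= c (t 0%N) `&` c (t 1%N))%O.
    by move=> h C; have [k [a [ap ka]]] := h C; exists k, a; rewrite (le_trans ap).
  by rewrite lexI (le_trans (pdec _ _ _) h1) ?(le_trans (pdec _ _ _) h2) // ltnS ?leq_maxl ?leq_maxr.
(* [p q] is disjoint from every small member of index below q, so bumps found below it are unchanged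
   when such members are subtracted. *)
move=> n L q; have [k0 e0] := pc q.
have [t dt ht] : exists2 t, disjoint_family c t L & forall r, (r < L)%N ->
    (c (t r) <= c k0)%O /\ exists k, (n <= k)%N /\ ratr 1 <= `|nu k (c (t r))|.
  have : heavy (c k0) by rewrite -e0.
  elim: L k0 {e0} => [|L IH] k0 h0; first by exists id.
  have [k [ab nk h1 h2]] := hW (n, c k0) h0; rewrite /= in ab nk h1 h2.
  have [k1 e1] := cW n k0; have [k2 e2] := cd k0 k1.
  have add1 i j : heavy (c i) -> (c i <= c k0)%O -> (c j <= c k0)%O -> (c i `&` c j)%O = \bot%O ->
      ratr 1 <= `|nu k (c j)| ->
      exists2 t, disjoint_family c t L.+1 & forall r, (r < L.+1)%N ->
      (c (t r) <= c k0)%O /\ exists k, (n <= k)%N /\ ratr 1 <= `|nu k (c (t r))|.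
    move=> hi le1 le2 dj hj; have [t dt ht] := IH i hi.
    exists (fun r => if (r == L)%N then j else t r).
      apply: disjoint_extend => // r rL; apply: disjointW dj => //; exact: (ht r rL).1.
    move=> r; rewrite ltnS leq_eqVlt; case: eqP => [_ _|_ /= rL]; first by split=> //; exists k.
    by have [h3 h4] := ht r rL; split=> //; exact: le_trans le1.
  have d12 : (c k1 `&` c k2)%O = \bot%O.
    by apply/eqP; rewrite -e2 disj_leC lexC leBC.
  rewrite e1 in ab h1 h2; rewrite e2 in h2.
  have le2 : (c k2 <= c k0)%O by rewrite -e2 leBx.
  have [h|h] := heavy_split h0 ab; first by apply: (add1 k1 k2).
  by apply: (add1 k2 k1) => //; [rewrite -e2|rewrite meetC].
exists t => // r rL; have [le [k [nk hk]]] := ht r rL; exists k; split=> // y hy.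
rewrite (_ : (_ `\` _)%O = c (t r)) //; apply/eqP; rewrite eq_diff leUr lexx /=.
rewrite disj_leC lexC; apply/joinsP => m _; have [sm yq] := hy m (ltn_ord m).
rewrite lexC; apply: le_trans le _; rewrite -e0; apply: le_trans (pdec _ _ yq) _.
by rewrite -disj_leC; apply/eqP; exact: psm sm.
Qed.

End Unbounded.

Section Uncontrolled.
Variable e1 : rat.
Hypothesis e1_gt0 : 0 < e1.

Definition inv n : rat := (n.+1%:R)^-1.
(** The factors telescope ([weight_sum]), so that all weights together stay below a quarter of
    [e1]. *)
Definition weight n : rat := e1 / 4 * (inv n * inv n.+1).

Definition negligible q d b : Prop :=
  forall i a, (i < q)%N -> (a <= b)%O -> `|nu i a| < ratr (inv d).
Definition witnesses k b q d : Prop :=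
  [/\ negligible q d b, ratr e1 <= `|nu k b| & (q <= k)%N].
(** The indices in [Z] alone refute uniform control by any finite number of terms at any precision.
    This notion is stable under splitting [Z] in two, by [rich_split]. *)
Definition rich (Z : nat -> Prop) : Prop :=
  forall q d, exists k b, Z k /\ witnesses k b q d.

Lemma inv_gt0 n : 0 < inv n. Proof. by rewrite invr_gt0 ltr0n. Qed.

Lemma inv_le m n : (m <= n)%N -> ratr (inv n) <= ratr (inv m) :> R.
Proof. by move=> mn; rewrite ler_rat lef_pV2 ?posrE ?ltr0n // ler_nat. Qed.

Lemma witnesses_le k b q d q' d' : (q' <= q)%N -> (d' <= d)%N ->
  witnesses k b q d -> witnesses k b q' d'.
Proof.
move=> qq dd [h1 h2 h3]; split=> //; last exact: leq_trans h3.
by move=> i a iq ab; apply: lt_le_trans (h1 i a _ ab) (inv_le dd); exact: leq_trans qq.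
Qed.

Lemma rich_split Z A : rich Z -> rich (fun k => Z k /\ A k) \/ rich (fun k => Z k /\ ~ A k).
Proof.
move=> rZ; apply: contrapT => /not_orP[/existsNP[q1 /existsNP[d1 h1]] /existsNP[q2 /existsNP[d2 h2]]].
have [k [b [Zk w]]] := rZ (maxn q1 q2) (maxn d1 d2).
have [Ak|nA] := pselect (A k).
  by apply: h1; exists k, b; split=> //; apply: witnesses_le w; exact: leq_maxl.
by apply: h2; exists k, b; split=> //; apply: witnesses_le w; exact: leq_maxr.
Qed.

Lemma weight_gt0 n : 0 < weight n.
Proof. by rewrite !mulr_gt0 ?inv_gt0 // invr_gt0. Qed.

Lemma weight_sum n : e1 / 4 * (1 - inv n) + weight n = e1 / 4 * (1 - inv n.+1).
Proof.
rewrite /weight /inv -mulrDr; congr (_ * _); rewrite -[n.+2%:R]natr1.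
have : n.+1%:R != 0 :> rat by rewrite pnatr_eq0.
have : n.+1%:R + 1 != 0 :> rat by rewrite natr1 pnatr_eq0.
move: (n.+1%:R) => x x1 x0; field; by rewrite x0 x1.
Qed.

Lemma small_joins k (f : nat -> B) n : (forall m a, (m < n)%N -> (a <= f m)%O -> `|nu k a| < ratr (weight m)) ->
  forall a, (a <= joins f n)%O -> `|nu k a| <= ratr (e1 / 4 * (1 - inv n)).
Proof.
elim: n => [|n IH] h a.
  rewrite /joins big_ord0 lex0 => /eqP ->; rewrite (additive0 (add_nu k)) normr0.
  by rewrite /inv invr1 subrr mulr0 rmorph0.
rewrite joinsS => an; rewrite (additive_split (add_nu k) a (f n)) -weight_sum rmorphD addrC.
apply: le_trans (ler_normD _ _) _; apply: lerD.
  apply: IH => [m x mn|]; first by apply: h; exact: ltnW.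
  by rewrite leBLR joinC.
by apply: ltW; apply: h => //; exact: leIr.
Qed.

(** A decreasing sequence of rich index sets decides, for each pair (n, j), whether its measures
    stay below [weight n] on all parts of [c j]; if so, j is small at level n. The boundedness of
    the sequence limits the disjoint exceptions at each level, and the weights are summable, so that
    [no_bumps] applies. *)
Lemma rich_none : rich (fun=> True) -> False.
Proof.
move=> rT; have [C hC] := null_bounded.
have md : mf M (fun p : B * B => (p.1 `\` p.2)%O) by exact: mf_diff mle.
have minv : mf M inv by rewrite /inv; mst.
have minvN : mf N inv by rewrite /inv; mst.
have mweight : mf M weight by rewrite /weight; mst.
have mwit : ms M (fun p : nat * B * nat * nat => witnesses p.1.1.1 p.1.1.2 p.1.2 p.2).
  by rewrite /witnesses /negligible; mst.
have [||E mE hE] := choice_ext HV HP HG (T := nat) (Z := B) (R := fun n b =>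
    (exists b, witnesses (dig n 0) b (dig n 1) (dig n 2)) -> witnesses (dig n 0) b (dig n 1) (dig n 2)).
- by mst.
- by move=> n; have [[b hb]|nb] := pselect (exists b, witnesses (dig n 0) b (dig n 1) (dig n 2));
    [exists b|exists \bot%O].
have [|c mcN [c0 _ cj cd cE]] := closed_algebra (W := fun n _ => E n); first by mst.
have mc : mf M c := NM mcN.
have richc Z q d : rich Z -> exists k i, Z k /\ witnesses k (c i) q d.
  move=> /(_ q d)[k [b [Zk w]]].
  have [x hx] := dig_ex 3 (fun l => match l with 0 => k | 1 => q | _ => d end)%N.
  have [i ei] := cE x 0%N; exists k, i; split=> //.
  by have := hE x; rewrite !hx //= ei; apply; exists b.
pose (A := fun s k => forall a, (a <= c (un s).2)%O -> `|nu k a| < ratr (weight (un s).1)).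
have mA : ms M (fun p : nat * nat => A p.1 p.2) by rewrite /A; mst.
(* The half of Z that satisfies [A s] is kept if it is rich, and the other half otherwise. *)
pose (cut_ := fun s (Z : pow M nat) k => sval Z k /\ (A s k <-> rich (fun k => sval Z k /\ A s k))).
have mcut : ms M (fun p : nat * pow M nat * nat => cut_ p.1.1 p.1.2 p.2).
  by rewrite /cut_ /rich; mst.
have mcut1 s Z : ms M (cut_ s Z).
  by refine (ms_pre3 (a := fun=> s) (b := fun=> Z) (c := fun k => k) mcut _ _ _); mst.
pose (step := fun s Z => exist _ _ (mcut1 s Z) : pow M nat).
have mstep : mf M (fun p : nat * pow M nat => step p.1 p.2) by apply: mf_pow.
have mall : ms M (fun _ : nat => True) by mst.
pose (Z := fix Z s := if s is s'.+1 then step s' (Z s') else exist _ _ mall : pow M nat).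
have ZS s k : sval (Z s.+1) k <-> sval (Z s) k /\ (A s k <-> rich (fun k => sval (Z s) k /\ A s k)) by [].
have mZ : mf M Z.
  have mZ2 : mf M (fun q : nat * nat => Z q.2).
    by apply: (mf_rec (g := fun _ : nat => exist _ _ mall : pow M nat)
      (h := fun _ s z => step s z) (f := fun _ s => Z s)) => //; by mst.
  by refine (mf_comp (f := fun n : nat => (n, n)) (g := fun q => Z q.2) _ mZ2); mst.
have richZ s : rich (fun k => sval (Z s) k).
  elim: s => [|s IH] /=; first by [].
  have [r|nr] := pselect (rich (fun k => sval (Z s) k /\ A s k)).
    by move=> q d; have [k [b [[Zk Ak] w]]] := r q d; exists k, b; split.
  have [//|r] := rich_split (A s) IH.
  by move=> q d; have [k [b [[Zk Ak] w]]] := r q d; exists k, b; split.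
have Zdec s s' k : (s <= s')%N -> sval (Z s') k -> sval (Z s) k.
  by move=> /subnK <-; elim: (s' - s)%N => // x IH; rewrite addSn => /ZS[/IH].
pose (small := fun n j => rich (fun k => sval (Z (pr n j)) k /\ A (pr n j) k)).
have mpr : mf M (fun p : nat * nat => pr p.1 p.2) by rewrite /pr; mst.
have msm : ms M (fun p : nat * nat => small p.1 p.2) by rewrite /small /rich; mst.
have decide s n j k : (pr n j < s)%N -> sval (Z s) k ->
    (small n j <-> forall a, (a <= c j)%O -> `|nu k a| < ratr (weight n)).
  move=> /Zdec h /h /ZS[_]; rewrite {1}/A un_pr /= => e; exact: iff_sym e.
(* L disjoint exceptions at level n need L times [weight n] of a variation that is at most twice
   |C|; inserting the weight gives at most [K0] times (n + 1)(n + 2) of them. *)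
pose K0 := Num.bound (ratr (4 / e1) * (`|C| + `|C|)).
apply: (no_bumps HV HP HG Hmeager Hlaver HB Hsigma mnu add_nu bv_nu null_nu
  (c := c) (Ks := fun n => (K0 * (n.+1 * n.+2))%N) (small := small) (q0 := e1 / 2)) => //.
- by rewrite divr_gt0.
- by mst.
- move=> n q d; have [k [b [Zk w]]] := richZ (pr n 0) q d; exists k, b; split=> //; split=> //.
  move=> a; rewrite un_pr /= c0 lex0 => /eqP ->.
  by rewrite (additive0 (add_nu k)) normr0 ltr0q weight_gt0.
- move=> n t L dt ns; pose s := (\max_(r < L) pr n (t r)).+1.
  have [k [_ [Zk _]]] := richZ s 0%N 0%N.
  have /choice[a ha] r : exists a, (r < L)%N -> (a <= c (t r))%O /\ ratr (weight n) <= `|nu k a|.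
    have [rL|rL] := ltnP r L; last by exists \bot%O.
    apply: contrapT => na; apply: (ns r rL); apply/(decide s n (t r) k) => //.
      by rewrite ltnS; exact: (leq_bigmax (F := fun r : 'I_L => pr n (t r)) (Ordinal rL)).
    move=> a aj; rewrite ltNge; apply/negP => h; apply: na; exists a.
    by [].
  have := variation_le (add_nu k) (hC k) (pairwise_disjoint (a := a) (L := L) _).
  move=> /(_ (fun i j iL jL ij => disjointW (ha i iL).1 (ha j jL).1 (dt i j iL jL ij))).
  rewrite big_map => le; have {le} : L%:R * ratr (weight n) <= `|C| + `|C|.
    apply: le_trans (le_trans le _); last by apply: lerD; exact: ler_norm.
    have -> : iota 0 L = index_iota 0 L by rewrite /index_iota subn0.
    rewrite mulr_natl -{1}(subn0 L) -sumr_const_nat.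
    by rewrite big_seq [leRHS]big_seq; apply: ler_sum => j; rewrite mem_iota subn0 /= => /ha[].
  move=> le; rewrite -(ler_nat R) natrM.
  have e1R : 0 < ratr e1 :> R by rewrite ltr0q.
  have P0 : 0 < ((n.+1 * n.+2)%N)%:R :> R by rewrite ltr0n.
  apply: (@le_trans _ _ (ratr (4 / e1) * (`|C| + `|C|) * (n.+1 * n.+2)%N%:R)); last first.
    by rewrite ler_pM2r // ltW // archi_boundP // mulr_ge0 ?addr_ge0 // ler0q divr_ge0 // ltW.
  have -> : L%:R = ratr (4 / e1) * (L%:R * ratr (weight n)) * (n.+1 * n.+2)%N%:R :> R.
    rewrite -!(ratr_nat R) -!rmorphM; congr ratr; rewrite /weight /inv natrM.
    have h1 : n.+1%:R != 0 :> rat by rewrite pnatr_eq0.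
    have h2 : n.+2%:R != 0 :> rat by rewrite pnatr_eq0.
    move: (n.+1%:R) (n.+2%:R) h1 h2 => x y x0 y0; field; by rewrite x0 y0 (gt_eqF e1_gt0).
  by rewrite ler_pM2r // ler_pM2l // ltr0q divr_gt0.
(* At stage s all pairs (m, j) with m < n and j < q have been decided. *)
move=> n L q; pose s := (\max_(m < n) \max_(j < q) pr m j).+1.
have sP m j : (m < n)%N -> (j < q)%N -> (pr m j < s)%N.
  move=> mn jq; rewrite ltnS; apply: leq_trans (leq_bigmax (Ordinal mn)) => /=.
  exact: (leq_bigmax (F := fun j : 'I_q => pr m j) (Ordinal jq)).
(* Out of [e1], one quarter is spent on making the witnesses disjoint and one quarter on subtracting
   small members, which leaves the half required as [q0]. *)
have [t dt ht] : exists2 t, disjoint_family c t L & forall r, (r < L)%N ->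
    exists k, [/\ (n <= k)%N, sval (Z s) k & ratr (e1 * (3 / 4)) <= `|nu k (c (t r))|].
  have [D hD] : exists D, inv D <= e1 / 4.
    exists (Num.bound (4 / e1)); rewrite /inv -[leRHS]invrK lef_pV2 ?posrE ?ltr0n //; last first.
      by rewrite invr_gt0 divr_gt0.
    rewrite invf_div; apply: ltW; apply: lt_le_trans (archi_boundP _) _; last by rewrite ler_nat.
    by rewrite divr_ge0 // ltW.
  suff /(_ 0%N 0%N)[t [u [dt _ _ ht]]] : forall q' d', exists t u, [/\ disjoint_family c t L,
      forall r, (r < L)%N -> (c (t r) <= c u)%O, negligible q' d' (c u) &
      forall r, (r < L)%N -> exists k,
        [/\ (n <= k)%N, sval (Z s) k & ratr (e1 * (3 / 4)) <= `|nu k (c (t r))|]].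
    by exists t.
  elim: L => [|L IH] q' d'.
    exists id, 0%N; split=> // i a _; rewrite c0 lex0 => /eqP ->.
    by rewrite (additive0 (add_nu i)) normr0 ltr0q inv_gt0.
  (* The new witness is taken first; the others then lie in an element [c u] that is negligible for
     its index k, so that removing [c u] costs it little. The precision [(d'.*2).+1] is half of
     [inv d'], as two negligible pieces are joined. *)
  have [k [i [Zk [w1 w2 w3]]]] := richc _ (maxn q' n) (d'.*2).+1 (richZ s).
  have [t [u [dt tu nu_ ht]]] := IH (maxn q' k.+1) (maxn (d'.*2).+1 D).
  have [j ej] := cd i u; have [v ev] := cj i u.
  exists (fun r => if (r == L)%N then j else t r), v; split.
  - apply: disjoint_extend => // r rL; rewrite -ej; apply/eqP.
    by rewrite disj_leC (le_trans (tu r rL)) // lexC leBC.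
  - move=> r; rewrite ltnS leq_eqVlt; case: eqP => [_ _|_ /= rL]; rewrite -ev -?ej.
      by apply: le_trans (leBx _ _) _; exact: leUl.
    by apply: le_trans (tu r rL) _; exact: leUr.
  - move=> x a xq; rewrite -ev => au; rewrite (additive_split (add_nu x) a (c u)).
    have h1 : `|nu x (a `&` c u)%O| < ratr (inv (d'.*2).+1).
      apply: lt_le_trans (nu_ x _ _ (leIr _ _)) (inv_le (leq_maxl _ _)).
      by rewrite leq_max xq.
    have h2 : `|nu x (a `\` c u)%O| < ratr (inv (d'.*2).+1).
      by apply: w1; [rewrite leq_max xq|rewrite leBLR joinC].
    apply: le_lt_trans (ler_normD _ _) _; apply: lt_le_trans (ltrD h1 h2) _.
    rewrite -rmorphD ler_rat /inv.
    have -> : ((d'.*2).+2)%:R = d'.+1%:R * 2 :> rat by rewrite -doubleS -muln2 natrM.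
    have h0 : d'.+1%:R != 0 :> rat by rewrite pnatr_eq0.
    move: (d'.+1%:R) h0 => x' h0; rewrite le_eqVlt; apply/orP; left; apply/eqP; field; exact: h0.
  move=> r; rewrite ltnS leq_eqVlt; case: eqP => [_ _|_ /= rL]; last exact: ht.
  exists k; split=> //; first by apply: leq_trans w3; exact: leq_maxr.
  have h1 : `|nu k (c i `&` c u)%O| < ratr (inv D).
    apply: lt_le_trans (nu_ k _ _ (leIr _ _)) (inv_le (leq_maxr _ _)).
    by rewrite leq_max ltnSn orbT.
  move: w2; rewrite (additive_split (add_nu k) (c i) (c u)) -ej => w2.
  have := le_trans w2 (ler_normD _ _).
  have : ratr (inv D) <= ratr (e1 / 4) :> R by rewrite ler_rat.
  have -> : ratr e1 = ratr (e1 * (3 / 4)) + ratr (e1 / 4) :> R.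
    by rewrite -rmorphD; congr ratr; field.
  move: h1; move: (ratr _) (ratr _) (ratr _) => x y z; lra.
exists t => // r rL; have [k [nk Zk hk]] := ht r rL; exists k; split=> // y hy.
have := @small_joins k (fun m => c (dig y m)) n _ (c (t r) `&` joins (fun m => c (dig y m)) n)%O.
have small_y m a : (m < n)%N -> (a <= c (dig y m))%O -> `|nu k a| < ratr (weight m).
  by move=> mn; have [sm yq] := hy m mn; apply: (decide s m (dig y m) k _ Zk).1 => //; exact: sP.
move=> /(_ small_y (leIr _ _)) h.
have h' : `|nu k (c (t r) `&` joins (fun m => c (dig y m)) n)%O| <= ratr (e1 / 4).
  apply: le_trans h _; rewrite ler_rat ler_piMr ?(divr_ge0 (ltW e1_gt0)) // gerBl; exact: ltW (inv_gt0 n).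
move: hk h'; rewrite (additive_split (add_nu k) (c (t r)) (joins (fun m => c (dig y m)) n)) => h1 h2.
have := le_trans h1 (ler_normD _ _).
have -> : ratr (e1 * (3 / 4)) = ratr (e1 / 2) + ratr (e1 / 4) :> R.
  by rewrite -rmorphD; congr ratr; field.
move: h2; move: (ratr _) (ratr _) => x z; lra.
Qed.

End Uncontrolled.

(** Uniform absolute continuity with respect to finitely many terms of the sequence itself, whose
    variations then serve as a control measure. *)
Definition controlled (mu : nat -> B -> R) : Prop := forall eps : R, 0 < eps ->
  exists q (delta : R), 0 < delta /\ forall b,
    (forall i a, (i < q)%N -> (a <= b)%O -> `|mu i a| < delta) -> forall k, `|mu k b| < eps.

Theorem null_controlled : controlled nu.
Proof.
move=> eps eps0; have [e1 /andP[e10 e1e]] := rat_between eps0.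
rewrite ltr0q in e10; apply: contrapT => nc; apply: (rich_none e10) => q d.
(* The second entry of the minimum forces the index of a counterexample to be at least q. *)
pose delta := Num.min (ratr (inv d)) (ratr e1) : R.
have d0 : 0 < delta by rewrite lt_min !ltr0q inv_gt0.
apply: contrapT => nk; apply: nc; exists q, delta; split=> // b hb k.
rewrite ltNge; apply/negP => ek; apply: nk; exists k, b; split=> //.
have e1k : ratr e1 <= `|nu k b| by apply: le_trans ek; exact: ltW.
split=> //; first by move=> i a iq ab; have := hb i a iq ab; rewrite lt_min => /andP[].
rewrite leqNgt; apply/negP => kq; have := hb k b kq (lexx b).
by rewrite lt_min => /andP[_]; rewrite ltNge e1k.
Qed.

End Control.

(** * Jordan decomposition and total variation *)

Section Variation.
Context {R : realType} {d : Order.disp_t} {B : ctbDistrLatticeType d}.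
Variables (m : B -> R) (C : R).
Hypotheses (add : additive_on m) (hC : forall a, `|m a| <= C).
Local Open Scope order_scope.

Definition pos_part (f : B -> R) (b : B) : R := sup [set f a | a in [set a | a <= b]].

Lemma pos_part_has_sup b : has_sup [set m a | a in [set a | a <= b]].
Proof.
split; first by exists (m b), b => //=; exact: lexx.
by exists C => _ [a _ <-]; apply: le_trans (hC a); exact: ler_norm.
Qed.

Lemma pos_part_ge a b : a <= b -> (m a <= pos_part m b)%R.
Proof. by move=> ab; apply: sup_upper_bound; [exact: pos_part_has_sup|exists a]. Qed.

Lemma pos_part_le b t : (forall a, a <= b -> (m a <= t)%R) -> (pos_part m b <= t)%R.
Proof. by move=> h; apply: sup_le_ub; [exact: (pos_part_has_sup b).1|move=> _ [a ab <-]; exact: h]. Qed.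

Lemma pos_part_ge0 b : (0 <= pos_part m b)%R.
Proof. by rewrite -(additive0 add); exact/pos_part_ge/le0x. Qed.

Lemma pos_part_add : additive_on (pos_part m).
Proof.
move=> b c bc; apply/eqP; rewrite eq_le; apply/andP; split.
  apply: pos_part_le => x xbc; rewrite (additive_split add x b) lerD //.
    by apply: pos_part_ge; exact: leIr.
  by apply: pos_part_ge; rewrite leBLR.
rewrite -lerBrDr; apply: pos_part_le => x xb; rewrite lerBrDr -lerBrDl.
apply: pos_part_le => y yc; rewrite lerBrDl -add; last exact: disjointW bc.
by apply: pos_part_ge; exact: leU2.
Qed.

Lemma pos_part_ltP b t : (t < pos_part m b)%R <-> exists a, a <= b /\ (t < m a)%R.
Proof.
split=> [h|[a [ab ta]]]; last exact: lt_le_trans ta (pos_part_ge ab).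
apply: contrapT => n; move: h; rewrite ltNge => /negP; apply; apply: pos_part_le => a ab.
by rewrite leNgt; apply/negP => h; apply: n; exists a.
Qed.

End Variation.

Section TotalVariation.
Context {R : realType} {d : Order.disp_t} {B : ctbDistrLatticeType d}.
Variables (m : B -> R) (C : R).
Hypotheses (add : additive_on m) (hC : forall a, `|m a| <= C).
Local Open Scope order_scope.
Let opp a : R := (- m a)%R.

Lemma add_opp : additive_on opp.
Proof. by move=> a b ab; rewrite /opp add // opprD. Qed.

Lemma opp_le a : (`|opp a| <= C)%R. Proof. by rewrite normrN. Qed.

Definition total_variation b : R := (pos_part m b + pos_part opp b)%R.

Lemma total_variation_add : additive_on total_variation.
Proof.
move=> b c bc; rewrite /total_variation (pos_part_add add hC bc) (pos_part_add add_opp opp_le bc).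
by rewrite addrACA.
Qed.

Lemma total_variation_ge0 b : (0 <= total_variation b)%R.
Proof. by apply: addr_ge0; [exact: (pos_part_ge0 add hC)|exact: (pos_part_ge0 add_opp opp_le)]. Qed.

Lemma norm_le_variation b : (`|m b| <= total_variation b)%R.
Proof.
have p0 := pos_part_ge0 add hC b; have n0 := pos_part_ge0 add_opp opp_le b.
have h1 := pos_part_ge hC (lexx b); have h2 := pos_part_ge opp_le (lexx b).
by rewrite /total_variation ler_norml /opp in n0 h1 h2 *; apply/andP; split; lra.
Qed.

Lemma total_variation_le b : (total_variation b <= C + C)%R.
Proof.
apply: lerD; [apply: (pos_part_le hC) => a _|apply: (pos_part_le opp_le) => a _].
  by apply: le_trans (hC a); exact: ler_norm.
by apply: le_trans (opp_le a); exact: ler_norm.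
Qed.

End TotalVariation.

Lemma positive_mono (R : realType) d (B : ctbDistrLatticeType d) (m : B -> R) (a b : B) :
  additive_on m -> (forall a, 0 <= m a) -> (a <= b)%O -> m a <= m b.
Proof. by move=> add m0 ab; rewrite (additive_sub add ab) lerDl. Qed.

(** * Strict convexity and small convex combinations *)

Section Hypotenuse.
Variable R : realType.
Implicit Types l x y K t : R.

Definition hyp l x : R := Num.sqrt (l ^+ 2 + x ^+ 2).

Lemma hyp_ge0 l x : 0 <= hyp l x. Proof. exact: sqrtr_ge0. Qed.

Lemma hyp_sqr l x : hyp l x ^+ 2 = l ^+ 2 + x ^+ 2.
Proof. by rewrite sqr_sqrtr // addr_ge0 ?sqr_ge0. Qed.

Lemma hyp_le l x t : 0 <= t -> l ^+ 2 + x ^+ 2 <= t ^+ 2 -> hyp l x <= t.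
Proof. by move=> t0 h; rewrite -(ler_pXn2r (n := 2)) ?nnegrE ?hyp_ge0 // hyp_sqr. Qed.

Lemma hyp_scalar l x l' x' : l * l' + x * x' <= hyp l x * hyp l' x'.
Proof.
apply: le_trans (ler_norm _) _; rewrite -(ler_pXn2r (n := 2)) ?nnegrE ?mulr_ge0 ?hyp_ge0 //.
rewrite exprMn !hyp_sqr real_normK ?num_real //.
have := sqr_ge0 (l * x' - x * l'); nra.
Qed.

Lemma hyp_triangle l x l' x' : hyp (l + l') (x + x') <= hyp l x + hyp l' x'.
Proof.
apply: hyp_le; first by rewrite addr_ge0 ?hyp_ge0.
have h := hyp_scalar l x l' x'; rewrite [leRHS]sqrrD !hyp_sqr; lra.
Qed.

Lemma hyp_double l x : hyp (l + l) (x + x) = 2 * hyp l x.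
Proof.
apply/eqP; rewrite -(eqrXn2 (n := 2)) ?mulr_ge0 ?hyp_ge0 // exprMn !hyp_sqr.
by apply/eqP; ring.
Qed.

Lemma hyp_le_add l x : 0 <= l -> hyp l x <= l + `|x|.
Proof.
move=> l0; apply: hyp_le; first by rewrite addr_ge0.
have h : 0 <= l * `|x| by rewrite mulr_ge0.
rewrite [leRHS]sqrrD real_normK ?num_real //; lra.
Qed.

(* Quantitative strict convexity of the norm, transversally to the vector (l, 0). *)
Lemma hyp_defect l x y K t : 0 <= l -> 0 <= K -> 0 < t -> `|x| <= K * l -> `|y| <= K * l ->
  `|x - y| <= t * l + 4 * (K + 1) ^+ 3 / t * (hyp l x + hyp l y - hyp (l + l) (x + y)).
Proof.
move=> l0 K0 t0 xl yl; set D := hyp l x + hyp l y - _.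
have D0 : 0 <= D by rewrite subr_ge0 hyp_triangle.
move: l0; rewrite le_eqVlt => /orP[/eqP e|l0].
  move: xl yl; rewrite -e !mulr0 !normr_le0 => /eqP -> /eqP ->.
  rewrite subrr normr0 add0r mulr_ge0 //.
  by rewrite divr_ge0 ?mulr_ge0 ?exprn_ge0 ?addr_ge0 // ltW.
pose p := hyp l x; pose q := hyp l y; pose s := hyp (l + l) (x + y).
have [p0 q0 s0] : [/\ 0 <= p, 0 <= q & 0 <= s] by split; exact: hyp_ge0.
have pl : p <= (K + 1) * l.
  by apply: le_trans (hyp_le_add _ (ltW l0)) _; rewrite mulrDl mul1r addrC lerD2r.
have ql : q <= (K + 1) * l.
  by apply: le_trans (hyp_le_add _ (ltW l0)) _; rewrite mulrDl mul1r addrC lerD2r.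
have spq : s <= p + q by exact: hyp_triangle.
have ep : p ^+ 2 = l ^+ 2 + x ^+ 2 := hyp_sqr l x.
have eq : q ^+ 2 = l ^+ 2 + y ^+ 2 := hyp_sqr l y.
have es : s ^+ 2 = (l + l) ^+ 2 + (x + y) ^+ 2 := hyp_sqr _ _.
have g0 : 0 <= p * q - (l ^+ 2 + x * y).
  by have := hyp_scalar l x l y; rewrite -/p -/q expr2 subr_ge0.
(* The defect [D] is the difference of p + q and s. Multiplied by their sum it gives twice the
   defect in the Cauchy-Schwarz inequality, which Lagrange's identity relates to the square of x -
   y. *)
have e1 : D * (p + q + s) = 2 * (p * q - (l ^+ 2 + x * y)).
  rewrite /D -/p -/q -/s; have -> : (p + q - s) * (p + q + s) = p ^+ 2 + q ^+ 2 + 2 * (p * q) - s ^+ 2 by ring.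
  by rewrite ep eq es; ring.
have e2 : (p * q - (l ^+ 2 + x * y)) * (p * q + (l ^+ 2 + x * y)) = l ^+ 2 * (x - y) ^+ 2.
  have -> : (p * q - (l ^+ 2 + x * y)) * (p * q + (l ^+ 2 + x * y)) =
    p ^+ 2 * q ^+ 2 - (l ^+ 2 + x * y) ^+ 2 by ring.
  by rewrite ep eq; ring.
pose k := (K + 1) * l; have k0 : 0 <= k by rewrite mulr_ge0 ?addr_ge0 // ltW.
have b1 : p * q + (l ^+ 2 + x * y) <= 2 * k ^+ 2.
  have pq : p * q <= k ^+ 2 by rewrite expr2 ler_pM.
  have h : l ^+ 2 + x * y <= p * q by rewrite -subr_ge0.
  lra.
have b2 : D * (p + q + s) <= D * (4 * k) by rewrite ler_wpM2l // /k; lra.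
have b3 : l ^+ 2 * (x - y) ^+ 2 <= (D * (2 * k)) * (2 * k ^+ 2).
  rewrite -e2; apply: (@le_trans _ _ ((p * q - (l ^+ 2 + x * y)) * (2 * k ^+ 2))).
    exact: ler_wpM2l.
  by rewrite ler_wpM2r ?mulr_ge0 ?exprn_ge0 //; lra.
have b4 : (x - y) ^+ 2 <= 4 * (K + 1) ^+ 3 * l * D.
  rewrite -(ler_pM2l (exprn_gt0 2 l0)); apply: le_trans b3 _; rewrite /k.
  by rewrite le_eqVlt; apply/orP; left; apply/eqP; ring.
(* This trades the square of x - y for a linear bound, with t as free parameter. *)
have amgm : `|x - y| * (t * l) <= (t * l) ^+ 2 + (x - y) ^+ 2.
  have := sqr_ge0 (`|x - y| - t * l); rewrite sqrrB real_normK ?num_real //.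
  have := sqr_ge0 (x - y); have := sqr_ge0 (t * l); nra.
have tl0 : 0 < t * l by rewrite mulr_gt0.
rewrite -(ler_pM2r tl0); apply: le_trans amgm _.
have -> : (t * l + 4 * (K + 1) ^+ 3 / t * D) * (t * l) = (t * l) ^+ 2 + 4 * (K + 1) ^+ 3 * l * D.
  by field; rewrite gt_eqF.
by rewrite lerD2l.
Qed.

End Hypotenuse.

Section Energy.
Context {R : realType} {d : Order.disp_t} {B : ctbDistrLatticeType d}.
Variable l : B -> R.
Hypotheses (addl : additive_on l) (l0 : forall a, 0 <= l a).
Implicit Types (u v : B -> R) (s : seq B) (a b : B).

(* Total variation of the vector measure (l, u) over the atoms of the algebra
   generated by s below a. *)
Fixpoint energy u s a : R :=
  if s is b :: s' then energy u s' (a `&` b)%O + energy u s' (a `\` b)%O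
  else hyp (l a) (u a).

(** Refining a partition increases the sum of the norms, by the triangle inequality on each atom. *)
Lemma energy_sub u s a b : additive_on u ->
  energy u s a <= energy u s (a `&` b)%O + energy u s (a `\` b)%O.
Proof.
move=> addu; elim: s a => [|c s ih] a /=.
  by rewrite (additive_split addl a b) (additive_split addu a b) hyp_triangle.
apply: le_trans (lerD (ih (a `&` c)%O) (ih (a `\` c)%O)) _.
rewrite !diffE -!meetA ![(c `&` _)%O]meetC ![(~` c `&` _)%O]meetC addrACA; exact: lexx.
Qed.

Lemma energy_cat_r u s t a : additive_on u -> energy u t a <= energy u (s ++ t) a.
Proof.
move=> addu; elim: s a => [|b s ih] a //=.
by apply: le_trans (energy_sub t a b addu) _; exact: lerD.
Qed.

Lemma energy_le u C s a : additive_on u -> (forall b, `|u b| <= C) ->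
  energy u s a <= l a + total_variation u a.
Proof.
move=> addu hC; elim: s a => [|b s ih] a /=.
  apply: le_trans (hyp_le_add _ (l0 a)) _; rewrite lerD2l; exact: (norm_le_variation addu hC).
rewrite (additive_split addl a b) (additive_split (total_variation_add addu hC) a b) addrACA.
exact: lerD.
Qed.

Definition midpoint u v b : R := (u b + v b) / 2.

(** Summed over the atoms, the loss in the triangle inequality for the vectors (l, u) and (l, v);
    each summand is the defect bounded from below in [hyp_defect]. *)
Definition defect u v s a : R := energy u s a + energy v s a - 2 * energy (midpoint u v) s a.

Lemma defect_cons u v b s a :
  defect u v (b :: s) a = defect u v s (a `&` b)%O + defect u v s (a `\` b)%O.
Proof. by rewrite /defect /=; ring. Qed.

Lemma defect_nil u v a : defect u v [::] a = hyp (l a) (u a) + hyp (l a) (v a) - hyp (l a + l a) (u a + v a).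
Proof.
rewrite /defect /= -hyp_double /midpoint; congr (_ - hyp _ _).
by field.
Qed.

Lemma defect_ge0 u v s a : 0 <= defect u v s a.
Proof.
elim: s a => [|b s ih] a; last by rewrite defect_cons addr_ge0.
by rewrite defect_nil subr_ge0 hyp_triangle.
Qed.

(* On g the measures u or v are large compared with l, so that g is l-small once K is large. *)
Lemma defect_bound u v C K t s a : additive_on u -> additive_on v ->
  (forall b, `|u b| <= C) -> (forall b, `|v b| <= C) -> 0 <= K -> 0 < t ->
  exists2 g, (g <= a)%O & K * l g <= total_variation u g + total_variation v g /\
    `|u (a `\` g)%O - v (a `\` g)%O| <= t * l a + 4 * (K + 1) ^+ 3 / t * defect u v s a.
Proof.
move=> addu addv uC vC K0 t0.
have M0 : 0 <= 4 * (K + 1) ^+ 3 / t.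
  by rewrite divr_ge0 ?mulr_ge0 ?exprn_ge0 ?addr_ge0 // ltW.
elim: s a => [|b s ih] a; last first.
  have [g ga [g1 g2]] := ih (a `&` b)%O; have [h ha [h1 h2]] := ih (a `\` b)%O.
  have gb : (g <= b)%O by apply: le_trans ga _; exact: leIr.
  have hb : (h `&` b = \bot)%O.
    by apply/le_anti; rewrite le0x andbT; apply: le_trans (leI2 ha (lexx b)) _; rewrite diffE -meetA meetCx meetx0.
  have gh : (g `&` h = \bot)%O.
    by apply/le_anti; rewrite le0x andbT -hb meetC; apply: leI2 => //; exact: lexx.
  exists (g `|` h)%O; first by rewrite leUx (le_trans ga (leIl _ _)) (le_trans ha (leBx _ _)).
  split.
    rewrite addl // (total_variation_add addu uC gh) (total_variation_add addv vC gh) mulrDr; lra.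
  have split (m : B -> R) : additive_on m ->
      m (a `\` (g `|` h))%O = m ((a `&` b) `\` g)%O + m ((a `\` b) `\` h)%O.
    move=> addm; rewrite (additive_split addm _ b); congr (m _ + m _).
      have bh : (b <= ~` h)%O by rewrite -disj_leC meetC hb.
      by rewrite !diffE complU -!meetA; congr (_ `&` _)%O; rewrite [(~` h `&` b)%O]meetC (meet_l bh) meetC.
    have bg : (~` b <= ~` g)%O by rewrite leC.
    by rewrite !diffE complU -!meetA; congr (_ `&` _)%O; rewrite meetCA (meet_r bg) meetC.
  rewrite (split u addu) (split v addv) defect_cons (additive_split addl a b) opprD addrACA.
  by apply: le_trans (ler_normD _ _) _; lra.
(* An atom on which u or v is large compared with l goes into g as a whole; on the others
   [hyp_defect] applies. *)
have [h|h] := boolP ((`|u a| <= K * l a) && (`|v a| <= K * l a)).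
  exists \bot%O; first exact: le0x.
  have [ua va] := andP h; rewrite (additive0 addl) mulr0 diffx0 defect_nil; split.
    by rewrite addr_ge0 // (total_variation_ge0 _ uC, total_variation_ge0 _ vC).
  exact: hyp_defect.
exists a; first exact: lexx.
have nu := norm_le_variation addu uC a; have nv := norm_le_variation addv vC a.
have u0 := total_variation_ge0 addu uC a; have v0 := total_variation_ge0 addv vC a.
split; first by move: h; rewrite negb_and -!ltNge => /orP[]h; lra.
rewrite diffxx (additive0 addu) (additive0 addv) subrr normr0.
by apply: addr_ge0; [rewrite mulr_ge0 // ltW|rewrite mulr_ge0 ?defect_ge0].
Qed.
End Energy.

Section Mazur.
Context {R : realType} {d : Order.disp_t} {B : ctbDistrLatticeType d}.
Variables (nu : nat -> B -> R) (C : R).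
Hypotheses (add_nu : forall k, additive_on (nu k)) (nu_le : forall k a, `|nu k a| <= C).
Hypotheses (null_nu : null_sequence nu) (control : controlled nu).
Implicit Types (Z : nat -> Prop).

Inductive comb Z : (B -> R) -> Prop :=
  | comb_base k : Z k -> comb Z (nu k)
  | comb_mid u v : comb Z u -> comb Z v -> comb Z (midpoint u v).

Lemma comb_sub Z Z' u : (forall k, Z k -> Z' k) -> comb Z u -> comb Z' u.
Proof. by move=> h; elim=> [k /h|v w _ hv _ hw]; [exact: comb_base|exact: comb_mid]. Qed.

Lemma comb_additive Z u : comb Z u -> additive_on u.
Proof.
elim=> [k _|v w _ hv _ hw a b ab]; first exact: add_nu.
by rewrite /midpoint hv // hw //; field.
Qed.

Lemma comb_norm Z u a e : comb Z u -> (forall k, Z k -> `|nu k a| <= e) -> `|u a| <= e.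
Proof.
move=> cu h; elim: cu => [k /h //|v w _ hv _ hw].
rewrite /midpoint normrM (ger0_norm (x := 2^-1)) ?invr_ge0 // ler_pdivrMr //.
by apply: le_trans (ler_normD _ _) _; rewrite mulr_natr mulr2n lerD.
Qed.

Definition tail Z N k : Prop := Z k /\ (N <= k)%N.

(** Let l be the sum of the variations of the controlling terms, and minimize the energy relative to
    l over combinations from the tails of Z. Two nearly minimal combinations have a midpoint of
    nearly the same energy, so they nearly agree off an l-small set, on which control makes both
    small. For given a the second one may be taken from a tail that is small at a, so a single u is
    small everywhere. *)
Lemma small_midpoint Z e : 0 < e -> (forall N, exists k, tail Z N k) ->
  exists2 u, comb Z u & forall a, `|u a| <= e.
Proof.
(* Five errors occur: u and v on g, v on a, and the two terms of [defect_bound]. *)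
move=> e0 Zinf; pose e' := e / 5; have e'0 : 0 < e' by rewrite divr_gt0.
have C0 : 0 <= C := le_trans (normr_ge0 _) (nu_le 0 \bot%O).
have [q [dl [dl0 ctl]]] := control e'0.
pose l b := \sum_(i < q) total_variation (nu i) b.
have addl : additive_on l.
  move=> a b ab; rewrite /l -big_split; apply: eq_bigr => i _.
  exact: (total_variation_add (add_nu i) (nu_le i)).
have tv0 i b : 0 <= total_variation (nu i) b := total_variation_ge0 (add_nu i) (nu_le i) b.
have l0 a : 0 <= l a by apply: sumr_ge0 => i _; exact: tv0.
have lsmall b : l b < dl -> forall k, `|nu k b| <= e'.
  move=> lb k; apply/ltW/ctl => i a iq ab; apply: le_lt_trans lb.
  apply: le_trans (norm_le_variation (add_nu i) (nu_le i) a) _.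
  apply: (@le_trans _ _ (total_variation (nu i) b)).
    exact: positive_mono (total_variation_add (add_nu i) (nu_le i)) (tv0 i) ab.
  rewrite /l (bigD1 (Ordinal iq)) //= lerDl; apply: sumr_ge0 => j _; exact: tv0.
have cle N u : comb (tail Z N) u -> forall a, `|u a| <= C.
  by move=> cu a; apply: (comb_norm cu) => k _.
have tvle N u a : comb (tail Z N) u -> total_variation u a <= C + C.
  by move=> cu; exact: (total_variation_le (cle N u cu)).
(* The variations of u and v on g are at most 2 C each, so K times [l g] is at most 4 C, and [l g]
   falls below [dl]. *)
pose K := 4 * C / dl + 1; have K0 : 0 < K by rewrite ltr_wpDl // divr_ge0 ?mulr_ge0 // ltW.
pose t := e' / (l \top%O + 1).
have lt0 : 0 < l \top%O + 1 by rewrite ltr_wpDl.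
have t0 : 0 < t by rewrite divr_gt0.
pose L := 4 * (K + 1) ^+ 3 / t.
have L0 : 0 < L by rewrite divr_gt0 // mulr_gt0 // exprn_gt0 // addr_gt0.
pose eta := e' / (4 * L); have eta0 : 0 < eta by rewrite divr_gt0 // mulr_gt0.
(* The supremum of S is the limit along the tails of the infimum of the energies, the energy of u
   being the supremum over all partitions s. *)
pose S := [set x | exists N, forall u, comb (tail Z N) u -> exists s, x < energy l u s \top%O].
have Ssup : has_sup S.
  split.
    exists (-1), 0%N => u _; exists [::] => /=; apply: lt_le_trans (hyp_ge0 _ _); lra.
  exists (l \top%O + (C + C)) => x [N h]; have [k Zk] := Zinf N.
  have cu := comb_base Zk; have [s hs] := h _ cu; apply: le_trans (ltW hs) _.
  apply: le_trans (energy_le addl l0 _ _ (add_nu k) (nu_le k)) _.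
  by rewrite lerD2l; exact: tvle cu.
have [x Sx hx] := sup_adherent eta0 Ssup.
have [N0 hN0] : S x := Sx.
have near N : exists2 u, comb (tail Z N) u & forall s, energy l u s \top%O <= sup S + eta.
  apply: contrapT => n; have : S (sup S + eta).
    exists N => u cu; apply: contrapT => m; apply: n; exists u => // s.
    by rewrite leNgt; apply/negP => h; apply: m; exists s.
  by move/(sup_upper_bound Ssup); lra.
have [u cu hu] := near N0.
exists u; first by apply: comb_sub cu => k [].
move=> a; have [n hn] := null_nu a e'0.
have [v cv hv] := near (maxn N0 n).
have cv0 : comb (tail Z N0) v.
  by apply: comb_sub cv => k [Zk]; rewrite geq_max => /andP[].
have [s hs] := hN0 _ (comb_mid cu cv0).
have addu := comb_additive cu; have addv := comb_additive cv.
have addw := comb_additive (comb_mid cu cv0).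
have [g ga [g1 g2]] := defect_bound addl l0 s a addu addv (cle _ _ cu) (cle _ _ cv) (ltW K0) t0.
have lg : l g < dl.
  rewrite -(ltr_pM2l K0); apply: le_lt_trans g1 _.
  have h1 := tvle _ _ g cu; have h2 := tvle _ _ g cv.
  apply: (@le_lt_trans _ _ (4 * C)); first lra.
  have -> : K * dl = 4 * C + dl by rewrite /K; field; rewrite gt_eqF.
  by rewrite ltrDl.
have sm m Z' b : comb Z' m -> (forall k, `|nu k b| <= e') -> `|m b| <= e'.
  by move=> cm h; apply: (comb_norm cm) => k _.
have ug := sm _ _ g cu (lsmall g lg); have vg := sm _ _ g cv (lsmall g lg).
have va : `|v a| <= e'.
  by apply: (comb_norm cv) => k [_]; rewrite geq_max => /andP[_ nk]; apply/ltW/hn.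
have D : L * defect l u v s a <= e'.
  have h : defect l u v s a <= 4 * eta.
    (* With a as the first divider, the defect at a is one of two nonnegative summands of the
       whole. *)
    apply: (@le_trans _ _ (defect l u v (a :: s) \top%O)).
      by rewrite defect_cons meet1x lerDl defect_ge0.
    have h1 := hu (a :: s); have h2 := hv (a :: s).
    have h3 := energy_cat_r addl [:: a] s \top%O addw; rewrite /= in h3.
    rewrite /defect /=; rewrite /= in h1 h2; lra.
  apply: (@le_trans _ _ (L * (4 * eta))); first by rewrite ler_pM2l.
  by rewrite le_eqVlt; apply/orP; left; apply/eqP; rewrite /eta; field; rewrite gt_eqF.
have tl : t * l a <= e'.
  rewrite /t mulrAC ler_pdivrMr // ler_pM2l //.
  by apply: le_trans (positive_mono addl l0 (lex1 a)) _; rewrite lerDl.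
have ea := additive_sub addu ga; have eb := additive_sub addv ga.
have e5 : e = e' + e' + e' + e' + e' by rewrite /e'; field.
have {g2}g2 := le_trans g2 (lerD tl D).
move: ug vg va g2; rewrite !ler_norml ea eb e5 => /andP[? ?] /andP[? ?] /andP[? ?] /andP[? ?].
by apply/andP; split; lra.
Qed.
End Mazur.

(** * Complex functions and the Stone space inside V[G] *)

Section ComplexNorm.
Variable R : realType.
Implicit Type z : R[i].

Lemma normcE z : Normc.normc z = hyp (complex.Re z) (complex.Im z). Proof. by case: z. Qed.

Lemma Re_le_normc z : `|complex.Re z| <= Normc.normc z.
Proof.
rewrite normcE -(ler_pXn2r (n := 2)) ?nnegrE ?hyp_ge0 // hyp_sqr real_normK ?num_real //.
by rewrite lerDl sqr_ge0.
Qed.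

Lemma Im_le_normc z : `|complex.Im z| <= Normc.normc z.
Proof.
rewrite normcE -(ler_pXn2r (n := 2)) ?nnegrE ?hyp_ge0 // hyp_sqr real_normK ?num_real //.
by rewrite lerDr sqr_ge0.
Qed.

Lemma normc_le_add z : Normc.normc z <= `|complex.Re z| + `|complex.Im z|.
Proof.
rewrite normcE; apply: le_trans (hyp_le_add _ (normr_ge0 (complex.Re z))).
by rewrite le_eqVlt /hyp real_normK ?num_real ?eqxx.
Qed.

End ComplexNorm.

Section ComplexIn.
Context {N : cls} {hN : zermelo N} {R : realType}.

Definition cn : Type := (rn N R * rn N R)%type.

Lemma code_complex (z : R[i]) : code z = op (code (complex.Re z)) (code (complex.Im z)).
Proof. exact: code_pair. Qed.

Lemma code_complexP (z : R[i]) :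
  N (code z) <-> N (code (complex.Re z)) /\ N (code (complex.Im z)).
Proof. by rewrite code_complex; split=> [/(z_op_inv hN)|[]]; last exact: z_op. Qed.

Definition to_cn (z : R[i]) (hz : N (code z)) : cn :=
  (exist _ (complex.Re z) (((code_complexP z).1 hz).1), exist _ (complex.Im z) (((code_complexP z).1 hz).2)).

Lemma code_to_cn z (hz : N (code z)) : code (to_cn hz) = code z.
Proof. by rewrite code_complex /to_cn code_pair. Qed.

Section Functions.
Context {T : Type} {cT : Coded T} {iT : inN N T}.

Lemma mf_fin {S : Type} {cS : Coded S} (f : T -> S) t : mf N f -> N (code (f t)).
Proof.
move=> hf; have /(z_trans hN hf) : op (code t) (code (f t)) ∈ code f by apply/mem_fun; exists t.
by move/(z_op_inv hN) => [].
Qed.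

Lemma mf_complexP (f : T -> R[i]) :
  mf N f <-> mr N (fun t => complex.Re (f t)) /\ mr N (fun t => complex.Im (f t)).
Proof.
have key (hf : forall t, N (code (f t))) : mf N f <-> mf N (fun t => to_cn (hf t)).
  have e : code (fun t => to_cn (hf t)) = code f by apply: code_fun_eq => t; rewrite code_to_cn.
  by rewrite /mf e.
split=> [h|[h1 h2]].
  have hf t := mf_fin t h; have /(key hf) h0 := h.
  split; [have h1 : mf N (fun t => (to_cn (hf t)).1) by mst|have h1 : mf N (fun t => (to_cn (hf t)).2) by mst];
    exact: mr_rn h1.
have hf t : N (code (f t)) by apply/code_complexP; split; [exact: mr_fin h1 t|exact: mr_fin h2 t].
apply/(key hf); apply: mf_pair.
  exact: ((mr_mf _).2 h1).
exact: ((mr_mf _).2 h2).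
Qed.

End Functions.

Section TwoArguments.
Context {S T : Type} {cS : Coded S} {cT : Coded T} {iS : inN N S} {iT : inN N T}.

Lemma mr_complex2 (f : S -> T -> R[i]) : mf N f ->
  mr N (fun p : S * T => complex.Re (f p.1 p.2)) /\ mr N (fun p : S * T => complex.Im (f p.1 p.2)).
Proof.
move=> hf; have h1 s : mf N (f s) := mf_fin s hf.
have h2 s : mf N (fun t => to_cn (mf_fin t (h1 s))).
  have e : code (fun t => to_cn (mf_fin t (h1 s))) = code (f s).
    by apply: code_fun_eq => t; rewrite code_to_cn.
  by rewrite /mf e; exact: h1.
pose g s : fsp N T cn := exist _ _ (h2 s).
have hg : mf N g.
  have e : code g = code f.
    by apply: code_fun_eq => s; apply: code_fun_eq => t; rewrite code_to_cn.
  by rewrite /mf e.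
split.
  have h : mf N (fun p : S * T => (sval (g p.1) p.2).1) by mst.
  exact: mr_rn h.
have h : mf N (fun p : S * T => (sval (g p.1) p.2).2) by mst.
exact: mr_rn h.
Qed.

End TwoArguments.
End ComplexIn.

Section Points.
Variables (V : class) (HV : transitive_ZFC V).
Variables (dP : Order.disp_t) (P : preorderType dP) (cP : Coded P).
Hypothesis HP : ordered_in V cP.
Variables (G : P -> Prop) (HG : generic V cP G).
Variables (dB : Order.disp_t) (B : ctbDistrLatticeType dB) (cB : Coded B).
Hypothesis HB : ordered_in V cB.

Let N := clsh V.
Let hN : zermelo N := clsh_zfc HV.
Notation M := (extM V cP G).
Let hM : zermelo M := ext_zermelo HV HP HG.
#[local] Existing Instance hN.
#[local] Existing Instance hM.
Let NM x : N x -> M x := @ext_sub V HV dP P cP HP G HG x.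
Let inN_alg : inN N B := inN_algebra HV HB.
#[local] Existing Instance inN_alg.
Let inM_alg : inN M B := inM_algebra HV HP HG HB.
#[local] Existing Instance inM_alg.
Let mle : ms M (fun p : B*B => is_true (p.1 <= p.2)%O) := msM_le HV HP HG HB.
Let mjoin := mf_join mle.
Let mdiff := mf_diff mle.
Local Open Scope order_scope.

Notation point := (stone (ext V cP G) cB).

Definition ideal (I : B -> Prop) : Prop :=
  [/\ I \bot, forall a b, a <= b -> I b -> I a & forall a b, I a -> I b -> I (a `|` b)].

Lemma mf_compl : mf M (fun a : B => ~` a).
Proof.
apply: (mf_iff (g := fun a : B => \top `\` a)); first by move=> a; rewrite diffE meet1x.
by mst.
Qed.

Lemma mf_meet : mf M (fun p : B * B => p.1 `&` p.2).
Proof.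
have hc := mf_compl.
apply: (mf_iff (g := fun p : B * B => p.1 `\` ~` p.2)); last by mst.
by move=> p; rewrite diffE complK.
Qed.

Definition undecided (A : pow M B) b := ~ sval A b /\ ~ sval A (~` b).

Section Extension.
Variable ch : pow M B -> B.
Hypothesis mch : mf M ch.

Lemma ms_extend (A : pow M B) :
  ms M (fun y => sval A y \/ undecided A (ch A) /\ exists a, sval A a /\ y <= a `|` ch A).
Proof. by rewrite /undecided; have hc := mf_compl; mst. Qed.

Definition extend (A : pow M B) : pow M B := exist _ _ (ms_extend A).

Lemma mf_extend : mf M extend.
Proof. by apply: mf_pow => /=; rewrite /undecided; have hc := mf_compl; mst. Qed.

End Extension.

(** The tower that adds an undecided element at each step, chosen by [choice_ext], ends in a proper
    ideal that decides everything; its complement is the required ultrafilter of V[G]. *)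
Theorem prime_ideal (I : B -> Prop) : ms M I -> ideal I -> ~ I \top ->
  exists2 x : point, True & forall a, I a -> ~ sval x a.
Proof.
move=> mI hI nI; have hc := mf_compl.
have mR : ms M (fun p : pow M B * B => (exists b, undecided p.1 b) -> undecided p.1 p.2).
  by rewrite /undecided; mst.
have [|ch mch hch] := choice_ext HV HP HG (R := fun A b => (exists b, undecided A b) -> undecided A b) mR.
  by move=> A; have [[b hb]|n] := pselect (exists b, undecided A b); [exists b|exists \bot].
pose (A0 := exist _ I mI : pow M B).
have [U tU fU] := @tower_top M hM B cB inM_alg A0 (extend ch) (mf_extend mch).
pose (proper := fun A : pow M B => ideal (sval A) /\ ~ sval A \top).
have fle A' y : sval A' y -> sval (extend ch A') y by left.
have iU y : I y -> sval U y by move=> Iy; exact: (tower_base fle tU).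
pose (tw := tower A0 (extend ch)).
have key A : tw A -> proper A.
  have ht := @ms_tower M hM B cB inM_alg A0 (extend ch) (mf_extend mch).
  move=> tA; suff [//] : tw A /\ proper A.
  apply: (tower_ind (F := fun A => tw A /\ proper A) _ _ tA) => [|{tA A}].
    by rewrite /tw /proper /ideal; mst.
  split=> [A [tA [[A1 Ad Aj] A2]]|F hF].
    split; first exact: tower_step.
    have [hu|hu] := pselect (undecided A (ch A)); last first.
      have e y : sval (extend ch A) y -> sval A y by case=> [//|[/hu]].
      split; last by move/e.
      split; first exact: fle.
        by move=> a b ab /e Ab; apply: fle; exact: Ad Ab.
      by move=> a b /e Aa /e Ab; apply: fle; exact: Aj.
    have e y : sval (extend ch A) y -> exists2 a, sval A a & y <= a `|` ch A.
      by case=> [Ay|[_ [a [Aa ya]]]]; [exists y => //; exact: leUl|exists a].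
    have e' a y : sval A a -> y <= a `|` ch A -> sval (extend ch A) y.
      by move=> Aa ya; right; split=> //; exists a.
    split; first split.
    - exact: fle.
    - by move=> a b ab /e[c Ac bc]; apply: (e' c) => //; exact: le_trans bc.
    - move=> a b /e[c Ac ac] /e[c' Ac' bc']; apply: (e' (c `|` c')); first exact: Aj.
      by rewrite leUx (le_trans ac) ?(le_trans bc') // leU2 // ?leUl ?leUr.
    - move=> /e[a Aa ta]; apply: hu.2; apply: Ad Aa.
      have e2 : ~` ch A = ~` ch A `&` a.
        by rewrite -{1}(meet_l (le_trans (lex1 (~` ch A)) ta)) meetUr meetCx joinx0.
      by rewrite e2 leIr.
  have base A : sval F A -> forall y, I y -> sval A y.
    by move=> FA y Iy; exact: (tower_base fle (hF A FA).1).
  have sub A : sval F A -> forall y, sval A y -> sval (union_pow A0 F) y by move=> FA y Ay; right; exists A.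
  have dir y z : sval (union_pow A0 F) y -> sval (union_pow A0 F) z -> exists A : pow M B,
      [/\ proper A, forall w, sval A w -> sval (union_pow A0 F) w, sval A y & sval A z].
    move=> [Iy|[A [FA Ay]]] [Iz|[C [FC Cz]]].
    - by exists A0; split=> //; left.
    - by exists C; split=> //; [exact: (hF C FC).2|exact: sub|exact: base].
    - by exists A; split=> //; [exact: (hF A FA).2|exact: sub|exact: base].
    - have [h|h] := tower_chain (mf_extend mch) fle (hF C FC).1 (hF A FA).1.
        by exists C; split=> //; [exact: (hF C FC).2|exact: sub|exact: h].
      by exists A; split=> //; [exact: (hF A FA).2|exact: sub|apply: h; left].
  split; first by apply: tower_union => A /hF[].
  split; first split.
  - by left; case: hI.
  - by move=> a b ab Ub; have [A [[[_ Ad _] _] s Ab _]] := dir b b Ub Ub; apply: s; exact: Ad Ab.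
  - by move=> a b Ua Ub; have [A [[[_ _ Aj] _] s Aa Ab]] := dir a b Ua Ub; apply: s; exact: Aj.
  - by move=> U1; have [A [[_ nA] _ A1 _]] := dir _ _ U1 U1.
have [[U0 Ud Uj] U1] := key U tU.
have tot b : sval U b \/ sval U (~` b).
  apply: contrapT => n; have hu : undecided U (ch U).
    by apply: hch; exists b; split=> h; apply: n; [left|right].
  apply: hu.1; apply: fU; right; split=> //; exists \bot; split=> //; rewrite join0x; exact: lexx.
have mx : ms M (fun b => ~ sval U b) by mst.
have ux : ultrafilter (fun b => ~ sval U b).
  split.
  - by split=> // /(_ U0).
  - by move=> a b nUa ab Ub; apply: nUa; exact: Ud Ub.
  - move=> a b nUa nUb Uab; have [//|Ua] := tot a; have [//|Ub] := tot b.
    by apply: U1; have := Uj _ _ Uab (Uj _ _ Ua Ub); rewrite -complI joinxC.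
  - move=> a; apply: contrapT => n; apply: U1; rewrite -(joinxC a); apply: Uj; apply: contrapT => h; apply: n.
      by left.
    by right.
have ex : ext V cP G (encode (fun b => ~ sval U b)) by apply/extME.
pose (x := exist (fun x => ultrafilter x /\ ext V cP G (encode x)) _ (conj ux ex) : point).
exists x => // a Ia /=; apply; exact: iU.
Qed.

(** Compactness of the Stone space, in the form in which it is used: a property of clopen sets that
    passes to parts and to joins, and holds near every point, holds for the whole space. *)
Lemma ideal_principle (I : B -> Prop) : ms M I -> ideal I ->
  (forall x : point, exists2 a, sval x a & I a) -> I \top.
Proof.
move=> mI hI h; apply: contrapT => n; have [x _ hx] := prime_ideal mI hI n.
by have [a xa /hx] := h x.
Qed.

Let coded_point : Coded point := @coded_stone (ext V cP G) dB B cB.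
#[local] Existing Instance coded_point.

Lemma point_ms (x : point) : ms M (sval x).
Proof. have [_ h] := svalP x; exact: ((extME HV cP G _).1 h). Qed.

Lemma inM_point_ : inN M point /\ ms M (fun p : point * B => sval p.1 p.2).
Proof.
pose (j := fun x : point => exist _ _ (point_ms x) : pow M B).
have inj : injective (code : point -> hset).
  move=> x y e; have {}e : j x = j y by apply: (@in_inj M _ _ _).
  have : sval x = sval y := congr1 sval e.
  by case: x {e} => x hx; case: y => y hy /= e; apply: eq_exist.
have hc := mf_compl; have hm := mf_meet.
have [||i1 i2] := @inN_image M hM (pow M B) _ point coded_point j inj.
- by [].
- apply: (ms_iff (B := fun A : pow M B => ultrafilter (sval A))).
    move=> [A hA]; split=> [[x ->]|uA]; first by have [] := svalP x.
    have eA : ext V cP G (encode A) by apply/extME.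
    by exists (exist _ A (conj uA eA)); apply: eq_exist.
  by rewrite /ultrafilter; mst.
split=> //; have : ms M (fun p : point * B => sval (j p.1) p.2) by mst.
by [].
Qed.

Variable R : realType.
Notation Cf := (CK (ext V cP G) R cB).
Let inM_point : inN M point := inM_point_.1.
#[local] Existing Instance inM_point.

Let coded_Cf : Coded Cf := coded_sig (coded_fun coded_point (@coded_complex R)) (Q := _).
#[local] Existing Instance coded_Cf.

Lemma Cf_mf (f : Cf) : mf M (sval f).
Proof. have [h _] := svalP f; exact: ((extME HV cP G _).1 h). Qed.

(** Continuity is tested with rational tolerances and on the two real parts separately; this singles
    out a definable subset of the pairs of real functions of V[G]. *)
Lemma inM_Cf_ : inN M Cf /\ (mr M (fun p : Cf * point => complex.Re (sval p.1 p.2)) /\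
  mr M (fun p : Cf * point => complex.Im (sval p.1 p.2))).
Proof.
have hx := inM_point_.2.
pose (g := fun (f : Cf) x => to_cn (mf_fin x (Cf_mf f)) : @cn M R).
have hg f : mf M (g f).
  have e : code (g f) = code (sval f) by apply: code_fun_eq => t; rewrite code_to_cn.
  by rewrite /mf e; exact: Cf_mf.
pose (j := fun f => exist _ _ (hg f) : fsp M point (@cn M R)).
have jE f x : sval (sval (j f) x).1 = complex.Re (sval f x) /\ sval (sval (j f) x).2 = complex.Im (sval f x) by [].
have cj f : code (j f) = code f.
  have e : code (g f) = code (sval f) by apply: code_fun_eq => t; rewrite code_to_cn.
  exact: e.
have inj : injective (code : Cf -> hset).
  move=> f f' e; have {}e : j f = j f'.
    by apply: (@in_inj M _ _ _); rewrite !cj.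
  have e' x : sval f x = sval f' x.
    have [e1 e2] := jE f x; have [e3 e4] := jE f' x.
    by apply/eqP; rewrite eq_complex -e1 -e2 -e3 -e4 e !eqxx.
  case: f {e} e' => f hf; case: f' => f' hf' /= e; apply: eq_exist; exact/funext.
pose (c := fun h : fsp M point (@cn M R) => forall x q, (0 < q)%R -> exists a, sval x a /\
  forall y, sval y a -> `|sval (sval h y).1 - sval (sval h x).1| < ratr q /\
     `|sval (sval h y).2 - sval (sval h x).2| < ratr q).
have [||i1 i2] := @inN_image M hM (fsp M point (@cn M R)) _ Cf coded_Cf j inj.
- exact: cj.
- apply: (ms_iff (B := c)); last by rewrite /c; mst.
  move=> h; split=> [[f ->]|ch].
    have [_ cf] := svalP f; move=> x q q0; have [|a xa ha] := cf x (ratr q); first by rewrite ltr0q.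
    exists a; split=> // y ya; have := ha y ya => hn; split.
      by apply: le_lt_trans hn; rewrite /= -raddfB; exact: Re_le_normc.
    by apply: le_lt_trans hn; rewrite /= -raddfB; exact: Im_le_normc.
  pose f (x : point) : R[i] := Complex (sval (sval h x).1) (sval (sval h x).2).
  have mf0 : mf M f.
    apply/mf_complexP; split; rewrite /f /=.
      have h1 : mf M (fun t => (sval h t).1) by mst.
      exact: mr_rn h1.
    have h1 : mf M (fun t => (sval h t).2) by mst.
    exact: mr_rn h1.
  have cf : continuous_in f.
    split; first by apply/extME.
    move=> x eps eps0; have [q /andP[q0 qe]] := rat_between (divr_gt0 eps0 (ltr0Sn R 1)).
    rewrite ltr0q in q0; have [a [xa ha]] := ch x q q0; exists a => // y /ha[h1 h2].
    apply: le_lt_trans (normc_le_add _) _; rewrite /= in h1 h2 *; lra.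
  have fe (k k' : fsp M point (@cn M R)) : (forall x, sval k x = sval k' x) -> k = k'.
    by case: k k' => [k ?] [k' ?] /= e; apply: eq_exist; exact/funext.
  exists (exist _ f cf); apply: fe => x.
  have e (u v : @cn M R) : sval u.1 = sval v.1 -> sval u.2 = sval v.2 -> u = v.
    by case: u v => [[u1 ?] [u2 ?]] [[v1 ?] [v2 ?]] /= ? ?; congr (_, _); apply: eq_exist.
  exact: e.
split=> //; split.
  have h : mf M (fun p : Cf * point => (sval (j p.1) p.2).1) by mst.
  exact: mr_rn h.
have h : mf M (fun p : Cf * point => (sval (j p.1) p.2).2) by mst.
exact: mr_rn h.
Qed.

End Points.

(** * Integration of continuous functions *)

Lemma inv_ex (q : rat) : 0 < q -> exists n, inv n < q.
Proof.
move=> q0; exists (Num.bound q^-1); rewrite /inv -[ltRHS]invrK ltf_pV2 ?posrE ?invr_gt0 ?ltr0n //.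
by apply: lt_trans (archi_boundP _) _; rewrite ?invr_ge0 ?ltr_nat // ltW.
Qed.

Lemma mf_inv (N : cls) (hN : zermelo N) : mf N inv.
Proof. by rewrite /inv; mst. Qed.
#[local] Hint Resolve mf_inv : mst.

Lemma small_zero (R : realType) (x K : R) :
  (forall n, `|x| <= K * ratr (inv n)) -> x = 0.
Proof.
move=> h; apply/eqP; rewrite -normr_le0 leNgt; apply/negP => x0.
have K0 : 0 < K.
  by rewrite -(pmulr_lgt0 _ (x := ratr (inv 0))) ?ltr0q ?inv_gt0 //; exact: lt_le_trans (h 0%N).
have [q /andP[q0 qx]] := rat_between (divr_gt0 x0 K0); rewrite ltr0q in q0.
have [n hn] := inv_ex q0; move: (h n); rewrite leNgt => /negP; apply.
rewrite mulrC -ltr_pdivlMr //; apply: lt_trans qx; by rewrite ltr_rat.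
Qed.

Section Integral.
Variables (R : realType) (V : class) (HV : transitive_ZFC V).
Variables (dP : Order.disp_t) (P : preorderType dP) (cP : Coded P).
Hypothesis HP : ordered_in V cP.
Variables (G : P -> Prop) (HG : generic V cP G).
Variables (dB : Order.disp_t) (B : ctbDistrLatticeType dB) (cB : Coded B).
Hypothesis HB : ordered_in V cB.

Notation M := (extM V cP G).
Let hM : zermelo M := ext_zermelo HV HP HG.
#[local] Existing Instance hM.
Let inM_alg : inN M B := inM_algebra HV HP HG HB.
#[local] Existing Instance inM_alg.
Let mle : ms M (fun p : B*B => is_true (p.1 <= p.2)%O) := msM_le HV HP HG HB.
Let mjoin := mf_join mle.
Let mdiff := mf_diff mle.
Let mcompl : mf M (fun a : B => ~` a)%O := mf_compl HV HP HG HB.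
Let mmeet : mf M (fun p : B * B => p.1 `&` p.2)%O := mf_meet HV HP HG HB.

Notation point := (stone (ext V cP G) cB).
Let coded_point : Coded point := @coded_stone (ext V cP G) dB B cB.
#[local] Existing Instance coded_point.
Let inM_point : inN M point := (inM_point_ HV HP HG HB).1.
#[local] Existing Instance inM_point.
Let hx : ms M (fun p : point * B => sval p.1 p.2) := (inM_point_ HV HP HG HB).2.
Implicit Types (u v : point -> R) (m th rho : B -> R).
Local Open Scope order_scope.

Lemma point_meet (x : point) a b : sval x a -> sval x b -> sval x (a `&` b).
Proof. by have [[_ _ h _] _] := svalP x; exact: h. Qed.

Lemma point_top (x : point) : sval x \top.
Proof. by have [[[h _] _ _ _] _] := svalP x. Qed.

Lemma point_up (x : point) a b : sval x a -> a <= b -> sval x b.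
Proof. by have [[_ h _ _] _] := svalP x; exact: h. Qed.

Lemma point_dec (x : point) a : sval x a \/ sval x (~` a).
Proof. by have [[_ _ _ h] _] := svalP x; exact: h. Qed.

Lemma point_disj (x : point) a : sval x a -> ~ sval x (~` a).
Proof.
move=> h1 h2; have [[[_ h] _ _ _] _] := svalP x; apply: h.
by rewrite -(meetxC a); exact: point_meet.
Qed.

Definition continuous_real u := forall (x : point) (eps : R), (0 < eps)%R ->
  exists2 a, sval x a & forall y : point, sval y a -> (`|u y - u x| < eps)%R.

(* rho has density u with respect to m, up to an error th near every point. *)
Definition approx th u m rho := forall x : point,
  exists2 a, sval x a & forall b, b <= a -> (`|rho b - u x * m b| <= th b)%R.

Lemma local_bound (f g : B -> R) : mr M f -> additive_on f -> mr M g -> additive_on g ->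
  (forall x : point, exists2 a, sval x a & forall b, b <= a -> (`|f b| <= g b)%R) ->
  forall b, (`|f b| <= g b)%R.
Proof.
move=> mf_ addf mg addg h b.
pose (I := fun a : B => forall b, b <= a -> (`|f b| <= g b)%R).
suff : I \top by apply; exact: lex1.
apply: (ideal_principle HV HP HG HB) => //; first by rewrite /I; mst.
split.
- move=> c; rewrite lex0 => /eqP ->; rewrite (additive0 addf) (additive0 addg) normr0; exact: lexx.
- by move=> c c' cc' h' e ec; apply: h'; exact: le_trans cc'.
- move=> c c' hc hc' e ee; rewrite (additive_split addf e c) (additive_split addg e c).
  apply: le_trans (ler_normD _ _) _; apply: lerD; first by apply: hc; exact: leIr.
  by apply: hc'; rewrite leBLR.
Qed.

Lemma approx_unique th th' u m rho rho' :
  mr M th -> additive_on th -> mr M th' -> additive_on th' ->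
  mr M rho -> additive_on rho -> mr M rho' -> additive_on rho' ->
  approx th u m rho -> approx th' u m rho' ->
  forall b, (`|rho b - rho' b| <= th b + th' b)%R.
Proof.
move=> mt at_ mt' at' mrho ar mrho' ar' h h'.
apply: (local_bound (f := fun b => (rho b - rho' b)%R) (g := fun b => (th b + th' b)%R)).
- by mrt.
- by move=> a b ab; rewrite ar // ar' //; ring.
- by mrt.
- by move=> a b ab; rewrite at_ // at' //; ring.
move=> x; have [a xa ha] := h x; have [b xb hb] := h' x.
exists (a `&` b); first exact: point_meet.
move=> c cab; have hc := ha c (le_trans cab (leIl _ _)); have hc' := hb c (le_trans cab (leIr _ _)).
have -> : (rho c - rho' c = (rho c - u x * m c) - (rho' c - u x * m c))%R by ring.
by apply: le_trans (ler_normB _ _) _; exact: lerD.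
Qed.

(** Near a point x the multiple of m by u x will do. Approximations over a and over b are glued by
    cutting along a and its complement, and compactness extends this to the whole algebra. *)
Lemma approx_ex u m l (q : rat) : mr M u -> continuous_real u -> mr M m -> additive_on m ->
  mr M l -> additive_on l -> (forall b, `|m b| <= l b)%R -> (0 < q)%R ->
  exists rho : fsp M B R, additive_on (sval rho) /\
    approx (fun b => ratr q * l b)%R u m (sval rho).
Proof.
move=> mu cu mm addm ml addl hl q0.
have l0 b : (0 <= l b)%R := le_trans (normr_ge0 _) (hl b).
have q0R : (0 <= ratr q :> R)%R by rewrite ler0q ltW.
pose (near := fun (rho : fsp M B R) (x : point) => exists2 c, sval x c &
   forall b, b <= c -> (`|sval rho b - u x * m b| <= ratr q * l b)%R).
pose (J := fun a : B => exists rho : fsp M B R, additive_on (sval rho) /\ forall x : point, sval x a -> near rho x).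
suff [rho [add h]] : J \top by exists rho; split=> // x; apply: h; exact: point_top.
apply: (ideal_principle HV HP HG HB); first by rewrite /J /near /additive_on; mst.
  split.
  - have mf0 : mf M m by apply/mr_mf.
    exists (exist _ m mf0); split=> // x h; exfalso.
    by have [[[_ n] _ _ _] _] := svalP x.
  - move=> a b ab [rho [add h]]; exists rho; split=> // x xa; apply: h; exact: point_up ab.
  - move=> a b [r1 [add1 h1]] [r2 [add2 h2]].
    have mf1 : mf M (fun c => sval r1 (c `&` a) + sval r2 (c `\` a))%R by apply/mr_mf; mrt.
    exists (exist _ _ mf1); split=> [c e ce|x xab] /=.
      rewrite meetUl add1; last exact: disjointW (leIl c a) (leIl e a) ce.
      rewrite !diffE meetUl add2; last exact: disjointW (leIl c _) (leIl e _) ce.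
      ring.
    have [xa|xa] := point_dec x a.
      have [c xc hc] := h1 x xa; exists (c `&` a); first exact: point_meet.
      move=> e ee /=; have ea : e <= a := le_trans ee (leIr _ _).
      rewrite (meet_l ea); have -> : e `\` a = \bot by apply/eqP; rewrite diff_eq0.
      by rewrite (additive0 add2) addr0; apply: hc; exact: le_trans ee (leIl _ _).
    have xb : sval x b.
      apply: point_up (point_meet xab xa) _.
      by rewrite meetUl meetxC join0x; exact: leIl.
    have [c xc hc] := h2 x xb; exists (c `&` ~` a); first exact: point_meet.
    move=> e ee /=; have ea : e <= ~` a := le_trans ee (leIr _ _).
    have -> : e `&` a = \bot by apply/eqP; rewrite disj_leC.
    rewrite (additive0 add1) add0r diffE (meet_l ea); apply: hc; exact: le_trans ee (leIl _ _).
move=> x; have [|a xa ha] := cu x (ratr q); first by rewrite ltr0q.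
exists a => //; have ux : M (code (u x)) := mr_fin mu x.
have mf0 : mf M (fun b => u x * m b)%R by apply/mr_mf; mrt.
exists (exist _ _ mf0); split=> [b c bc /=|y ya]; first by rewrite addm // mulrDr.
exists \top => [|b _ /=]; first exact: point_top.
rewrite -mulrBl normrM distrC; apply: (@le_trans _ _ (ratr q * `|m b|)%R).
  by rewrite ler_wpM2r // ltW // ha.
by rewrite ler_wpM2l.
Qed.

Definition good m := [/\ mr M m, additive_on m & exists C, forall a, (`|m a| <= C)%R].

Lemma mr_pos_part m : good m -> mr M (pos_part m).
Proof.
move=> [mm addm [C hC]].
apply: (mrI (B := fun p => exists a, a <= p.1 /\ (ratr p.2 < m a)%R)); last by mst.
by move=> b q; exact: pos_part_ltP.
Qed.

Lemma good_lin (s : R) m m' : M (code s) -> good m -> good m' -> good (fun a => s * m a + m' a)%R.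
Proof.
move=> hs [mm addm [C hC]] [mm' addm' [C' hC']]; split; first by mrt.
  by move=> a b ab; rewrite addm // addm' //; ring.
exists (`|s| * C + C')%R => a; apply: le_trans (ler_normD _ _) _.
by rewrite normrM lerD // ler_wpM2l.
Qed.

Lemma good_zero : good (fun=> 0%R).
Proof.
split; first by mrt.
  by move=> a b _; rewrite addr0.
by exists 0%R => a; rewrite normr0; exact: lexx.
Qed.

Lemma mr_total_variation m : good m -> mr M (total_variation m).
Proof.
move=> gm; have h1 := mr_pos_part gm.
have gn : good (fun a => - m a)%R.
  case: gm => mm addm [C hC]; split; first by mrt.
    by move=> a b ab; rewrite addm // opprD.
  by exists C => a; rewrite normrN.
have h2 := mr_pos_part gn; rewrite /total_variation; mrt.
Qed.

Lemma good_variation m : good m -> [/\ additive_on (total_variation m),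
  forall b, (0 <= total_variation m b)%R & forall b, (`|m b| <= total_variation m b)%R].
Proof.
move=> [mm addm [C hC]]; split.
- exact: (total_variation_add addm hC).
- exact: (total_variation_ge0 addm hC).
- exact: (norm_le_variation addm hC).
Qed.

Definition int_err m n b : R := (ratr (inv n) * total_variation m b)%R.

Lemma int_errP m n : good m -> mr M (int_err m n) /\ additive_on (int_err m n).
Proof.
move=> gm; have h := mr_total_variation gm; have [a _ _] := good_variation gm.
split; first by rewrite /int_err; mrt.
by move=> b c bc; rewrite /int_err a // mulrDr.
Qed.

(** Lower estimates of the integral. Taking their supremum avoids the choice of a sequence of
    approximations and makes the cuts of the integral definable in V[G], as used in [mr_int]. *)
Definition integrals u m : set R := [set y | exists n (rho : fsp M B R),
  additive_on (sval rho) /\ approx (int_err m n) u m (sval rho) /\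
  y = (sval rho \top - int_err m n \top)%R].

Definition integral_of u m : R := sup (integrals u m).

Lemma int_ex u m n : mr M u -> continuous_real u -> good m ->
  exists rho : fsp M B R, additive_on (sval rho) /\ approx (int_err m n) u m (sval rho).
Proof.
move=> mu cu gm; have [a0 _ a1] := good_variation gm; have [mm addm _] := gm.
exact: approx_ex (mr_total_variation gm) a0 a1 (inv_gt0 n).
Qed.

Lemma fsp_mr (rho : fsp M B R) : mr M (sval rho).
Proof. by apply/mr_mf; exact: (svalP rho). Qed.

Lemma integrals_has_sup u m : mr M u -> continuous_real u -> good m -> has_sup (integrals u m).
Proof.
move=> mu cu gm; have [rho [add h]] := int_ex 0 mu cu gm; split.
  by exists (sval rho \top - int_err m 0 \top)%R, 0%N, rho.
exists (sval rho \top + int_err m 0 \top)%R => _ [n [rho' [add' [h' ->]]]].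
have [m1 e1] := int_errP n gm; have [m2 e2] := int_errP 0 gm.
have := approx_unique m1 e1 m2 e2 (fsp_mr rho') add' (fsp_mr rho) add h' h \top.
by rewrite ler_norml => /andP[_]; lra.
Qed.

(** By [approx_unique] every lower estimate is at most the value of rho plus the error; conversely,
    estimates with [inv n] as error come from approximations that are just as close to rho, and n
    tends to infinity. *)
Lemma int_spec u m th rho : mr M u -> continuous_real u -> good m ->
  mr M th -> additive_on th -> mr M rho -> additive_on rho -> approx th u m rho ->
  (`|integral_of u m - rho \top| <= th \top)%R.
Proof.
move=> mu cu gm mt at_ mrho ar h; have hs := integrals_has_sup mu cu gm.
rewrite ler_norml; apply/andP; split; last first.
  rewrite lerBlDr; apply: (sup_le_ub hs.1) => _ [n [rho' [add' [h' ->]]]].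
  have [m1 e1] := int_errP n gm.
  have := approx_unique m1 e1 mt at_ (fsp_mr rho') add' mrho ar h' h \top.
  by rewrite ler_norml => /andP[_]; lra.
have [_ l0 _] := good_variation gm; have {l0}l0 := l0 \top.
rewrite leNgt; apply/negP => hlt; pose dl := (- th \top - (integral_of u m - rho \top))%R.
have dl0 : (0 < dl)%R by rewrite /dl; lra.
suff dl_small n : (`|dl| <= 2 * total_variation m \top * ratr (inv n))%R.
  by move: dl0; rewrite (small_zero dl_small) ltxx.
have [rho' [add' h']] := int_ex n mu cu gm; have [m1 e1] := int_errP n gm.
have := approx_unique m1 e1 mt at_ (fsp_mr rho') add' mrho ar h' h \top.
have : (sval rho' \top - int_err m n \top <= integral_of u m)%R.
  by apply: sup_upper_bound => //; exists n, rho'.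
rewrite (gtr0_norm dl0) /dl /int_err ler_norml => h1 /andP[h2 h3]; lra.
Qed.

Lemma integral_linear u v (s : R) m : M (code s) -> mr M u -> continuous_real u ->
  mr M v -> continuous_real v -> continuous_real (fun x => s * u x + v x)%R -> good m ->
  (integral_of (fun x => s * u x + v x) m = s * integral_of u m + integral_of v m)%R.
Proof.
move=> hs mu cu mv cv cuv gm; apply/eqP; rewrite -subr_eq0; apply/eqP.
apply: (small_zero (K := (2 * (`|s| + 1) * total_variation m \top)%R)) => n.
have [r1 [a1 h1]] := int_ex n mu cu gm; have [r2 [a2 h2]] := int_ex n mv cv gm.
have [me ae] := int_errP n gm.
have k1 := int_spec mu cu gm me ae (fsp_mr r1) a1 h1.
have k2 := int_spec mv cv gm me ae (fsp_mr r2) a2 h2.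
have f1 := fsp_mr r1; have f2 := fsp_mr r2.
have h : approx (fun b => `|s| * int_err m n b + int_err m n b)%R (fun x => s * u x + v x)%R m
    (fun b => s * sval r1 b + sval r2 b)%R.
  move=> x; have [a xa ha] := h1 x; have [b xb hb] := h2 x.
  exists (a `&` b); first exact: point_meet.
  move=> c cab; have hc := ha c (le_trans cab (leIl _ _)); have hc' := hb c (le_trans cab (leIr _ _)).
  have -> : (s * sval r1 c + sval r2 c - (s * u x + v x) * m c =
    s * (sval r1 c - u x * m c) + (sval r2 c - v x * m c))%R by ring.
  by apply: le_trans (ler_normD _ _) _; rewrite normrM lerD // ler_wpM2l.
have k := int_spec (th := (fun b => `|s| * int_err m n b + int_err m n b)%R)
  (rho := (fun b => s * sval r1 b + sval r2 b)%R) _ cuv gm _ _ _ _ h.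
have {k}k : (`|integral_of (fun x => s * u x + v x) m - (s * sval r1 \top + sval r2 \top)| <=
    `|s| * int_err m n \top + int_err m n \top)%R.
  apply: k; try mrt.
    by move=> b c bc; rewrite ae //; ring.
  by move=> b c bc; rewrite a1 // a2 //; ring.
set X := integral_of _ m in k *.
have -> : (X - (s * integral_of u m + integral_of v m) = (X - (s * sval r1 \top + sval r2 \top))
   - (s * (integral_of u m - sval r1 \top) + (integral_of v m - sval r2 \top)))%R by ring.
apply: le_trans (ler_normB _ _) _; apply: le_trans (lerD k (ler_normD _ _)) _.
rewrite normrM; have hs1 := ler_wpM2l (normr_ge0 s) k1.
rewrite /int_err in k2 hs1 *; lra.
Qed.

Lemma integral_linear_measure u (s : R) m m' : M (code s) -> mr M u -> continuous_real u ->
  good m -> good m' ->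
  (integral_of u (fun b => s * m b + m' b) = s * integral_of u m + integral_of u m')%R.
Proof.
move=> hs mu cu gm gm'; have gmm := good_lin hs gm gm'.
apply/eqP; rewrite -subr_eq0; apply/eqP.
apply: (small_zero (K := (2 * (`|s| * total_variation m \top + total_variation m' \top))%R)) => n.
have [r1 [a1 h1]] := int_ex n mu cu gm; have [r2 [a2 h2]] := int_ex n mu cu gm'.
have [me ae] := int_errP n gm; have [me' ae'] := int_errP n gm'.
have k1 := int_spec mu cu gm me ae (fsp_mr r1) a1 h1.
have k2 := int_spec mu cu gm' me' ae' (fsp_mr r2) a2 h2.
have f1 := fsp_mr r1; have f2 := fsp_mr r2.
have h : approx (fun b => `|s| * int_err m n b + int_err m' n b)%R u (fun b => s * m b + m' b)%R
    (fun b => s * sval r1 b + sval r2 b)%R.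
  move=> x; have [a xa ha] := h1 x; have [b xb hb] := h2 x.
  exists (a `&` b); first exact: point_meet.
  move=> c cab; have hc := ha c (le_trans cab (leIl _ _)); have hc' := hb c (le_trans cab (leIr _ _)).
  have -> : (s * sval r1 c + sval r2 c - u x * (s * m c + m' c) =
    s * (sval r1 c - u x * m c) + (sval r2 c - u x * m' c))%R by ring.
  by apply: le_trans (ler_normD _ _) _; rewrite normrM lerD // ler_wpM2l.
have k := int_spec (th := (fun b => `|s| * int_err m n b + int_err m' n b)%R)
  (rho := (fun b => s * sval r1 b + sval r2 b)%R) mu cu gmm _ _ _ _ h.
have {k}k : (`|integral_of u (fun b => s * m b + m' b) - (s * sval r1 \top + sval r2 \top)| <=
    `|s| * int_err m n \top + int_err m' n \top)%R.
  apply: k; try mrt.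
    by move=> b c bc; rewrite ae // ae' //; ring.
  by move=> b c bc; rewrite a1 // a2 //; ring.
set X := integral_of _ _ in k *.
have -> : (X - (s * integral_of u m + integral_of u m') = (X - (s * sval r1 \top + sval r2 \top))
   - (s * (integral_of u m - sval r1 \top) + (integral_of u m' - sval r2 \top)))%R by ring.
apply: le_trans (ler_normB _ _) _; apply: le_trans (lerD k (ler_normD _ _)) _.
rewrite normrM; have hs1 := ler_wpM2l (normr_ge0 s) k1.
rewrite /int_err in k2 hs1 *; lra.
Qed.

Lemma integral_le u m (K : R) : mr M u -> continuous_real u -> good m ->
  (forall x, `|u x| <= K)%R -> (`|integral_of u m| <= K * total_variation m \top)%R.
Proof.
move=> mu cu gm hK; have [al l0 lm] := good_variation gm; have mv := mr_total_variation gm.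
apply/ler_addgt0Pl => e e0.
pose lt := total_variation m \top; have lt1 : (0 < lt + 1)%R by rewrite ltr_wpDl // l0.
(* K may be a real outside V[G], so a slightly larger rational is used in the error function. *)
have [q /andP[q1 q2]] := @rat_between R K (K + e / (lt + 1))%R ltac:(by rewrite ltrDl divr_gt0).
have h : approx (fun b => ratr q * total_variation m b)%R u m (fun=> 0%R).
  move=> x; exists \top; first exact: point_top.
  move=> b _; rewrite sub0r normrN normrM ler_pM //; apply: le_trans (hK x) _; exact: ltW.
have := int_spec mu cu gm _ _ _ _ h; rewrite subr0 => /(_ ltac:(mrt) _ ltac:(mrt) _) k.
apply: le_trans (k _ _) _.
- by move=> b c bc; rewrite al // mulrDr.
- by move=> b c bc; rewrite addr0.
apply: (@le_trans _ _ ((K + e / (lt + 1)) * lt)%R); first by rewrite ler_wpM2r ?l0 // ltW.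
rewrite mulrDl addrC lerD2r mulrAC ler_pdivrMr // ler_wpM2l ?lerDl // ltW //.
Qed.

Lemma integral_indicator u m a : mr M u -> continuous_real u -> good m ->
  (forall x, u x = if `[< sval x a >] then 1 else 0)%R -> integral_of u m = m a.
Proof.
move=> mu cu gm hu; have [mm am _] := gm.
have h : approx (fun=> 0%R) u m (fun b => m (b `&` a)).
  move=> x; have [xa|xa] := point_dec x a.
    exists a => // b ba; rewrite hu; case: asboolP => // _.
    by rewrite (meet_l ba) mul1r subrr normr0; exact: lexx.
  exists (~` a) => // b ba; rewrite hu; case: asboolP => [/point_disj//|_].
  have -> : b `&` a = \bot by apply/eqP; rewrite disj_leC.
  by rewrite mul0r subr0 (additive0 am) normr0; exact: lexx.
have := int_spec mu cu gm _ _ _ _ h => /(_ ltac:(mrt) _ ltac:(mrt) _) k.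
apply/eqP; rewrite -subr_eq0 -normr_le0; move: k; rewrite meet1x; apply.
- by move=> b c bc; rewrite addr0.
- by move=> b c bc; rewrite meetUl am //; exact: disjointW (leIl b a) (leIl c a) bc.
Qed.

Lemma mr_int (T : Type) (cT : Coded T) (iT : inN M T) (F : T -> point -> R) m :
  mr M (fun p : T * point => F p.1 p.2) -> (forall t, continuous_real (F t)) -> good m ->
  mr M (fun t => integral_of (F t) m).
Proof.
move=> mF cF gm; have ml := mr_total_variation gm; have [mm am _] := gm.
have mFt t : mr M (F t).
  by refine (mr_comp (h := fun x => (t, x)) (f := fun p => F p.1 p.2) _ mF); mst.
apply: (mrI (B := fun p => exists n (rho : fsp M B R), additive_on (sval rho) /\
  approx (int_err m n) (F p.1) m (sval rho) /\ (ratr p.2 < sval rho \top - int_err m n \top)%R)).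
  move=> t q; have hs := integrals_has_sup (mFt t) (cF t) gm; split=> [h|[n [rho [a [h1 h2]]]]].
    have [_ [n [rho [a [h1 ->]]]] h2] := sup_gt hs.1 h; by exists n, rho.
  apply: lt_le_trans h2 _; apply: sup_upper_bound => //; by exists n, rho.
by rewrite /additive_on /approx /int_err; mst.
Qed.

End Integral.

(** * From convergent sequences to null sequences *)

Section Convergent.
Variables (R : realType) (V : class) (HV : transitive_ZFC V).
Variables (dP : Order.disp_t) (P : preorderType dP) (cP : Coded P).
Hypothesis HP : ordered_in V cP.
Variables (G : P -> Prop) (HG : generic V cP G).
Hypothesis Hproper : proper_forcing V cP.
Hypothesis Hlaver : laver_property V cP.
Hypothesis Hmeager : preserves_nonmeager R V cP.
Variables (dB : Order.disp_t) (B : ctbDistrLatticeType dB) (cB : Coded B).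
Hypothesis HB : ordered_in V cB.
Hypothesis Hsigma : sigma_complete V cB.

Notation M := (extM V cP G).
Let hM : zermelo M := ext_zermelo HV HP HG.
#[local] Existing Instance hM.
Let inM_alg : inN M B := inM_algebra HV HP HG HB.
#[local] Existing Instance inM_alg.
Let mle : ms M (fun p : B*B => is_true (p.1 <= p.2)%O) := msM_le HV HP HG HB.

Variable mm : nat -> B -> R.
Hypothesis mmm : mr M (fun p => mm p.1 p.2).
Hypothesis addm : forall k, additive_on (mm k).
Hypothesis bvm : forall k, bounded_variation (mm k).
Hypothesis convm : forall a, exists l : R, forall eps, 0 < eps ->
  exists n, forall k, (n <= k)%N -> `|mm k a - l| < eps.

Lemma bounded_each k : exists t : nat, forall a, `|mm k a| <= t%:R.
Proof.
have [C hC] := bvm k; exists (Num.bound C) => a.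
have h := hC [:: a] isT; rewrite big_seq1 in h; apply: le_trans h _.
have [C0|C0] := leP 0 C; first exact/ltW/archi_boundP.
by apply: le_trans (ltW C0) _; rewrite ler0n.
Qed.

(** Let t k be least such that its square bounds the first k + 1 terms. If t were unbounded, the
    terms divided by t k + 1 would form a null sequence, hence be bounded by some C. Then the terms
    up to k are at most (t k + 1) C, which is below the square of t k - 1 once t k exceeds C + 3,
    against minimality. *)
Lemma uniform_bound : exists C, forall k a, `|mm k a| <= C.
Proof.
pose (Q := fun k t : nat => forall (i : nat) (a : B), (i <= k)%N -> `|mm i a| <= ratr (t * t)%N%:R).
have mQ : ms M (fun p => Q p.1 p.2) by rewrite /Q; mst.
have exQ k : exists t, Q k t.
  have [f hf] := choice bounded_each; exists (\max_(i < k.+1) f i)%N => i a ik.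
  rewrite ratr_nat; apply: le_trans (hf i a) _; rewrite ler_nat.
  have h : (f i <= \max_(i < k.+1) f i)%N by rewrite (leq_bigmax_cond (Ordinal (ik : (i < k.+1)%N))).
  case: (\max_(i < k.+1) f i)%N h => [//|s h]; apply: leq_trans h _; exact: leq_pmulr.
have [t mt ht] := mf_least mQ exQ.
have mono i k : (i <= k)%N -> (t i <= t k)%N.
  by move=> ik; apply: (ht i).2 => j a ji; apply: (ht k).1; exact: leq_trans ik.
have [[T hT]|nT] := pselect (exists T, forall k, (t k <= T)%N).
  exists (T * T)%:R => k a; apply: le_trans ((ht k).1 k a (leqnn k)) _.
  by rewrite ratr_nat ler_nat leq_mul.
pose nu k a : R := ratr (inv (t k)) * mm k a.
have unb T : exists k, (T < t k)%N.
  apply: contrapT => n; apply: nT; exists T => k; rewrite leqNgt; apply/negP => h; apply: n; by exists k.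
have mnu : mr M (fun p => nu p.1 p.2) by rewrite /nu; have minv := mf_inv hM; mrt.
have inv0 k : 0 < ratr (inv k) :> R by rewrite ltr0q inv_gt0.
have add_nu k : additive_on (nu k) by move=> a b ab; rewrite /nu addm // mulrDr.
have bv_nu k : bounded_variation (nu k).
  have [C hC] := bounded_each k.
  have nC a : `|nu k a| <= ratr (inv (t k)) * C%:R.
    by rewrite normrM gtr0_norm // ler_pM2l.
  exists (ratr (inv (t k)) * C%:R + ratr (inv (t k)) * C%:R) => s ps.
  exact: (variation_le (add_nu k) nC ps).
have null_nu : null_sequence nu.
  move=> a e e0; have [l hl] := convm a; have [n hn] := hl 1 ltr01.
  pose L := `|l| + 1; have L0 : 0 < L by rewrite ltr_wpDl.
  have [q /andP[q0 qe]] := rat_between (divr_gt0 e0 L0); rewrite ltr0q in q0.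
  have [T hT] := inv_ex q0; have [k0 hk0] := unb T.
  exists (maxn n k0) => k; rewrite geq_max => /andP[nk kk].
  have bd : `|mm k a| <= L.
    have := hn k nk; have := ler_normD (mm k a - l) l; rewrite subrK /L; lra.
  rewrite /nu normrM gtr0_norm //; apply: le_lt_trans (ler_wpM2l (ltW (inv0 _)) bd) _.
  rewrite -ltr_pdivlMr //; apply: le_lt_trans qe; rewrite ler_rat.
  apply: le_trans (ltW hT); rewrite /inv lef_pV2 ?posrE ?ltr0n // ler_nat ltnS.
  by apply: leq_trans (ltnW hk0) _; exact: mono.
have [C0 hC0] := null_bounded HV HP HG Hproper Hlaver Hmeager HB Hsigma mnu add_nu bv_nu null_nu.
pose C := Num.bound `|C0|.
have hC k a : `|nu k a| <= C%:R.
  by apply: le_trans (hC0 k a) _; apply: le_trans (ler_norm _) _; exact/ltW/archi_boundP.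
have [k hk] := unb (C + 3)%N; exfalso.
have [s es] : exists s, t k = s.+1 by exists (t k).-1; rewrite prednK //; lia.
have : ~ Q k s by move=> /(ht k).2; rewrite es ltnn.
apply=> i a ik; rewrite ratr_nat.
have e : mm i a = (t i).+1%:R * nu i a.
  have ei : ratr (inv (t i)) = (t i).+1%:R^-1 :> R by rewrite /inv fmorphV /= rmorph_nat.
  by rewrite /nu ei mulrA divff ?mul1r // pnatr_eq0.
rewrite e normrM ger0_norm ?ler0n //; apply: (@le_trans _ _ ((t i).+1%:R * C%:R)).
  by rewrite ler_wpM2l ?ler0n.
rewrite -natrM ler_nat; have := mono i k ik; rewrite es => h.
apply: (@leq_trans (s.+2 * C)); first by rewrite leq_mul2r ltnS h orbT.
nia.
Qed.

Definition limit_of (l : B -> R) : Prop := forall a eps, 0 < eps ->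
  exists n, forall k, (n <= k)%N -> `|mm k a - l a| < eps.

(** The cuts of the limit are expressed through those of the sequence, which puts the limit into
    V[G]; the uniform bound makes it a measure. *)
Lemma limit_good l : limit_of l -> good V cP G cB l.
Proof.
move=> hl; have [C hC] := uniform_bound; split.
- apply: (mrI (B := fun p => exists r, p.2 < r /\ exists n, forall k, (n <= k)%N -> ratr r < mm k p.1)).
    move=> a q /=; split=> [h|[r [qr [n hn]]]].
      have /rat_between[r /andP[h1 h2]] := h; exists r; split; first by rewrite -(ltr_rat R).
      have [n hn] := hl a (l a - ratr r) ltac:(by rewrite subr_gt0).
      by exists n => k /hn; rewrite ltr_norml => /andP[h3 _]; lra.
    rewrite -(ltr_rat R) in qr; rewrite ltNge; apply/negP => h.
    have [n' hn'] := hl a (ratr r - ratr q) ltac:(by rewrite subr_gt0).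
    have := hn' (maxn n n') (leq_maxr _ _); have := hn (maxn n n') (leq_maxl _ _).
    by rewrite ltr_norml => h1 /andP[_ h2]; lra.
  by mst.
- move=> a b ab; apply/eqP; rewrite -subr_eq0 -normr_le0 leNgt; apply/negP => e0.
  set e := `|_| in e0; have e3 : 0 < e / 3 by rewrite divr_gt0.
  have [n1 h1] := hl (a `|` b)%O _ e3; have [n2 h2] := hl a _ e3; have [n3 h3] := hl b _ e3.
  pose k := (n1 + n2 + n3)%N.
  have /h1 k1 : (n1 <= k)%N by rewrite /k; lia.
  have /h2 k2 : (n2 <= k)%N by rewrite /k; lia.
  have /h3 k3 : (n3 <= k)%N by rewrite /k; lia.
  have : e < e; last by rewrite ltxx.
  rewrite {1}/e (_ : l (a `|` b)%O - (l a + l b) =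
    (mm k a - l a) + (mm k b - l b) - (mm k (a `|` b)%O - l (a `|` b)%O)); last by rewrite addm //; ring.
  have t1 := ler_normB ((mm k a - l a) + (mm k b - l b)) (mm k (a `|` b)%O - l (a `|` b)%O).
  have t2 := ler_normD (mm k a - l a) (mm k b - l b); lra.
- exists C => a; apply/ler_addgt0Pl => e e0; have [n hn] := hl a e e0.
  have := hn n (leqnn n); have := hC n a; have := ler_normD (l a - mm n a) (mm n a).
  by rewrite subrK distrC; lra.
Qed.

Lemma sequence_good k : good V cP G cB (mm k).
Proof.
have [C hC] := uniform_bound; split=> //; last by exists C.
by refine (mr_comp (h := fun a : B => (k, a)) (f := fun p => mm p.1 p.2) _ mmm); mst.
Qed.

Lemma convergent_control : exists2 l, limit_of l &
  let nu k a := mm k a - l a in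
  [/\ forall k, good V cP G cB (nu k), exists C, forall k a, `|nu k a| <= C,
    null_sequence nu & controlled nu].
Proof.
have [l hl] := choice convm; have gl := limit_good hl; have [C hC] := uniform_bound.
have [ml al [C' hC']] := gl.
exists l => // nu.
have mnu : mr M (fun p => nu p.1 p.2) by rewrite /nu; mrt.
have add_nu k : additive_on (nu k) by move=> a b ab; rewrite /nu addm // al //; ring.
have nC k a : `|nu k a| <= C + C' by apply: le_trans (ler_normB _ _) _; exact: lerD.
have null_nu : null_sequence nu by move=> a e; exact: hl.
split=> //; last first.
- apply: (null_controlled HV HP HG Hproper Hlaver Hmeager HB Hsigma mnu add_nu _ null_nu) => k.
  by exists ((C + C') + (C + C')) => s; exact: (variation_le (add_nu k) (nC k)).
- by exists (C + C').
move=> k; split=> //; last by exists (C + C').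
by refine (mr_comp (h := fun a : B => (k, a)) (f := fun p => nu p.1 p.2) _ mnu); mst.
Qed.

End Convergent.

(** * Functionals of the bidual along a null sequence *)

Lemma half_sum_ge (R : realType) (x y z e : R) : x + y = z + z -> e <= x -> e <= y -> e <= z.
Proof. lra. Qed.

Section Functional.
Variables (R : realType) (V : class) (HV : transitive_ZFC V).
Variables (dP : Order.disp_t) (P : preorderType dP) (cP : Coded P).
Hypothesis HP : ordered_in V cP.
Variables (G : P -> Prop) (HG : generic V cP G).
Variables (dB : Order.disp_t) (B : ctbDistrLatticeType dB) (cB : Coded B).
Hypothesis HB : ordered_in V cB.

Notation M := (extM V cP G).
Let hM : zermelo M := ext_zermelo HV HP HG.
#[local] Existing Instance hM.
Let inM_alg : inN M B := inM_algebra HV HP HG HB.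
#[local] Existing Instance inM_alg.
Let mle : ms M (fun p : B*B => is_true (p.1 <= p.2)%O) := msM_le HV HP HG HB.
Let mjoin := mf_join mle.

Notation point := (stone (ext V cP G) cB).
Notation Cf := (CK (ext V cP G) R cB).
Notation dual := (CK_dual (ext V cP G) R cB).
Let coded_point : Coded point := @coded_stone (ext V cP G) dB B cB.
#[local] Existing Instance coded_point.
Let inM_point : inN M point := (inM_point_ HV HP HG HB).1.
#[local] Existing Instance inM_point.
Let coded_Cf : Coded Cf := coded_sig (coded_fun coded_point (@coded_complex R)) (Q := _).
#[local] Existing Instance coded_Cf.
Let inM_Cf : inN M Cf := (inM_Cf_ HV HP HG HB R).1.
#[local] Existing Instance inM_Cf.
Let hx : ms M (fun p : point * B => sval p.1 p.2) := (inM_point_ HV HP HG HB).2.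
Notation good := (good V cP G cB).
Implicit Types (f g h : Cf) (p q : B -> R).

Definition re f (x : point) : R := complex.Re (sval f x).
Definition im f (x : point) : R := complex.Im (sval f x).

Lemma mr_re2 : mr M (fun t : Cf * point => re t.1 t.2).
Proof. exact: (inM_Cf_ HV HP HG HB R).2.1. Qed.
Lemma mr_im2 : mr M (fun t : Cf * point => im t.1 t.2).
Proof. exact: (inM_Cf_ HV HP HG HB R).2.2. Qed.

Lemma mr_re f : mr M (re f).
Proof.
by refine (mr_comp (h := fun x : point => (f, x)) (f := fun t => re t.1 t.2) _ mr_re2); mst.
Qed.
Lemma mr_im f : mr M (im f).
Proof.
by refine (mr_comp (h := fun x : point => (f, x)) (f := fun t => im t.1 t.2) _ mr_im2); mst.
Qed.

Lemma re_continuous f : continuous_real (re f).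
Proof.
move=> x e e0; have [_ cf] := svalP f; have [a xa ha] := cf x e e0; exists a => // y /ha.
by apply: le_lt_trans; rewrite /re -raddfB; exact: Re_le_normc.
Qed.
Lemma im_continuous f : continuous_real (im f).
Proof.
move=> x e e0; have [_ cf] := svalP f; have [a xa ha] := cf x e e0; exists a => // y /ha.
by apply: le_lt_trans; rewrite /im -raddfB; exact: Im_le_normc.
Qed.
Hint Resolve mr_re mr_im re_continuous im_continuous : core.

Lemma continuous_lin (u v : point -> R) s : continuous_real u -> continuous_real v ->
  continuous_real (fun x => s * u x + v x).
Proof.
move=> cu cv x e e0; have s0 : 0 < `|s| + 1 by rewrite ltr_wpDl.
have e1 : 0 < e / 2 / (`|s| + 1) by rewrite !divr_gt0.
have e2 : 0 < e / 2 by rewrite divr_gt0.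
have [a xa ha] := cu x _ e1; have [b xb hb] := cv x _ e2.
exists (a `&` b)%O; first exact: point_meet.
move=> y yab; have ya := point_up yab (leIl a b); have yb := point_up yab (leIr b a).
have -> : s * u y + v y - (s * u x + v x) = s * (u y - u x) + (v y - v x) by ring.
apply: le_lt_trans (ler_normD _ _) _; rewrite normrM.
have h1 := ltW (ha y ya); have h2 := hb y yb.
have : `|s| * `|u y - u x| <= (`|s| + 1) * (e / 2 / (`|s| + 1)).
  by apply: ler_pM => //; rewrite lerDl.
by rewrite mulrCA mulfV ?gt_eqF // mulr1; lra.
Qed.

(** By compactness, with a rational bound near each point. It makes the supremum in [sup_norm] a
    genuine bound. *)
Lemma Cf_bounded f : exists K, forall x, Normc.normc (sval f x) <= K.
Proof.
pose (I := fun a : B => exists t : rat, forall x, sval x a -> `|re f x| <= ratr t /\ `|im f x| <= ratr t).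
suff [q hq] : I \top%O.
  exists (ratr q + ratr q) => x; have [h1 h2] := hq x (point_top x).
  by apply: le_trans (normc_le_add _) _; exact: lerD.
have m1 := mr_re f; have m2 := mr_im f.
apply: (ideal_principle HV HP HG HB); first by rewrite /I; mst.
  split.
  - by exists 0 => x h; exfalso; have [[[_ n] _ _ _] _] := svalP x.
  - by move=> a b ab [q hq]; exists q => x xa; apply: hq; exact: point_up ab.
  - move=> a b [q hq] [r hr]; exists (Num.max q r) => x xab.
    have h (t : rat) : `|re f x| <= ratr t /\ `|im f x| <= ratr t -> t <= Num.max q r ->
        `|re f x| <= ratr (Num.max q r) /\ `|im f x| <= ratr (Num.max q r).
      move=> [h1 h2]; rewrite -(ler_rat R) => tm; split; exact: le_trans tm.
    have [xa|xa] := point_dec x a; first by apply: h (hq x xa) _; rewrite le_max lexx.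
    apply: h (hr x _) _; last by rewrite le_max lexx orbT.
    apply: point_up (point_meet xab xa) _; rewrite meetUl meetxC join0x; exact: leIl.
move=> x; have [a xa ha] := re_continuous f x ltr01; have [b xb hb] := im_continuous f x ltr01.
exists (a `&` b)%O; first exact: point_meet.
have [|r /andP[r1 _]] := @rat_between R (`|re f x| + `|im f x| + 1) (`|re f x| + `|im f x| + 2); first lra.
exists r => y yab.
have h1 := ha y (point_up yab (leIl _ _)); have h2 := hb y (point_up yab (leIr _ _)).
have := ler_normD (re f y - re f x) (re f x); have := ler_normD (im f y - im f x) (im f x).
have := normr_ge0 (re f x); have := normr_ge0 (im f x).
by rewrite !subrK; split; lra.
Qed.

Lemma normc_le_sup f x : Normc.normc (sval f x) <= sup_norm f.
Proof.
apply: sup_upper_bound; last by exists x.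
split; first by exists (Normc.normc (sval f x)), x.
by have [K hK] := Cf_bounded f; exists K => _ [y _ <-].
Qed.

(** The integral of f with respect to the complex measure p + i q, in real and imaginary parts. *)
Definition cint p q f : R[i] :=
  Complex (integral_of (re f) p - integral_of (im f) q) (integral_of (im f) p + integral_of (re f) q).

Lemma code_Complex (s t : R) : M (code (Complex s t)) -> M (code s) /\ M (code t).
Proof. by move/code_complexP. Qed.

Lemma cint_linear p q f g h (a : R[i]) : good p -> good q -> M (code a) ->
  (forall x, sval h x = a * sval f x + sval g x) -> cint p q h = a * cint p q f + cint p q g.
Proof.
move=> gp gq; case: a => [s t] /code_Complex[hs ht] hh.
have hnt : M (code (- t)).
  have m : mr M (fun _ : nat => - t) by mrt.
  exact: mr_fin m 0%N.
have key (m : B -> R) : good m ->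
    integral_of (re h) m = s * integral_of (re f) m + (- t * integral_of (im f) m + integral_of (re g) m) /\
    integral_of (im h) m = s * integral_of (im f) m + (t * integral_of (re f) m + integral_of (im g) m).
  move=> gm.
  have e1 : re h = fun x => s * re f x + (- t * im f x + re g x).
    by apply/funext => x; rewrite /re /im hh; case: (sval f x) => a b; case: (sval g x) => c d /=; ring.
  have e2 : im h = fun x => s * im f x + (t * re f x + im g x).
    by apply/funext => x; rewrite /re /im hh; case: (sval f x) => a b; case: (sval g x) => c d /=; ring.
  have c1 : continuous_real (fun x => - t * im f x + re g x) by exact: continuous_lin.
  have c2 : continuous_real (fun x => t * re f x + im g x) by exact: continuous_lin.
  have f1 := mr_re f; have f2 := mr_im f; have g1 := mr_re g; have g2 := mr_im g.
  have m1 : mr M (fun x => - t * im f x + re g x) by mrt.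
  have m2 : mr M (fun x => t * re f x + im g x) by mrt.
  rewrite e1 e2; split.
    rewrite (integral_linear HV HP HG HB hs) //; last exact: continuous_lin.
    by rewrite (integral_linear HV HP HG HB hnt).
  rewrite (integral_linear HV HP HG HB hs) //; last exact: continuous_lin.
  by rewrite (integral_linear HV HP HG HB ht).
have [p1 p2] := key p gp; have [q1 q2] := key q gq.
by apply/eqP; rewrite eq_complex /cint /= p1 p2 q1 q2; apply/andP; split; apply/eqP; ring.
Qed.

Lemma cint_le p q f K : good p -> good q -> (forall x, Normc.normc (sval f x) <= K) ->
  Normc.normc (cint p q f) <= K * (2 * (total_variation p \top%O + total_variation q \top%O)).
Proof.
move=> gp gq hK.
have h1 x : `|re f x| <= K := le_trans (Re_le_normc _) (hK x).
have h2 x : `|im f x| <= K := le_trans (Im_le_normc _) (hK x).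
apply: le_trans (normc_le_add _) _; rewrite /cint /=.
have a1 := integral_le HV HP HG HB (mr_re f) (@re_continuous f) gp h1.
have a2 := integral_le HV HP HG HB (mr_im f) (@im_continuous f) gp h2.
have a3 := integral_le HV HP HG HB (mr_re f) (@re_continuous f) gq h1.
have a4 := integral_le HV HP HG HB (mr_im f) (@im_continuous f) gq h2.
have b1 := ler_normB (integral_of (re f) p) (integral_of (im f) q).
have b2 := ler_normD (integral_of (im f) p) (integral_of (re f) q).
lra.
Qed.

Lemma variation_ge0 p : good p -> 0 <= total_variation p \top%O.
Proof. by case=> _ a [C hC]; exact: total_variation_ge0 a hC _. Qed.

Lemma cint_dual p q : good p -> good q ->
  in_dual (ext V cP G) _ (@sup_norm (ext V cP G) R dB B cB) (cint p q).
Proof.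
move=> gp gq; split.
- apply/(extME HV).
  have h : mf M (cint p q); last exact: h.
  have r m : good m -> mr M (fun f : Cf => integral_of (re f) m).
    move=> gm; refine (mr_int HV HP HG HB inM_Cf (F := re) mr_re2 re_continuous gm).
  have i m : good m -> mr M (fun f : Cf => integral_of (im f) m).
    move=> gm; refine (mr_int HV HP HG HB inM_Cf (F := im) mr_im2 im_continuous gm).
  have r1 := r p gp; have r2 := r q gq; have i1 := i p gp; have i2 := i q gq.
  by apply/mf_complexP; rewrite /cint /=; split; mrt.
- move=> a f g h /(extME HV) ha; exact: cint_linear.
- exists (2 * (total_variation p \top%O + total_variation q \top%O)) => f.
  rewrite mulrC; apply: cint_le => // x; exact: normc_le_sup.
Qed.

Definition dual_of p q (gp : good p) (gq : good q) : dual := exist _ (cint p q) (cint_dual gp gq).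

Lemma dual_norm_le p q (gp : good p) (gq : good q) :
  CK_dual_norm (dual_of gp gq) <= 2 * (total_variation p \top%O + total_variation q \top%O).
Proof.
have v0 : 0 <= 2 * (total_variation p \top%O + total_variation q \top%O).
  by rewrite mulr_ge0 // addr_ge0 // variation_ge0.
rewrite /CK_dual_norm /dual_norm; set S := [set _ | _ in _].
have [ne|e] := pselect (S !=set0); last first.
  by rewrite (_ : S = set0) ?sup0 //; apply/seteqP; split=> // x Sx; case: e; exists x.
apply: sup_le_ub => // _ [f /= hf <-]; rewrite -[leRHS]mul1r; apply: cint_le => // x.
exact: le_trans (normc_le_sup f x) hf.
Qed.

Lemma dual_norm_ge0 p q (gp : good p) (gq : good q) : 0 <= CK_dual_norm (dual_of gp gq).
Proof.
rewrite /CK_dual_norm /dual_norm; set S := [set _ | _ in _].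
have S0 y : S y -> 0 <= y by move=> [f _ <-]; exact: le_trans (normr_ge0 _) (Re_le_normc _).
have [hs|/sup_out -> //] := pselect (has_sup S).
by have [y Sy] := hs.1; apply: le_trans (S0 y Sy) _; exact: sup_upper_bound.
Qed.

Lemma cint_add p q p' q' p2 q2 f : good p -> good q -> good p' -> good q' ->
  (forall b, p2 b = p b + p' b) -> (forall b, q2 b = q b + q' b) ->
  cint p2 q2 f = cint p q f + cint p' q' f.
Proof.
move=> gp gq gp' gq' hp hq.
have h1 : M (code (1 : R)) by exact: code_real1.
have -> : p2 = (fun b => 1 * p b + p' b) by apply/funext => b; rewrite hp mul1r.
have -> : q2 = (fun b => 1 * q b + q' b) by apply/funext => b; rewrite hq mul1r.
rewrite /cint !(integral_linear_measure HV HP HG HB h1) //.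
by apply/eqP; rewrite eq_complex /=; apply/andP; split; apply/eqP; ring.
Qed.

Notation zero := (fun _ : B => 0 : R).
Let gz : good zero := good_zero R HV HP HG HB.

Lemma integral_zero (u : point -> R) : mr M u -> continuous_real u -> integral_of u zero = 0.
Proof.
move=> mu cu; have h1 : M (code (1 : R)) by exact: code_real1.
have := integral_linear_measure HV HP HG HB h1 mu cu gz gz.
have -> : (fun b : B => 1 * zero b + zero b) = zero by apply/funext => b; rewrite mulr0 addr0.
by rewrite mul1r; lra.
Qed.

Notation ii := (Complex 0 1 : R[i]).

Lemma cint_split p q f : good p -> good q -> cint p q f = ii * cint q zero f + cint p zero f.
Proof.
move=> gp gq; rewrite /cint !integral_zero //.
by apply/eqP; rewrite eq_complex /=; apply/andP; split; apply/eqP; ring.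
Qed.

Section Bidual.
Variable Phi : CK_bidual (ext V cP G) R cB.

Lemma Phi_linear (a : R[i]) (F F' F2 : dual) : M (code a) ->
  (forall f, sval F2 f = a * sval F f + sval F' f) -> sval Phi F2 = a * sval Phi F + sval Phi F'.
Proof. by move=> ha h; have [_ l _] := svalP Phi; apply: l h; apply/(extME HV). Qed.

Lemma Phi_add (F F' F2 : dual) :
  (forall f, sval F2 f = sval F f + sval F' f) -> sval Phi F2 = sval Phi F + sval Phi F'.
Proof.
move=> h; rewrite -[sval Phi F]mul1r; apply: Phi_linear => [|f]; last by rewrite h mul1r.
by apply/code_complexP; split; [exact: code_real1|exact: code_real0].
Qed.

Lemma Phi_bound : exists2 c, 0 <= c & forall p (gp : good p),
  Normc.normc (sval Phi (dual_of gp gz)) <= c * total_variation p \top%O.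
Proof.
have [_ _ [c hc]] := svalP Phi; exists (`|c| * 2); first by rewrite mulr_ge0.
have z0 : total_variation zero \top%O = 0 :> R.
  apply/le_anti/andP; split; last exact: variation_ge0.
  by rewrite -[leRHS](addr0 0); apply: total_variation_le => a; rewrite normr0.
move=> p gp; apply: le_trans (hc _) _.
have := dual_norm_le gp gz; rewrite z0 addr0 => h.
have v0 := variation_ge0 gp.
apply: (@le_trans _ _ (`|c| * (2 * total_variation p \top%O))); last by rewrite mulrA.
apply: (@le_trans _ _ (`|c| * CK_dual_norm (dual_of gp gz))); last by rewrite ler_wpM2l.
by rewrite ler_wpM2r ?dual_norm_ge0 // ler_norm.
Qed.

Variables (nu : nat -> B -> R) (C : R).
Hypotheses (gnu : forall k, good (nu k)) (nu_le : forall k a, `|nu k a| <= C).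
Hypotheses (null_nu : null_sequence nu) (control : controlled nu).

Lemma good_midpoint (u v : B -> R) : good u -> good v -> good (midpoint u v).
Proof.
move=> gu gv; have hh : M (code (2^-1 : R)).
  by have := @code_ratr M hM R (2^-1); rewrite fmorphV /= rmorph_nat.
have := good_lin HV HP HG HB hh gu (good_lin HV HP HG HB hh gv gz).
congr (good _); apply/funext => b; rewrite /midpoint; ring.
Qed.

(** The value of [s] after [Phi] at a midpoint is the mean of two values, so a lower bound persists.
    Goodness is carried along because only measures of V[G] define elements of the dual. *)
Lemma Phi_comb Z (s : R[i] -> R) (e : R) u : (forall z w, s (z + w) = s z + s w) ->
  (forall k, Z k -> e <= s (sval Phi (dual_of (gnu k) gz))) -> comb nu Z u ->
  exists gu : good u, e <= s (sval Phi (dual_of gu gz)).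
Proof.
move=> sD hZ; elim=> [k Zk|v w _ [gv hv] _ [gw hw]]; first by exists (gnu k); exact: hZ.
have gm := good_midpoint gv gw; exists gm.
pose (v2 := fun b => 1 * v b + w b).
have g2 : good v2 by apply: (good_lin HV HP HG HB); first exact: code_real1.
have z0 (b : B) : zero b = zero b + zero b by rewrite addr0.
have e1 : sval Phi (dual_of g2 gz) = sval Phi (dual_of gv gz) + sval Phi (dual_of gw gz).
  by apply: Phi_add => f /=; apply: cint_add => // b; rewrite /v2 mul1r.
have e2 : sval Phi (dual_of g2 gz) = sval Phi (dual_of gm gz) + sval Phi (dual_of gm gz).
  by apply: Phi_add => f /=; apply: cint_add => // b; rewrite /v2 /midpoint mul1r; field.
have h := congr1 s e2; rewrite e1 !sD in h; exact: half_sum_ge h hv hw.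
Qed.

(** Otherwise infinitely many terms have value at least e, hence so have all their midpoint
    combinations; but one of these is so small on the algebra that the boundedness of [Phi]
    contradicts this. *)
Lemma Phi_half (s : R[i] -> R) (e : R) : (forall z w, s (z + w) = s z + s w) ->
  (forall z, s z <= Normc.normc z) -> 0 < e ->
  exists n, forall k, (n <= k)%N -> s (sval Phi (dual_of (gnu k) gz)) < e.
Proof.
move=> sD sle e0; apply: contrapT => n.
pose Z k := e <= s (sval Phi (dual_of (gnu k) gz)).
have Zinf N : exists k, tail Z N k.
  apply: contrapT => m; apply: n; exists N => k Nk; rewrite ltNge; apply/negP => h.
  by apply: m; exists k.
have [c c0 hc] := Phi_bound.
(* A measure bounded by d has total variation at most 2 d, so its value under [Phi] is at most 2 c
   d, which is below e. *)
pose d := e / (4 * (c + 1)); have c1 : 0 < c + 1 by rewrite ltr_wpDl.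
have d0 : 0 < d by rewrite divr_gt0 // mulr_gt0.
have addn k : additive_on (nu k) by have [] := gnu k.
have [u cu hu] := small_midpoint addn nu_le null_nu control d0 Zinf.
have [gu] := Phi_comb sD (fun k (h : Z k) => h) cu; rewrite leNgt => /negP; apply.
apply: le_lt_trans (sle _) _; apply: le_lt_trans (hc u gu) _.
apply: (@le_lt_trans _ _ (c * (d + d))).
  by rewrite ler_wpM2l //; exact: total_variation_le.
have : (c + 1) * (d + d) = e / 2 by rewrite /d; field; rewrite gt_eqF.
rewrite mulrDl mul1r; lra.
Qed.

Lemma Phi_null (e : R) : 0 < e -> exists n, forall k, (n <= k)%N ->
  Normc.normc (sval Phi (dual_of (gnu k) gz)) < e.
Proof.
move=> e0; have e2 : 0 < e / 2 by rewrite divr_gt0.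
have [|z|n1 h1] := @Phi_half (@complex.Re R) _ _ _ e2; first exact: raddfD.
  by apply: le_trans (Re_le_normc z); exact: ler_norm.
have [z w|z|n2 h2] := @Phi_half (fun z => - complex.Re z) _ _ _ e2; first by rewrite raddfD opprD.
  by apply: le_trans (Re_le_normc z); rewrite -normrN; exact: ler_norm.
have [|z|n3 h3] := @Phi_half (@complex.Im R) _ _ _ e2; first exact: raddfD.
  by apply: le_trans (Im_le_normc z); exact: ler_norm.
have [z w|z|n4 h4] := @Phi_half (fun z => - complex.Im z) _ _ _ e2; first by rewrite raddfD opprD.
  by apply: le_trans (Im_le_normc z); rewrite -normrN; exact: ler_norm.
exists (n1 + n2 + n3 + n4)%N => k nk.
have k1 := h1 k ltac:(lia); have k2 := h2 k ltac:(lia); have k3 := h3 k ltac:(lia); have k4 := h4 k ltac:(lia).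
apply: le_lt_trans (normc_le_add _) _.
rewrite [ltRHS](_ : e = e / 2 + e / 2); last by field.
by apply: ltrD; rewrite ltr_norml; apply/andP; split; lra.
Qed.

End Bidual.
End Functional.

(** * The Vitali-Hahn-Saks property in V[G] *)

Lemma complex_cvgP (R : realType) (u : nat -> R[i]) (l : R[i]) :
  u @ \oo --> (l : (R[i] : numFieldType)) <->
  forall e : R, 0 < e -> exists n, forall k, (n <= k)%N -> Normc.normc (u k - l) < e.
Proof.
have nE (z : R[i]) (e : R) : (`|z| < e%:C%C) = (Normc.normc z < e).
  by case: z => a b; rewrite normc_def /= ltcR.
have E := @cvgrPdist_lt (R[i] : numFieldType) (R[i] : numFieldType) nat \oo _ u l.
split=> [/E h e e0|h].
  have [|n _ hn] := h e%:C%C; first by rewrite ltcR.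
  by exists n => k /hn /=; rewrite distrC nE.
apply/E => -[e ei]; rewrite ltcE /= => /andP[/eqP -> e0].
have [n hn] := h e e0; exists n => // k /hn; rewrite distrC; by rewrite (nE _ e).
Qed.

Lemma additive_raddf (R : realType) d (B : ctbDistrLatticeType d) (m : B -> R[i])
  (s : {additive R[i] -> R}) : (forall z, `|s z| <= Normc.normc z) ->
  (forall a b, (a `&` b = \bot)%O -> m (a `|` b)%O = m a + m b) ->
  (exists c : R, forall t : seq B, pairwise (fun a b => (a `&` b == \bot)%O) t ->
     \sum_(a <- t) Normc.normc (m a) <= c) ->
  additive_on (fun a => s (m a)) /\ bounded_variation (fun a => s (m a)).
Proof.
move=> hs add [c hc]; split=> [a b ab|]; first by rewrite add // raddfD.
by exists c => t pt; apply: le_trans (hc t pt); apply: ler_sum => a _; exact: hs.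
Qed.

Section VHS.
Variables (R : realType) (V : class) (HV : transitive_ZFC V).
Variables (dP : Order.disp_t) (P : preorderType dP) (cP : Coded P).
Hypothesis HP : ordered_in V cP.
Variables (G : P -> Prop) (HG : generic V cP G).
Hypothesis Hproper : proper_forcing V cP.
Hypothesis Hlaver : laver_property V cP.
Hypothesis Hmeager : preserves_nonmeager R V cP.
Variables (dB : Order.disp_t) (B : ctbDistrLatticeType dB) (cB : Coded B).
Hypothesis HB : ordered_in V cB.
Hypothesis Hsigma : sigma_complete V cB.

Notation M := (extM V cP G).
Let hM : zermelo M := ext_zermelo HV HP HG.
#[local] Existing Instance hM.
Let inM_alg : inN M B := inM_algebra HV HP HG HB.
#[local] Existing Instance inM_alg.
Let gz := good_zero R HV HP HG HB.
Notation D g := (dual_of HV HP HG HB g gz).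

Lemma Phi_converges (Phi : CK_bidual (ext V cP G) R cB) (mm : nat -> B -> R) (l : B -> R)
  (gm : forall k, good V cP G cB (mm k)) (gl : good V cP G cB l) :
  (forall k, good V cP G cB (fun a => mm k a - l a)) ->
  (exists C, forall k a, `|mm k a - l a| <= C) ->
  null_sequence (fun k a => mm k a - l a) -> controlled (fun k a => mm k a - l a) ->
  forall e, 0 < e -> exists n, forall k, (n <= k)%N ->
    Normc.normc (sval Phi (D (gm k)) - sval Phi (D gl)) < e.
Proof.
move=> gn [C hC] null ctl e e0.
have [n hn] := Phi_null HV HP HG HB Phi gn hC null ctl e0.
exists n => k /hn; congr (Normc.normc _ < _).
apply/eqP; rewrite eq_sym subr_eq; apply/eqP.
apply: (Phi_add HV HP HG) => f /=; apply: (cint_add HV HP HG HB) => // b; first by rewrite subrK.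
by rewrite addr0.
Qed.

Theorem ext_vitali_hahn_saks : vitali_hahn_saks (ext V cP G) R cB.
Proof.
move=> m /(extME HV) mm meas conv.
have [mre mim] := mr_complex2 mm.
(* The real and the imaginary parts of the measures are treated alike; each has a limit measure of
   its own. *)
have part (s : {additive R[i] -> R}) : (forall z, `|s z| <= Normc.normc z) ->
    mr M (fun p : nat * B => s (m p.1 p.2)) ->
  exists2 l : B -> R, good V cP G cB l & (forall k, good V cP G cB (fun a => s (m k a))) /\
    [/\ forall k, good V cP G cB (fun a => s (m k a) - l a),
      exists C, forall k a, `|s (m k a) - l a| <= C,
      null_sequence (fun k a => s (m k a) - l a) & controlled (fun k a => s (m k a) - l a)].
  move=> hs ms.
  have ab k : additive_on (fun a => s (m k a)) /\ bounded_variation (fun a => s (m k a)).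
    by have [_ add bv] := meas k; exact: additive_raddf.
  have add k := (ab k).1; have bv k := (ab k).2.
  have cv a : exists l : R, forall e, 0 < e -> exists n, forall k, (n <= k)%N -> `|s (m k a) - l| < e.
    have [l _ /complex_cvgP h] := conv a; exists (s l) => e /h[n hn]; exists n => k /hn.
    by apply: le_lt_trans; rewrite -raddfB.
  have [l hl h] := convergent_control HV HP HG Hproper Hlaver Hmeager HB Hsigma ms add bv cv.
  exists l; first exact: limit_good ms add bv cv _ hl.
  by split=> // k; exact: (sequence_good HV HP HG Hproper Hlaver Hmeager HB Hsigma ms add bv cv).
have [p gp [gmp [np1 np2 np3 np4]]] := part (@complex.Re R) (@Re_le_normc R) mre.
have [q gq [gmq [nq1 nq2 nq3 nq4]]] := part (@complex.Im R) (@Im_le_normc R) mim.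
pose F n := dual_of HV HP HG HB (gmp n) (gmq n).
pose F0 := dual_of HV HP HG HB gp gq.
exists F => [n a f hf|Psi].
  have im0 x : `|im f x| <= 0 by rewrite /im hf; case: asboolP => _ /=; rewrite normr0.
  have re1 x : re f x = if `[< sval x a >] then 1 else 0 by rewrite /re hf; case: asboolP.
  have z k : good V cP G cB k -> integral_of (im f) k = 0.
    move=> gk; apply/eqP; rewrite -normr_le0.
    by have := integral_le HV HP HG HB (mr_im HV HP HG HB f) (im_continuous f) gk im0; rewrite mul0r.
  have r k : good V cP G cB k -> integral_of (re f) k = k a.
    by move=> gk; exact: (integral_indicator HV HP HG HB (mr_re HV HP HG HB f) (re_continuous f) gk re1).
  rewrite /F /= /cint (z _ (gmp n)) (z _ (gmq n)) (r _ (gmp n)) (r _ (gmq n)).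
  by apply/eqP; rewrite eq_complex /= subr0 add0r !eqxx.
exists (sval Psi F0).
  apply/(extME HV); have [/(extME HV) h _ _] := svalP Psi; exact: (mf_fin F0 h).
apply/complex_cvgP => e e0; have e4 : 0 < e / 4 by rewrite divr_gt0.
have [n1 h1] := Phi_converges Psi gmp gp np1 np2 np3 np4 e4.
have [n2 h2] := Phi_converges Psi gmq gq nq1 nq2 nq3 nq4 e4.
exists (maxn n1 n2) => k; rewrite geq_max => /andP[/h1 k1 /h2 k2].
have hi : M (code (Complex 0 1 : R[i])).
  by apply/code_complexP; split; [exact: code_real0|exact: code_real1].
(* Linearity of the functional over the scalars of V[G] separates the two real sequences. *)
have split_ u v (gu : good V cP G cB u) (gv : good V cP G cB v) :
    sval Psi (dual_of HV HP HG HB gu gv) = Complex 0 1 * sval Psi (D gv) + sval Psi (D gu).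
  by apply: (Phi_linear HV Psi hi) => f /=; exact: (cint_split HV HP HG HB).
rewrite (split_ _ _ (gmp k) (gmq k)) (split_ _ _ gp gq); move: k1 k2.
set A := sval Psi (D (gmp k)); set A0 := sval Psi (D gp).
set C := sval Psi (D (gmq k)); set C0 := sval Psi (D gq) => k1 k2.
have -> : Complex 0 1 * C + A - (Complex 0 1 * C0 + A0) = Complex 0 1 * (C - C0) + (A - A0) by ring.
have a1 := le_lt_trans (Re_le_normc _) k1; have a2 := le_lt_trans (Im_le_normc _) k1.
have a3 := le_lt_trans (Re_le_normc _) k2; have a4 := le_lt_trans (Im_le_normc _) k2.
apply: le_lt_trans (normc_le_add _) _; move: a1 a2 a3 a4.
case: (C - C0) => c1 c2; case: (A - A0) => d1 d2 /=.
rewrite !mul0r !mul1r sub0r add0r => a1 a2 a3 a4.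
have := ler_normD (- c2) d1; have := ler_normD c1 d2; rewrite normrN.
have : e = e / 4 + e / 4 + e / 4 + e / 4 by field.
lra.
Qed.

End VHS.

Theorem theorem5p3 (R : realType) (V : class) (HV : transitive_ZFC V)
    (dP : Order.disp_t) (P : preorderType dP) (cP : Coded P)
    (HP : ordered_in V cP)
    (Hproper : proper_forcing V cP) (Hlaver : laver_property V cP)
    (Hmeager : preserves_nonmeager R V cP)
    (dB : Order.disp_t) (B : ctbDistrLatticeType dB) (cB : Coded B)
    (HB : ordered_in V cB) (Hsigma : sigma_complete V cB)
    (G : P -> Prop) (HG : generic V cP G) :
  vitali_hahn_saks (ext V cP G) R cB.
Proof. exact: (ext_vitali_hahn_saks HV HP HG Hproper Hlaver Hmeager HB Hsigma). Qed.
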